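(* Let $E\subset\partial\mathbb{D}$ be a nonempty closed set of Lebesgue measure zero. Then there exists a singular probability measure $\mu$ supported on $E$ such that: (i) $\mu(I)\ge|I|$ for every dyadic arc $I$ with $I\cap E\neq\emptyset$; (ii) $S_\mu\in W^1$, and hence $S_\mu$ satisfies the permanence property $[S_\mu]_{\mathcal{B}}\cap H^\infty=S_\mu H^\infty$.
   Context: $|I|$ is the normalized Lebesgue measure of an arc; dyadic arcs are the arcs of the standard dyadic decomposition of $\partial\mathbb{D}$ (arcs $\{e^{2\pi i t}: t\in[j2^{-n},(j+1)2^{-n})\}$). $W^1$ is the space of analytic $g$ on $\mathbb{D}$ with $|g(0)|+\int_{\mathbb{D}}|g'|dA<\infty$. $\mathcal{B}$ is the Bloch space of analytic $f$ with $|f(0)|+\sup_z(1-|z|)|f'(z)|<\infty$, identified with the dual of $W^1$ via the pairing $\lim_{r\to1^-}\int_{\partial\mathbb{D}}f(r\zeta)\overline{g(r\zeta)}dm(\zeta)$, with the weak-star topology; $[f]_{\mathcal{B}}$ is the weak-star closure of polynomial multiples of $f$. $S_\mu(z)=\exp(-\int\frac{\zeta+z}{\zeta-z}d\mu(\zeta))$; $H^\infty$ bounded analytic functions. *)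

(* Defs.v *)
(* mathcomp-analysis (measure theory, Lebesgue integral,
   normed topology, derivatives) + real_closed's complex numbers R[i]. *)
From HB Require Import structures.
From mathcomp Require Import all_boot all_order all_algebra.
From mathcomp Require Import all_classical all_reals all_analysis.
From mathcomp Require Import complex.
Set Implicit Arguments. Unset Strict Implicit. Unset Printing Implicit Defensive.
Import Order.TTheory GRing.Theory Num.Theory numFieldNormedType.Exports.
Local Open Scope classical_set_scope.
Local Open Scope ring_scope.
Local Open Scope complex_scope.

(* The complex plane over a real type R, with its numClosedField structure
   (hence its normed-module / topological structure over itself, so that
   [derivable f z 1] is complex differentiability). *)
Definition CC (R : realType) : numClosedFieldType := R[i].

Section Defs.
Variable R : realType.
Local Notation C := (CC R).

(* modulus as a real number *)
Definition cabs (z : C) : R := Num.sqrt (complex.Re z ^+ 2 + complex.Im z ^+ 2).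

(* the open unit disc *)
Definition disc : set C := [set z | cabs z < 1].

(* the unit circle *)
Definition circle : set C := [set z | cabs z = 1].

(* parametrization of the unit circle: t |-> e^{2 pi i t}; the normalized
   Lebesgue measure on the circle is the image of Lebesgue measure on [0,1) *)
Definition circ (t : R) : C := cos (2 * pi * t) +i* sin (2 * pi * t).

Definition unit_interval : set R := [set t | 0 <= t < 1].

(* complex exponential *)
Definition cexp (w : C) : C :=
  (expR (complex.Re w))%:C * (cos (complex.Im w) +i* sin (complex.Im w)).

(* dyadic interval [j 2^-n, (j+1) 2^-n); the dyadic arc is its image by circ *)
Definition dyadic (n j : nat) : set R :=
  [set t | j%:R / 2 ^+ n <= t < j.+1%:R / 2 ^+ n].

(* Herglotz integral  int (zeta+z)/(zeta-z) dmu(zeta), for a measure mu on the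
   circle represented (via circ) by a measure on R concentrated on [0,1). *)
Definition herglotz (mu : {measure set R -> \bar R}) (z : C) : C :=
  (Rintegral mu unit_interval (fun t => complex.Re ((circ t + z) / (circ t - z))))
  +i* (Rintegral mu unit_interval (fun t => complex.Im ((circ t + z) / (circ t - z)))).

(* singular inner function S_mu(z) = exp(- int (zeta+z)/(zeta-z) dmu(zeta)) *)
Definition S_mu (mu : {measure set R -> \bar R}) (z : C) : C :=
  cexp (- herglotz mu z).

(* analytic on the disc = complex differentiable at each point of the disc *)
Definition analytic_disc (f : C -> C) : Prop :=
  forall z, disc z -> derivable f z 1.

(* W^1 : analytic g with |g(0)| + int_D |g'| dA < oo  (dA area measure) *)
Definition W1 (g : C -> C) : Prop :=
  analytic_disc g /\
  (\int[(lebesgue_measure \x lebesgue_measure)%E]_(p in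
      [set p : R * R | (p.1 ^+ 2 + p.2 ^+ 2 < 1)%R])
     (cabs ('D_1 g (p.1 +i* p.2)))%:E < +oo)%E.

(* Bloch space *)
Definition bloch (f : C -> C) : Prop :=
  analytic_disc f /\
  exists M : R, forall z, disc z -> (1 - cabs z) * cabs ('D_1 f z) <= M.

(* H^oo *)
Definition Hinf (f : C -> C) : Prop :=
  analytic_disc f /\ exists M : R, forall z, disc z -> cabs (f z) <= M.

(* integral over the circle (normalized Lebesgue measure) of a
   complex-valued function of the circle *)
Definition circ_integral (F : C -> C) : C :=
  (Rintegral lebesgue_measure unit_interval (fun t => complex.Re (F (circ t))))
  +i* (Rintegral lebesgue_measure unit_interval (fun t => complex.Im (F (circ t)))).

(* the duality pairing between B and W^1:
   lim_{r -> 1^-} int f(r zeta) conj(g(r zeta)) dm(zeta) *)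
Definition bpair (f g : C -> C) : C :=
  lim ((fun r : R => circ_integral (fun zeta => f (r%:C * zeta) * (g (r%:C * zeta))^*))
         @ (1 : R)^'-).

(* the weak-star closure in B of the polynomial multiples of f:
   h in B such that every basic weak-star neighbourhood
   { u : |<u - h, g_k>| < eps, k } (g_k in W^1, eps > 0) contains some p f *)
Definition wstar_closure_polmul (f : C -> C) : set (C -> C) :=
  [set h | bloch h /\
    forall (gs : seq (C -> C)) (eps : R), (forall g, g \in gs -> W1 g) -> 0 < eps ->
      exists p : {poly C}, forall g, g \in gs ->
        cabs (bpair (fun z => p.[z] * f z - h z) g) < eps].

(* permanence property [f]_B cap H^oo = f H^oo (as functions on the disc) *)
Definition permanence (f : C -> C) : Prop :=
  forall u : C -> C,
    (wstar_closure_polmul f u /\ Hinf u) <->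
    (exists h, Hinf h /\ forall z, disc z -> u z = f z * h z).

End Defs.

(* Main.v *)
(** Call a dyadic interval a gap if it does not meet E but its parent does; up to the null set E the gaps K partition the circle. Choosing a point x_K of E in the parent of each gap, let T be the map equal to x_K on K, and mu the image of Lebesgue measure under T, i.e. the sum of the |K| delta_{x_K}. A dyadic arc I meeting E contains the parent of every gap it contains, so T maps I into itself (up to E) and mu(I) >= |I|.

S_mu' is S_mu times a multiple of the integral of e(Tt)/(e(Tt) - z)^2. As the integral of e(t)/(e(t) - z)^2 vanishes, S_mu' is controlled by a sum over gaps of |S_mu| times the integral over K of the difference of the two kernels, and it suffices to bound the area integral of each term by C|K|. At distance at least a multiple of |K| from x_K the kernels nearly cancel and the term is O(|K|^2 / |z - x_K|^3). Closer than that, the arc kernel is integrated exactly, with singularities 1/|z - a| at the endpoints a of K, and the atom is damped by |S_mu| <= exp(-|K| P(x_K, z)), P the Poisson kernel.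

For the permanence property of S = S_mu: if u is in the closure of the polynomial multiples of S, test against the function of W^1 representing f |-> int f conj(S) P_z dm - f(z)/S(z). It nearly annihilates every p S, because |S| has boundary values 1, whence |u(z)/S(z)| <= 2 sup|u| + 5. Conversely, for h bounded, S h is approximated by the products of S with polynomials approximating the dilates of h, since bounded locally uniform convergence passes to the limit in the pairing with W^1. *)

(* A bound C|K| per gap suffices because the gaps are disjoint in [0,1), so the |K| sum to at most
   1. Near x_K the atom |K|/|z - x_K|^2 just fails to be integrable over the plane, by a logarithm.
   As sqrt(y) exp(-y) is bounded, the damping trades it for sqrt|K| / (|z - x_K| sqrt(1 - |z|^2)),
   whose integral over a disc of radius O(|K|) is O(|K|). The area estimates are made on |z| <= r
   with constants independent of r; there finitely many gaps matter, since what they leave of the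
   circle has small measure and the kernels are bounded.

   The weak-star topology enters through the pairing alone. Its limit exists for bounded f and g in
   W^1 because the integral of f(x.) conj g(y.) depends only on the product xy: passing from one
   diagonal radius to another becomes an increment of g along radii, controlled by the area integral
   of |g'|, uniformly over all f with a given bound. This uniformity is what lets a polynomial be
   chosen after the radius. In the converse direction all that matters about 2 sup|u| + 5 is that it
   does not depend on z. *)
Require Import Defs.
From HB Require Import structures.
From mathcomp Require Import all_boot all_order all_algebra.
From mathcomp Require Import all_classical all_reals all_analysis.
From mathcomp Require Import measurable_realfun ftc.
From mathcomp Require Import complex ring lra.
Set Implicit Arguments. Unset Strict Implicit. Unset Printing Implicit Defensive.
Import Order.TTheory GRing.Theory Num.Theory numFieldNormedType.Exports.
Local Open Scope classical_set_scope.
Local Open Scope ring_scope.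
Local Open Scope complex_scope.

(** * Complex differentiability and integrals *)

Section ComplexPlane.
Variable R : realType.
Local Notation C := (CC R).
Local Notation Re := (@complex.Re R).
Local Notation Im := (@complex.Im R).
Implicit Types (z w : C) (f g : C -> C).

Lemma normC_cabs z : `|z| = ((cabs z)%:C : C).
Proof. exact: normc_def. Qed.

Lemma ReD z w : Re (z + w) = Re z + Re w. Proof. by case: z; case: w. Qed.
Lemma ImD z w : Im (z + w) = Im z + Im w. Proof. by case: z; case: w. Qed.
Lemma ReN z : Re (- z) = - Re z. Proof. by case: z. Qed.
Lemma ImN z : Im (- z) = - Im z. Proof. by case: z. Qed.
Lemma ReM z w : Re (z * w) = Re z * Re w - Im z * Im w.
Proof. by case: z; case: w. Qed.
Lemma ImM z w : Im (z * w) = Re z * Im w + Im z * Re w.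
Proof. by case: z; case: w. Qed.

Lemma Ceq z w : Re z = Re w -> Im z = Im w -> z = w.
Proof. by case: z => a b; case: w => c d /= -> ->. Qed.

Lemma cabs_ge0 z : 0 <= cabs z. Proof. exact: sqrtr_ge0. Qed.

Lemma cabsE (z : C) (r : R) : (`|z| <= (r%:C : C)) = (cabs z <= r).
Proof. by rewrite normC_cabs lecR. Qed.

Lemma cabs_ltE (z : C) (r : R) : (`|z| < (r%:C : C)) = (cabs z < r).
Proof. by rewrite normC_cabs ltcR. Qed.

Lemma cabsM z w : cabs (z * w) = cabs z * cabs w.
Proof. by case: (etrans (esym (normC_cabs (z * w))) (etrans (normrM z w) (congr2 *%R (normC_cabs z) (normC_cabs w)))); rewrite mul0r mulr0 subr0. Qed.

Lemma cabs0 : cabs (0 : C) = 0.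
Proof. by rewrite /cabs /= expr0n addr0 sqrtr0. Qed.

Lemma cabs1 : cabs (1 : C) = 1.
Proof. by rewrite /cabs /= expr0n addr0 expr1n sqrtr1. Qed.

Lemma cabsN z : cabs (- z) = cabs z.
Proof. by rewrite /cabs ReN ImN !sqrrN. Qed.

Lemma cabs_distC z w : cabs (z - w) = cabs (w - z).
Proof. by rewrite -cabsN opprB. Qed.

Lemma cabsD z w : cabs (z + w) <= cabs z + cabs w.
Proof. by rewrite -cabsE (le_trans (ler_normD _ _))// !normC_cabs -rmorphD. Qed.

Lemma cabsB z w : cabs (z - w) <= cabs z + cabs w.
Proof. by rewrite -(cabsN w) cabsD. Qed.

Lemma cabs_triB z w : cabs z - cabs w <= cabs (z - w).
Proof. by rewrite lerBlDr (le_trans _ (cabsD _ _))// subrK. Qed.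

Lemma cabs_eq0 z : (cabs z == 0) = (z == 0).
Proof.
apply/eqP/eqP => [h|->]; last exact: cabs0.
by apply/eqP; rewrite -normr_eq0 normC_cabs h.
Qed.

Lemma cabs_gt0 z : (0 < cabs z) = (z != 0).
Proof. by rewrite lt_neqAle cabs_ge0 andbT eq_sym cabs_eq0. Qed.

Lemma cabsV z : cabs z^-1 = (cabs z)^-1.
Proof.
have [->|z0] := eqVneq z 0; first by rewrite invr0 cabs0 invr0.
have zn : cabs z != 0 by rewrite cabs_eq0.
by apply: (mulfI zn); rewrite -cabsM !divff// cabs1.
Qed.

Lemma cabsf z w : cabs (z / w) = cabs z / cabs w.
Proof. by rewrite cabsM cabsV. Qed.

Lemma cabsX z n : cabs (z ^+ n) = cabs z ^+ n.
Proof. by elim: n => [|n ih]; rewrite ?expr0 ?cabs1// !exprS cabsM ih. Qed.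

Lemma cabs_real (r : R) : cabs (r%:C : C) = `|r|.
Proof. by rewrite /cabs /= expr0n addr0 sqrtr_sqr. Qed.

Lemma cabs_ge_Re z : `|Re z| <= cabs z.
Proof. by rewrite /cabs -sqrtr_sqr ler_wsqrtr// lerDl sqr_ge0. Qed.

Lemma cabs_ge_Im z : `|Im z| <= cabs z.
Proof. by rewrite /cabs -sqrtr_sqr ler_wsqrtr// lerDr sqr_ge0. Qed.

Lemma cabs_ReIm z : cabs z <= `|Re z| + `|Im z|.
Proof.
rewrite -(@ler_pXn2r _ 2%N)// ?nnegrE ?addr_ge0 ?cabs_ge0//.
rewrite sqr_sqrtr ?addr_ge0 ?sqr_ge0// sqrrD !real_normK ?num_real//.
by rewrite -addrAC lerDl mulrn_wge0// mulr_ge0.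
Qed.

Lemma cabs_sqr z : cabs z ^+ 2 = Re z ^+ 2 + Im z ^+ 2.
Proof. by rewrite sqr_sqrtr// addr_ge0 ?sqr_ge0. Qed.

(** Conjugation whose two parts compute by reduction; [conj_cconj] identifies it with the [^*] that
    occurs in [bpair]. *)
Definition cconj z : C := Re z -i* Im z.

Lemma conj_cconj z : (z^*)%R = cconj z.
Proof. by case: z. Qed.

Lemma cabs_conj z : cabs (cconj z) = cabs z.
Proof. by rewrite /cabs /= sqrrN. Qed.

Lemma cconjD z w : cconj (z + w) = cconj z + cconj w.
Proof. by apply: Ceq; rewrite /cconj /= ?ReD ?ImD//= opprD. Qed.
Lemma cconjN z : cconj (- z) = - cconj z.
Proof. by apply: Ceq; rewrite /cconj /= ?ReN ?ImN. Qed.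
Lemma cconjB z w : cconj (z - w) = cconj z - cconj w.
Proof. by rewrite cconjD cconjN. Qed.
Lemma cconjM z w : cconj (z * w) = cconj z * cconj w.
Proof. by rewrite -!conj_cconj rmorphM. Qed.
Lemma cconjV z : cconj z^-1 = (cconj z)^-1.
Proof. by rewrite -!conj_cconj fmorphV. Qed.
Lemma cconjK z : cconj (cconj z) = z.
Proof. by case: z => a b; rewrite /cconj /= opprK. Qed.
Lemma cconj_real (r : R) : cconj (r%:C : C) = r%:C.
Proof. by rewrite /cconj /= oppr0. Qed.
Lemma mul_cconj z : z * cconj z = ((cabs z ^+ 2)%:C : C).
Proof. by apply: Ceq; rewrite ?ReM ?ImM /= ?cabs_sqr; ring. Qed.

Lemma Re_real_mul (r : R) z : Re ((r%:C : C) * z) = r * Re z.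
Proof. by rewrite ReM /= mul0r subr0. Qed.
Lemma Im_real_mul (r : R) z : Im ((r%:C : C) * z) = r * Im z.
Proof. by rewrite ImM /= mul0r addr0. Qed.

Lemma circD (s t : R) : circ (s + t) = circ s * circ t :> C.
Proof. by apply: Ceq; rewrite ?ReM ?ImM /= mulrDr ?cosD ?sinD; ring. Qed.

Lemma circ0 : circ 0 = 1 :> C.
Proof. by apply: Ceq; rewrite /= mulr0 ?cos0 ?sin0. Qed.

Lemma circ1 : circ 1 = 1 :> C.
Proof. by apply: Ceq; rewrite /= mulr1 mulr_natl ?cos2pi ?sin2pi. Qed.

Lemma cabs_circ (t : R) : cabs (circ t : C) = 1.
Proof. by rewrite /cabs /= cos2Dsin2 sqrtr1. Qed.

Lemma circ_neq0 (t : R) : (circ t : C) != 0.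
Proof. by rewrite -cabs_eq0 cabs_circ oner_eq0. Qed.

Lemma circ_mul_conj (t : R) : circ t * cconj (circ t) = 1 :> C.
Proof. by rewrite mul_cconj cabs_circ expr1n. Qed.

Lemma circN (t : R) : circ (- t) = cconj (circ t) :> C.
Proof. by rewrite /cconj /circ /= mulrN cosN sinN. Qed.

Lemma cconj_circ (t : R) : cconj (circ t : C) = (circ t)^-1.
Proof. by rewrite -[RHS]mulr1 -(circ_mul_conj t) mulKf// circ_neq0. Qed.

(** An explicit eps-delta form of complex differentiability, equivalent to [derivable] by [hdP]. *)
Definition hd f z (d : C) := forall e : R, 0 < e -> exists2 del : R, 0 < del &
  forall h : C, cabs h < del -> cabs (f (z + h) - f z - d * h) <= e * cabs h.

Definition ccont f z := forall e : R, 0 < e -> exists2 del : R, 0 < del &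
  forall h : C, cabs h < del -> cabs (f (z + h) - f z) <= e.

Lemma nbhsC (z : C) (A : set C) :
  nbhs z A <-> exists2 del : R, 0 < del & forall h : C, cabs h < del -> A (z + h).
Proof.
split=> [/nbhs_ballP[e /= e0 H]|[del d0 H]].
  have /complex_realP [r er] : e \is Num.real by rewrite ger0_real// ltW.
  have r0 : 0 < r by move: e0; rewrite er ltcR.
  exists r => // h hr; apply: H; rewrite /ball /= opprD addrA subrr sub0r normrN.
  by rewrite er cabs_ltE.
apply/nbhs_ballP; exists (del%:C : C) => /=; first by rewrite ltcR.
move=> w; rewrite /ball /= distrC cabs_ltE => /H; by rewrite addrC subrK.
Qed.

Lemma hd_deriv f z d : hd f z d -> derivable f z 1 /\ 'D_1 f z = d.
Proof.
move=> H.
have cv : (fun h : C => h^-1 *: ((f \o shift z) (h *: (1:C)) - f z)) @ (0:C)^' --> (d : C).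
  apply/cvgrPdist_le => /= e e0.
  have /complex_realP [r er] : e \is Num.real by rewrite ger0_real// ltW.
  have r0 : 0 < r by move: e0; rewrite er ltcR.
  have [del d0 Hd] := H _ r0.
  apply/nbhsC; exists del => // h hd h0; rewrite add0r in h0 *.
  have {}h0 : (h : C) != 0 by exact: h0.
  have K : cabs (d - h^-1 * (f (z + h) - f z) : C) <= r.
    have -> : d - h^-1 * (f (z + h) - f z) = - (h^-1 * (f (z + h) - f z - d * h)).
      by field.
    by rewrite cabsN cabsM cabsV ler_pdivrMl ?cabs_gt0// [cabs h * _]mulrC; exact: (Hd _ hd).
  rewrite er cabsE /= -[h *: _]/(h * 1 : C) mulr1 [h + z]addrC.
  exact: K.
split; first by apply/cvg_ex; exists d.
by apply: cvg_lim cv; exact: norm_hausdorff.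
Qed.

Lemma deriv_hd f z : derivable f z 1 -> hd f z ('D_1 f z).
Proof.
move=> H e e0.
have cv : (fun h : C => h^-1 *: ((f \o shift z) (h *: (1:C)) - f z)) @ (0:C)^'
  --> ('D_1 f z : C) by exact: H.
have e0' : (0 : C) < (e%:C : C) by rewrite ltcR.
move/cvgrPdist_le : cv => /(_ _ e0') /nbhsC[del d0 Hd].
exists del => // h hd.
have [->|h0] := eqVneq h 0.
  by rewrite addr0 subrr mulr0 subr0 cabs0 mulr0.
have := Hd _ hd; rewrite add0r => /(_ h0); rewrite cabsE.
rewrite /= -[h *: _]/(h * 1 : C) mulr1 [h + z]addrC => K.
have {}K : cabs ('D_1 f z - h^-1 * (f (z + h) - f z) : C) <= e by exact: K.
move: K; set d : C := 'D_1 f z.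
have -> : d - h^-1 * (f (z + h) - f z) = - (h^-1 * (f (z + h) - f z - d * h)).
  by field.
by rewrite cabsN cabsM cabsV ler_pdivrMl ?cabs_gt0// [cabs h * _]mulrC.
Qed.

Lemma hdP f z d : hd f z d <-> derivable f z 1 /\ 'D_1 f z = d.
Proof. by split; [exact: hd_deriv|case=> /deriv_hd + <-]. Qed.

Lemma hd_eq f g z d (del : R) : 0 < del ->
  (forall h : C, cabs h < del -> f (z + h) = g (z + h)) -> hd f z d -> hd g z d.
Proof.
move=> d0 fg H e /H[del' d0' H']; exists (Num.min del del'); first by rewrite lt_min d0.
move=> h; rewrite lt_min => /andP[h1 h2]; rewrite -fg// -[in g z](addr0 z) -fg ?cabs0// addr0.
exact: H'.
Qed.

Lemma hd_ccont f z d : hd f z d -> ccont f z.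
Proof.
move=> H e e0; have [del d0 H1] := H 1 ltr01.
have c0 : 0 < 1 + cabs d by rewrite ltr_wpDr ?cabs_ge0.
exists (Num.min del (e / (1 + cabs d))); first by rewrite lt_min d0 divr_gt0.
move=> h; rewrite lt_min ltr_pdivlMr// => /andP[/H1 h1 h2].
rewrite -(subrK (d * h) (_ - _)) (le_trans (cabsD _ _))// cabsM.
by rewrite (le_trans (lerD h1 (lexx _)))// -mulrDl mulrC ltW.
Qed.

Lemma hd_cst (c : C) z : hd (fun=> c) z 0.
Proof. by move=> e e0; exists 1 => // h _; rewrite subrr mul0r subr0 cabs0 mulr_ge0 ?cabs_ge0// ltW. Qed.

Lemma hd_id z : hd id z 1.
Proof.
by move=> e e0; exists 1 => // h _; rewrite mul1r [z + h]addrC addrK subrr cabs0 mulr_ge0 ?cabs_ge0// ltW.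
Qed.

Lemma hdD f g z a b : hd f z a -> hd g z b -> hd (fun x => f x + g x) z (a + b).
Proof.
move=> Hf Hg e e0; have e2 : 0 < e / 2 by rewrite divr_gt0.
have [d1 d10 H1] := Hf _ e2; have [d2 d20 H2] := Hg _ e2.
exists (Num.min d1 d2); first by rewrite lt_min d10.
move=> h; rewrite lt_min => /andP[/H1 h1 /H2 h2].
have -> : f (z + h) + g (z + h) - (f z + g z) - (a + b) * h =
  (f (z + h) - f z - a * h) + (g (z + h) - g z - b * h) by ring.
rewrite (le_trans (cabsD _ _))// (le_trans (lerD h1 h2))//.
by rewrite -mulrDl -splitr.
Qed.

Lemma hd_comp f g z a b : hd f z a -> hd g (f z) b -> hd (g \o f) z (b * a).
Proof.
move=> Hf Hg e e0.
have ca : 0 < 1 + cabs a by rewrite ltr_wpDr ?cabs_ge0.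
have cb : 0 < 1 + cabs b by rewrite ltr_wpDr ?cabs_ge0.
have ea : 0 < e / 2 / (1 + cabs a) by rewrite !divr_gt0.
(* The entry 1 gives |k| <= (1 + |a|)|h| for the increment [k] of [f]; the other entry pays for the
   factor |b|. *)
have eb : 0 < Num.min 1 (e / 2 / (1 + cabs b)) by rewrite lt_min ltr01 !divr_gt0.
have [d1 d10 H1] := Hf _ eb; have [d2 d20 H2] := Hg _ ea.
exists (Num.min d1 (d2 / (1 + cabs a))); first by rewrite lt_min d10 divr_gt0.
move=> h; rewrite lt_min => /andP[/H1 h1]; rewrite ltr_pdivlMr// => h2.
set k := f (z + h) - f z in h1.
have k1 : cabs k <= (1 + cabs a) * cabs h.
  rewrite -(subrK (a * h) k) (le_trans (cabsD _ _))// cabsM mulrDl lerD// (le_trans h1)//.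
  by rewrite ler_wpM2r ?cabs_ge0// ge_min lexx.
have k2 : cabs k < d2 by rewrite (le_lt_trans k1)// mulrC.
have := H2 _ k2; rewrite /k [f z + _]addrC subrK -/k => {}H2.
have -> : (g \o f) (z + h) - (g \o f) z - b * a * h =
  (g (f (z + h)) - g (f z) - b * k) + b * (k - a * h) by rewrite /=; ring.
rewrite (le_trans (cabsD _ _))// [e]splitr mulrDl lerD//.
  by rewrite (le_trans H2)// (le_trans (ler_wpM2l (ltW ea) k1))// mulrA mulfVK ?gt_eqF.
rewrite cabsM (le_trans (ler_wpM2l (cabs_ge0 _) h1))// mulrA ler_wpM2r ?cabs_ge0//.
have : Num.min 1 (e / 2 / (1 + cabs b)) <= e / 2 / (1 + cabs b) by rewrite ge_min lexx orbT.
move=> /(ler_wpM2l (cabs_ge0 b)) /le_trans; apply.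
rewrite mulrCA -[leRHS]mulr1 ler_wpM2l ?(ltW (divr_gt0 e0 _))//.
by rewrite ler_pdivrMr// mul1r lerDr.
Qed.

Lemma hd_sqr z : hd (fun x => x * x) z (2 * z).
Proof.
move=> e e0; exists e => // h hd.
have -> : (z + h) * (z + h) - z * z - 2 * z * h = h * h by ring.
by rewrite cabsM ler_wpM2r ?cabs_ge0// ltW.
Qed.

Lemma hdN f z a : hd f z a -> hd (fun x => - f x) z (- a).
Proof.
move=> Hf e /Hf[d d0 H]; exists d => // h /H.
have -> : - f (z + h) - - f z - - a * h = - (f (z + h) - f z - a * h) by ring.
by rewrite cabsN.
Qed.

Lemma hdB f g z a b : hd f z a -> hd g z b -> hd (fun x => f x - g x) z (a - b).
Proof. by move=> Hf Hg; apply: hdD => //; apply: hdN. Qed.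

(** Polarisation: f g = ((f + g)^2 - (f - g)^2) / 4, so the product rule follows from the chain rule
    applied to squaring. *)
Lemma hdM f g z a b : hd f z a -> hd g z b ->
  hd (fun x => f x * g x) z (a * g z + f z * b).
Proof.
move=> Hf Hg.
have Hq (p : C -> C) c : hd p z c -> hd (fun x => p x * p x / 4) z (p z * c / 2).
  move=> /hd_comp/(_ (hd_sqr (p z))) H e e0; have [//|d d0 {}H] := H (e * 4).
    by rewrite mulr_gt0.
  exists d => // h /H; rewrite /=.
  have -> : p (z + h) * p (z + h) - p z * p z - 2 * p z * c * h =
    4 * (p (z + h) * p (z + h) / 4 - p z * p z / 4 - p z * c / 2 * h) by field.
  have c4 : cabs (4 : C) = 4.
    by rewrite -(rmorph_nat (real_complex R) 4) cabs_real ger0_norm.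
  by rewrite cabsM c4 [e * 4]mulrC -[leRHS]mulrA ler_pM2l.
have := hdB (Hq _ _ (hdD Hf Hg)) (Hq _ _ (hdB Hf Hg)).
have -> : (f z + g z) * (a + b) / 2 - (f z - g z) * (a - b) / 2 = a * g z + f z * b by field.
by apply: (hd_eq ltr01) => h _; field.
Qed.

Lemma hdV z : z != 0 -> hd (fun x => x^-1) z (- (z ^- 2)).
Proof.
move=> z0 e e0; set r := cabs z; have r0 : 0 < r by rewrite cabs_gt0.
exists (Num.min (r / 2) (e * r ^+ 3 / 2)).
  by rewrite lt_min divr_gt0// divr_gt0// mulr_gt0// exprn_gt0.
move=> h; rewrite lt_min => /andP[h1 h2].
have zh : r / 2 <= cabs (z + h).
  have := cabs_triB z (- h); rewrite cabsN opprK -/r; lra.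
have zh0 : z + h != 0 by rewrite -cabs_gt0 (lt_le_trans _ zh)// divr_gt0.
have -> : (z + h)^-1 - z^-1 - - z ^- 2 * h = h * (h / ((z + h) * z ^+ 2)) by field; rewrite z0.
rewrite cabsM [e * _]mulrC ler_wpM2l ?cabs_ge0// cabsf cabsM cabsX -/r ler_pdivrMr; last first.
  by rewrite mulr_gt0 ?cabs_gt0// exprn_gt0.
apply: (le_trans (ltW h2)); rewrite -mulrA ler_wpM2l ?(ltW e0)//.
by rewrite exprS mulrAC ler_wpM2r// exprn_ge0// ltW.
Qed.

Lemma hd_div f g z a b : g z != 0 -> hd f z a -> hd g z b ->
  hd (fun x => f x / g x) z (a / g z - f z * b / g z ^+ 2).
Proof.
move=> g0 Hf Hg; have := hdM Hf (hd_comp Hg (hdV g0)).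
by congr (hd _ _ _); rewrite /=; field.
Qed.

End ComplexPlane.

(** Complex, bounded, measurable. On sets of finite measure this implies integrability and, unlike
    integrability, it is stable under products, so one class serves nearly all complex integrals
    below. *)
Definition cbm (R : realType) d (T : measurableType d) (D : set T) (p : T -> CC R) :=
  [/\ measurable_fun D (@complex.Re R \o p), measurable_fun D (@complex.Im R \o p) &
  exists M, forall t, D t -> cabs (p t) <= M].

Section ComplexIntegral.
Variable R : realType.
Local Notation C := (CC R).
Local Notation Re := (@complex.Re R).
Local Notation Im := (@complex.Im R).
Implicit Types (p q : R -> C) (D : set R).

Definition pcont p t := forall e : R, 0 < e -> exists2 del : R, 0 < del &
  forall h : R, `|h| < del -> cabs (p (t + h) - p t) <= e.

Lemma pcont_cts (u : R -> R) t :
  (forall e : R, 0 < e -> exists2 del : R, 0 < del &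
    forall h : R, `|h| < del -> `|u (t + h) - u t| <= e) <-> {for t, continuous u}.
Proof.
split=> [H|/cvgrPdist_le H e e0].
  apply/cvgrPdist_le => e /H[d d0 Hd].
  apply/nbhs_ballP; exists d => //= s; rewrite /ball /= distrC => /Hd.
  by rewrite [t + _]addrC subrK distrC.
have /nbhs_ballP[d /= d0 Hd] := H _ e0; exists d => // h hd.
rewrite distrC; apply: Hd; rewrite /ball /=.
by rewrite opprD addrA subrr sub0r normrN.
Qed.

Lemma pcontP p t : pcont p t <->
  {for t, continuous (Re \o p)} /\ {for t, continuous (Im \o p)}.
Proof.
split=> [H|[/pcont_cts H1 /pcont_cts H2] e e0].
  split; apply/pcont_cts => e /H[d d0 Hd]; exists d => // h /Hd; apply: le_trans.
    by rewrite /= -ReN -ReD cabs_ge_Re.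
  by rewrite /= -ImN -ImD cabs_ge_Im.
have e2 : 0 < e / 2 by rewrite divr_gt0.
have [d1 d10 {}H1] := H1 _ e2; have [d2 d20 {}H2] := H2 _ e2.
exists (Num.min d1 d2); first by rewrite lt_min d10.
move=> h; rewrite lt_min => /andP[/H1 h1 /H2 h2].
by rewrite (le_trans (cabs_ReIm _))// ReD ImD ReN ImN [e]splitr lerD.
Qed.

Lemma pcont_comp (f : C -> C) p t : ccont f (p t) -> pcont p t -> pcont (f \o p) t.
Proof.
move=> Hf Hp e /Hf[d d0 {}Hf]; have [|d1 d10 H1] := Hp (d / 2); first by rewrite divr_gt0.
exists d1 => // h /H1 h1; rewrite /=.
have := Hf (p (t + h) - p t); rewrite [p t + _]addrC subrK; apply.
by rewrite (le_lt_trans h1)// ltr_pdivrMr// ltr_pMr// ltr1n.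
Qed.

Lemma pcont_cst (c : C) t : pcont (fun=> c) t.
Proof. by move=> e e0; exists 1 => // h _; rewrite subrr cabs0 ltW. Qed.

Lemma pcontD p q t : pcont p t -> pcont q t -> pcont (fun s => p s + q s) t.
Proof.
move=> Hp Hq e e0; have e2 : 0 < e / 2 by rewrite divr_gt0.
have [d1 d10 H1] := Hp _ e2; have [d2 d20 H2] := Hq _ e2.
exists (Num.min d1 d2); first by rewrite lt_min d10.
move=> h; rewrite lt_min => /andP[/H1 h1 /H2 h2].
by rewrite opprD addrACA (le_trans (cabsD _ _))// [e]splitr lerD.
Qed.

Lemma pcontM p q t : pcont p t -> pcont q t -> pcont (fun s => p s * q s) t.
Proof.
move=> /pcontP[p1 p2] /pcontP[q1 q2]; apply/pcontP; split.
- rewrite (_ : _ \o _ = (fun s => (Re \o p) s * (Re \o q) s - (Im \o p) s * (Im \o q) s)); last first.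
    by apply/funext => s; rewrite /= ReM.
  by apply: cvgB; apply: cvgM.
- rewrite (_ : _ \o _ = (fun s => (Re \o p) s * (Im \o q) s + (Im \o p) s * (Re \o q) s)); last first.
    by apply/funext => s; rewrite /= ImM.
  by apply: cvgD; apply: cvgM.
Qed.

Lemma pcontN p t : pcont p t -> pcont (fun s => - p s) t.
Proof. by move=> H e /H[d d0 {}H]; exists d => // h /H; rewrite -opprD cabsN. Qed.

Lemma pcontB p q t : pcont p t -> pcont q t -> pcont (fun s => p s - q s) t.
Proof. by move=> Hp Hq; apply: pcontD => //; apply: pcontN. Qed.

Lemma pcontV p t : p t != 0 -> pcont p t -> pcont (fun s => (p s)^-1) t.
Proof. by move=> p0; apply: (@pcont_comp (fun x => x^-1)); apply: hd_ccont (hdV p0). Qed.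

Lemma pcont_circ t : pcont (@circ R) t.
Proof.
apply/pcontP; split.
  rewrite (_ : _ \o _ = cos \o *%R (2 * pi))//.
  by apply: continuous_comp; [exact: mulrl_continuous|exact: continuous_cos].
rewrite (_ : _ \o _ = sin \o *%R (2 * pi))//.
by apply: continuous_comp; [exact: mulrl_continuous|exact: continuous_sin].
Qed.

Lemma pcont_real (u : R -> R) t : {for t, continuous u} -> pcont (fun s => (u s)%:C : C) t.
Proof.
move=> /pcont_cts H e /H[d d0 {}H]; exists d => // h /H.
by rewrite -rmorphB cabs_real.
Qed.

Lemma pcont_cbm (a b : R) p : (forall t, a <= t <= b -> pcont p t) -> cbm `[a, b] p.
Proof.
move=> H.
have cw (u : R -> R) : (forall t, a <= t <= b -> {for t, continuous u}) ->
    measurable_fun `[a, b] u /\ (exists M, forall t, a <= t <= b -> `|u t| <= M).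
  move=> Hu; have wc : {within `[a, b], continuous u}.
    by apply: continuous_in_subspaceT => t; rewrite inE /= in_itv => /Hu.
  split; first exact: subspace_continuous_measurable_fun.
  have [ab|ba] := leP a b; last first.
    by exists 0 => t /andP[h1 h2]; have := lt_le_trans ba (le_trans h1 h2); rewrite ltxx.
  have [c1 _ h1] := EVT_max ab wc; have [c2 _ h2] := EVT_min ab wc.
  exists (`|u c1| + `|u c2|) => t tab.
  have {}tab : t \in `[a, b] by rewrite in_itv.
  have := h1 _ tab; have := h2 _ tab; have := ler_norm (u c1).
  have := ler_norm (- u c2); have := normr_ge0 (u c1); have := normr_ge0 (u c2).
  by rewrite normrN ler_norml => *; apply/andP; split; lra.
have [|m1 [M1 b1]] := cw (Re \o p); first by move=> t /H /pcontP[].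
have [|m2 [M2 b2]] := cw (Im \o p); first by move=> t /H /pcontP[].
split => //; exists (M1 + M2) => t; rewrite /= in_itv => tab.
by rewrite (le_trans (cabs_ReIm _))// lerD ?b1 ?b2.
Qed.

Lemma unit_intervalE : @unit_interval R = `[0, 1[%classic.
Proof. by apply/seteqP; split => t /=; rewrite in_itv. Qed.

Lemma measurable_unit : measurable (@unit_interval R).
Proof. by rewrite unit_intervalE. Qed.

End ComplexIntegral.

Section ComplexIntegralGeneric.
Variable R : realType.
Local Notation C := (CC R).
Local Notation Re := (@complex.Re R).
Local Notation Im := (@complex.Im R).
Context d (T : measurableType d).
Implicit Types (p q : T -> C) (D : set T).

Lemma cbm_sub D D' p : measurable D' -> D `<=` D' -> cbm D' p -> cbm D p.
Proof.
move=> mD DD' [m1 m2 [M b]]; split; [exact: measurable_funS m1|exact: measurable_funS m2|].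
by exists M => t /DD'; exact: b.
Qed.

Lemma eq_cbm D p q : (forall t, q t = p t) -> cbm D p -> cbm D q.
Proof. by move=> /funext ->. Qed.

Lemma cbm_cst D (c : C) : cbm D (fun=> c).
Proof.
by split; [exact: measurable_cst|exact: measurable_cst|exists (cabs c)].
Qed.

Lemma cbmD D p q : cbm D p -> cbm D q -> cbm D (fun t => p t + q t).
Proof.
move=> [p1 p2 [M p3]] [q1 q2 [N q3]]; split.
- rewrite (_ : _ \o _ = (Re \o p) \+ (Re \o q)); first exact: measurable_funD.
  by apply/funext => t; rewrite /= ReD.
- rewrite (_ : _ \o _ = (Im \o p) \+ (Im \o q)); first exact: measurable_funD.
  by apply/funext => t; rewrite /= ImD.
- by exists (M + N) => t Dt; rewrite (le_trans (cabsD _ _))// lerD ?p3 ?q3.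
Qed.

Lemma cbmM D p q : cbm D p -> cbm D q -> cbm D (fun t => p t * q t).
Proof.
move=> [p1 p2 [M p3]] [q1 q2 [N q3]]; split.
- rewrite (_ : _ \o _ = ((Re \o p) \* (Re \o q)) \- ((Im \o p) \* (Im \o q))).
    by apply: measurable_funB; exact: measurable_funM.
  by apply/funext => t; rewrite /= ReM.
- rewrite (_ : _ \o _ = ((Re \o p) \* (Im \o q)) \+ ((Im \o p) \* (Re \o q))).
    by apply: measurable_funD; exact: measurable_funM.
  by apply/funext => t; rewrite /= ImM.
- by exists (M * N) => t Dt; rewrite cabsM ler_pM ?cabs_ge0 ?p3 ?q3.
Qed.

Lemma cbmZ D (c : C) p : cbm D p -> cbm D (fun t => c * p t).
Proof. by apply: cbmM; exact: cbm_cst. Qed.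

Lemma cbmN D p : cbm D p -> cbm D (fun t => - p t).
Proof.
move=> /(cbmZ (-1)); rewrite (_ : (fun t => -1 * p t) = (fun t => - p t))//.
by apply/funext => t; rewrite mulN1r.
Qed.

Lemma cbmB D p q : cbm D p -> cbm D q -> cbm D (fun t => p t - q t).
Proof. by move=> Hp Hq; apply: cbmD => //; apply: cbmN. Qed.

Lemma cbm_conj D p : cbm D p -> cbm D (fun t => cconj (p t)).
Proof.
move=> [p1 p2 [M p3]]; split => //.
- rewrite (_ : _ \o _ = \- (Im \o p)); first exact: measurable_funN.
  by apply/funext.
- by exists M => t /p3; rewrite cabs_conj.
Qed.

Section OneMeasure.
Variables (mu : {measure set T -> \bar R}) (D : set T).
Hypotheses (mD : measurable D) (fD : (mu D < +oo)%E).

(** It has the shape of [herglotz] and [circ_integral], so that both are instances of it by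
    unfolding. *)
Definition cint p : C :=
  (Rintegral mu D (fun t => Re (p t))) +i* (Rintegral mu D (fun t => Im (p t))).

Lemma eq_cint p q : (forall t, D t -> p t = q t) -> cint p = cint q.
Proof.
by move=> pq; congr (_ +i* _); apply: eq_Rintegral => t; rewrite inE => /pq ->.
Qed.

Lemma bm_integrable (u : T -> R) M : measurable_fun D u ->
  (forall t, D t -> `|u t| <= M) -> mu.-integrable D (EFin \o u).
Proof.
move=> mu_ b; apply: measurable_bounded_integrable => //.
exists `|M|; split; first exact: normr_real.
by move=> x xM t /= Dt; rewrite (le_trans (b _ Dt))// (le_trans (ler_norm _))// ltW.
Qed.

Lemma cbm_Re p : cbm D p -> mu.-integrable D (EFin \o (fun t => Re (p t))).
Proof. by move=> [p1 _ [M b]]; apply: (bm_integrable p1 (M := M)) => t /b; apply: le_trans; exact: cabs_ge_Re. Qed.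

Lemma cbm_Im p : cbm D p -> mu.-integrable D (EFin \o (fun t => Im (p t))).
Proof. by move=> [_ p1 [M b]]; apply: (bm_integrable p1 (M := M)) => t /b; apply: le_trans; exact: cabs_ge_Im. Qed.

Lemma cbm_cabs p : cbm D p -> mu.-integrable D (EFin \o (fun t => cabs (p t))).
Proof.
move=> [p1 p2 [M b]]; apply: (@bm_integrable _ M); last first.
  by move=> t /b; rewrite ger0_norm ?cabs_ge0.
apply: (@measurableT_comp _ _ _ _ _ _ (@Num.sqrt R)).
  exact: continuous_measurable_fun (@sqrt_continuous R).
by apply: measurable_funD; exact: measurable_funX.
Qed.

Lemma cintD p q : cbm D p -> cbm D q -> cint (fun t => p t + q t) = cint p + cint q.
Proof.
move=> hp hq; rewrite /cint; congr (_ +i* _).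
  by rewrite -RintegralD ?cbm_Re//; apply: eq_Rintegral => t _; rewrite ReD.
by rewrite -RintegralD ?cbm_Im//; apply: eq_Rintegral => t _; rewrite ImD.
Qed.

Lemma cintZ (c : C) p : cbm D p -> cint (fun t => c * p t) = c * cint p.
Proof.
move=> hp; have [i1 i2] := (cbm_Re hp, cbm_Im hp).
have iZ (r : R) (u : T -> R) : mu.-integrable D (EFin \o u) ->
    mu.-integrable D (EFin \o (fun t => r * u t)).
  by move=> iu; have := integrableZl mD r iu; congr (_.-integrable _ _); apply/funext.
apply: Ceq; rewrite ?ReM ?ImM /=.
  rewrite -!RintegralZl// -RintegralB//; [|exact: iZ|exact: iZ].
  by apply: eq_Rintegral => t _; rewrite ReM.
rewrite -!RintegralZl// -RintegralD//; [|exact: iZ|exact: iZ].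
by apply: eq_Rintegral => t _; rewrite ImM.
Qed.

Lemma cintN p : cbm D p -> cint (fun t => - p t) = - cint p.
Proof.
move=> hp; rewrite -mulN1r -cintZ//.
by apply: eq_cint => t _; rewrite mulN1r.
Qed.

Lemma cintB p q : cbm D p -> cbm D q -> cint (fun t => p t - q t) = cint p - cint q.
Proof. by move=> hp hq; rewrite cintD ?cintN//; exact: cbmN. Qed.

Lemma cint_conj p : cbm D p -> cint (fun t => cconj (p t)) = cconj (cint p).
Proof.
move=> hp; rewrite /cint /cconj; congr (_ +i* _) => /=.
rewrite -mulN1r -RintegralZl ?cbm_Im//.
by apply: eq_Rintegral => t _; rewrite mulN1r.
Qed.

Lemma cint_cst (c : C) : cint (fun=> c) = ((fine (mu D))%:C : C) * c.
Proof.
rewrite /cint !Rintegral_cst//; apply: Ceq; rewrite ?Re_real_mul ?Im_real_mul /=.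
  by rewrite mulrC.
by rewrite mulrC.
Qed.

Lemma cabs_cint p : cbm D p -> cabs (cint p) <= Rintegral mu D (fun t => cabs (p t)).
Proof.
move=> hp; have [->|n0] := eqVneq (cint p) 0.
  by rewrite cabs0; apply: Rintegral_ge0 => t _; exact: cabs_ge0.
(* A unimodular constant that turns the integral into its modulus: |int p| = int Re(u p) <= int
   |p|. *)
pose u : C := cconj (cint p) / ((cabs (cint p))%:C : C).
have cr0 : ((cabs (cint p))%:C : C) != 0 by rewrite -cabs_eq0 cabs_real normr_eq0 cabs_eq0.
have cu : cabs u = 1.
  by rewrite cabsf cabs_conj cabs_real ger0_norm ?cabs_ge0// divff// cabs_eq0.
have -> : cabs (cint p) = Re (u * cint p).
  rewrite /u mulrAC [cconj _ * _]mulrC mul_cconj.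
  have -> : ((cabs (cint p) ^+ 2)%:C : C) = (cabs (cint p))%:C * (cabs (cint p))%:C.
    by rewrite -rmorphM expr2.
  by rewrite mulfK.
rewrite -cintZ// /cint /=; apply: le_Rintegral => //; [exact: cbm_Re (cbmZ _ hp)|exact: cbm_cabs|].
move=> t _; rewrite (le_trans (ler_norm _))// (le_trans (cabs_ge_Re _))//.
by rewrite cabsM cu mul1r.
Qed.

Lemma le_cint p (v : T -> R) : cbm D p -> mu.-integrable D (EFin \o v) ->
  (forall t, D t -> cabs (p t) <= v t) -> cabs (cint p) <= Rintegral mu D v.
Proof.
move=> hp iv pv; apply: (le_trans (cabs_cint hp)); apply: le_Rintegral => //.
exact: cbm_cabs.
Qed.

Lemma cint_bound p M : cbm D p -> (forall t, D t -> cabs (p t) <= M) ->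
  cabs (cint p) <= M * fine (mu D).
Proof.
move=> hp pM; rewrite -Rintegral_cst//; apply: le_cint => //.
have := @finite_measure_integrable_cst.
by move=> _; apply: (@bm_integrable _ `|M|).
Qed.

End OneMeasure.
End ComplexIntegralGeneric.

Section UnitCircleIntegrable.
Variable R : realType.
Local Notation C := (CC R).
Implicit Types (p : R -> C).

Lemma pcont_cbm1 p : (forall t, pcont p t) -> cbm (@unit_interval R) p.
Proof.
move=> H; have K := @pcont_cbm R 0 1 p (fun t _ => H t).
apply: (cbm_sub _ _ K) => //.
by move=> t /andP[h1 h2] /=; rewrite in_itv /= h1 ltW.
Qed.

End UnitCircleIntegrable.

(** * The complex exponential and Cauchy-type integrals *)

Section CauchyType.
Variable R : realType.
Local Notation C := (CC R).
Local Notation Re := (@complex.Re R).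
Local Notation Im := (@complex.Im R).
Local Notation U := (@unit_interval R).

Lemma is_derive_eps (u : R -> R) (t d : R) : is_derive t 1 u d ->
  forall e : R, 0 < e -> exists2 del : R, 0 < del &
    forall h : R, `|h| < del -> `|u (t + h) - u t - d * h| <= e * `|h|.
Proof.
move=> [du ud] e e0.
have cv : (fun h : R => h^-1 *: ((u \o shift t) (h *: (1:R)) - u t)) @ (0:R)^' --> d.
  by rewrite -ud; exact: du.
move/cvgrPdist_le : cv => /(_ _ e0) /nbhs_ballP[del /= d0 H].
exists del => // h hd; have [->|h0] := eqVneq h 0.
  by rewrite addr0 subrr mulr0 subr0 normr0 mulr0.
have := H h; rewrite /ball /= sub0r normrN => /(_ hd h0).
rewrite -[h *: _]/(h * 1 : R) mulr1 -[_ *: _]/(_ * _ : R) [h + t]addrC.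
have -> : d - h^-1 * (u (t + h) - u t) = - (h^-1 * (u (t + h) - u t - d * h)) by field.
by rewrite normrN normrM normfV ler_pdivrMl ?normr_gt0// [`|h| * _]mulrC.
Qed.

Lemma cexpD (a b : C) : cexp (a + b) = cexp a * cexp b.
Proof.
rewrite /cexp; apply: Ceq; rewrite !(ReM,ImM) /= ReD ImD expRD cosD sinD; ring.
Qed.

Lemma cexp0 : cexp (0 : C) = 1.
Proof. by rewrite /cexp /= expR0 cos0 sin0; apply: Ceq; rewrite ?ReM ?ImM /=; ring. Qed.

Lemma cabs_cexp (w : C) : cabs (cexp w) = expR (Re w).
Proof.
by rewrite /cexp cabsM cabs_real ger0_norm ?expR_ge0// /cabs /= cos2Dsin2 sqrtr1 mulr1.
Qed.

Lemma cexp_neq0 (w : C) : cexp w != 0.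
Proof. by rewrite -cabs_gt0 cabs_cexp expR_gt0. Qed.

Lemma hd_cexp0 : hd (@cexp R) 0 1.
Proof.
move=> e e0; pose e' := e / 6; have e'0 : 0 < e' by rewrite divr_gt0.
have [|d1 d10 H1] := @is_derive_eps (@expR R) 0 1 _ e' e'0.
  by have := is_derive_expR (0 : R); rewrite expR0.
have [|d2 d20 H2] := @is_derive_eps (@cos R) 0 0 _ e' e'0.
  by have := is_derive_cos (0 : R); rewrite sin0 oppr0.
have [|d3 d30 H3] := @is_derive_eps (@sin R) 0 1 _ e' e'0.
  by have := is_derive_sin (0 : R); rewrite cos0.
exists (Num.min (Num.min d1 d2) (Num.min d3 (Num.min 1 e'))).
  by rewrite !lt_min d10 d20 d30 ltr01.
move=> h; rewrite !lt_min => /andP[/andP[h1 h2] /and3P[h3 h4 h5]].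
have hr := cabs_ge_Re h; have hi := cabs_ge_Im h.
have {}H1 := H1 _ (le_lt_trans hr h1).
have {}H2 := H2 _ (le_lt_trans hi h2).
have {}H3 := H3 _ (le_lt_trans hi h3).
move: H1 H2 H3; rewrite !add0r expR0 cos0 sin0 !mul1r mul0r !subr0 cexp0.
set x := Re h in hr *; set y := Im h in hi * => H1 H2 H3.
pose c : C := cos y +i* sin y.
have cc : cabs c = 1 by rewrite /c /cabs /= cos2Dsin2 sqrtr1.
(* With c = e^{iy}: e^h - 1 - h = (e^x - 1 - x) c + (1 + x)(c - 1 - iy) + ixy. The three terms cost
   1, 4 and 1 times e'|h|, whence e' = e/6. *)
have -> : cexp h - 1 - h = ((expR x - 1 - x)%:C : C) * c
   + ((1 + x)%:C : C) * (c - 1 - 'i * ((y%:C) : C)) + 'i * (x%:C : C) * (y%:C : C).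
  rewrite /cexp -/x -/y -/c; apply: Ceq; rewrite !(ReM,ImM,ReD,ImD,ReN,ImN) /= -/x -/y; ring.
have b1 : cabs (((expR x - 1 - x)%:C : C) * c) <= e' * cabs h.
  by rewrite cabsM cc mulr1 cabs_real (le_trans H1)// ler_wpM2l// ltW.
have b2 : cabs (c - 1 - 'i * ((y%:C) : C)) <= 2 * e' * cabs h.
  rewrite (le_trans (cabs_ReIm _))//.
  have -> : Re (c - 1 - 'i * (y%:C : C)) = cos y - 1.
    by rewrite !(ReM,ImM,ReD,ImD,ReN,ImN) /=; ring.
  have -> : Im (c - 1 - 'i * (y%:C : C)) = sin y - y.
    by rewrite !(ReM,ImM,ReD,ImD,ReN,ImN) /=; ring.
  have := ler_wpM2l (ltW e'0) hi; lra.
have b3 : cabs ((1 + x)%:C : C) <= 2.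
  rewrite cabs_real (le_trans (ler_normD _ _))// normr1.
  by have := ltW (le_lt_trans hr h4); lra.
have b4 : cabs ('i * (x%:C : C) * (y%:C : C)) <= e' * cabs h.
  have ci : cabs ('i : C) = 1 by rewrite /cabs /= expr0n add0r expr1n sqrtr1.
  rewrite cabsM cabsM ci mul1r !cabs_real.
  by rewrite ler_pM// (le_trans hr)// ltW.
have b5 : cabs (((1 + x)%:C : C) * (c - 1 - 'i * ((y%:C) : C))) <= 4 * e' * cabs h.
  rewrite cabsM (le_trans (ler_pM (cabs_ge0 _) (cabs_ge0 _) b3 b2))//; lra.
have -> : e * cabs h = (e' * cabs h + 4 * e' * cabs h) + e' * cabs h.
  by rewrite /e'; field.
by rewrite (le_trans (cabsD _ _))// lerD// (le_trans (cabsD _ _))// lerD.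
Qed.

Lemma hd_cexp (w : C) : hd (@cexp R) w (cexp w).
Proof.
move=> e e0; have ew : 0 < e / cabs (cexp w) by rewrite divr_gt0// cabs_gt0 cexp_neq0.
have [d d0 H] := hd_cexp0 ew; exists d => // h /H; rewrite add0r cexp0 mul1r => h1.
have -> : cexp (w + h) - cexp w - cexp w * h = cexp w * (cexp h - 1 - h).
  by rewrite cexpD; ring.
rewrite cabsM -ler_pdivlMl ?cabs_gt0 ?cexp_neq0// (le_trans h1)//.
by rewrite mulrA [_^-1 * e]mulrC.
Qed.

Lemma pcont_scale_circ (r t : R) : pcont (fun t => (r%:C : C) * circ t) t.
Proof. by apply: pcontM; [exact: pcont_cst|exact: pcont_circ]. Qed.

Lemma circ_sub_ge (r t : R) (z : C) : 0 <= r -> r - cabs z <= cabs ((r%:C : C) * circ t - z).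
Proof.
move=> r0; have := cabs_triB ((r%:C : C) * circ t) z.
by rewrite cabsM cabs_real cabs_circ mulr1 ger0_norm.
Qed.

Lemma circ_sub_neq0 (r t : R) (z : C) : cabs z < r -> (r%:C : C) * circ t - z != 0.
Proof.
move=> zr; rewrite -cabs_gt0 (lt_le_trans _ (circ_sub_ge _ _ _))// ?subr_gt0//.
by rewrite (le_trans (cabs_ge0 z))// ltW.
Qed.

Lemma cbm_circ_subV (r : R) (z : C) : cabs z < r ->
  cbm U (fun t => ((r%:C : C) * circ t - z)^-1).
Proof.
move=> zr; apply: pcont_cbm1 => t; apply: pcontV; first exact: circ_sub_neq0.
by apply: pcontB; [exact: pcont_scale_circ|exact: pcont_cst].
Qed.

Section Transform.
Context d (T : measurableType d).
Variables (mu : {measure set T -> \bar R}) (D : set T) (ep : T -> C).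
Hypothesis mD : measurable D.
Hypothesis fmu : (mu D < +oo)%E.
Hypothesis ep1 : forall t, cabs (ep t) = 1.
Hypothesis cbe : forall r z, cabs z < r -> cbm D (fun t => ((r%:C : C) * ep t - z)^-1).
Implicit Types (p : T -> C).

Let ep_sub_ge (r : R) t (z : C) : 0 <= r -> r - cabs z <= cabs ((r%:C : C) * ep t - z).
Proof.
move=> r0; have := cabs_triB ((r%:C : C) * ep t) z.
by rewrite cabsM cabs_real ep1 mulr1 ger0_norm.
Qed.

Let ep_sub_neq0 (r : R) t (z : C) : cabs z < r -> (r%:C : C) * ep t - z != 0.
Proof.
move=> zr; rewrite -cabs_gt0 (lt_le_trans _ (ep_sub_ge _ _ _))// ?subr_gt0//.
by rewrite (le_trans (cabs_ge0 z))// ltW.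
Qed.

(** The unimodular map [ep] is kept abstract because it is used twice: as [circ] for Cauchy's
    formula, and as [circ] composed with [T] for the derivative of the Herglotz integral. *)
Definition cauchy_type (p : T -> C) (r : R) n (z : C) : C :=
  cint mu D (fun t => p t * ((r%:C : C) * ep t - z)^-1 ^+ n).

Lemma cbm_cauchy p r n z : cbm D p -> cabs z < r ->
  cbm D (fun t => p t * ((r%:C : C) * ep t - z)^-1 ^+ n).
Proof.
move=> hp zr; apply: cbmM => //; elim: n => [|n ih].
  by under eq_fun do rewrite expr0; exact: cbm_cst.
by under eq_fun do rewrite exprS; apply: cbmM => //; exact: cbe.
Qed.

Lemma cauchy_type_bound p r n z M : cbm D p -> cabs z < r ->
  (forall t, D t -> cabs (p t) <= M) ->
  cabs (cauchy_type p r n z) <= M / (r - cabs z) ^+ n * fine (mu D).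
Proof.
move=> hp zr pM; have r0 : 0 <= r by rewrite (le_trans (cabs_ge0 z))// ltW.
apply: cint_bound => //; first exact: cbm_cauchy.
move=> t Dt; rewrite cabsM cabsX cabsV ler_pM ?cabs_ge0 ?exprn_ge0 ?invr_ge0 ?cabs_ge0 ?pM//.
rewrite -exprVn lerXn2r ?nnegrE ?invr_ge0 ?cabs_ge0 ?subr_ge0 ?(ltW zr)//.
rewrite lef_pV2 ?posrE ?ep_sub_ge ?subr_gt0//.
by rewrite cabs_gt0 ep_sub_neq0.
Qed.

(** The remainder is explicit: with w = r ep(t), 1/(w - z - h) - 1/(w - z) - h/(w - z)^2 = h^2 / ((w
    - z - h)(w - z)^2). The constant [K] bounds its integral divided by h^2, as long as |h| is less
    than half of r - |z|. *)
Lemma hd_cauchy_type p r z : cbm D p -> cabs z < r ->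
  hd (cauchy_type p r 1) z (cauchy_type p r 2 z).
Proof.
move=> hp zr; have [_ _ [M pM]] := hp.
have r0 : 0 <= r by rewrite (le_trans (cabs_ge0 z))// ltW.
set dd := r - cabs z; have dd0 : 0 < dd by rewrite subr_gt0.
move=> e e0.
pose K := `|M| * ((dd / 2)^-1 * dd ^- 2) * fine (mu D).
have K0 : 0 <= K.
  rewrite /K !mulr_ge0 ?invr_ge0 ?exprn_ge0 ?fine_ge0 ?mulr_ge0 ?invr_ge0// ltW//.
exists (Num.min (dd / 2) (e / (K + 1))).
  by rewrite lt_min !divr_gt0// ltr_wpDl.
move=> h; rewrite lt_min => /andP[h1 h2].
have zhr : cabs (z + h) < r.
  by rewrite (le_lt_trans (cabsD _ _))//; rewrite /dd in h1; lra.
pose q t := (((r%:C : C) * ep t - (z + h))^-1 * ((r%:C : C) * ep t - z)^-1 ^+ 2).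
have hq : cbm D (fun t => p t * q t).
  rewrite /q; under eq_fun do rewrite mulrC -mulrA [_ * p _]mulrC; apply: cbmM.
    exact: cbe.
  exact: cbm_cauchy.
have E : cauchy_type p r 1 (z + h) - cauchy_type p r 1 z - cauchy_type p r 2 z * h =
    h ^+ 2 * cint mu D (fun t => p t * q t).
  rewrite /cauchy_type -cintZ// ?(mulrC _ h) -?cintZ -?cintB//; try exact: mD.
  - by apply: eq_cint => t Dt; rewrite /q; field; rewrite !ep_sub_neq0.
  - by apply: cbmB; exact: cbm_cauchy.
  - by apply: cbmZ; exact: cbm_cauchy.
  - exact: cbm_cauchy.
  - exact: cbm_cauchy.
  - exact: cbm_cauchy.
rewrite E cabsM.
have B : cabs (cint mu D (fun t => p t * q t)) <= K.
  apply: cint_bound => //.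
  move=> t Dt; rewrite cabsM ler_pM ?cabs_ge0 ?(le_trans (pM _ Dt)) ?ler_norm//.
  rewrite /q cabsM cabsX !cabsV ler_pM ?invr_ge0 ?exprn_ge0 ?invr_ge0 ?cabs_ge0//.
    rewrite lef_pV2 ?posrE ?cabs_gt0 ?ep_sub_neq0 ?divr_gt0//.
    apply: (le_trans _ (ep_sub_ge _ _ _)) => //.
    by have := cabsD z h; rewrite /dd in h1 *; lra.
  rewrite -exprVn ler_pXn2r ?nnegrE ?invr_ge0 ?cabs_ge0 ?(ltW dd0)//.
  rewrite lef_pV2 ?posrE ?cabs_gt0 ?ep_sub_neq0//.
  exact: ep_sub_ge.
rewrite cabsX expr2 -mulrA mulrC -mulrA [leRHS]mulrC ler_wpM2l ?cabs_ge0//.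
have KK : 0 < K + 1 by rewrite ltr_wpDl.
move: h2; rewrite ltr_pdivlMr// => h2.
rewrite (le_trans (ler_wpM2r (cabs_ge0 _) B))// (le_trans _ (ltW h2))// mulrC.
by rewrite ler_wpM2l ?cabs_ge0// lerDl.
Qed.

Lemma ccont_cauchy_type2 p r z : cbm D p -> cabs z < r -> ccont (cauchy_type p r 2) z.
Proof.
move=> hp zr; have [_ _ [M pM]] := hp.
have r0 : 0 <= r by rewrite (le_trans (cabs_ge0 z))// ltW.
set dd := r - cabs z; have dd0 : 0 < dd by rewrite subr_gt0.
move=> e e0.
pose K := `|M| * ((dd / 2)^-1 * dd ^- 2 + (dd / 2) ^- 2 * dd^-1) * fine (mu D).
have K0 : 0 <= K.
  have i1 : 0 <= dd^-1 by rewrite invr_ge0 ltW.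
  have i2 : 0 <= (dd / 2)^-1 by rewrite invr_ge0 divr_ge0// ltW.
  by rewrite /K !mulr_ge0 ?fine_ge0// addr_ge0// mulr_ge0// -exprVn exprn_ge0.
exists (Num.min (dd / 2) (e / (K + 1))).
  by rewrite lt_min !divr_gt0// ltr_wpDl.
move=> h; rewrite lt_min => /andP[h1 h2].
have zhr : cabs (z + h) < r.
  by rewrite (le_lt_trans (cabsD _ _))//; rewrite /dd in h1; lra.
pose u t := ((r%:C : C) * ep t - (z + h))^-1.
pose v t := ((r%:C : C) * ep t - z)^-1.
have hv : cbm D v by exact: cbe.
have hu : cbm D u by exact: cbe.
pose q t := u t * (v t * v t) + (u t * u t) * v t.
have hq : cbm D q by apply: cbmD; apply: cbmM => //; apply: cbmM.
have E : cauchy_type p r 2 (z + h) - cauchy_type p r 2 z = h * cint mu D (fun t => p t * q t).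
  rewrite /cauchy_type -cintZ// -?cintB//; [|exact: cbm_cauchy..|exact: cbmM].
  by apply: eq_cint => t Dt; rewrite /q /u /v; field; rewrite !ep_sub_neq0.
have B : cabs (cint mu D (fun t => p t * q t)) <= K.
  apply: cint_bound => //; first exact: cbmM.
  move=> t Dt; rewrite cabsM ler_pM ?cabs_ge0 ?(le_trans (pM _ Dt)) ?ler_norm//.
  have uB : cabs (u t) <= (dd / 2)^-1.
    rewrite cabsV lef_pV2 ?posrE ?cabs_gt0 ?ep_sub_neq0 ?divr_gt0//.
    apply: (le_trans _ (ep_sub_ge _ _ _)) => //.
    by have := cabsD z h; rewrite /dd in h1 *; lra.
  have vB : cabs (v t) <= dd^-1.
    rewrite cabsV lef_pV2 ?posrE ?cabs_gt0 ?ep_sub_neq0//.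
    exact: ep_sub_ge.
  rewrite (le_trans (cabsD _ _))// !cabsM -!exprVn !expr2.
  by apply: lerD; rewrite !ler_pM ?mulr_ge0 ?cabs_ge0.
have KK : 0 < K + 1 by rewrite ltr_wpDl.
rewrite E cabsM; move: h2; rewrite ltr_pdivlMr// => h2.
rewrite (le_trans (ler_wpM2l (cabs_ge0 _) B))// (le_trans _ (ltW h2))//.
by rewrite ler_wpM2l ?cabs_ge0// lerDl.
Qed.

End Transform.
End CauchyType.

(** * Cauchy's theorem and its consequences on circles *)

Section Goursat.
Variable R : realType.
Local Notation C := (CC R).
Local Notation lam := (@lebesgue_measure R).

Lemma lam_itv_fin (a b : R) : (lam `[a, b] < +oo)%E.
Proof. by rewrite lebesgue_measure_itv /=; case: ifP => _; rewrite ?ltry// -EFinB ltry. Qed.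

Lemma lam_itv (a b : R) : a <= b -> fine (lam `[a, b]) = b - a.
Proof.
rewrite lebesgue_measure_itv /= lte_fin le_eqVlt => /predU1P[->|ab].
  by rewrite ltxx subrr.
by rewrite ab.
Qed.

Lemma cint_split (p : R -> C) (a b c : R) : a <= b -> b <= c -> cbm `[a, c] p ->
  cint lam `[a, c] p = cint lam `[a, b] p + cint lam `[b, c] p.
Proof.
move=> ab bc hp.
have main (u : R -> R) : lam.-integrable `[a, c] (EFin \o u) ->
    Rintegral lam `[a, c] u = Rintegral lam `[a, b] u + Rintegral lam `[b, c] u.
  move=> iu; have := Rintegral_itvB iu (_ : (BLeft a <= BRight b)%O) (_ : (BRight b <= BRight c)%O).
  rewrite !bnd_simp => /(_ ab bc) E.
  have i2 : lam.-integrable `]b, c] (EFin \o u).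
    by apply: integrableS iu => //; apply: subset_itvr; rewrite bnd_simp.
  by have := Rintegral_itv_obnd_cbnd i2; rewrite -E => <-; rewrite addrC subrK.
have fc := lam_itv_fin a c.
by apply: Ceq; rewrite /cint ?ReD ?ImD /=; apply: main; [exact: cbm_Re|exact: cbm_Im].
Qed.

Variables (G : R -> R -> C) (om : C) (a b c d : R).
Hypotheses (om0 : om != 0) (ab : a <= b) (cd : c <= d).

(** [G] is differentiable at every point of the rectangle, as a function of the complex variable [x + om y] *)
Hypothesis gd : forall x y, a <= x <= b -> c <= y <= d ->
  exists A : C, forall e, 0 < e -> exists2 del : R, 0 < del & forall s t : R,
    `|s| < del -> `|t| < del ->
    cabs (G (x + s) (y + t) - G x y - A * ((s%:C : C) + om * (t%:C : C))) <= e * (`|s| + `|t|).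

(** Multiplied by [om], this is the contour integral of [G] around the rectangle with corner (x, y)
    and sides u, v. *)
Let J x y u v : C :=
  cint lam `[y, y + v] (fun t => G (x + u) t - G x t) -
  om^-1 * cint lam `[x, x + u] (fun s => G s (y + v) - G s y).

Let gc x y : a <= x <= b -> c <= y <= d -> pcont (G^~ y) x /\ pcont (G x) y.
Proof.
move=> hx hy; have [A H] := gd hx hy.
have [d1 d10 {}H] := H 1 ltr01.
have base (s t e K : R) : 0 < e -> 0 <= K -> `|s| < d1 -> `|t| < d1 -> `|s| + `|t| < e / (1 + K) ->
    cabs (A * ((s%:C : C) + om * (t%:C : C))) <= K * (`|s| + `|t|) ->
    cabs (G (x + s) (y + t) - G x y) <= e.
  move=> e0 K0 sd td st B.
  rewrite -(subrK (A * ((s%:C : C) + om * (t%:C : C))) (_ - _)).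
  rewrite (le_trans (cabsD _ _))// (le_trans (lerD (H _ _ sd td) B))//.
  move: st; rewrite ltr_pdivlMr ?ltr_pwDl// => st; rewrite -mulrDl.
  by rewrite mulrC ltW.
split=> e e0.
  exists (Num.min d1 (e / (1 + cabs A))).
    by rewrite lt_min d10 divr_gt0// ltr_pwDl// cabs_ge0.
  move=> h; rewrite lt_min => /andP[h1 h2].
  rewrite -[y in G (_ + _) y]addr0; apply: (base _ _ _ (cabs A)) => //; rewrite ?normr0 ?addr0//.
    exact: cabs_ge0.
  by rewrite mulr0 addr0 cabsM cabs_real.
exists (Num.min d1 (e / (1 + cabs A * cabs om))).
  by rewrite lt_min d10 divr_gt0// ltr_pwDl// mulr_ge0 ?cabs_ge0.
move=> h; rewrite lt_min => /andP[h1 h2].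
rewrite -[x in G x (_ + _)]addr0; apply: (base _ _ _ (cabs A * cabs om)) => //; rewrite ?normr0 ?add0r//.
  by rewrite mulr_ge0 ?cabs_ge0.
by rewrite !cabsM cabs_real mulrA.
Qed.

Let cbx x1 x2 y : a <= x1 -> x2 <= b -> c <= y <= d -> cbm `[x1, x2] (G^~ y).
Proof.
move=> h1 h2 hy; apply: pcont_cbm => t /andP[t1 t2].
by apply: (gc _ hy).1; rewrite (le_trans h1)// (le_trans t2).
Qed.

Let cby y1 y2 x : c <= y1 -> y2 <= d -> a <= x <= b -> cbm `[y1, y2] (G x).
Proof.
move=> h1 h2 hx; apply: pcont_cbm => t /andP[t1 t2].
by apply: (gc hx _).2; rewrite (le_trans h1)// (le_trans t2).
Qed.

Let Jx x y u u' v : a <= x -> 0 <= u -> 0 <= u' -> x + u + u' <= b -> c <= y -> 0 <= v ->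
  y + v <= d -> J x y (u + u') v = J x y u v + J (x + u) y u' v.
Proof.
move=> hx u0 u0' xb hy v0 yd; rewrite /J.
have xu : x <= x + u by rewrite lerDl.
have xu' : x + u <= x + u + u' by rewrite lerDl.
have yv : y <= y + v by rewrite lerDl.
have fv := lam_itv_fin y (y + v).
have hyd : c <= y <= d by rewrite hy (le_trans yv).
have hyd' : c <= y + v <= d by rewrite yd (le_trans hy).
have X1 : a <= x <= b by rewrite hx (le_trans xu)// (le_trans xu').
have X2 : a <= x + u <= b by rewrite (le_trans hx)//= (le_trans xu').
have X3 : a <= x + u + u' <= b by rewrite xb (le_trans _ xu')// (le_trans hx).
rewrite addrA (@cint_split _ x (x + u))//; last by apply: cbmB; exact: cbx.
rewrite -[X in X - _ = _](_ : cint lam `[y, y + v] (fun t => G (x + u) t - G x t)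
  + cint lam `[y, y + v] (fun t => G (x + u + u') t - G (x + u) t) = _); last first.
  rewrite -cintD//; [|by apply: cbmB; exact: cby..].
  by apply: eq_cint => t _; ring.
ring.
Qed.

Let Jy x y u v v' : a <= x -> 0 <= u -> x + u <= b -> c <= y -> 0 <= v -> 0 <= v' ->
  y + v + v' <= d -> J x y u (v + v') = J x y u v + J x (y + v) u v'.
Proof.
move=> hx u0 xb hy v0 v0' yd; rewrite /J.
have xu : x <= x + u by rewrite lerDl.
have yv : y <= y + v by rewrite lerDl.
have yv' : y + v <= y + v + v' by rewrite lerDl.
have fu := lam_itv_fin x (x + u).
have Y1 : c <= y <= d by rewrite hy (le_trans yv)// (le_trans yv').
have Y2 : c <= y + v <= d by rewrite (le_trans hy)//= (le_trans yv').
have Y3 : c <= y + v + v' <= d by rewrite yd (le_trans _ yv')// (le_trans hy).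
have X1 : a <= x <= b by rewrite hx (le_trans xu).
have X2 : a <= x + u <= b by rewrite xb (le_trans hx).
rewrite addrA (@cint_split _ y (y + v))//; last by apply: cbmB; exact: cby.
rewrite -[X in _ - _ * X = _](_ : cint lam `[x, x + u] (fun t => G t (y + v) - G t y)
  + cint lam `[x, x + u] (fun t => G t (y + v + v') - G t (y + v)) = _); last first.
  rewrite -cintD//; [|by apply: cbmB; exact: cbx..].
  by apply: eq_cint => t _; ring.
ring.
Qed.

Let inside x y u v := [/\ a <= x, 0 <= u, x + u <= b & c <= y /\ 0 <= v /\ y + v <= d].

(** Halving both sides cuts the rectangle into four; [J] is additive under cuts, so one quarter
    carries at least a quarter of |J|. *)
Let Jsub x y u v : inside x y u v -> exists q : R * R,
  [/\ inside q.1 q.2 (u / 2) (v / 2), x <= q.1, q.1 + u / 2 <= x + u, y <= q.2 &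
     q.2 + v / 2 <= y + v /\ cabs (J x y u v) <= 4 * cabs (J q.1 q.2 (u / 2) (v / 2))].
Proof.
move=> [ax u0 xb [cy [v0 yd]]].
have u2 : 0 <= u / 2 by rewrite divr_ge0.
have v2 : 0 <= v / 2 by rewrite divr_ge0.
pose u' := u / 2; pose v' := v / 2.
have E : J x y u v = (J x y u' v' + J x (y + v') u' v') + (J (x + u') y u' v' + J (x + u') (y + v') u' v').
  have -> : u = u' + u' by rewrite /u'; lra.
  have -> : v = v' + v' by rewrite /v'; lra.
  have e1 : u' + u' = u by rewrite /u'; lra.
  have e2 : v' + v' = v by rewrite /v'; lra.
  rewrite Jx ?Jy//; rewrite /u' /v'; lra.
have ms (s1 s2 s3 s4 : C) : exists i j : bool,
    cabs ((s1 + s2) + (s3 + s4)) <= 4 * cabs (if i then if j then s1 else s2 else if j then s3 else s4).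
  have := le_trans (cabsD (s1 + s2) (s3 + s4)) (lerD (cabsD _ _) (cabsD _ _)).
  have [|h1] := lerP (cabs (s1 + s2 + (s3 + s4))) (4 * cabs s1); first by exists true, true.
  have [|h2] := lerP (cabs (s1 + s2 + (s3 + s4))) (4 * cabs s2); first by exists true, false.
  have [|h3] := lerP (cabs (s1 + s2 + (s3 + s4))) (4 * cabs s3); first by exists false, true.
  have [|h4] := lerP (cabs (s1 + s2 + (s3 + s4))) (4 * cabs s4); first by exists false, false.
  lra.
have [i [j]] := ms (J x y u' v') (J x (y + v') u' v') (J (x + u') y u' v') (J (x + u') (y + v') u' v').
rewrite -E => B.
exists ((if i then x else x + u'), (if j then y else y + v')) => /=.
split; last split; last by move: B; case: i; case: j.
- rewrite /inside; split; [case: i {B}; rewrite /u'; lra|exact: u2| case: i {B}; rewrite /u'; lra|].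
  split; [|split; [exact: v2|]]; case: j {B}; rewrite /v'; lra.
- by case: i {B}; rewrite /u'; lra.
- by case: i {B}; rewrite /u'; lra.
- by case: j {B}; rewrite /v'; lra.
- by case: j {B}; rewrite /v'; lra.
Qed.

(** [J] vanishes on affine functions of x + om y, so [G] may be replaced by its error [Er] at (X,
    Y), which is at most e(u + v) on sides of length u and v. *)
Let small x y u v X Y A e del : inside x y u v -> x <= X <= x + u -> y <= Y <= y + v ->
  0 < e -> u < del -> v < del ->
  (forall s t : R, `|s| < del -> `|t| < del ->
    cabs (G (X + s) (Y + t) - G X Y - A * ((s%:C : C) + om * (t%:C : C))) <= e * (`|s| + `|t|)) ->
  cabs (J x y u v) <= 2 * (1 + cabs om^-1) * (u + v) ^+ 2 * e.
Proof.
move=> [ax u0 xb [cy [v0 yd]]] /andP[xX Xx] /andP[yY Yy] e0 ud vd H.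
have hx : a <= x <= b by rewrite ax (le_trans _ xb)// lerDl.
have hx' : a <= x + u <= b by rewrite xb (le_trans ax)// lerDl.
have hy : c <= y <= d by rewrite cy (le_trans _ yd)// lerDl.
have hy' : c <= y + v <= d by rewrite yd (le_trans cy)// lerDl.
have fv := lam_itv_fin y (y + v); have fu := lam_itv_fin x (x + u).
have yv : y <= y + v by rewrite lerDl.
have xu : x <= x + u by rewrite lerDl.
pose Er s t := G s t - G X Y - A * (((s - X)%:C : C) + om * ((t - Y)%:C : C)).
have bE s t : x <= s <= x + u -> y <= t <= y + v -> cabs (Er s t) <= e * (u + v).
  move=> /andP[s1 s2] /andP[t1 t2].
  have sX : `|s - X| <= u by rewrite ler_norml; apply/andP; split; lra.
  have tY : `|t - Y| <= v by rewrite ler_norml; apply/andP; split; lra.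
  have := H (s - X) (t - Y) (le_lt_trans sX ud) (le_lt_trans tY vd).
  rewrite [X + _]addrC [Y + _]addrC !subrK => /le_trans; apply.
  by rewrite ler_wpM2l ?(ltW e0)// lerD.
have c1 : cbm `[y, y + v] (fun t => G (x + u) t - G x t) by apply: cbmB; exact: cby.
have c2 : cbm `[x, x + u] (fun s => G s (y + v) - G s y) by apply: cbmB; exact: cbx.
have E1 t : Er (x + u) t - Er x t = (G (x + u) t - G x t) - A * (u%:C : C).
  by rewrite /Er !rmorphB rmorphD /=; ring.
have E2 s : Er s (y + v) - Er s y = (G s (y + v) - G s y) - A * om * (v%:C : C).
  by rewrite /Er !rmorphB rmorphD /=; ring.
have -> : J x y u v = cint lam `[y, y + v] (fun t => Er (x + u) t - Er x t) -
  om^-1 * cint lam `[x, x + u] (fun s => Er s (y + v) - Er s y).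
  have -> : cint lam `[y, y + v] (fun t => Er (x + u) t - Er x t) = cint lam `[y, y + v]
     (fun t => (G (x + u) t - G x t) - A * (u%:C : C)) by apply: eq_cint => t _; exact: E1.
  have -> : cint lam `[x, x + u] (fun s => Er s (y + v) - Er s y) = cint lam `[x, x + u]
     (fun s => (G s (y + v) - G s y) - A * om * (v%:C : C)) by apply: eq_cint => t _; exact: E2.
  rewrite /J !cintB//; try exact: cbm_cst; try exact: cbx; try exact: cby.
  rewrite !cint_cst// !lam_itv// [y + v]addrC [x + u]addrC !addrK.
  by rewrite [v + y]addrC [u + x]addrC; field.
have e2 t : y <= t <= y + v -> cabs (Er (x + u) t - Er x t) <= 2 * (e * (u + v)).
  move=> ht; rewrite mulr_natl mulr2n (le_trans (cabsB _ _))// lerD//; apply: bE => //.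
    by rewrite xu lexx.
  by rewrite lexx.
have e1 s : x <= s <= x + u -> cabs (Er s (y + v) - Er s y) <= 2 * (e * (u + v)).
  move=> ht; rewrite mulr_natl mulr2n (le_trans (cabsB _ _))// lerD//; apply: bE => //.
    by rewrite yv lexx.
  by rewrite lexx.
have b1 : cabs (cint lam `[y, y + v] (fun t => Er (x + u) t - Er x t)) <= 2 * (e * (u + v)) * v.
  have lv : fine (lam `[y, y + v]) = v by rewrite lam_itv// addrAC subrr add0r.
  rewrite -[X in _ <= _ * X]lv; apply: cint_bound => //.
  by apply: (eq_cbm E1); apply: cbmB => //; exact: cbm_cst.
have b2 : cabs (cint lam `[x, x + u] (fun s => Er s (y + v) - Er s y)) <= 2 * (e * (u + v)) * u.
  have lu : fine (lam `[x, x + u]) = u by rewrite lam_itv// addrAC subrr add0r.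
  rewrite -[X in _ <= _ * X]lu; apply: cint_bound => //.
  by apply: (eq_cbm E2); apply: cbmB => //; exact: cbm_cst.
rewrite (le_trans (cabsB _ _))// cabsM.
rewrite (le_trans (lerD b1 (ler_wpM2l (cabs_ge0 _) b2)))//.
set k := cabs om^-1; have k0 : 0 <= k := cabs_ge0 _.
have euv : 0 <= 2 * (e * (u + v)) by rewrite mulr_ge0// mulr_ge0 ?(ltW e0)// addr_ge0.
rewrite (_ : 2 * (1 + k) * (u + v) ^+ 2 * e = 2 * (e * (u + v)) * ((1 + k) * (u + v))); last by ring.
rewrite [k * _]mulrCA -mulrDr ler_wpM2l// mulrDl mul1r lerD//.
  by rewrite lerDr.
by rewrite ler_wpM2l// lerDl.
Qed.

Lemma goursat : cint lam `[c, d] (fun t => G b t - G a t) =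
  om^-1 * cint lam `[a, b] (fun s => G s d - G s c).
Proof.
pose w := b - a; pose h := d - c.
have w0 : 0 <= w by rewrite subr_ge0.
have h0 : 0 <= h by rewrite subr_ge0.
suff : J a c w h = 0.
  rewrite /J /w /h [a + _]addrC [c + _]addrC !subrK => /eqP.
  by rewrite subr_eq0 => /eqP.
pose st n (q : R * R) := inside q.1 q.2 (w / 2 ^+ n) (h / 2 ^+ n).
have half (z : R) n : z / 2 ^+ n / 2 = z / 2 ^+ n.+1.
  by rewrite -mulrA -invfM exprS [2 * _]mulrC.
(* The choice of a quarter is made total by returning [q] itself when [q] is not an admissible
   corner; by [stq] the iteration never meets that case. *)
pose nx n q : R * R := if pselect (st n q) is left H then sval (cid (Jsub H)) else q.
have nxP n q : st n q -> [/\ st n.+1 (nx n q), q.1 <= (nx n q).1,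
    (nx n q).1 + w / 2 ^+ n.+1 <= q.1 + w / 2 ^+ n,
    q.2 <= (nx n q).2 & (nx n q).2 + h / 2 ^+ n.+1 <= q.2 + h / 2 ^+ n /\
    cabs (J q.1 q.2 (w / 2 ^+ n) (h / 2 ^+ n)) <=
      4 * cabs (J (nx n q).1 (nx n q).2 (w / 2 ^+ n.+1) (h / 2 ^+ n.+1))].
  rewrite /nx; case: pselect => // H _; case: (cid (Jsub H)) => q' /=.
  by rewrite /st !half => -[].
pose q := fix q n := if n is m.+1 then nx m (q m) else (a, c).
have stq n : st n (q n).
  elim: n => [|n ih]; last by case: (nxP _ _ ih).
  rewrite /st /= /inside expr0 !divr1; split; [exact: lexx|exact: w0|rewrite /w; lra|].
  by split; [exact: lexx|split; [exact: h0|rewrite /h; lra]].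
have Jq n : cabs (J a c w h) <= 4 ^+ n * cabs (J (q n).1 (q n).2 (w / 2 ^+ n) (h / 2 ^+ n)).
  elim: n => [|n ih]; first by rewrite /= expr0 mul1r !divr1.
  apply: (le_trans ih); rewrite exprSr -mulrA ler_wpM2l ?exprn_ge0//.
  by have [_ _ _ _ []] := nxP _ _ (stq n).
have nest n m : (n <= m)%N -> [/\ (q n).1 <= (q m).1, (q m).1 + w / 2 ^+ m <= (q n).1 + w / 2 ^+ n,
    (q n).2 <= (q m).2 & (q m).2 + h / 2 ^+ m <= (q n).2 + h / 2 ^+ n].
  move=> /subnK <-; elim: (m - n)%N => [|k [i1 i2 i3 i4]]; first by rewrite add0n.
  have [_ j1 j2 j3 [j4 _]] := nxP _ _ (stq (k + n)).
  rewrite addSn; split; [exact: le_trans j1|exact: le_trans i2|exact: le_trans j3|exact: le_trans i4].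
(* The common point of the nested intervals is the supremum of their left ends. *)
have lub (x : nat -> R) (z : R) : 0 <= z -> (forall n m, (n <= m)%N -> x n <= x m /\
    x m + z / 2 ^+ m <= x n + z / 2 ^+ n) -> exists X, forall n, x n <= X <= x n + z / 2 ^+ n.
  move=> z0 H; have ubx n : ubound (range x) (x n + z / 2 ^+ n).
    move=> _ [m _ <-]; have zn k : 0 <= z / 2 ^+ k by rewrite divr_ge0// exprn_ge0.
    have [nm|mn] := leqP n m.
      by have [_] := H _ _ nm; apply: le_trans; rewrite lerDl.
    by have [+ _] := H _ _ (ltnW mn); move=> /le_trans; apply; rewrite lerDl.
  exists (sup (range x)) => n; apply/andP; split.
    by apply: ub_le_sup; [exists (x 0%N + z / 2 ^+ 0)|exists n].
  by apply: ge_sup; [exists (x 0%N); exists 0%N|].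
have [|X hX] := lub (fun n => (q n).1) w w0; first by move=> n m /nest[].
have [|Y hY] := lub (fun n => (q n).2) h h0; first by move=> n m /nest[].
have XI : a <= X <= b by move: (hX 0%N); rewrite /= expr0 divr1 /w [a + _]addrC subrK.
have YI : c <= Y <= d by move: (hY 0%N); rewrite /= expr0 divr1 /h [c + _]addrC subrK.
have [A HA] := gd XI YI.
pose K := 2 * (1 + cabs om^-1) * (w + h) ^+ 2.
have K0 : 0 <= K.
  apply: mulr_ge0; first by rewrite mulr_ge0// addr_ge0// cabs_ge0.
  by rewrite exprn_ge0// addr_ge0.
have bJ e : 0 < e -> cabs (J a c w h) <= K * e.
  move=> e0; have [del d0 Hd] := HA _ e0.
  have [n Hn] : exists n, (w + h) / 2 ^+ n < del.
    exists (Num.truncn ((w + h) / del)).+1.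
    rewrite ltr_pdivrMr ?exprn_gt0// mulrC -ltr_pdivrMr//.
    apply: (lt_le_trans (truncnS_gt _)).
    by rewrite -natrX ler_nat ltnW// ltn_expl.
  have n2 : 0 < (2 : R) ^+ n by rewrite exprn_gt0.
  have wn : w / 2 ^+ n < del by rewrite (le_lt_trans _ Hn)// ler_wpM2r ?invr_ge0 ?(ltW n2)// lerDl.
  have hn : h / 2 ^+ n < del by rewrite (le_lt_trans _ Hn)// ler_wpM2r ?invr_ge0 ?(ltW n2)// lerDr.
  have := small (stq n) (hX n) (hY n) e0 wn hn Hd.
  (* The square of the side lengths supplies 1/4^n, which cancels the 4^n lost in n bisections and
     leaves K e. *)
  rewrite -mulrDl expr_div_n => /(ler_wpM2l (_ : 0 <= 4 ^+ n)) B.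
  apply: (le_trans (Jq n)); apply: (le_trans (B _)); first by rewrite exprn_ge0.
  rewrite /K -exprM muln2 -addnn exprD le_eqVlt; apply/orP; left; apply/eqP.
  by rewrite (_ : 4 ^+ n = 2 ^+ n * 2 ^+ n); [field; rewrite gt_eqF|rewrite -exprMn -natrM].
apply/eqP; rewrite -cabs_eq0 eq_le cabs_ge0 andbT.
apply/ler_addgt0Pr => e e0; rewrite add0r.
have K1 : 0 < K + 1 by rewrite ltr_wpDl.
apply: (le_trans (bJ (e / (K + 1)) _)); first by rewrite divr_gt0.
by rewrite mulrCA ler_piMr ?(ltW e0)// ler_pdivrMr// mul1r lerDl.
Qed.

End Goursat.

(** * Means over circles *)

Section MeanValue.
Variable R : realType.
Local Notation C := (CC R).
Local Notation lam := (@lebesgue_measure R).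
Local Notation U := (@unit_interval R).

Lemma lamU : lam U = 1%E.
Proof. by rewrite unit_intervalE lebesgue_measure_itv /= lte_fin ltr01 sube0. Qed.

Lemma lamU_fin : (lam U < +oo)%E.
Proof. by rewrite lamU ltry. Qed.

Lemma cint_unit_closed (p : R -> C) : cbm `[(0 : R), 1] p -> cint lam `[(0 : R), 1] p = cint lam U p.
Proof.
move=> hp; have f1 := lam_itv_fin 0 (1 : R).
have s : `[0 : R, 1[ `<=` `[0, 1] by apply: subset_itvl; rewrite bnd_simp.
have i1 : lam.-integrable `[(0:R), 1[ (EFin \o (fun t => complex.Re (p t))).
  by apply: integrableS (cbm_Re _ f1 hp).
have i2 : lam.-integrable `[(0:R), 1[ (EFin \o (fun t => complex.Im (p t))).
  by apply: integrableS (cbm_Im _ f1 hp).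
by rewrite unit_intervalE /cint (Rintegral_itv_bndo_bndc i1) (Rintegral_itv_bndo_bndc i2).
Qed.

(** Compactness of [0,1] makes the continuity uniform, also for displacements that leave the curve:
    a circle of nearby radius is treated as a displacement of the given one. *)
Lemma ccont_unif_curve (F : C -> C) (p : R -> C) :
  (forall t, pcont p t) -> (forall t, ccont F (p t)) ->
  forall e : R, 0 < e -> exists2 del : R, 0 < del & forall t (h : C), 0 <= t <= 1 ->
    cabs h < del -> cabs (F (p t + h) - F (p t)) <= e.
Proof.
move=> hp hF e e0.
pose P (del t : R) := forall h : C, cabs h < del -> cabs (F (p t + h) - F (p t)) <= e.
have NC : near_covering `[(0 : R), 1] by apply/compact_near_coveringP; exact: segment_compact.
have [|d /= d0 H] := NC R (0 : R)^'+ P _.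
  move=> t _; have [|d1 d10 H1] := hF t (e / 2); first by rewrite divr_gt0.
  have [|d2 d20 H2] := hp t (d1 / 3); first by rewrite divr_gt0.
  exists ([set t' | `|t' - t| < d2], [set del | del < d1 / 2]).
    split => /=.
      by apply/nbhs_ballP; exists d2 => //= s; rewrite /ball /= distrC.
    by apply: nbhs_right_lt; rewrite divr_gt0.
  move=> [t' del] [/= /H2]; rewrite [t + _]addrC subrK => ht hd h hh.
  have -> : F (p t' + h) - F (p t') =
     (F (p t + (p t' - p t + h)) - F (p t)) - (F (p t + (p t' - p t)) - F (p t)).
    have -> : p t + (p t' - p t + h) = p t' + h by ring.
    have -> : p t + (p t' - p t) = p t' by ring.
    ring.
  rewrite (le_trans (cabsB _ _))// [e]splitr lerD// H1//; last lra.
  by rewrite (le_lt_trans (cabsD _ _))//; lra.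
exists (d / 2); first by rewrite divr_gt0.
move=> t h t01 hh; apply: (H (d / 2)) => //=.
- by rewrite sub0r normrN ger0_norm ?divr_ge0// ?(ltW d0)// ltr_pdivrMr// ltr_pMr// ltr1n.
- by rewrite divr_gt0.
Qed.

Definition cmean (F : C -> C) (r : R) : C := cint lam U (fun t => F ((r%:C : C) * circ t)).

Lemma cbm_circle (F : C -> C) r : (forall t, ccont F ((r%:C : C) * circ t)) ->
  cbm U (fun t => F ((r%:C : C) * circ t)).
Proof.
move=> H; apply: pcont_cbm1 => t; apply: (@pcont_comp _ F (fun t => (r%:C : C) * circ t)) => //.
exact: pcont_scale_circ.
Qed.

Lemma cmean_near (F : C -> C) r e : (forall t, ccont F ((r%:C : C) * circ t)) -> 0 < e ->
  exists2 del : R, 0 < del & forall s, `|s - r| < del ->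
   (forall t, ccont F ((s%:C : C) * circ t)) -> cabs (cmean F s - cmean F r) <= e.
Proof.
move=> H e0; have [d d0 Hd] := ccont_unif_curve (pcont_scale_circ r) H e0.
exists d => // s sr Hs.
rewrite /cmean -cintB; try exact: cbm_circle; try exact: measurable_unit; try exact: lamU_fin.
have l1 : fine (lam U) = 1 by rewrite lamU.
rewrite -[e]mulr1 -[X in _ <= _ * X]l1.
apply: cint_bound; [exact: measurable_unit|exact: lamU_fin| |].
  by apply: cbmB; exact: cbm_circle.
move=> t /andP[t0 t1]; have := Hd t (((s - r)%:C : C) * circ t).
have -> : (r%:C : C) * circ t + ((s - r)%:C : C) * circ t = (s%:C : C) * circ t.
  by rewrite rmorphB /=; ring.
rewrite cabsM cabs_real cabs_circ mulr1.
by apply => //; rewrite t0 ltW.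
Qed.

Lemma cabs_scale_circ (r t : R) : 0 <= r -> cabs ((r%:C : C) * circ t) = r.
Proof. by move=> r0; rewrite cabsM cabs_real cabs_circ mulr1 ger0_norm. Qed.

Definition twopii : C := 0 +i* (2 * pi).

Lemma twopii_neq0 : twopii != 0.
Proof.
apply/eqP => /(congr1 (@complex.Im R)) /= /eqP; rewrite mulf_eq0 pnatr_eq0 /=.
by rewrite gt_eqF ?pi_gt0.
Qed.

Lemma cexp_polar (x y : R) : cexp ((x%:C : C) + twopii * (y%:C : C)) = ((expR x)%:C : C) * circ y.
Proof. by rewrite /cexp ReD ImD ReM ImM /= !(mul0r,mulr0,addr0,add0r,subr0). Qed.

(** Under the exponential the annulus becomes the rectangle [ln s1, ln s2] x [0,1] with complex
    variable x + 2 pi i y. The sides y = 0 and y = 1 have the same image and cancel in [goursat];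
    the other two sides give the two means. *)
Lemma annulus_mean (F : C -> C) (r1 r2 s1 s2 : R) : 0 <= r1 ->
  (forall w, r1 < cabs w -> cabs w < r2 -> exists d, hd F w d) ->
  r1 < s1 -> s1 <= s2 -> s2 < r2 -> cmean F s1 = cmean F s2.
Proof.
move=> r10 HF rs ss sr.
have s10 : 0 < s1 by exact: le_lt_trans rs.
have s20 : 0 < s2 by exact: lt_le_trans ss.
pose G x y := F (((expR x)%:C : C) * circ y).
have lnle : ln s1 <= ln s2 by rewrite ler_ln.
have gd x y : ln s1 <= x <= ln s2 -> (0 : R) <= y <= 1 ->
  exists A : C, forall e, 0 < e -> exists2 del : R, 0 < del & forall s t : R,
    `|s| < del -> `|t| < del ->
    cabs (G (x + s) (y + t) - G x y - A * ((s%:C : C) + twopii * (t%:C : C))) <= e * (`|s| + `|t|).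
  move=> /andP[x1 x2] _; pose z : C := (x%:C : C) + twopii * (y%:C : C).
  have [||d Hd] := HF (cexp z).
  - by rewrite cexp_polar cabs_scale_circ ?expR_ge0// (lt_le_trans rs)// -ler_ln ?posrE ?expR_gt0// expRK.
  - by rewrite cexp_polar cabs_scale_circ ?expR_ge0// (le_lt_trans _ sr)// -ler_ln ?posrE ?expR_gt0// expRK.
  have HFe := hd_comp (hd_cexp z) Hd; exists (d * cexp z) => e e0.
  pose K := 1 + cabs twopii; have K0 : 0 < K by rewrite ltr_pwDl// cabs_ge0.
  have [|del d0 H] := HFe (e / K); first by rewrite divr_gt0.
  exists (del / (2 * K)); first by rewrite divr_gt0// mulr_gt0.
  move=> s t sd td; have kst : cabs ((s%:C : C) + twopii * (t%:C : C)) <= K * (`|s| + `|t|).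
    rewrite (le_trans (cabsD _ _))// cabsM !cabs_real /K mulrDl mul1r mulrDr.
    by have := cabs_ge0 twopii; have := normr_ge0 s; have := normr_ge0 t; nra.
  have := H ((s%:C : C) + twopii * (t%:C : C)).
  rewrite /= /G.
  have -> : z + ((s%:C : C) + twopii * (t%:C : C)) = ((x + s)%:C : C) + twopii * ((y + t)%:C : C).
    by rewrite /z !rmorphD /=; ring.
  rewrite /z !cexp_polar => H'; apply: (le_trans (H' _)).
    rewrite (le_lt_trans kst)//; move: sd td; rewrite !ltr_pdivlMr ?mulr_gt0//; lra.
  have -> : e * (`|s| + `|t|) = e / K * (K * (`|s| + `|t|)).
    by rewrite mulrA mulfVK// gt_eqF.
  by rewrite ler_wpM2l// divr_ge0 ?(ltW e0) ?(ltW K0).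
have H := goursat twopii_neq0 lnle ler01 gd.
have HC s : s1 <= s <= s2 -> forall t, ccont F ((s%:C : C) * circ t).
  move=> /andP[h1 h2] t; have [||d /hd_ccont//] := HF ((s%:C : C) * circ t).
    by rewrite cabs_scale_circ ?(lt_le_trans rs)// (le_trans (ltW s10)).
  by rewrite cabs_scale_circ ?(le_lt_trans _ sr)// (le_trans (ltW s10)).
have HCI s : s1 <= s <= s2 -> cbm `[(0 : R), 1] (fun t => F ((s%:C : C) * circ t)).
  move=> hs; apply: pcont_cbm => t _.
  by apply: (@pcont_comp _ F (fun t => (s%:C : C) * circ t)); [exact: HC|exact: pcont_scale_circ].
have i1 : s1 <= s1 <= s2 by rewrite lexx.
have i2 : s1 <= s2 <= s2 by rewrite lexx andbT.
move: H; rewrite /G.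
have -> : cint lam `[ln s1, ln s2] (fun s => F (((expR s)%:C : C) * circ 1) - F (((expR s)%:C : C) * circ 0)) = 0.
  rewrite (@eq_cint _ _ _ _ _ _ (fun=> 0)); last by move=> t _; rewrite circ1 circ0 subrr.
  by rewrite cint_cst// mulr0.
rewrite mulr0 !lnK ?posrE// cint_unit_closed; last by apply: cbmB; exact: HCI.
rewrite cintB; [|exact: measurable_unit|exact: lamU_fin|exact: cbm_circle (HC _ i2)|exact: cbm_circle (HC _ i1)].
by move/eqP; rewrite subr_eq0 eq_sym => /eqP.
Qed.

Lemma cmean0 (F : C -> C) : cmean F 0 = F 0.
Proof.
rewrite /cmean (@eq_cint _ _ _ _ _ _ (fun=> F 0)); last by move=> t _; rewrite mul0r.
rewrite cint_cst; last exact: measurable_unit.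
 have -> : fine (lam U) = 1 by rewrite lamU.
by rewrite mul1r.
Qed.

(** A single circle on which differentiability fails is harmless, as the circle means depend continuously on the radius. *)
Lemma mean_value (F : C -> C) (r0 s0 r : R) :
  (forall w, cabs w < r0 -> ccont F w) ->
  (forall w, cabs w < r0 -> cabs w != s0 -> exists d, hd F w d) ->
  0 <= s0 -> 0 <= r < r0 -> cmean F r = F 0.
Proof.
move=> Fc Fd s00 /andP[rge rr0].
have Fcc s : 0 <= s < r0 -> forall t, ccont F ((s%:C : C) * circ t).
  by move=> /andP[s1 s2] t; apply: Fc; rewrite cabs_scale_circ.
(* If the mean has the value at [c] on all radii strictly between [c] and [s], continuity in the
   radius carries this value to [s]. *)
have lim (s c : R) : 0 <= s < r0 -> c != s -> 0 <= c < r0 ->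
  (forall s', Num.min c s < s' < Num.max c s -> cmean F s' = cmean F c) -> cmean F s = cmean F c.
  move=> hs cs hc H; apply/eqP; rewrite -subr_eq0 -cabs_eq0 eq_le cabs_ge0 andbT.
  apply/ler_addgt0Pr => e e0; rewrite add0r.
  have [d d0 Hd] := cmean_near (Fcc _ hs) e0.
  have [s' s's s'm] : exists2 s', `|s' - s| < d & Num.min c s < s' < Num.max c s.
    have [lt|gt|E] := ltgtP c s; last by rewrite E eqxx in cs.
      exists (s - Num.min (d / 2) ((s - c) / 2)).
        rewrite addrAC subrr add0r normrN ger0_norm; first by rewrite gt_min; apply/orP; left; lra.
        by rewrite le_min; apply/andP; split; lra.
      have : Num.min (d / 2) ((s - c) / 2) <= (s - c) / 2 by rewrite ge_min lexx orbT.
      have : 0 < Num.min (d / 2) ((s - c) / 2) by rewrite lt_min; apply/andP; split; lra.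
      lra.
    exists (s + Num.min (d / 2) ((c - s) / 2)).
      rewrite addrAC subrr add0r ger0_norm; first by rewrite gt_min; apply/orP; left; lra.
      by rewrite le_min; apply/andP; split; lra.
    have : Num.min (d / 2) ((c - s) / 2) <= (c - s) / 2 by rewrite ge_min lexx orbT.
    have : 0 < Num.min (d / 2) ((c - s) / 2) by rewrite lt_min; apply/andP; split; lra.
    lra.
  rewrite -(H _ s'm) cabs_distC; apply: Hd => //; apply: Fcc.
  move: s'm => /andP[]; rewrite gt_min lt_max; case/andP: hs => ? ?; case/andP: hc => ? ?.
  by move=> /orP[] ? /orP[] ?; apply/andP; split; lra.
(* For an annulus a < |w| < b lying on one side of the exceptional circle. *)
have ann (c s a b : R) : 0 <= a -> a < c < b -> a < s < b -> b <= r0 -> (s0 <= a \/ b <= s0) ->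
   cmean F c = cmean F s.
  move=> a0 /andP[ac cb] /andP[as_ sb] br out.
  have D w : a < cabs w -> cabs w < b -> exists d, hd F w d.
    move=> w1 w2; apply: Fd; first lra.
    by case: out => ?; [rewrite gt_eqF|rewrite lt_eqF]; lra.
  have [cs|/ltW sc] := leP c s.
    exact: (annulus_mean a0 D).
  by rewrite (annulus_mean a0 D as_ sc cb).
have low (s : R) : 0 <= s -> s < r0 -> s <= s0 -> cmean F s = F 0.
  move=> sge sr ss.
  have low1 (c : R) : 0 < c -> c < r0 -> c < s0 -> cmean F c = F 0.
    move=> c0 cr cs; rewrite -cmean0; symmetry; apply: lim; rewrite ?lexx ?(ltW c0) ?(lt_trans c0)//.
      by rewrite gt_eqF.
    move=> s'; rewrite min_r ?max_l ?(ltW c0)// => /andP[h1 h2].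
    apply: (ann _ _ 0 (Num.min r0 s0)).
    - exact: lexx.
    - by rewrite h1 lt_min; apply/andP; split; lra.
    - by rewrite c0 lt_min cr.
    - by rewrite ge_min lexx.
    - by right; rewrite ge_min lexx orbT.
  have [s_lt|] := ltP s s0.
    by move: sge; rewrite le_eqVlt => /predU1P[<-|sgt]; [exact: cmean0|exact: low1].
  move=> s_ge; have sE : s = s0 by lra.
  move: sge; rewrite le_eqVlt => /predU1P[<-|sgt]; first exact: cmean0.
  rewrite -(low1 (s / 2)); [|lra..]; apply: lim; [lra|by rewrite lt_eqF; lra|lra|].
  move=> s'; rewrite min_l ?max_r; [|lra..] => s'm.
  by rewrite !low1//; lra.
have [rs|sr] := leP r s0; first exact: low.
have s0r : s0 < r0 by lra.
rewrite -(low s0)//; symmetry; apply: lim; [lra|by rewrite gt_eqF|lra|].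
move=> s'; rewrite min_r ?max_l; [|lra..] => /andP[h1 h2].
by apply: (ann _ _ s0 r0) => //; [lra|lra|left].
Qed.

End MeanValue.

(** * Cauchy's formula, derivative estimates and polynomial approximation *)

Section CauchyFormula.
Variable R : realType.
Local Notation C := (CC R).
Local Notation lam := (@lebesgue_measure R).
Local Notation U := (@unit_interval R).

Definition hol (r0 : R) (f : C -> C) := forall w, cabs w < r0 -> exists d, hd f w d.

Lemma hol_cmean r0 f r : hol r0 f -> 0 <= r < r0 -> cmean f r = f 0.
Proof.
move=> hf; apply: (@mean_value _ _ _ 0) => //.
- by move=> w /hf[d /hd_ccont].
- by move=> w /hf.
Qed.

Lemma hol_circle r0 f r : hol r0 f -> 0 <= r < r0 ->
  cbm U (fun t => f ((r%:C : C) * circ t)).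
Proof.
move=> hf /andP[rge rr0]; apply: cbm_circle => t.
by have [|d /hd_ccont//] := hf ((r%:C : C) * circ t); rewrite cabs_scale_circ.
Qed.

(** On |w| = r one has conj w = r^2/w, hence w/(w - a) = 1 + conj G(w), where [G] is holomorphic
    beyond the circle and G(0) = 0. *)
Lemma cint_cauchy_kernel (a : C) (r : R) : cabs a < r ->
  cint lam U (fun t => ((r%:C : C) * circ t) / ((r%:C : C) * circ t - a)) = 1.
Proof.
move=> ar; have r0 : 0 < r by exact: le_lt_trans (cabs_ge0 a) ar.
have rC : (r%:C : C) != 0 by rewrite -cabs_eq0 cabs_real normr_eq0 gt_eqF.
pose G (w : C) : C := cconj a * w / ((r%:C : C) * r%:C - cconj a * w).
(* The harmonic mean of r and r^2/|a|, the modulus of the pole of [G]; in this form it also makes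
   sense for a = 0. *)
pose R1 := 2 * r ^+ 2 / (r + cabs a).
have ra : 0 < r + cabs a by rewrite ltr_wpDr ?cabs_ge0.
have rR1 : r < R1 by rewrite ltr_pdivlMr// expr2; nra.
have Gd (w : C) : cabs w < R1 -> (r%:C : C) * r%:C - cconj a * w != 0.
  move=> wR; rewrite subr_eq0; apply/eqP => /(congr1 (@cabs R)).
  rewrite !cabsM cabs_conj cabs_real gtr0_norm// => E.
  have := cabs_ge0 a; have := cabs_ge0 w; move: wR; rewrite ltr_pdivlMr// expr2; nra.
have hG : hol R1 G.
  move=> w wR; pose rr : C := (r%:C : C) * r%:C.
  have HN := hdM (hd_cst (cconj a) w) (hd_id w).
  have H := @hd_div R _ (fun x => rr - cconj a * x) w _ _ (Gd _ wR) HN (hdB (hd_cst rr w) HN).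
  by eexists; exact: H.
have M0 : cmean G r = 0.
  by rewrite (hol_cmean hG) ?(ltW r0)// /G mulr0 mul0r.
have k1 t : (r%:C : C) * circ t - a != 0 by exact: circ_sub_neq0.
have hcG : cbm U (fun t => G ((r%:C : C) * circ t)).
  by apply: (hol_circle hG); rewrite ltW.
have -> : cint lam U (fun t => ((r%:C : C) * circ t) / ((r%:C : C) * circ t - a)) =
   cint lam U (fun t => 1 + cconj (G ((r%:C : C) * circ t))).
  apply: eq_cint => t _; rewrite /G !cconjM cconjV cconjB !cconjM cconjK !cconj_real cconj_circ.
  have c0 := circ_neq0 t.
  have -> : (r%:C : C) * r%:C - a * (r%:C * (circ t)^-1) = r%:C * (circ t)^-1 * (r%:C * circ t - a).
    by field.
  by field; rewrite rC c0 k1.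
rewrite cintD; [|exact: measurable_unit|exact: lamU_fin|exact: cbm_cst|exact: cbm_conj].
rewrite cint_conj; [|exact: measurable_unit|exact: lamU_fin|exact: hcG].
rewrite -/(cmean G r) M0 cint_cst; last exact: measurable_unit.
have -> : fine (lam U) = 1 by rewrite lamU.
by rewrite mulr1 /cconj /= oppr0; apply: Ceq; rewrite ?ReD ?ImD /= addr0.
Qed.

Lemma cbe_circ (r : R) (z : C) : cabs z < r -> cbm (T := measurableTypeR R) U (fun t => ((r%:C : C) * circ t - z)^-1).
Proof. exact: cbm_circ_subV. Qed.

Definition cauchy_lam := @cauchy_type R _ _ lam U (@circ R).

Lemma cauchy_formula r0 f r a : hol r0 f -> r < r0 -> cabs a < r ->
  f a = cauchy_lam (fun t => f ((r%:C : C) * circ t) * ((r%:C : C) * circ t)) r 1 a.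
Proof.
move=> hf rr0 ar; have r_gt0 : 0 < r by exact: le_lt_trans (cabs_ge0 a) ar.
have rI : 0 <= r < r0 by rewrite ltW.
have [f'a Hfa] := hf a (lt_trans ar rr0).
pose F w : C := if w == a then a * f'a else w * (f w - f a) / (w - a).
have Fd w : cabs w < r0 -> w != a -> exists d, hd F w d.
  move=> wr wa; have [f'w Hfw] := hf w wr.
  have wa0 : w - a != 0 by rewrite subr_eq0.
  have H := @hd_div R (fun x => x * (f x - f a)) (fun x => x - a) w _ _ wa0
    (hdM (hd_id w) (hdB Hfw (hd_cst (f a) w))) (hdB (hd_id w) (hd_cst a w)).
  eexists; apply: (hd_eq _ _ H); first by rewrite -cabs_gt0 in wa0; exact: wa0.
  move=> h hh; rewrite /F; case: eqP => // E.
  by move: hh; rewrite -E opprD addrA subrr sub0r cabsN ltxx.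
have Fc w : cabs w < r0 -> ccont F w.
  move=> wr; have [->|wa] := eqVneq w a; last by have [d /hd_ccont] := Fd _ wr wa.
  move=> e e0; have K0 : 0 < cabs a + 1 by rewrite ltr_wpDl ?cabs_ge0.
  have K1 : 0 < cabs f'a + 1 by rewrite ltr_wpDl ?cabs_ge0.
  have [|d1 d10 H1] := Hfa (e / 2 / (cabs a + 1)); first by rewrite !divr_gt0.
  exists (Num.min d1 (Num.min 1 (e / 2 / (cabs f'a + 1)))).
    by rewrite !lt_min d10 ltr01 !divr_gt0.
  move=> h; rewrite !lt_min => /and3P[h1 h2 h3].
  rewrite /F eqxx; case: eqP => [_|/eqP ha]; first by rewrite subrr cabs0 ltW.
  have h0 : h != 0 by apply: contraNneq ha => ->; rewrite addr0.
  have -> : (a + h) * (f (a + h) - f a) / (a + h - a) - a * f'a =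
      (a + h) * ((f (a + h) - f a - f'a * h) / h) + h * f'a.
    by rewrite (_ : a + h - a = h); [field|ring].
  have B1 : cabs ((f (a + h) - f a - f'a * h) / h) <= e / 2 / (cabs a + 1).
    by rewrite cabsf ler_pdivrMr ?cabs_gt0// H1.
  have B2 : cabs (a + h) <= cabs a + 1 by rewrite (le_trans (cabsD _ _))// lerD// ltW.
  rewrite (le_trans (cabsD _ _))// [e]splitr lerD// cabsM.
    rewrite (le_trans (ler_pM (cabs_ge0 _) (cabs_ge0 _) B2 B1))// mulrC mulfVK// gt_eqF//.
  move: h3; rewrite ltr_pdivlMr// => h3.
  by rewrite (le_trans _ (ltW h3))// ler_wpM2l ?cabs_ge0// lerDl.
have FF := @mean_value R F r0 (cabs a) r Fc _ (cabs_ge0 a) rI.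
have {}FF : cmean F r = 0.
  rewrite FF => [|w wr wa]; last by apply: Fd => //; apply: contraNneq wa => ->.
  by rewrite /F; case: eqP => [<-|_]; rewrite !mul0r.
have k0 t : (r%:C : C) * circ t - a != 0 by exact: circ_sub_neq0.
pose k t : C := ((r%:C : C) * circ t) / ((r%:C : C) * circ t - a).
have hk : cbm U k.
  by apply: cbmM; [apply: pcont_cbm1 => t; exact: pcont_scale_circ|exact: cbm_circ_subV].
have hfc := hol_circle hf rI.
have E : cmean F r = cint lam U (fun t => f ((r%:C : C) * circ t) * k t - f a * k t).
  apply: eq_cint => t _; rewrite /F /k; case: eqP => [E|_]; first by move: (k0 t); rewrite E subrr eqxx.
  by field; rewrite k0.
move: FF; rewrite E cintB; [|exact: measurable_unit|exact: lamU_fin|exact: cbmM|exact: cbmZ].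
rewrite cintZ; [|exact: measurable_unit|exact: lamU_fin|exact: hk].
rewrite cint_cauchy_kernel// mulr1 => /eqP; rewrite subr_eq0 => /eqP <-.
by apply: eq_cint => t _; rewrite /k expr1 mulrA.
Qed.

Lemma cbm_cauchy_density r0 f r : hol r0 f -> 0 <= r < r0 ->
  cbm U (fun t => f ((r%:C : C) * circ t) * ((r%:C : C) * circ t)).
Proof.
move=> hf rI; apply: cbmM; first exact: (hol_circle hf).
by apply: pcont_cbm1 => t; exact: pcont_scale_circ.
Qed.

Lemma hd_cauchy_lam (p : R -> C) r z : cbm U p -> cabs z < r ->
  hd (cauchy_lam p r 1) z (cauchy_lam p r 2 z).
Proof.
move=> hp zr; apply: hd_cauchy_type => //; [exact: measurable_unit|exact: lamU_fin| |].
  by move=> t; exact: cabs_circ.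
exact: cbe_circ.
Qed.

Lemma cauchy_deriv r0 f r a : hol r0 f -> r < r0 -> cabs a < r ->
  hd f a (cauchy_lam (fun t => f ((r%:C : C) * circ t) * ((r%:C : C) * circ t)) r 2 a).
Proof.
move=> hf rr0 ar; have r_gt0 : 0 < r by exact: le_lt_trans (cabs_ge0 a) ar.
have rI : 0 <= r < r0 by rewrite ltW.
have H := hd_cauchy_lam (cbm_cauchy_density hf rI) ar.
have ra : 0 < r - cabs a by rewrite subr_gt0.
apply: (hd_eq ra _ H) => h hh; rewrite -(cauchy_formula hf)//.
by rewrite (le_lt_trans (cabsD _ _))// addrC -ltrBrDr.
Qed.

Lemma cauchy_estimate r0 f M : hol r0 f -> (forall w, cabs w < r0 -> cabs (f w) <= M) ->
  0 < r0 -> cabs ('D_1 f 0) <= M / r0.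
Proof.
move=> hf fM r00.
have B r : 0 < r < r0 -> cabs ('D_1 f 0) <= M / r.
  move=> /andP[rgt rr0]; have a0 : cabs (0 : C) < r by rewrite cabs0.
  have /hdP[_ ->] := cauchy_deriv hf rr0 a0.
  have rI : 0 <= r < r0 by rewrite ltW.
  have := @cauchy_type_bound R _ _ lam U (@circ R) _ _ _ _ (fun t => f ((r%:C : C) * circ t) * ((r%:C : C) * circ t)) r 2 0 (M * r).
  move=> /(_ (measurable_unit (R := R)) (lamU_fin R) (@cabs_circ R) cbe_circ).
  move=> /(_ (cbm_cauchy_density hf rI) a0 _)/le_trans; apply.
    move=> t _; rewrite cabsM (cabs_scale_circ t (ltW rgt)) ler_wpM2r ?(ltW rgt)// fM// cabs_scale_circ// ltW//.
  have -> : fine (lam U) = 1 by rewrite lamU.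
  rewrite cabs0 subr0 mulr1 expr2 invfM mulrA mulfK ?gt_eqF//.
have M0 : 0 <= M by apply: le_trans (cabs_ge0 (f 0)) (fM _ _); rewrite cabs0.
rewrite ler_pdivlMr// leNgt; apply/negP => H.
have D0 : 0 < cabs ('D_1 f 0).
  by rewrite -(pmulr_lgt0 _ r00); exact: le_lt_trans M0 H.
(* The estimate is known for radii below r0; were it false at r0, a radius midway between M/|f'(0)|
   and r0 would contradict it. *)
pose r := (M / cabs ('D_1 f 0) + r0) / 2.
have q1 : M / cabs ('D_1 f 0) < r0 by rewrite ltr_pdivrMr// mulrC.
have q0 : 0 <= M / cabs ('D_1 f 0) by rewrite divr_ge0// ltW.
have rI : 0 < r < r0 by rewrite /r; apply/andP; split; lra.
have := B r rI; case/andP: rI => rgt rlt; rewrite ler_pdivlMr// leNgt => /negP; apply.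
by rewrite mulrC -ltr_pdivrMr// /r; lra.
Qed.

Lemma ccont_deriv r0 f a : hol r0 f -> cabs a < r0 -> ccont (fun z => 'D_1 f z) a.
Proof.
move=> hf ar; pose r := (cabs a + r0) / 2.
have ar' : cabs a < r by rewrite /r; lra.
have rr0 : r < r0 by rewrite /r; lra.
have rI : 0 <= r < r0 by rewrite rr0 andbT (le_trans (cabs_ge0 a))// ltW.
have := @ccont_cauchy_type2 R _ _ lam U (@circ R) (measurable_unit (R := R)) (lamU_fin R) (@cabs_circ R) cbe_circ _ r a (cbm_cauchy_density hf rI) ar'.
move=> H e /H[d d0 Hd]; exists (Num.min d (r - cabs a)); first by rewrite lt_min d0 subr_gt0.
move=> h; rewrite lt_min => /andP[h1 h2].
have ahr : cabs (a + h) < r by rewrite (le_lt_trans (cabsD _ _))// addrC -ltrBrDr.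
have /hdP[_ ->] := cauchy_deriv hf rr0 ahr.
have /hdP[_ ->] := cauchy_deriv hf rr0 ar'.
exact: Hd.
Qed.

(** The polynomials are Taylor sums with coefficients given by Cauchy's formula. The remainder is
    z^n times an integral of f w^{-n} w/(w - z), hence O((rho/r)^n) on |z| <= rho. *)
Lemma poly_approx r0 f rho e : hol r0 f -> 0 <= rho < r0 -> 0 < e ->
  exists P : {poly C}, forall z, cabs z <= rho -> cabs (f z - P.[z]) <= e.
Proof.
move=> hf /andP[rhoge rhor0] e0; pose r := (rho + r0) / 2.
have rhor : rho < r by rewrite /r; lra.
have rr0 : r < r0 by rewrite /r; lra.
have rgt : 0 < r by lra.
have rI : 0 <= r < r0 by rewrite ltW.
pose w t : C := (r%:C : C) * circ t.
have w0 t : w t != 0 by rewrite -cabs_eq0 cabs_scale_circ ?(ltW rgt)// gt_eqF.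
have hfc : cbm U (fun t => f (w t)) := hol_circle hf rI.
have hw n : cbm U (fun t => (w t)^-1 ^+ n).
  apply: pcont_cbm1 => t; elim: n => [|n ih].
    by under eq_fun do rewrite expr0; exact: (@pcont_cst _ 1).
  under eq_fun do rewrite exprS.
  apply: (@pcontM _ (fun s => (w s)^-1) (fun s => (w s)^-1 ^+ n)); last exact: ih.
  by apply: pcontV; [exact: w0|exact: pcont_scale_circ].
have hwz z : cabs z < r -> cbm U (fun t => w t / (w t - z)).
  move=> zr; apply: cbmM; first by apply: pcont_cbm1 => t; exact: pcont_scale_circ.
  exact: cbm_circ_subV.
pose c n := cint lam U (fun t => f (w t) * (w t)^-1 ^+ n).
pose P n : {poly C} := \poly_(i < n) c i.
have E n z : cabs z < r -> f z - (P n).[z] =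
    z ^+ n * cint lam U (fun t => f (w t) * ((w t)^-1 ^+ n * (w t / (w t - z)))).
  move=> zr; elim: n => [|n ih].
    rewrite /P poly_def big_ord0 horner0 subr0 expr0 mul1r (cauchy_formula hf rr0 zr).
    by apply: eq_cint => t _; rewrite expr0 mul1r expr1 -/(w t) mulrA.
  have -> : (P n.+1).[z] = (P n).[z] + c n * z ^+ n.
    by rewrite /P !poly_def big_ord_recr /= hornerD hornerZ hornerXn.
  have hq m : cbm U (fun t => f (w t) * ((w t)^-1 ^+ m * (w t / (w t - z)))).
    by apply: cbmM; [exact: hfc|apply: cbmM; [exact: hw|exact: hwz]].
  have EI : cint lam U (fun t => f (w t) * ((w t)^-1 ^+ n * (w t / (w t - z)))) - c n =
      z * cint lam U (fun t => f (w t) * ((w t)^-1 ^+ n.+1 * (w t / (w t - z)))).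
    rewrite -cintZ; [|exact: measurable_unit|exact: lamU_fin|exact: hq].
    rewrite /c -cintB; [|exact: measurable_unit|exact: lamU_fin|exact: hq|by apply: cbmM; [exact: hfc|exact: hw]].
    by apply: eq_cint => t _; rewrite exprS; field; rewrite w0 circ_sub_neq0.
  by rewrite opprD addrA ih [c n * _]mulrC -mulrBr EI mulrA exprSr.
have [_ _ [M fM]] := hfc.
have q1 : rho / r < 1 by rewrite ltr_pdivrMr// mul1r.
have q0 : 0 <= rho / r by rewrite divr_ge0// ltW.
pose K := `|M| * (r / (r - rho)).
have K0 : 0 <= K.
  by rewrite mulr_ge0// divr_ge0 ?(ltW rgt)// subr_ge0 ltW.
have [n Hn] : exists n, (rho / r) ^+ n * (K + 1) <= e.
  have K1 : 0 < K + 1 by rewrite ltr_wpDl.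
  have eK : 0 < e / (K + 1) by rewrite divr_gt0.
  have := @cvg_expr R (rho / r); rewrite ger0_norm// => /(_ q1)/cvgrPdist_le/(_ _ eK)[n _ /(_ n (leqnn n))] /=.
  rewrite sub0r normrN ger0_norm ?exprn_ge0// ler_pdivlMr// => H.
  by exists n.
exists (P n) => z zrho; have zr : cabs z < r by exact: le_lt_trans rhor.
rewrite E// cabsM cabsX; apply: le_trans Hn.
have B : cabs (cint lam U (fun t => f (w t) * ((w t)^-1 ^+ n * (w t / (w t - z))))) <= r^-1 ^+ n * K.
  have l1 : fine (lam U) = 1 by rewrite lamU.
  rewrite -[leRHS]mulr1 -[X in _ <= _ * X]l1; apply: cint_bound; [exact: measurable_unit|exact: lamU_fin| |].
    by apply: cbmM; [exact: hfc|apply: cbmM; [exact: hw|exact: hwz]].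
  move=> t Ut; rewrite !cabsM cabsX !cabsV /w (cabs_scale_circ t (ltW rgt)) /K mulrCA.
  rewrite ler_wpM2l ?exprn_ge0 ?invr_ge0 ?(ltW rgt)//.
  apply: ler_pM; rewrite ?cabs_ge0 ?mulr_ge0 ?invr_ge0 ?cabs_ge0 ?(ltW rgt)//.
    by rewrite (le_trans (fM _ Ut))// ler_norm.
  rewrite cabs_real gtr0_norm// cabs_circ mulr1.
  rewrite ler_wpM2l ?(ltW rgt)// lef_pV2 ?posrE ?subr_gt0 ?cabs_gt0 ?circ_sub_neq0//.
  by rewrite (le_trans _ (circ_sub_ge t z (ltW rgt)))// lerB.
have zn : cabs z ^+ n <= rho ^+ n by rewrite lerXn2r ?nnegrE ?cabs_ge0.
rewrite (le_trans (ler_pM _ (cabs_ge0 _) zn B)) ?exprn_ge0 ?cabs_ge0//.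
by rewrite mulrA -exprMn ler_wpM2l ?exprn_ge0// lerDl.
Qed.

End CauchyFormula.

(** * The fundamental theorem of calculus along curves *)

Section FTCurve.
Variable R : realType.
Local Notation C := (CC R).
Local Notation Re := (@complex.Re R).
Local Notation Im := (@complex.Im R).
Local Notation lam := (@lebesgue_measure R).

Lemma eps_is_derive (u : R -> R) (t d : R) :
  (forall e : R, 0 < e -> exists2 del : R, 0 < del &
    forall h : R, `|h| < del -> `|u (t + h) - u t - d * h| <= e * `|h|) ->
  is_derive t 1 u d.
Proof.
move=> H.
have cv : (fun h : R => h^-1 *: ((u \o shift t) (h *: (1:R)) - u t)) @ (0:R)^' --> d.
  apply/cvgrPdist_le => e /H[del d0 Hd].
  apply/nbhs_ballP; exists del => // h; rewrite /ball /= sub0r normrN => hd h0.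
  rewrite -[h *: _]/(h * 1 : R) mulr1 -[_ *: _]/(_ * _ : R) [h + t]addrC.
  have -> : d - h^-1 * (u (t + h) - u t) = - (h^-1 * (u (t + h) - u t - d * h)) by field.
  by rewrite normrN normrM normfV ler_pdivrMl ?normr_gt0// [`|h| * _]mulrC Hd.
by split; [apply/cvg_ex; exists d|apply/cvg_lim].
Qed.

Lemma is_derive_cts (u : R -> R) (t d : R) : is_derive t 1 u d -> {for t, continuous u}.
Proof. by move=> [du _]; apply: differentiable_continuous; apply/derivable1_diffP. Qed.

Lemma FTC_real (u v : R -> R) (s r : R) : s < r ->
  (forall x, s <= x <= r -> is_derive x 1 u (v x)) ->
  (forall x, s <= x <= r -> {for x, continuous v}) ->
  Rintegral lam `[s, r] v = u r - u s.
Proof.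
move=> sr du cv; rewrite /Rintegral (@continuous_FTC2 _ _ u)//.
- by apply: continuous_in_subspaceT => x; rewrite inE /= in_itv => /cv.
- split.
  + by move=> x; rewrite in_itv /= => /andP[h1 h2]; have [] : is_derive x 1 u (v x) by apply: du; rewrite !ltW.
  + by apply: cvg_at_right_filter; apply: is_derive_cts (du s _); rewrite lexx ltW.
  + by apply: cvg_at_left_filter; apply: is_derive_cts (du r _); rewrite lexx ltW.
- move=> x; rewrite in_itv /= => /andP[h1 h2]; rewrite derive1E.
  by have [_ ->] : is_derive x 1 u (v x) by apply: du; rewrite !ltW.
Qed.

Definition pder (p : R -> C) t (q : C) := forall e : R, 0 < e -> exists2 del : R, 0 < del &
  forall h : R, `|h| < del -> cabs (p (t + h) - p t - q * (h%:C : C)) <= e * `|h|.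

Lemma pder_comp (f : C -> C) (p : R -> C) t a q : hd f (p t) a -> pder p t q ->
  pder (f \o p) t (a * q).
Proof.
move=> Hf Hp e e0.
have cq : 0 < 1 + cabs q by rewrite ltr_pwDl ?cabs_ge0.
have ca : 0 < 1 + cabs a by rewrite ltr_pwDl ?cabs_ge0.
have [|d1 d10 H1] := Hf (e / 2 / (1 + cabs q)); first by rewrite !divr_gt0.
have [|d2 d20 H2] := Hp (Num.min 1 (e / 2 / (1 + cabs a))); first by rewrite lt_min ltr01 !divr_gt0.
exists (Num.min d2 (d1 / (1 + cabs q))); first by rewrite lt_min d20 divr_gt0.
move=> h; rewrite lt_min => /andP[/H2 h1]; rewrite ltr_pdivlMr// => h2.
set k := p (t + h) - p t in h1.
have k1 : cabs k <= (1 + cabs q) * `|h|.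
  rewrite -(subrK (q * (h%:C : C)) k) (le_trans (cabsD _ _))// cabsM cabs_real mulrDl lerD//.
  by rewrite (le_trans h1)// ler_wpM2r// ge_min lexx.
have k2 : cabs k < d1 by rewrite (le_lt_trans k1)// mulrC.
have := H1 _ k2; rewrite /k [p t + _]addrC subrK -/k => {}H1.
have -> : (f \o p) (t + h) - (f \o p) t - a * q * (h%:C : C) =
  (f (p (t + h)) - f (p t) - a * k) + a * (k - q * (h%:C : C)) by rewrite /=; ring.
rewrite (le_trans (cabsD _ _))// [e]splitr mulrDl lerD//.
  rewrite (le_trans H1)// (le_trans (ler_wpM2l _ k1)) ?divr_ge0 ?(ltW e0) ?(ltW cq)//.
  by rewrite mulrA mulfVK ?gt_eqF.
rewrite cabsM (le_trans (ler_wpM2l (cabs_ge0 _) h1))// mulrA ler_wpM2r//.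
have : Num.min 1 (e / 2 / (1 + cabs a)) <= e / 2 / (1 + cabs a) by rewrite ge_min lexx orbT.
move=> /(ler_wpM2l (cabs_ge0 a)) /le_trans; apply.
by rewrite mulrA ler_pdivrMr// mulrC ler_wpM2l ?divr_ge0 ?(ltW e0)// lerDr.
Qed.

Lemma pder_Re (p : R -> C) t q : pder p t q ->
  is_derive t 1 (fun s => Re (p s)) (Re q) /\ is_derive t 1 (fun s => Im (p s)) (Im q).
Proof.
move=> H; split; apply: eps_is_derive => e /H[d d0 Hd]; exists d => // h /Hd; apply: le_trans.
  have -> : Re (p (t + h)) - Re (p t) - Re q * h = Re (p (t + h) - p t - q * (h%:C : C)).
    by rewrite !(ReD, ReN, ReM) /=; ring.
  exact: cabs_ge_Re.
have -> : Im (p (t + h)) - Im (p t) - Im q * h = Im (p (t + h) - p t - q * (h%:C : C)).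
  by rewrite !(ImD, ImN, ImM) /=; ring.
exact: cabs_ge_Im.
Qed.

Lemma FTC_curve (p q : R -> C) (s r : R) : s <= r ->
  (forall t, s <= t <= r -> pder p t (q t)) -> (forall t, s <= t <= r -> pcont q t) ->
  cint lam `[s, r] q = p r - p s.
Proof.
rewrite le_eqVlt => /predU1P[->|sr] Hp Hq.
  rewrite subrr set_itv1 /cint /Rintegral !integral_set1 //=.
apply: Ceq; rewrite /cint ?ReD ?ImD ?ReN ?ImN /=.
  apply: (@FTC_real (fun s => Re (p s)) (fun s => Re (q s))) => // t ht; first by have [] := pder_Re (Hp t ht).
  by have [] := (pcontP q t).1 (Hq t ht).
apply: (@FTC_real (fun s => Im (p s)) (fun s => Im (q s))) => // t ht; first by have [] := pder_Re (Hp t ht).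
by have [] := (pcontP q t).1 (Hq t ht).
Qed.

Lemma pder_scale (c : C) t : pder (fun s : R => (s%:C : C) * c) t c.
Proof.
move=> e e0; exists 1 => // h _.
have -> : ((t + h)%:C : C) * c - (t%:C : C) * c - c * (h%:C : C) = 0 by rewrite rmorphD /=; ring.
by rewrite cabs0 mulr_ge0// ltW.
Qed.

Lemma pcont_scale (c : C) t : pcont (fun s : R => (s%:C : C) * c) t.
Proof.
apply: (@pcontM _ (fun s : R => (s%:C : C)) (fun=> c)); last exact: pcont_cst.
by apply: (@pcont_real _ id); exact: cvg_id.
Qed.

(** The velocity of x |-> x circ t is unimodular, so the length of the increment involves |g'|
    alone. *)
Lemma radial_increment (g : C -> C) (s r t : R) : hol 1 g -> 0 <= s <= r -> r < 1 ->
  cabs (g ((r%:C : C) * circ t) - g ((s%:C : C) * circ t)) <=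
  Rintegral lam `[s, r] (fun x => cabs ('D_1 g ((x%:C : C) * circ t))).
Proof.
move=> hg /andP[s0 sr] r1; have hx x : s <= x <= r -> cabs ((x%:C : C) * circ t) < 1.
  by move=> /andP[h1 h2]; rewrite cabs_scale_circ ?(le_trans s0)// (le_lt_trans h2).
pose p x := g ((x%:C : C) * circ t).
pose q x : C := 'D_1 g ((x%:C : C) * circ t) * circ t.
have Hp x : s <= x <= r -> pder p x (q x).
  move=> /hx h; have [d /[dup]/hdP[_ <-] Hd] := hg _ h.
  exact: (@pder_comp g (fun y => (y%:C : C) * circ t)) Hd (pder_scale (circ t) x).
have Hq x : s <= x <= r -> pcont q x.
  move=> /hx h; apply: (@pcontM _ (fun x => 'D_1 g ((x%:C : C) * circ t)) (fun=> circ t)); last exact: pcont_cst.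
  apply: (@pcont_comp _ (fun z => 'D_1 g z) (fun y => (y%:C : C) * circ t)); last exact: pcont_scale.
  exact: (ccont_deriv hg h).
rewrite -/(p r) -/(p s) -(FTC_curve sr Hp Hq).
have fin := lam_itv_fin s r.
apply: (le_trans (cabs_cint _ fin _)) => //; first exact: pcont_cbm.
rewrite le_eqVlt; apply/orP; left; apply/eqP; apply: eq_Rintegral => x _.
by rewrite cabsM cabs_circ mulr1.
Qed.

End FTCurve.

(** * The pairing on circles *)

Section Pairing.
Variable R : realType.
Local Notation C := (CC R).
Local Notation lam := (@lebesgue_measure R).
Local Notation U := (@unit_interval R).

(** The pairing of the statement is the case x = y. Two radii are allowed because only their product
    matters ([npair_prod]), so radius can be moved from one factor to the other. *)
Definition npair (f g : C -> C) (x y : R) : C :=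
  cint lam U (fun t => f ((x%:C : C) * circ t) * cconj (g ((y%:C : C) * circ t))).

Lemma hd_pow n (z : C) : exists d, hd (fun w : C => w ^+ n) z d.
Proof.
elim: n => [|n [d ih]].
  by exists 0; under eq_fun do rewrite expr0; exact: hd_cst.
have H := hdM (hd_id z) ih.
by eexists; under eq_fun do rewrite exprS; exact: H.
Qed.

Lemma cconjX (z : C) n : cconj (z ^+ n) = cconj z ^+ n.
Proof. by elim: n => [|n ih]; rewrite ?expr0 /cconj ?oppr0//= !exprS -ih -cconjM. Qed.

Lemma hd_poly (P : {poly C}) (z : C) : exists d, hd (fun w : C => P.[w]) z d.
Proof.
elim/poly_ind: P => [|P c [d ih]].
  by exists 0; under eq_fun do rewrite horner0; exact: hd_cst.
have H := hdD (hdM ih (hd_id z)) (hd_cst c z).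
by eexists; under eq_fun do rewrite hornerD hornerM hornerX hornerC; exact: H.
Qed.

Lemma cbm_npair r0 (f g : C -> C) x y : hol r0 f -> hol r0 g -> 0 <= x < r0 -> 0 <= y < r0 ->
  cbm U (fun t => f ((x%:C : C) * circ t) * cconj (g ((y%:C : C) * circ t))).
Proof.
by move=> hf hg hx hy; apply: cbmM; [exact: hol_circle hf hx|apply: cbm_conj; exact: hol_circle hg hy].
Qed.

(** The integral equals (xy)^n times the conjugate of the mean of g(w) w^{-n} over |w| = y. That
    function is holomorphic in the punctured disc, so its mean does not depend on y. *)
Lemma npair_monomial (g : C -> C) n x y x' y' : hol 1 g ->
  0 < y < 1 -> 0 < y' < 1 -> x * y = x' * y' ->
  npair (fun w => w ^+ n) g x y = npair (fun w => w ^+ n) g x' y'.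
Proof.
move=> hg yI y'I E.
pose F w : C := g w * w^-1 ^+ n.
have hF w : 0 < cabs w -> cabs w < 1 -> exists d, hd F w d.
  rewrite cabs_gt0 => w0 w1; have [d Hd] := hg _ w1.
  have [c Hc] := hd_pow n w^-1.
  by eexists; exact: hdM Hd (hd_comp (hdV w0) Hc).
have EF z s : 0 < s < 1 -> npair (fun w => w ^+ n) g z s = ((z * s)%:C : C) ^+ n * cconj (cmean F s).
  move=> /andP[s0 s1]; have sC : (s%:C : C) != 0 by rewrite -cabs_eq0 cabs_real normr_eq0 gt_eqF.
  have hFs : cbm U (fun t => F ((s%:C : C) * circ t)).
    apply: cbm_circle => t; have [||d /hd_ccont//] := hF ((s%:C : C) * circ t).
      by rewrite cabs_scale_circ// ltW.
    by rewrite cabs_scale_circ// ltW.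
  rewrite /cmean -cint_conj; [|exact: measurable_unit|exact: lamU_fin|exact: hFs].
  rewrite -cintZ; [|exact: measurable_unit|exact: lamU_fin|exact: cbm_conj].
  apply: eq_cint => t _; rewrite /F cconjM.
  have -> : cconj (((s%:C : C) * circ t)^-1 ^+ n) = ((s%:C : C)^-1 * circ t) ^+ n.
    by rewrite cconjX cconjV cconjM cconj_real cconj_circ invfM invrK.
  rewrite rmorphM /= [_ * (_ * _)]mulrCA mulrC -exprMn; congr (_ * _).
  by congr (_ ^+ _); field; rewrite sC.
rewrite (EF x y yI) (EF x' y' y'I) E.
suff -> : cmean F y = cmean F y' by [].
have [/andP[y0 y1] /andP[y'0 y'1]] := (yI, y'I).
have [yy|/ltW yy] := leP y y'; first exact: (annulus_mean _ hF).
by symmetry; exact: (annulus_mean _ hF).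
Qed.

Lemma npair_poly (P : {poly C}) (g : C -> C) x y x' y' : hol 1 g ->
  0 <= x < 1 -> 0 <= x' < 1 -> 0 < y < 1 -> 0 < y' < 1 -> x * y = x' * y' ->
  npair (fun w => P.[w]) g x y = npair (fun w => P.[w]) g x' y'.
Proof.
move=> hg xI x'I yI y'I E.
have yI' : 0 <= y < 1 by case/andP: yI => *; rewrite ltW.
have y'I' : 0 <= y' < 1 by case/andP: y'I => *; rewrite ltW.
have hpow n : hol 1 (fun w : C => w ^+ n) by move=> w _; exact: hd_pow.
have hsum n : hol 1 (fun w : C => \sum_(i < n) P`_i * w ^+ i).
  move=> w _; have [d Hd] := hd_poly (\poly_(i < n) P`_i) w.
  by exists d; move: Hd; congr (hd _ _ _); apply/funext => z; rewrite horner_poly.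
suff H n : npair (fun w => \sum_(i < n) P`_i * w ^+ i) g x y =
    npair (fun w => \sum_(i < n) P`_i * w ^+ i) g x' y'.
  by have := H (size P); congr (npair _ _ _ _ = npair _ _ _ _); apply/funext => z; rewrite horner_coef.
elim: n => [|n ih].
  have -> : (fun w => \sum_(i < 0) P`_i * w ^+ i) = (fun=> 0) by apply/funext => w; rewrite big_ord0.
  by rewrite /npair; apply: eq_cint => t _; rewrite !mul0r.
have step z s : 0 <= z < 1 -> 0 <= s < 1 -> npair (fun w => \sum_(i < n.+1) P`_i * w ^+ i) g z s =
    npair (fun w => \sum_(i < n) P`_i * w ^+ i) g z s + P`_n * npair (fun w => w ^+ n) g z s.
  move=> hz hs; have c1 := cbm_npair (hsum n) hg hz hs; have c2 := cbm_npair (hpow n) hg hz hs.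
  rewrite /npair -cintZ; [|exact: measurable_unit|exact: lamU_fin|exact: c2].
  rewrite -cintD; [|exact: measurable_unit|exact: lamU_fin|exact: c1|exact: cbmZ].
  by apply: eq_cint => t _; rewrite big_ord_recr /= mulrDl mulrA.
by rewrite (step _ _ xI yI') (step _ _ x'I y'I') ih (npair_monomial n hg yI y'I E).
Qed.

(** From polynomials to [f] by uniform approximation on the larger of the two circles where [f] is
    evaluated. *)
Lemma npair_prod (f g : C -> C) x y x' y' : hol 1 f -> hol 1 g ->
  0 <= x < 1 -> 0 <= x' < 1 -> 0 < y < 1 -> 0 < y' < 1 -> x * y = x' * y' ->
  npair f g x y = npair f g x' y'.
Proof.
move=> hf hg xI x'I yI y'I E.
have yI' : 0 <= y < 1 by case/andP: yI => *; rewrite ltW.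
have y'I' : 0 <= y' < 1 by case/andP: y'I => *; rewrite ltW.
have [_ _ [M1 gM1]] := hol_circle hg yI'.
have [_ _ [M2 gM2]] := hol_circle hg y'I'.
pose M := `|M1| + `|M2|.
apply/eqP; rewrite -subr_eq0 -cabs_eq0 eq_le cabs_ge0 andbT.
apply/ler_addgt0Pr => e e0; rewrite add0r.
have M0 : 0 < 2 * (M + 1) by rewrite mulr_gt0// ltr_wpDl// addr_ge0.
have rho : 0 <= Num.max x x' < 1.
  by case/andP: xI => x0 x1; case/andP: x'I => x'0 x'1; rewrite le_max x0 gt_max x1 x'1.
have [|P HP] := @poly_approx R 1 f (Num.max x x') (e / (2 * (M + 1))) hf rho; first by rewrite divr_gt0.
have hP : hol 1 (fun w : C => P.[w]) by move=> w _; exact: hd_poly.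
have near z s N : 0 <= z < 1 -> z <= Num.max x x' -> 0 <= s < 1 -> N <= M ->
   (forall t, U t -> cabs (g ((s%:C : C) * circ t)) <= N) ->
   cabs (npair f g z s - npair (fun w => P.[w]) g z s) <= e / 2.
  move=> hz zx hs NM gN.
  have c1 := cbm_npair hf hg hz hs; have c2 := cbm_npair hP hg hz hs.
  rewrite /npair -cintB; [|exact: measurable_unit|exact: lamU_fin|exact: c1|exact: c2].
  have l1 : fine (lam U) = 1 by rewrite lamU.
  rewrite -[leRHS]mulr1 -[X in _ <= _ * X]l1; apply: cint_bound; [exact: measurable_unit|exact: lamU_fin|exact: cbmB|].
  move=> t Ut; rewrite -mulrBl cabsM cabs_conj.
  have -> : e / 2 = e / (2 * (M + 1)) * (M + 1) by field; rewrite gt_eqF// ltr_wpDl// addr_ge0.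
  apply: ler_pM; rewrite ?cabs_ge0//.
    by apply: HP; rewrite cabs_scale_circ//; case/andP: hz.
  by rewrite (le_trans (gN _ Ut))// (le_trans NM)// lerDl.
have n1 := near x y _ xI _ yI' _ gM1; have n2 := near x' y' _ x'I _ y'I' _ gM2.
have -> : npair f g x y - npair f g x' y' = (npair f g x y - npair (fun w => P.[w]) g x y)
   - (npair f g x' y' - npair (fun w => P.[w]) g x' y').
  by rewrite (npair_poly P hg xI x'I yI y'I E); ring.
rewrite (le_trans (cabsB _ _))// [e]splitr lerD//.
  by apply: n1; rewrite ?le_max ?lexx// /M (le_trans (ler_norm _))// lerDl.
by apply: n2; rewrite ?le_max ?lexx ?orbT// /M (le_trans (ler_norm _))// lerDr.
Qed.

End Pairing.

(** * Area integrals of radial means *)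

Section Caratheodory.
Variable R : realType.
Local Notation mR := (measurableTypeR R).
Context d (T : measurableType d).

Let q n (x : R) : R := (Num.floor (x * n.+1%:R))%:~R / n.+1%:R.

Let q_near n x : `|q n x - x| <= n.+1%:R^-1.
Proof.
have n0 : 0 < (n.+1%:R : R) by rewrite ltr0n.
have := floor_le (x * n.+1%:R); have := lt_succ_floor (x * n.+1%:R) => h1 h2.
have -> : q n x - x = ((Num.floor (x * n.+1%:R))%:~R - x * n.+1%:R) / n.+1%:R.
  by rewrite /q mulrBl mulfK ?gt_eqF.
rewrite normrM normfV [`|n.+1%:R|]gtr0_norm// ler_piMl ?invr_ge0 ?(ltW n0)//.
by rewrite ler_norml; move: h1; rewrite intrD => h1; apply/andP; split; lra.
Qed.

(** Approximate the first variable by its dyadic-type truncations, which take countably many values. *)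
Lemma caratheodory_measurable (F : R -> T -> R) (O : set (mR * T)) : measurable O ->
  (forall x, measurable_fun setT (F x)) ->
  (forall p, O p -> {for p.1, continuous (F^~ p.2)}) ->
  measurable_fun O (fun p : mR * T => F p.1 p.2).
Proof.
move=> mO mF cF.
apply: (@measurable_fun_cvg _ _ _ _ (fun n (p : mR * T) => F (q n p.1) p.2)).
  move=> n; apply: measurable_funTS.
  (* [dec] enumerates the integers. On the strip [E k] the truncated variable is constant, and
     countably many strips cover the product. *)
  pose dec k : int := odflt 0 (unpickle k).
  have n0 : 0 < (n.+1%:R : R) by rewrite ltr0n.
  pose E k : set (mR * T) := [set p | ((dec k)%:~R <= (p.1 : R) * n.+1%:R < (dec k)%:~R + 1)].
  have -> : [set: mR * T] = \bigcup_k E k.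
    apply/esym/seteqP; split => // -[x y] _; exists (pickle (Num.floor (x * n.+1%:R))) => //.
    rewrite /E /dec pickleK /= floor_le /=.
    by have := lt_succ_floor (x * n.+1%:R); rewrite intrD.
  have mE k : measurable (E k).
    have -> : E k = (fst : mR * T -> mR) @^-1` `[(dec k)%:~R / n.+1%:R, ((dec k)%:~R + 1) / n.+1%:R[.
      by apply/seteqP; split => -[x y]; rewrite /E /= in_itv /= ler_pdivrMr// ltr_pdivlMr.
    by rewrite -[X in measurable X]setTI; exact: measurable_fst.
  apply/measurable_fun_bigcup => // k.
  apply: (@eq_measurable_fun _ _ _ _ _ (fun p : mR * T => F ((dec k)%:~R / n.+1%:R) p.2)).
    move=> [x y]; rewrite inE /E /= => H; congr (F _ _); rewrite /q; congr (_%:~R / _).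
    by apply/esym/floor_def; rewrite intrD.
  by apply: measurable_funTS; apply: measurableT_comp => //; exact: mF.
move=> [x y] /cF /= /cvgrPdist_le H; apply/cvgrPdist_le => e e0.
have /nbhs_ballP[del /= d0 Hd] := H _ e0.
near=> n; apply: Hd; rewrite /ball /= distrC (le_lt_trans (q_near _ _))//.
near: n; exact: near_infty_natSinv_lt (PosNum d0).
Unshelve. all: by end_near. Qed.

End Caratheodory.

(** * Shears and rotations of the plane *)

Section Planar.
Variable R : realType.
Local Notation mR := (measurableTypeR R).
Local Notation lam := (@lebesgue_measure R).
Local Notation lam2 := (lam \x lam)%E.
Local Open Scope ereal_scope.

Lemma lebesgue_measure_shift (c : R) (A : set mR) : measurable A ->
  pushforward lam ((fun x => x + c)%R : mR -> mR) A = lam A.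
Proof.
have mc : measurable_fun setT ((fun x => x + c)%R : mR -> mR).
  by apply: measurable_funD => //; exact: measurable_cst.
move=> mA.
have := @lebesgue_measure_unique R (pushforward lam ((fun x => x + c)%R : mR -> mR)).
move=> /(_ mc) H; rewrite -(H _ A mA)// => _ [[a b]] _ <-.
rewrite /pushforward.
rewrite [X in _ = lam X](_ : _ = `](a - c)%R, (b - c)%R]%classic); last first.
  by apply/seteqP; split => x /=; rewrite !in_itv /= ltrBlDr lerBrDr.
by rewrite !lebesgue_measure_itv/= !lte_fin ltrD2r -!EFinB opprB addrA subrK.
Qed.

Lemma ge0_integral_shift (c : R) (f : mR -> \bar R) : measurable_fun setT f ->
  (forall x, 0 <= f x) -> \int[lam]_x f (x + c)%R = \int[lam]_x f x.
Proof.
move=> mf f0.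
have mc : measurable_fun setT ((fun x => x + c)%R : mR -> mR).
  by apply: measurable_funD => //; exact: measurable_cst.
transitivity (\int[pushforward lam ((fun x => x + c)%R : mR -> mR)]_x f x).
  by rewrite ge0_integral_pushforward.
by apply: eq_measure_integral => A mA _; exact: lebesgue_measure_shift.
Qed.

Lemma ge0_integral_shear1 (c : R) (f : mR * mR -> \bar R) : measurable_fun setT f ->
  (forall p, 0 <= f p) -> \int[lam2]_p f (p.1 + c * p.2, p.2)%R = \int[lam2]_p f p.
Proof.
move=> mf f0.
have mg : measurable_fun setT ((fun p => (p.1 + c * p.2, p.2)%R) : mR * mR -> mR * mR).
  apply: measurable_fun_pair => //; apply: measurable_funD => //.
  by apply: measurable_funM => //; exact: measurable_cst.
rewrite fubini_tonelli2//; last exact: (measurableT_comp mf mg).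
rewrite [RHS]fubini_tonelli2//; apply: eq_integral => y _.
rewrite /fubini_G /=; apply: (@ge0_integral_shift (c * y)%R (fun x => f (x, y))) => //.
by apply: measurableT_comp => //; exact: pair2_measurable.
Qed.

Lemma ge0_integral_shear2 (c : R) (f : mR * mR -> \bar R) : measurable_fun setT f ->
  (forall p, 0 <= f p) -> \int[lam2]_p f (p.1, p.2 + c * p.1)%R = \int[lam2]_p f p.
Proof.
move=> mf f0.
have mg : measurable_fun setT ((fun p => (p.1, p.2 + c * p.1)%R) : mR * mR -> mR * mR).
  apply: measurable_fun_pair => //; apply: measurable_funD => //.
  by apply: measurable_funM => //; exact: measurable_cst.
rewrite fubini_tonelli1//; last exact: (measurableT_comp mf mg).
rewrite [RHS]fubini_tonelli1//; apply: eq_integral => x _.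
rewrite /fubini_F /=; apply: (@ge0_integral_shift (c * x)%R (fun y => f (x, y))) => //.
by apply: measurableT_comp => //; exact: pair1_measurable.
Qed.

Definition rot (a b : R) (p : mR * mR) : mR * mR := (a * p.1 - b * p.2, b * p.1 + a * p.2)%R.

Lemma measurable_rot a b : measurable_fun setT (rot a b).
Proof.
by apply: measurable_fun_pair; [apply: measurable_funB|apply: measurable_funD];
  apply: measurable_funM => //; exact: measurable_cst.
Qed.

(** A rotation is a product of three shears. *)
Lemma ge0_integral_rot (a b : R) (f : mR * mR -> \bar R) : (a ^+ 2 + b ^+ 2 = 1)%R ->
  measurable_fun setT f -> (forall p, 0 <= f p) ->
  \int[lam2]_p f (rot a b p) = \int[lam2]_p f p.
Proof.
move=> ab.
have gen (a' b' : R) (g : mR * mR -> \bar R) : (a' ^+ 2 + b' ^+ 2 = 1)%R -> (1 + a' != 0)%R ->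
    measurable_fun setT g -> (forall p, 0 <= g p) ->
    \int[lam2]_p g (rot a' b' p) = \int[lam2]_p g p.
  (* The slope of the two outer shears is minus the tangent of half the angle, finite because 1 + a'
     is nonzero; the middle shear has slope b'. *)
  move=> ab' a1 mg g0; pose k := (- (b' / (1 + a')))%R.
  have ms1 c : measurable_fun setT ((fun p => (p.1 + c * p.2, p.2)%R) : mR * mR -> mR * mR).
    apply: measurable_fun_pair => //; apply: measurable_funD => //.
    by apply: measurable_funM => //; exact: measurable_cst.
  have ms2 c : measurable_fun setT ((fun p => (p.1, p.2 + c * p.1)%R) : mR * mR -> mR * mR).
    apply: measurable_fun_pair => //; apply: measurable_funD => //.
    by apply: measurable_funM => //; exact: measurable_cst.
  have m1 : measurable_fun setT (fun p : mR * mR => g (p.1 + k * p.2, p.2)%R).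
    exact: (measurableT_comp mg (ms1 k)).
  have m2 : measurable_fun setT (fun p : mR * mR => g (p.1 + k * (p.2 + b' * p.1), p.2 + b' * p.1)%R).
    exact: (measurableT_comp m1 (ms2 b')).
  rewrite -(ge0_integral_shear1 k mg g0).
  rewrite -(ge0_integral_shear2 b' m1)//.
  rewrite -[RHS](ge0_integral_shear1 k m2)//.
  apply: eq_integral => -[x y] _ /=; congr g; rewrite /rot /= /k.
  have bb : (b' * b' = (1 - a') * (1 + a'))%R.
    by move: ab'; rewrite !expr2 => ab'; rewrite mulrBl !mul1r mulrDr mulr1; lra.
  congr (_, _); last first.
    apply: (mulfI a1); transitivity (b' * (1 + a') * x + (1 + a' - b' * b') * y)%R; last by field.
    rewrite bb; ring.
  apply: (mulfI a1); apply: (mulfI a1).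
  transitivity ((1 + a') * (1 + a' - b' * b') * x - b' * (2 * (1 + a') - b' * b') * y)%R; last by field.
  rewrite bb; ring.
(* The half-turn, where the half-angle tangent is infinite, is obtained as two quarter-turns. *)
have [a1|a1] := eqVneq (1 + a)%R 0%R; last exact: gen.
have aE : a = (-1)%R by lra.
have bE : b = 0%R by move: ab; rewrite aE sqrrN expr1n => /eqP; rewrite -subr_eq0 addrAC subrr add0r sqrf_eq0 => /eqP.
move=> mf f0.
have m1 : measurable_fun setT (fun p : mR * mR => f (rot 0 1 p)).
  exact: (measurableT_comp mf (measurable_rot 0 1)).
have h01 : ((0 : R) ^+ 2 + 1 ^+ 2 = 1)%R by rewrite expr0n expr1n add0r.
have n01 : (1 + 0 != 0 :> R)%R by rewrite addr0 oner_eq0.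
rewrite -(gen 0 1 f h01 n01 mf f0)%R -(gen 0 1 _ h01 n01 m1)%R//.
apply: eq_integral => -[x y] _ /=; congr f; rewrite /rot aE bE /=.
by congr (_, _); ring.
Qed.

End Planar.

Section Area.
Variable R : realType.
Local Notation mR := (measurableTypeR R).
Local Notation lam := (@lebesgue_measure R).

(** The library's canonical structures make [m1 \x m2] sigma-finite only when [m1], [m2] are subprobabilities, hence this alias. *)
Definition area : set (mR * mR)%type -> \bar R := (lam \x lam)%E.

HB.instance Definition _ := Measure.on area.

Lemma area_sigma_finite : sigma_finite setT area.
Proof.
have /sigma_finiteP[F [TF ndF Foo]] := sigma_finiteT lam.
exists (fun n => F n `*` F n).
  rewrite -setXTT TF predeqE => -[x y]; split.
    move=> [/= [n _ Fnx] [k _ Gky]]; exists (maxn n k) => //; split.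
    - by move: x Fnx; exact/subsetPset/ndF/leq_maxl.
    - by move: y Gky; exact/subsetPset/ndF/leq_maxr.
  by move=> [n _ []/= ? ?]; split; exists n.
move=> k; have [mFk Fk] := Foo k; split; first exact: measurableX.
by rewrite /area product_measure1E// lte_mul_pinfty// ge0_fin_numE.
Qed.

HB.instance Definition _ := Measure_isSigmaFinite.Build _ _ _ area area_sigma_finite.

End Area.

(** * From area integrals to circle means *)

Section RadialMeans.
Variable R : realType.
Local Notation C := (CC R).
Local Notation mR := (measurableTypeR R).
Local Notation lam := (@lebesgue_measure R).
Local Notation lam2 := (lam \x lam)%E.
Local Notation U := (@unit_interval R).
Variable G : C -> C.
Hypothesis Gc : forall z, cabs z < 1 -> ccont G z.

(** Extension by zero, so that integrals run over the whole plane, where rotations act. *)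
Definition psi (z : C) : R := if cabs z < 1 then cabs (G z) else 0.

Lemma psi_ge0 z : 0 <= psi z. Proof. by rewrite /psi; case: ifP => // _; exact: cabs_ge0. Qed.

Lemma cabs_lip (z w : C) : `|cabs z - cabs w| <= cabs (z - w).
Proof.
rewrite ler_norml; apply/andP; split; last exact: cabs_triB.
by rewrite lerNl opprB cabs_distC cabs_triB.
Qed.

Lemma cabs_curve_cts (p : R -> C) t : pcont p t -> {for t, continuous (fun s => cabs (p s))}.
Proof.
move=> hp; apply/(pcont_cts (fun s => cabs (p s))) => e /hp[d d0 H]; exists d => // h /H; apply: le_trans.
exact: cabs_lip.
Qed.

Lemma psi_curve_cts (p : R -> C) t : pcont p t -> cabs (p t) < 1 -> {for t, continuous (fun s => psi (p s))}.
Proof.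
move=> hp pt; apply/(pcont_cts (fun s => psi (p s))) => e e0.
have [d1 d10 H1] := Gc pt e0.
have [|d d0 H] := hp (Num.min (d1 / 2) ((1 - cabs (p t)) / 2)).
  by rewrite lt_min !divr_gt0// subr_gt0.
exists d => // h /H; rewrite le_min => /andP[h1 h2].
have E : p (t + h) = p t + (p (t + h) - p t) by ring.
have p1 : cabs (p (t + h)) < 1 by rewrite E (le_lt_trans (cabsD _ _))//; lra.
rewrite /psi pt p1 (le_trans (cabs_lip _ _))// E H1//; lra.
Qed.

Lemma measurable_psi_curve (p : R -> C) : (forall t, pcont p t) ->
  measurable_fun setT ((fun t => psi (p t)) : mR -> R).
Proof.
move=> hp; pose O : set R := [set t | cabs (p t) < 1].
have mO : measurable O.
  have mc : measurable_fun setT (fun t => cabs (p t)).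
    by apply: continuous_measurable_fun => t; exact: cabs_curve_cts.
  have -> : O = (fun t => cabs (p t)) @^-1` `]-oo, 1[ by apply/seteqP; split => t /=; rewrite in_itv.
  by rewrite -[X in measurable X]setTI; exact: mc.
have mr : measurable_fun O (fun t => psi (p t)).
  apply: subspace_continuous_measurable_fun => //.
  by apply: continuous_in_subspaceT => t; rewrite inE => Ot; exact: psi_curve_cts.
move/(measurable_restrictT _ mO) : mr.
congr measurable_fun; apply/funext => t; rewrite /patch; case: ifPn => // h.
rewrite /psi; case: ifPn => // h'; exfalso; move: h; rewrite notin_setE; exact.
Qed.

Definition cplane (p : mR * mR) : C := p.1 +i* p.2.
Definition unit_disc : set (mR * mR) := [set p : mR * mR | (p.1 ^+ 2 + p.2 ^+ 2 < 1)%R].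

Lemma unit_discE p : unit_disc p <-> cabs (cplane p) < 1.
Proof.
rewrite /unit_disc /cplane /cabs /=; set s := (_ + _)%R.
have s0 : 0 <= s by rewrite addr_ge0 ?sqr_ge0.
by rewrite -[X in _ <-> is_true (_ < X)]sqrtr1 ltr_sqrt.
Qed.

Lemma measurable_unit_disc : measurable unit_disc.
Proof.
have m : measurable_fun setT ((fun p => p.1 ^+ 2 + p.2 ^+ 2)%R : mR * mR -> R).
  by apply: measurable_funD; apply: measurable_funX.
have -> : unit_disc = (fun p : mR * mR => p.1 ^+ 2 + p.2 ^+ 2)%R @^-1` `]-oo, 1[.
  by apply/seteqP; split => t; rewrite /unit_disc /= in_itv.
by rewrite -[X in measurable X]setTI; exact: m.
Qed.

Lemma pcont_horizontal (y t : R) : pcont (fun x => cplane (x, y)) t.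
Proof. by apply/pcontP; split; [exact: cvg_id|exact: cvg_cst]. Qed.

Lemma pcont_vertical (x t : R) : pcont (fun y => cplane (x, y)) t.
Proof. by apply/pcontP; split; [exact: cvg_cst|exact: cvg_id]. Qed.

Lemma measurable_psi : measurable_fun setT (fun p => psi (cplane p)).
Proof.
have mr : measurable_fun unit_disc (fun p : mR * mR => (fun x y => psi (cplane (x, y))) p.1 p.2).
  apply: (@caratheodory_measurable _ _ _ (fun x y => psi (cplane (x, y))) unit_disc); first exact: measurable_unit_disc.
    by move=> x; apply: (@measurable_psi_curve (fun y => cplane (x, y))) => t; exact: pcont_vertical.
  move=> [x y] /unit_discE pD.
  by apply: (@psi_curve_cts (fun x => cplane (x, y))); [exact: pcont_horizontal|exact: pD].
move/(measurable_restrictT _ measurable_unit_disc) : mr.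
congr measurable_fun; apply/funext => -[x y]; rewrite /patch; case: ifPn => // h.
rewrite /psi; case: ifPn => // h'; exfalso; move: h; rewrite notin_setE; apply.
exact/unit_discE.
Qed.

Lemma cplane_rot t p : cplane (rot (cos (2 * pi * t)) (sin (2 * pi * t)) p) = circ t * cplane p.
Proof. by apply: Ceq; rewrite ?ReM ?ImM /=; ring. Qed.

Lemma measurable_psi_rot : measurable_fun setT (fun q : mR * (mR * mR) => psi (circ (q.1 : R) * cplane q.2)).
Proof.
apply: (@caratheodory_measurable _ _ _ (fun t p => psi (circ t * cplane p)) setT) => //.
  move=> t; under eq_fun do rewrite -cplane_rot.
  exact: (measurableT_comp measurable_psi (measurable_rot (cos (2 * pi * t)) (sin (2 * pi * t)))).
move=> [t p] _ /=; have [pD|pD] := ltP (cabs (cplane p)) 1.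
  apply: (@psi_curve_cts (fun t => circ t * cplane p)); last by rewrite cabsM cabs_circ mul1r.
  by apply: (@pcontM _ (@circ R) (fun=> cplane p)); [exact: pcont_circ|exact: pcont_cst].
rewrite (_ : (fun t => _) = fun=> 0); first exact: cvg_cst.
by apply/funext => s; rewrite /psi cabsM cabs_circ mul1r ltNge pD.
Qed.

Definition radial_mean (s : R) : R := Rintegral lam U (fun t => cabs (G ((s%:C : C) * circ t))).

Lemma polar_form (z : C) : exists2 t, U t & z = ((cabs z)%:C : C) * circ t.
Proof.
have [->|z0] := eqVneq z 0.
  by exists 0; [rewrite /unit_interval /= lexx ltr01|rewrite cabs0 mul0r].
have r0 : 0 < cabs z by rewrite cabs_gt0.
pose a := complex.Re z / cabs z; pose b := complex.Im z / cabs z.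
have ab : a ^+ 2 + b ^+ 2 = 1.
  by rewrite /a /b !expr_div_n -mulrDl -cabs_sqr divff// expf_neq0// gt_eqF.
have a1 : -1 <= a <= 1 
  by have := sqr_ge0 b; move: ab; rewrite !expr2 => ? ?; apply/andP; split; nra.
have pi0 := @pi_gt0 R.
suff [t Ut [ct st]] : exists2 t, U t & cos (2 * pi * t) = a /\ sin (2 * pi * t) = b.
  exists t => //; apply: Ceq; rewrite ?Re_real_mul ?Im_real_mul /= ?ct ?st /a /b mulrC divfK// gt_eqF//.
have ca : cos (acos a) = a by rewrite acosK.
have sa : sin (acos a) = `|b|.
  by rewrite sin_acos// (_ : 1 - a ^+ 2 = b ^+ 2) ?sqrtr_sqr// -ab; ring.
have [b0|b0] := leP 0 b.
  exists (acos a / (2 * pi)); first by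
    rewrite /unit_interval /= divr_ge0 ?mulr_ge0 ?(ltW pi0) ?acos_ge0//= ltr_pdivrMr ?mulr_gt0// mul1r;
    have := acos_lepi a1; lra.
  by rewrite mulrC divfK ?mulf_neq0 ?gt_eqF// ca sa ger0_norm.
have ac : 0 < acos a.
  rewrite lt_neqAle acos_ge0// andbT; apply/eqP => E.
  by move: sa; rewrite -E sin0 => /esym/eqP; rewrite normr_eq0 lt_eqF.
exists (1 - acos a / (2 * pi)).
  have := acos_lepi a1; rewrite /unit_interval /= => h.
  have : acos a / (2 * pi) <= 1 by rewrite ler_pdivrMr ?mulr_gt0// mul1r; lra.
  have : 0 < acos a / (2 * pi) by rewrite divr_gt0// mulr_gt0.
  lra.
rewrite mulrBr mulr1 [_ * (_ / _)]mulrC divfK ?mulf_neq0 ?gt_eqF//.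
have -> : 2 * pi - acos a = - acos a + pi *+ 2 by rewrite mulr2n; ring.
by rewrite cosD2pi sinD2pi cosN sinN ca sa ltr0_norm// opprK.
Qed.

Local Open Scope ereal_scope.

Lemma integral_unit_shift (h : R -> R) (c : R) : (0 <= c < 1)%R ->
  measurable_fun setT (h : mR -> R) -> (forall t, (0 <= h t)%R) -> (forall t, h (t + 1)%R = h t) ->
  \int[lam]_(t in U) (h (t + c)%R)%:E = \int[lam]_(t in U) (h t)%:E.
Proof.
move=> /andP[c0 c1] mh h0 hp.
have mE (D : set mR) : measurable_fun D (fun t : mR => (h t)%:E).
  by apply: measurable_funTS; exact/measurable_EFinP.
have shift (a b d : R) : \int[lam]_(t in `[a, b[) (h (t + d)%R)%:E =
    \int[lam]_(t in `[(a + d)%R, (b + d)%R[) (h t)%:E.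
  rewrite integral_mkcond [RHS]integral_mkcond.
  rewrite -[RHS](ge0_integral_shift d).
  - apply: eq_integral => t _; rewrite /patch !mem_setE !in_itv /= lerD2r ltrD2r.
    by case: ifP.
  - apply: (measurable_restrictT _ _).1; [exact: measurable_itv|exact: mE].
  - by move=> t; rewrite /patch; case: ifP => // _; rewrite lee_fin.
have split (a b d : R) : (a <= b)%R -> (b <= d)%R -> \int[lam]_(t in `[a, d[) (h t)%:E =
    \int[lam]_(t in `[a, b[) (h t)%:E + \int[lam]_(t in `[b, d[) (h t)%:E.
  move=> ab bd; rewrite -ge0_integral_setU//.
  - by rewrite -itv_bndbnd_setU// bnd_simp.
  - by move=> t _; rewrite lee_fin.
  - apply/disj_setPS => t [/=]; rewrite !in_itv /= => /andP[_ h1] /andP[h2 _].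
    by move: (lt_le_trans h1 h2); rewrite ltxx.
rewrite unit_intervalE shift add0r.
rewrite (split c 1%R) ?(ltW c1)//; last by rewrite lerDl.
rewrite [RHS](split 0%R c 1%R) ?(ltW c1)// addeC; congr (_ + _).
have := shift 0%R c 1%R; rewrite add0r addrC => <-.
by apply: eq_integral => t _; rewrite hp.
Qed.

Lemma radial_mean_EFin (s : R) : (0 <= s < 1)%R ->
  (radial_mean s)%:E = \int[lam]_(t in U) (cabs (G ((s%:C : C)%R * circ t)%R))%:E.
Proof.
move=> /andP[s0 s1].
have hc : cbm (T := mR) U (fun t => G ((s%:C : C) * circ t)%R).
  by apply: cbm_circle => t; apply: Gc; rewrite cabs_scale_circ.
have i := @cbm_cabs _ _ mR lam U (@measurable_unit R) (lamU_fin R) _ hc.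
rewrite /radial_mean /Rintegral fineK//.
by apply: integrable_fin_num i; exact: measurable_unit.
Qed.

(** This replaces polar coordinates. By rotation invariance the area integral equals its average
    over all rotations; exchanging the integrals, the average of |G(e^{2 pi i t} p)| over t is the
    circle mean at radius |p|. *)
Lemma integral_disc_radial :
  \int[lam2]_(p in unit_disc) (cabs (G (cplane p)))%:E =
  \int[lam2]_(p in unit_disc) (radial_mean (cabs (cplane p)))%:E.
Proof.
pose K := \int[lam2]_p (psi (cplane p))%:E.
have mpsiE : measurable_fun setT (fun p => (psi (cplane p))%:E) by apply/measurable_EFinP; exact: measurable_psi.
have -> : \int[lam2]_(p in unit_disc) (cabs (G (cplane p)))%:E = K.
  rewrite integral_mkcond; apply: eq_integral => p _; rewrite /patch /psi.
  case: ifPn => [|]; rewrite ?inE ?notin_setE; first by move=> /unit_discE ->.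
  by move=> h; case: ifPn => // /unit_discE.
have mrot : measurable_fun setT (fun q : mR * (mR * mR) => (psi (circ (q.1 : R) * cplane q.2)%R)%:E).
  by apply/measurable_EFinP; exact: measurable_psi_rot.
pose F (q : mR * (mR * mR)) := (if ((0 <= (q.1 : R) < 1)%R) then (psi (circ (q.1 : R) * cplane q.2)%R)%:E else 0).
have mF : measurable_fun setT F.
  apply: measurable_fun_ifT => //.
  have mU : measurable_fun setT (fun t : mR => (0 <= (t : R) < 1)%R).
    apply: (@measurable_fun_bool _ _ _ _ true); rewrite setTI.
    by rewrite (_ : _ @^-1` _ = U)//; exact: measurable_unit.
  exact: (measurableT_comp mU).
have F0 q : 0 <= F q by rewrite /F; case: ifP => // _; rewrite lee_fin psi_ge0.
have K1 : \int[lam]_t \int[lam2]_p F (t, p) = K.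
  transitivity (\int[lam]_(t in U) K).
    rewrite [RHS]integral_mkcond; apply: eq_integral => t _; rewrite /patch /F /=.
    case: (boolP (0 <= (t : R) < 1)%R) => h; last first.
      by rewrite memNset ?integral0//; exact/negP.
    have psiE0 p : 0 <= (psi (cplane p))%:E by rewrite lee_fin psi_ge0.
    rewrite mem_set// /K; have <- := ge0_integral_rot (cos2Dsin2 (2 * pi * t)%R) mpsiE psiE0.
    by apply: eq_integral => p _; rewrite cplane_rot.
  have mU : measurable (U : set mR) by exact: measurable_unit.
  have -> : \int[lam]_(t in U) K = K * lam U by exact: integral_cst.
  by rewrite lamU mule1.
have FT : \int[lam]_t \int[lam2]_p F (t, p) = \int[lam2]_p \int[lam]_t F (t, p).
  exact: (@fubini_tonelli _ _ _ _ R lam (@area R) F mF F0).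
rewrite -K1 FT [RHS]integral_mkcond.
apply: eq_integral => p _; rewrite /patch; case: ifPn => [|]; rewrite ?inE ?notin_setE => pD.
  have {}pD := (unit_discE p).1 pD.
  have r0 := cabs_ge0 (cplane p).
  have [t0 Ut0 E] := polar_form (cplane p).
  rewrite radial_mean_EFin ?r0//.
  have -> : \int[lam]_x F (x, p) = \int[lam]_(t in U) (psi (((cabs (cplane p))%:C : C) * circ (t + t0)%R)%R)%:E.
    rewrite [RHS]integral_mkcond; apply: eq_integral => t _; rewrite /patch /F /=.
    case: (boolP (0 <= (t : R) < 1)%R) => h; last by rewrite memNset//; exact/negP.
    by rewrite mem_set// {1}E mulrCA -circD.
  have mps : measurable_fun setT ((fun t => psi (((cabs (cplane p))%:C : C) * circ t)%R) : mR -> R).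
    by apply: measurable_psi_curve => t; exact: pcont_scale_circ.
  rewrite (@integral_unit_shift (fun t => psi (((cabs (cplane p))%:C : C) * circ t)%R))//.
  - by apply: eq_integral => t _; rewrite /psi cabs_scale_circ// pD.
  - by move=> t; exact: psi_ge0.
  - by move=> t; rewrite circD circ1 mulr1.
rewrite integral0_eq// => t _; rewrite /F /=; case: ifP => // _.
rewrite /psi cabsM cabs_circ mul1r; case: ifPn => // h.
by exfalso; apply: pD; exact/unit_discE.
Qed.

End RadialMeans.

Section RadialBound.
Variable R : realType.
Local Notation C := (CC R).
Local Notation mR := (measurableTypeR R).
Local Notation lam := (@lebesgue_measure R).
Local Notation lam2 := (lam \x lam)%E.
Local Notation U := (@unit_interval R).
Variable G : C -> C.
Hypothesis Gc : forall z, cabs z < 1 -> ccont G z.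
Local Notation m := (radial_mean G).

Lemma cbm_radial s : 0 <= s < 1 -> cbm (T := mR) U (fun t => G ((s%:C : C) * circ t)).
Proof. by move=> /andP[s0 s1]; apply: cbm_circle => t; apply: Gc; rewrite cabs_scale_circ. Qed.

Lemma radial_mean_ge0 s : 0 <= m s.
Proof. by apply: Rintegral_ge0 => t _; exact: cabs_ge0. Qed.

Lemma radial_mean_near s e : 0 <= s < 1 -> 0 < e -> exists2 del : R, 0 < del &
  forall s', 0 <= s' < 1 -> `|s' - s| < del -> `|m s' - m s| <= e.
Proof.
move=> /andP[s0 s1] e0.
have H t : ccont G ((s%:C : C) * circ t) by apply: Gc; rewrite cabs_scale_circ.
have [d d0 Hd] := ccont_unif_curve (pcont_scale_circ s) H e0.
exists d => // s' s'I ss.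
have hs := cbm_radial (introT andP (conj s0 s1)); have hs' := cbm_radial s'I.
have mU : measurable (U : set mR) by exact: measurable_unit.
have i1 := @cbm_cabs _ _ mR lam U mU (lamU_fin R) _ hs.
have i2 := @cbm_cabs _ _ mR lam U mU (lamU_fin R) _ hs'.
have i3 := @cbm_cabs _ _ mR lam U mU (lamU_fin R) _ (cbmB hs' hs).
have ic : lam.-integrable U (EFin \o (fun=> e : R)).
  by apply: (@bm_integrable _ _ mR lam U mU (lamU_fin R) _ `|e|) => //; exact: measurable_cst.
have l1 : fine (lam U) = 1 by rewrite lamU.
rewrite /radial_mean -RintegralB//.
pose D t := cabs (G ((s'%:C : C) * circ t)) - cabs (G ((s%:C : C) * circ t)).
have iB : lam.-integrable U (EFin \o D).
  by apply: eq_integrable (integrableB mU i2 i1).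
have iA : lam.-integrable U (EFin \o (fun t => `|D t|)).
  by apply: eq_integrable (integrable_abse iB).
rewrite (le_trans (le_normr_Rintegral mU iB))//.
rewrite -[e]mulr1 -[X in _ <= _ * X]l1 -Rintegral_cst//.
apply: le_Rintegral => //.
move=> t /andP[t0 t1]; apply: (le_trans (cabs_lip _ _)).
have := Hd t (((s' - s)%:C : C) * circ t).
have -> : (s%:C : C) * circ t + ((s' - s)%:C : C) * circ t = (s'%:C : C) * circ t.
  by rewrite rmorphB /=; ring.
by rewrite cabsM cabs_real cabs_circ mulr1; apply => //; rewrite t0 ltW.
Qed.

(** The circle mean as a radial function of the plane, complex-valued so that [psi] and its
    measurability results apply to it. *)
Definition radialC (z : C) : C := ((m (cabs z))%:C : C).

Lemma ccont_radialC z : cabs z < 1 -> ccont radialC z.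
Proof.
move=> z1 e e0; have zI : 0 <= cabs z < 1 by rewrite cabs_ge0.
have [d d0 H] := radial_mean_near zI e0.
exists (Num.min d (1 - cabs z)); first by rewrite lt_min d0 subr_gt0.
move=> h; rewrite lt_min => /andP[h1 h2]; rewrite -rmorphB cabs_real; apply: H.
  by rewrite cabs_ge0 (le_lt_trans (cabsD _ _))// addrC -ltrBrDr.
rewrite (le_lt_trans (cabs_lip _ _))//.
by have -> : z + h - z = h by ring.
Qed.

Lemma radial_mean_cts s : 0 < s < 1 -> {for s, continuous m}.
Proof.
move=> /andP[s0 s1]; apply/(pcont_cts m) => e e0.
have sI : 0 <= s < 1 by rewrite ltW.
have [d d0 H] := radial_mean_near sI e0.
exists (Num.min d (Num.min s (1 - s))); first by rewrite !lt_min d0 s0 subr_gt0.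
move=> h; rewrite !lt_min => /and3P[h1 h2 h3]; apply: H.
  by move: h2 h3; rewrite !ltr_norml => /andP[? ?] /andP[? ?]; apply/andP; split; lra.
by have -> : s + h - s = h by ring.
Qed.

(** Distance to the origin of the point of abscissa x on the horizontal line at height y. *)
Let F y x : R := Num.sqrt (x ^+ 2 + y ^+ 2).

Let F_derive (y x : R) : 0 < y -> is_derive x 1 (F y) (x / F y x).
Proof.
move=> y0; have p0 : 0 < x ^+ 2 + y ^+ 2 by rewrite ltr_wpDl ?sqr_ge0// exprn_gt0.
have D1 : is_derive x 1 (fun x : R => x ^+ 2 + y ^+ 2) (2 * x).
  apply: eps_is_derive => e e0; exists e => // h he.
  have -> : (x + h) ^+ 2 + y ^+ 2 - (x ^+ 2 + y ^+ 2) - 2 * x * h = h * h by ring.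
  by rewrite normrM ler_wpM2r// ltW.
have D2 := is_derive1_comp (f := @Num.sqrt R) (g := fun x : R => x ^+ 2 + y ^+ 2) (is_derive1_sqrt p0) D1.
by apply: is_derive_eq; rewrite /F; field; rewrite gt_eqF// sqrtr_gt0.
Qed.

Local Open Scope ereal_scope.

(** Substitute s = F y x along the line at height y: ds = (x/s) dx with x/s <= 1. As y <= 1/2, the
    range [y, r] of s contains [1/2, r]. *)
Lemma radial_substitution (y r : R) : (0 < y <= 2^-1)%R -> (2^-1 < r < 1)%R ->
  \int[lam]_(s in `[(2^-1)%R, r]) (m s)%:E <=
  \int[lam]_(x in `[0%R, Num.sqrt (r ^+ 2 - y ^+ 2)%R]) (m (F y x))%:E.
Proof.
move=> /andP[y0 y2] /andP[r2 r1].
set b := Num.sqrt (r ^+ 2 - y ^+ 2)%R.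
have yr : (y < r)%R by lra.
have b2 : (b ^+ 2 = r ^+ 2 - y ^+ 2)%R by rewrite sqr_sqrtr// subr_ge0 lerXn2r ?nnegrE ?ltW//; lra.
have b0 : (0 <= b)%R by exact: sqrtr_ge0.
have F0 : F y 0%R = y by rewrite /F expr0n add0r sqrtr_sqr gtr0_norm.
have Fb : F y b = r by rewrite /F b2 subrK sqrtr_sqr gtr0_norm//; lra.
have Fpos x : (0 < F y x)%R by rewrite sqrtr_gt0 ltr_wpDl ?sqr_ge0// exprn_gt0.
have dF : (F y)^`()%classic = (fun x => x / F y x)%R.
  by apply/funext => x; rewrite derive1E; have [_ ->] := F_derive x y0.
have cF : continuous (F y) by move=> x; exact: is_derive_cts (F_derive x y0).
have cdF : continuous (fun x : R => x / F y x)%R.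
  by move=> x; apply: cvgM; [exact: cvg_id|apply: cvgV; [rewrite gt_eqF|exact: cF]].
have mono : {in `[0%R, b] &, {homo (F y : R -> R) : x x' / (x < x')%R}}.
  move=> x x'; rewrite !in_itv /= => /andP[x0 _] /andP[x'0 _] xx.
  by rewrite ltr_sqrt ?ltrD2r ?ltrXn2r// ltr_wpDl ?sqr_ge0// exprn_gt0.
have cm : {within `[F y 0%R, F y b], continuous m}.
  apply: continuous_in_subspaceT => x; rewrite inE /= in_itv F0 Fb /= => /andP[h1 h2].
  by apply: radial_mean_cts; apply/andP; split; lra.
have mm : measurable_fun `[y, r] m.
  by apply: subspace_continuous_measurable_fun => //; move: cm; rewrite F0 Fb.
have SUB : \int[lam]_(x in `[y, r]) (m x)%:E = \int[lam]_(x in `[0%R, b]) (((m \o F y) * (F y)^`()%classic) x)%R%:E.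
  rewrite -[in LHS]F0 -[in LHS]Fb; apply: integration_by_substitution_increasing => //.
  - by rewrite dF => x _; exact: cdF.
  - by rewrite dF; apply: cvgP; apply: cvg_at_right_filter; exact: cdF.
  - by rewrite dF; apply: cvgP; apply: cvg_at_left_filter; exact: cdF.
  - split.
    + by move=> x _; have [] := F_derive x y0.
    + by apply: cvg_at_right_filter; exact: cF.
    + by apply: cvg_at_left_filter; exact: cF.
have cmF : {within `[0%R, b], continuous (m \o F y)}.
  apply: continuous_in_subspaceT => x; rewrite inE /= in_itv /= => /andP[h1 h2].
  apply: continuous_comp; first exact: cF.
  apply: radial_mean_cts; rewrite Fpos /= (le_lt_trans _ r1)// -Fb ler_sqrt ?lerD2r ?lerXn2r ?nnegrE//.
  by rewrite ltW// ltr_wpDl ?sqr_ge0// exprn_gt0.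
have mmF : measurable_fun `[0%R, b] (m \o F y) by apply: subspace_continuous_measurable_fun.
have mdF : measurable_fun `[0%R, b] (fun x => x / F y x)%R.
  by apply: measurable_funTS; exact: continuous_measurable_fun.
apply: (@le_trans _ _ (\int[lam]_(x in `[y, r]) (m x)%:E)).
  apply: ge0_subset_integral => //.
  - exact/measurable_EFinP.
  - by move=> x _; rewrite lee_fin radial_mean_ge0.
  - by apply: subset_itvr; rewrite bnd_simp.
rewrite SUB dF; apply: ge0_le_integral => //.
- move=> x; rewrite /= in_itv /= => /andP[x0 _]; rewrite lee_fin mulr_ge0 ?radial_mean_ge0//.
  by rewrite divr_ge0// ltW.
- by apply/measurable_EFinP; exact: measurable_funM.
- exact/measurable_EFinP.
- move=> x; rewrite /= in_itv /= => /andP[x0 _]; rewrite lee_fin ler_piMr ?radial_mean_ge0//.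
  rewrite ler_pdivrMr// mul1r -{1}[x]ger0_norm// -sqrtr_sqr ler_wsqrtr// lerDl sqr_ge0//.
Qed.

(** Each horizontal line at a height in ]0, 1/2] contributes at least the integral of the means over
    [1/2, r]. Integrating over these heights, of total length 1/2, gives the factor 2. *)
Lemma radial_bound (K r : R) : \int[lam2]_(p in @unit_disc R) (cabs (G (cplane p)))%:E <= K%:E ->
  (2^-1 < r < 1)%R -> (Rintegral lam `[(2^-1)%R, r] m <= 2 * K)%R.
Proof.
rewrite (integral_disc_radial Gc) => HK rI; have /andP[r2 r1] := rI.
pose H := psi radialC.
have mH := measurable_psi ccont_radialC.
have mHE : measurable_fun setT (fun p => (psi radialC (cplane p))%:E) by apply/measurable_EFinP.
have H0 p : 0 <= (psi radialC (cplane p))%:E by rewrite lee_fin psi_ge0.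
have E1 : \int[lam2]_(p in @unit_disc R) (radial_mean G (cabs (cplane p)))%:E = \int[lam2]_p (psi radialC (cplane p))%:E.
  rewrite integral_mkcond; apply: eq_integral => p _; rewrite /patch /psi.
  case: ifPn => [|]; rewrite ?inE ?notin_setE.
    by move=> /unit_discE ->; rewrite cabs_real ger0_norm// radial_mean_ge0.
  by move=> h; case: ifPn => // /unit_discE.
have mm : measurable_fun `[(2^-1)%R, r] m.
  apply: subspace_continuous_measurable_fun => //.
  apply: continuous_in_subspaceT => x; rewrite inE /= in_itv /= => /andP[h1 h2].
  by apply: radial_mean_cts; apply/andP; split; lra.
have bmm : exists M, forall t, (2^-1 <= t <= r)%R -> (`|m t| <= M)%R.
  have hp : cbm (T := R) `[(2^-1)%R, r] (fun t => radialC (t%:C : C)).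
    apply: pcont_cbm => t /andP[t1 t2]; apply: (@pcont_comp _ radialC (fun t => (t%:C : C))).
      by apply: ccont_radialC; rewrite cabs_real gtr0_norm; lra.
    by apply: (@pcont_real _ id); exact: cvg_id.
  have [_ _ [M hM]] := hp; exists M => t tI.
  have := hM t; rewrite /= in_itv /= => /(_ tI); rewrite /radialC !cabs_real [`|t|%R]gtr0_norm//; case/andP: tI; lra.
have [M HM] := bmm.
have im : lam.-integrable `[(2^-1)%R, r] (EFin \o m).
  apply: (@bm_integrable _ _ mR lam _ _ (lam_itv_fin _ _) m M) => //.
have PhiE : (Rintegral lam `[(2^-1)%R, r] m)%:E = \int[lam]_(s in `[(2^-1)%R, r]) (m s)%:E.
  by rewrite /Rintegral fineK//; exact: integrable_fin_num im.
have Phi0 : 0 <= \int[lam]_(s in `[(2^-1)%R, r]) (m s)%:E.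
  by apply: integral_ge0 => s _; rewrite lee_fin radial_mean_ge0.
suff : \int[lam]_(y in `]0%R, (2^-1)%R]) (Rintegral lam `[(2^-1)%R, r] m)%:E <= K%:E.
  rewrite integral_cst//= lebesgue_measure_itv /= lte_fin invr_gt0 ltr0n /= oppr0 adde0 -EFinM lee_fin.
  by rewrite ler_pdivrMr// mulrC.
apply: le_trans HK; rewrite E1 fubini_tonelli2//.
apply: (@le_trans _ _ (\int[lam]_(y in `]0%R, (2^-1)%R]) fubini_G lam (fun p => (psi radialC (cplane p))%:E) y)); last first.
  apply: ge0_subset_integral => //.
  - exact: measurable_fun_fubini_tonelli_G.
  - by move=> y _; apply: integral_ge0.
apply: ge0_le_integral => //.
- by move=> y _; rewrite PhiE.
- by apply: measurable_funTS; exact: measurable_fun_fubini_tonelli_G.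
move=> y; rewrite /= in_itv /= => yI; rewrite PhiE.
apply: (le_trans (radial_substitution yI rI)).
have /andP[y0 y2] := yI.
rewrite /fubini_G.
have meas : measurable_fun setT (fun x : mR => (psi radialC (cplane (x, y)))%:E).
  by apply: (measurableT_comp mHE); exact: pair2_measurable.
apply: (@le_trans _ _ (\int[lam]_(x in `[0%R, Num.sqrt (r ^+ 2 - y ^+ 2)%R]) (psi radialC (cplane (x, y)))%:E)).
  rewrite le_eqVlt; apply/orP; left; apply/eqP; apply: eq_integral => x.
  rewrite inE /= in_itv /= => /andP[x0 xb].
  have -> : F y x = cabs (cplane (x, y)) by [].
  have rb : (0 <= r ^+ 2 - y ^+ 2)%R by rewrite subr_ge0 lerXn2r ?nnegrE ?ltW//; lra.
  have x1 : (cabs (cplane (x, y)) < 1)%R.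
    apply/unit_discE; rewrite /unit_disc /=.
    have : (x ^+ 2 <= r ^+ 2 - y ^+ 2)%R.
      by rewrite -(sqr_sqrtr rb) lerXn2r ?nnegrE ?sqrtr_ge0.
    have : (r ^+ 2 < 1)%R by rewrite expr_lt1//; lra.
    lra.
  by rewrite /psi x1 cabs_real ger0_norm// radial_mean_ge0.
by apply: ge0_subset_integral.
Qed.

Lemma swap_radial (s r : R) : (0 <= s)%R -> (r < 1)%R ->
  \int[lam]_(t in U) \int[lam]_(x in `[s, r]) (cabs (G ((x%:C : C)%R * circ t)%R))%:E =
  \int[lam]_(x in `[s, r]) (m x)%:E /\
  measurable_fun (U : set mR) (fun t => \int[lam]_(x in `[s, r]) (cabs (G ((x%:C : C)%R * circ t)%R))%:E).
Proof.
move=> s0 r1.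
pose W (q : mR * mR) := psi G (((q.2 : R)%:C : C)%R * circ (q.1 : R))%R.
have mW : measurable_fun setT W.
  apply: (@caratheodory_measurable _ _ _ (fun t x => psi G (((x : R)%:C : C) * circ t)%R) setT) => //.
    by move=> t; apply: (measurable_psi_curve Gc (p := fun x : R => ((x%:C : C) * circ t)%R)) => x; exact: pcont_scale.
  move=> [t x] _ /=; have [pD|pD] := ltP (cabs (x%:C : C)) 1%R.
    apply: (psi_curve_cts Gc (p := fun t => ((x%:C : C) * circ t)%R)); last by rewrite cabsM cabs_circ mulr1.
    exact: pcont_scale_circ.
  rewrite (_ : (fun t => _) = fun=> 0%R); first exact: cvg_cst.
  by apply/funext => s'; rewrite /psi cabsM cabs_circ mulr1 ltNge pD.
have mI : measurable (`[s, r]%classic : set mR) by exact: measurable_itv.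
have mU : measurable (U : set mR) by exact: measurable_unit.
pose W' (q : mR * mR) : \bar R := if q.2 \in `[s, r] then (W q)%:E else 0.
pose W'' (q : mR * mR) : \bar R := if q.1 \in U then W' q else 0.
have b1 (A : set mR) : measurable A -> measurable_fun setT (fun x : mR => x \in A).
  move=> mA; apply: (@measurable_fun_bool _ _ _ _ true); rewrite setTI.
  by rewrite (_ : _ @^-1` _ = A)//; apply/seteqP; split => x /=; [exact: set_mem|exact: mem_set].
have mW' : measurable_fun setT W'.
  apply: measurable_fun_ifT => //; last exact/measurable_EFinP.
  have -> : (fun q : mR * mR => q.2 \in `[s, r]) = (fun q => q.2 \in (`[s, r]%classic : set mR)).
    by apply/funext => q; rewrite mem_setE.
  exact: (measurableT_comp (b1 _ mI)).
have mW'' : measurable_fun setT W''.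
  apply: measurable_fun_ifT => //; exact: (measurableT_comp (b1 _ mU)).
have W'0 q : 0 <= W' q by rewrite /W'; case: ifP => // _; rewrite lee_fin psi_ge0.
have W''0 q : 0 <= W'' q by rewrite /W''; case: ifP.
have inner t : \int[lam]_x W' (t, x) = \int[lam]_(x in `[s, r]) (cabs (G ((x%:C : C)%R * circ t)%R))%:E.
  rewrite [RHS]integral_mkcond; apply: eq_integral => x _; rewrite /patch /W' /W /= mem_setE.
  case: ifPn => //; rewrite in_itv /= => /andP[h1 h2].
  by rewrite /psi cabs_scale_circ ?(le_lt_trans h2 r1)// (le_trans s0).
split.
  transitivity (\int[lam]_t \int[lam]_x W'' (t, x)).
    rewrite integral_mkcond; apply: eq_integral => t _; rewrite /patch /W'' /=.
    by case: ifP => // _; rewrite ?inner// integral0.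
  rewrite fubini_tonelli// [RHS]integral_mkcond; apply: eq_integral => x _.
  rewrite /patch mem_setE; case: ifPn => xI.
    have xI' : (0 <= x < 1)%R by move: xI; rewrite in_itv /= => /andP[? ?]; apply/andP; split; lra.
    rewrite (radial_mean_EFin Gc xI') [RHS]integral_mkcond; apply: eq_integral => t _.
    rewrite /patch /W'' /W' /W /= xI; case: ifP => // _.
    by case/andP: xI' => ? ?; rewrite /psi cabs_scale_circ// (_ : (x < 1)%R).
  rewrite integral0_eq// => t _; rewrite /W'' /W' /= (negbTE xI); by case: ifP.
apply: measurable_funTS.
rewrite (_ : (fun t => _) = fubini_F lam W'); last by apply/funext => t; rewrite /fubini_F inner.
exact: measurable_fun_fubini_tonelli_F.
Qed.

End RadialBound.

(** * The permanence property *)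

Section PairingLimit.
Variable R : realType.
Local Notation C := (CC R).
Local Notation mR := (measurableTypeR R).
Local Notation lam := (@lebesgue_measure R).
Local Notation lam2 := (lam \x lam)%E.
Local Notation U := (@unit_interval R).

Lemma analytic_hol (f : C -> C) : analytic_disc f <-> hol 1 f.
Proof.
split=> [H w hw|H z hz]; first by exists ('D_1 f w); exact/deriv_hd/H.
by have [d /hdP[]] := H z hz.
Qed.

Lemma circ_npair (f g : C -> C) r :
  circ_integral (fun zeta => f ((r%:C : C) * zeta) * ((g ((r%:C : C) * zeta))^* )%R) = npair f g r r.
Proof. by rewrite /npair; apply: (@eq_cint _ _ mR lam U) => t _; rewrite conj_cconj. Qed.

Section OneFunction.
Variable g : C -> C.
Hypothesis hg : hol 1 g.
Let G z : C := 'D_1 g z.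
Let Gc z : cabs z < 1 -> ccont G z. Proof. by move=> h; exact: (ccont_deriv hg h). Qed.

Lemma radial_integrable s r : 0 < s -> r < 1 ->
  lam.-integrable `[s, r] (EFin \o radial_mean G).
Proof.
move=> s0 r1.
have mm : measurable_fun `[s, r] (radial_mean G).
  apply: subspace_continuous_measurable_fun => //.
  apply: continuous_in_subspaceT => x; rewrite inE /= in_itv /= => /andP[h1 h2].
  by apply: (radial_mean_cts Gc); apply/andP; split; lra.
have hp : cbm (T := R) `[s, r] (fun t => radialC G (t%:C : C)).
  apply: pcont_cbm => t /andP[t1 t2]; apply: (@pcont_comp _ (radialC G) (fun t => (t%:C : C))).
    by apply: (ccont_radialC Gc); rewrite cabs_real gtr0_norm; lra.
  by apply: (@pcont_real _ id); exact: cvg_id.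
have [_ _ [M hM]] := hp.
apply: (@bm_integrable _ _ mR lam _ _ (lam_itv_fin _ _) (radial_mean G) M) => // t tI.
have := hM t tI; rewrite /radialC !cabs_real [`|t|]gtr0_norm//.
by move: tI; rewrite /= in_itv /= => /andP[]; lra.
Qed.

(** With s = r'^2/r the product rule for radii gives npair f g r' r' = npair f g r s. Now [f] sits
    on the circle of radius r in both terms, and only the radial increment of [g] from s to r is
    left. *)
Lemma diagonal_increment (f : C -> C) M r r' : hol 1 f ->
  (forall w, cabs w < 1 -> cabs (f w) <= M) -> 0 < r' <= r -> r < 1 ->
  cabs (npair f g r r - npair f g r' r') <= M * Rintegral lam `[r' ^+ 2 / r, r] (radial_mean G).
Proof.
move=> hf fM /andP[r'0 r'r] r1; set s := r' ^+ 2 / r.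
have r0 : 0 < r by exact: lt_le_trans r'r.
have s0 : 0 < s by rewrite divr_gt0// exprn_gt0.
have sr : s <= r by rewrite /s ler_pdivrMr// -expr2 lerXn2r ?nnegrE ?(ltW r'0) ?(ltW r0).
have s1 : s < 1 by exact: le_lt_trans r1.
have rI : 0 <= r < 1 by rewrite ltW.
have sI : 0 <= s < 1 by rewrite ltW.
have M0 : 0 <= M by apply: le_trans (cabs_ge0 (f 0)) (fM _ _); rewrite cabs0.
have -> : npair f g r' r' = npair f g r s.
  apply: npair_prod => //; rewrite ?s0 ?r'0 ?(ltW r'0)//=.
  - by rewrite (le_lt_trans r'r).
  - by rewrite (le_lt_trans r'r).
  - by rewrite /s mulrCA divff ?gt_eqF// mulr1 expr2.
have c1 := cbm_npair hf hg rI rI; have c2 := cbm_npair hf hg rI sI.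
have mU : measurable (U : set mR) by exact: measurable_unit.
rewrite /npair -cintB//; try exact: lamU_fin.
pose d t := cabs (g ((r%:C : C) * circ t) - g ((s%:C : C) * circ t)).
have hd_ : cbm (T := mR) U (fun t => g ((r%:C : C) * circ t) - g ((s%:C : C) * circ t)).
  by apply: cbmB; exact: (hol_circle hg).
have id_ : lam.-integrable U (EFin \o d) := @cbm_cabs _ _ mR lam U mU (lamU_fin R) _ hd_.
have iMd : lam.-integrable U (EFin \o (fun t => M * d t)).
  by apply: eq_integrable (integrableZl mU M id_) => // t _.
apply: (@le_trans _ _ (Rintegral lam U (fun t => M * d t))).
  apply: le_cint => //; [exact: lamU_fin|exact: cbmB|].
  move=> t /andP[t0 t1]; rewrite -mulrBr -cconjB cabsM cabs_conj ler_wpM2r ?cabs_ge0// fM//.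
  by rewrite cabs_scale_circ// ltW.
rewrite RintegralZl// ler_wpM2l//.
have [SW mSW] := swap_radial Gc (ltW s0) r1.
have PhiE : (Rintegral lam `[s, r] (radial_mean G))%:E = (\int[lam]_(x in `[s, r]) (radial_mean G x)%:E)%E.
  by rewrite /Rintegral fineK//; exact: integrable_fin_num (radial_integrable s0 r1).
rewrite -lee_fin PhiE -SW.
have -> : (Rintegral lam U d)%:E = (\int[lam]_(t in U) (d t)%:E)%E.
  by rewrite /Rintegral fineK//; exact: integrable_fin_num id_.
apply: ge0_le_integral => //.
- by move=> t _; rewrite lee_fin cabs_ge0.
- exact: measurable_int id_.
move=> t _; have fin := lam_itv_fin s r.
have hq : cbm (T := mR) `[s, r] (fun x => G ((x%:C : C) * circ t)).
  apply: pcont_cbm => x /andP[h1 h2].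
  apply: (@pcont_comp _ G (fun y => (y%:C : C) * circ t)); last exact: pcont_scale.
  by apply: Gc; rewrite cabs_scale_circ; lra.
have iq := @cbm_cabs _ _ mR lam _ (measurable_itv _) fin _ hq.
have -> : (\int[lam]_(x in `[s, r]) (cabs (G (x%:C * circ t)))%:E =
    (Rintegral lam `[s, r] (fun x => cabs (G (x%:C * circ t))))%:E)%E.
  by rewrite /Rintegral fineK//; exact: integrable_fin_num iq.
by rewrite lee_fin; apply: radial_increment => //; rewrite (ltW s0) sr.
Qed.

Hypothesis W : (\int[lam2]_(p in @unit_disc R) (cabs (G (cplane p)))%:E < +oo)%E.

(** The integrals [T r] increase with r and are bounded by [radial_bound]; beyond a radius where [T]
    is within e of its supremum, at most e remains. *)
Lemma radial_tail e : 0 < e -> exists2 rho, 2^-1 < rho < 1 & forall s r, rho <= s <= r -> r < 1 ->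
  Rintegral lam `[s, r] (radial_mean G) <= e.
Proof.
move=> e0.
pose K := fine (\int[lam2]_(p in @unit_disc R) (cabs (G (cplane p)))%:E)%E.
have KE : (\int[lam2]_(p in @unit_disc R) (cabs (G (cplane p)))%:E <= K%:E)%E.
  rewrite /K fineK// ge0_fin_numE//; apply: integral_ge0 => p _.
  by rewrite lee_fin cabs_ge0.
pose T r := Rintegral lam `[2^-1, r] (radial_mean G).
pose A := [set T r | r in [set r | 2^-1 < r < 1]].
have ubA : ubound A (2 * K) by move=> _ [r rI <-]; exact: (radial_bound Gc KE rI).
have A0 : A !=set0 by exists (T (3 / 4)); exists (3 / 4) => //=; apply/andP; split; lra.
have hs : has_sup A by split => //; exists (2 * K).
have [_ [rho rhoI <-] Hrho] := sup_adherent e0 hs.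
have /andP[rho2 rho1] := rhoI.
exists rho => // s r /andP[rs sr] r1.
have addT a b : 2^-1 < a -> a <= b -> b < 1 ->
    T b = T a + Rintegral lam `[a, b] (radial_mean G).
  move=> a2 ab b1; have ib := @radial_integrable 2^-1 b ltac:(lra) b1.
  have := Rintegral_itvB ib (_ : (BLeft 2^-1 <= BRight a)%O) (_ : (BRight a <= BRight b)%O).
  rewrite !bnd_simp => /(_ (ltW a2) ab) E.
  have i2 : lam.-integrable `]a, b] (EFin \o radial_mean G).
    by apply: integrableS ib => //; apply: subset_itvr; rewrite bnd_simp ltW.
  by have := Rintegral_itv_obnd_cbnd i2; rewrite -E => <-; rewrite addrC subrK.
have Tr : T r <= sup A.
  by apply: ub_le_sup; [exists (2 * K)|exists r => //=; apply/andP; split; lra].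
have := addT s r ltac:(lra) sr r1; have := addT rho s rho2 rs ltac:(lra).
have : 0 <= Rintegral lam `[rho, s] (radial_mean G) by apply: Rintegral_ge0 => t _; exact: radial_mean_ge0.
lra.
Qed.

(** The radius depends on [g] and [e] only; it is the same for all bounded [f]. *)
Lemma diagonal_cauchy e : 0 < e -> exists2 rho, 2^-1 < rho < 1 & forall f M r r', hol 1 f ->
  (forall w, cabs w < 1 -> cabs (f w) <= M) -> rho <= r' <= r -> r < 1 ->
  cabs (npair f g r r - npair f g r' r') <= M * e.
Proof.
move=> e0; have [rho0 /andP[h1 h2] H] := radial_tail e0.
(* As ((1 + rho0)/2)^2 >= rho0 and r < 1, the lower radius r'^2/r stays above rho0. *)
exists ((1 + rho0) / 2); first by apply/andP; split; lra.
move=> f M r r' hf fM /andP[rr' r'r] r1.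
have M0 : 0 <= M by apply: le_trans (cabs_ge0 (f 0)) (fM _ _); rewrite cabs0.
apply: (le_trans (diagonal_increment hf fM _ r1)); first by apply/andP; split; lra.
rewrite ler_wpM2l//; apply: H => //; apply/andP; split.
  rewrite ler_pdivlMr; last lra.
  have : rho0 <= r' ^+ 2 by rewrite expr2; nra.
  nra.
by rewrite ler_pdivrMr; [rewrite expr2; nra|lra].
Qed.

End OneFunction.

Lemma left_cauchy (u : R -> R) :
  (forall e, 0 < e -> exists2 rho, rho < 1 & forall r, rho <= r < 1 -> `|u r - u rho| <= e) ->
  exists l, forall e, 0 < e -> exists2 rho, rho < 1 & forall r, rho <= r < 1 -> `|u r - l| <= e.
Proof.
move=> H.
have /cauchy_cvgP/cvg_ex[l Hl] : cauchy (u r @[r --> (1 : R)^'-]).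
  apply/cauchy_exP => e e0; have [|rho rho1 Hr] := H (e / 2); first by rewrite divr_gt0.
  exists (u rho); suff : \forall r \near (1 : R)^'-, ball (u rho) e (u r) by [].
  near=> r; rewrite /ball /= distrC.
  rewrite (le_lt_trans (Hr r _))//; last by rewrite ltr_pdivrMr// ltr_pMr// ltr1n.
  apply/andP; split; last by near: r; exact: nbhs_left_lt.
  by near: r; apply: nbhs_left_ge.
exists l => e e0.
move/cvgrPdist_le : Hl => /(_ _ e0) /nbhs_ballP[d /= d0 Hd].
exists (1 - d / 2); first by rewrite ltrBlDr ltrDl divr_gt0.
move=> r /andP[r1 r2]; rewrite distrC; apply: Hd => //=.
rewrite /ball /= ger0_norm ?subr_ge0 ?(ltW r2)//; lra.
Unshelve. all: by end_near. Qed.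

(** [bpair] is a total [lim]; here it is shown to be a genuine limit when [f] is bounded and [g] is
    in W^1, which is what makes estimates of it possible. *)
Lemma pairing_limit (f g : C -> C) M : hol 1 f -> W1 g ->
  (forall w, cabs w < 1 -> cabs (f w) <= M) ->
  forall e, 0 < e -> exists2 rho, rho < 1 & forall r, rho <= r < 1 ->
    cabs (npair f g r r - bpair f g) <= e.
Proof.
move=> hf [/analytic_hol hg Wg] fM.
have M0 : 0 <= M by apply: le_trans (cabs_ge0 (f 0)) (fM _ _); rewrite cabs0.
have M1 : 0 < M + 1 by rewrite ltr_wpDl.
have base e : 0 < e -> exists2 rho, rho < 1 & forall r, rho <= r < 1 ->
    cabs (npair f g r r - npair f g rho rho) <= e.
  move=> e0; have [|rho /andP[_ h2] H] := diagonal_cauchy hg Wg (e := e / (M + 1)); first by rewrite divr_gt0.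
  exists rho => // r /andP[h3 h4]; apply: le_trans (H f M r rho hf fM _ h4) _; first by rewrite lexx.
  by rewrite mulrCA ler_piMr ?(ltW e0)// ler_pdivrMr// mul1r lerDl.
have [|a Ha] := left_cauchy (u := fun r => complex.Re (npair f g r r)).
  move=> e /base[rho rho1 H]; exists rho => // r /H; apply: le_trans.
  by rewrite -ReN -ReD cabs_ge_Re.
have [|b Hb] := left_cauchy (u := fun r => complex.Im (npair f g r r)).
  move=> e /base[rho rho1 H]; exists rho => // r /H; apply: le_trans.
  by rewrite -ImN -ImD cabs_ge_Im.
pose l : C := a +i* b.
have Hl e : 0 < e -> exists2 rho, rho < 1 & forall r, rho <= r < 1 -> cabs (npair f g r r - l) <= e.
  move=> e0; have e2 : 0 < e / 2 by rewrite divr_gt0.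
  have [r1 r11 H1] := Ha _ e2; have [r2 r21 H2] := Hb _ e2.
  exists (Num.max r1 r2); first by rewrite gt_max r11.
  move=> r /andP[]; rewrite ge_max => /andP[h1 h2] h3.
  rewrite (le_trans (cabs_ReIm _))// ReD ImD ReN ImN [e]splitr lerD//.
    by apply: H1; rewrite h1.
  by apply: H2; rewrite h2.
suff -> : bpair f g = l by [].
rewrite /bpair; apply: cvg_lim; first exact: norm_hausdorff.
apply/cvgrPdist_le => /= e e0.
have /complex_realP [q eq] : e \is Num.real by rewrite ger0_real// ltW.
have q0 : 0 < q by move: e0; rewrite eq ltcR.
have [rho rho1 H] := Hl _ q0.
near=> r; rewrite eq.
have K : cabs (l - npair f g r r) <= q.
  rewrite cabs_distC; apply: H; apply/andP; split; last by near: r; exact: nbhs_left_lt.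
  by near: r; apply: nbhs_left_ge.
by rewrite cabsE circ_npair; exact: K.
Unshelve. all: by end_near. Qed.

End PairingLimit.

(** * Bounded multiples of S lie in the closure *)

Section InnerMultiples.
Variable R : realType.
Local Notation C := (CC R).
Local Notation mR := (measurableTypeR R).
Local Notation lam := (@lebesgue_measure R).
Local Notation U := (@unit_interval R).

Lemma holD r0 (f g : C -> C) : hol r0 f -> hol r0 g -> hol r0 (fun z => f z + g z).
Proof. by move=> hf hg w hw; have [a Ha] := hf w hw; have [b Hb] := hg w hw; exists (a + b); exact: hdD. Qed.

Lemma holB r0 (f g : C -> C) : hol r0 f -> hol r0 g -> hol r0 (fun z => f z - g z).
Proof. by move=> hf hg w hw; have [a Ha] := hf w hw; have [b Hb] := hg w hw; exists (a - b); exact: hdB. Qed.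

Lemma holM r0 (f g : C -> C) : hol r0 f -> hol r0 g -> hol r0 (fun z => f z * g z).
Proof.
by move=> hf hg w hw; have [a Ha] := hf w hw; have [b Hb] := hg w hw; eexists; exact: (hdM Ha Hb).
Qed.

Lemma hol_sub r0 r1 (f : C -> C) : r1 <= r0 -> hol r0 f -> hol r1 f.
Proof. by move=> h hf w hw; apply: hf; exact: lt_le_trans h. Qed.

Lemma hol_eq r0 (f g : C -> C) : (forall z, cabs z < r0 -> f z = g z) -> hol r0 f -> hol r0 g.
Proof.
move=> fg hf w hw; have [d Hd] := hf w hw; exists d.
have r : 0 < r0 - cabs w by rewrite subr_gt0.
apply: (hd_eq r _ Hd) => h hh; apply: fg.
by rewrite (le_lt_trans (cabsD _ _))// addrC -ltrBrDr.
Qed.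

Lemma hd_translate (f : C -> C) z w d : hd f (z + w) d -> hd (fun x => f (z + x)) w d.
Proof. by move=> H e /H[del d0 Hd]; exists del => // h /Hd; rewrite addrA. Qed.

(** Cauchy's estimate on the disc of radius 1 - |z| about z; in particular bounded functions are
    Bloch functions. *)
Lemma deriv_bound_bounded (f : C -> C) M z : hol 1 f -> (forall w, cabs w < 1 -> cabs (f w) <= M) ->
  cabs z < 1 -> cabs ('D_1 f z) <= M / (1 - cabs z).
Proof.
move=> hf fM z1.
have inD w : cabs w < 1 - cabs z -> cabs (z + w) < 1.
  by move=> hw; rewrite (le_lt_trans (cabsD _ _))// addrC -ltrBrDr.
have ht : hol (1 - cabs z) (fun w => f (z + w)).
  by move=> w /inD /hf[d Hd]; exists d; exact: hd_translate.
have := cauchy_estimate ht (fun w hw => fM _ (inD w hw)) _; rewrite subr_gt0 => /(_ z1).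
have [d Hd] := hf z z1.
have Hd0 : hd f (z + 0) d by rewrite addr0.
have /hdP[_ ->] := hd_translate Hd0.
by have /hdP[_ ->] := Hd.
Qed.

Lemma deriv_bounded_sub (f : C -> C) rho : hol 1 f -> rho < 1 ->
  exists M, forall z, cabs z <= rho -> cabs ('D_1 f z) <= M.
Proof.
move=> hf rho1; have [rho0|rho0] := ltP rho 0.
  by exists 0 => z; move=> /le_lt_trans/(_ rho0); rewrite ltNge cabs_ge0.
pose r := (1 + rho) / 2; have rr : rho < r by rewrite /r; lra.
have r1 : r < 1 by rewrite /r; lra.
have rI : 0 <= r < 1 by apply/andP; split; lra.
have hc := cbm_cauchy_density hf rI; have [_ _ [M HM]] := hc.
exists (M / (r - rho) ^+ 2) => z zr; have zr' : cabs z < r by exact: le_lt_trans rr.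
have /hdP[_ ->] := cauchy_deriv hf r1 zr'.
have := @cauchy_type_bound R _ _ lam U (@circ R) (@measurable_unit R) (lamU_fin R) (@cabs_circ R) (@cbe_circ R) _ r 2 z M hc zr' HM.
have l1 : fine (lam U) = 1 by rewrite lamU.
have M0 : 0 <= M by apply: le_trans (cabs_ge0 _) (HM 0 _); rewrite /unit_interval /= lexx ltr01.
rewrite l1 mulr1 => /le_trans; apply; rewrite ler_wpM2l// lef_pV2 ?posrE ?exprn_gt0 ?subr_gt0//.
by rewrite lerXn2r ?nnegrE ?subr_ge0 ?(ltW rr) ?(ltW zr')// lerB.
Qed.

Lemma bounded_approx (h : C -> C) M r' del : hol 1 h -> (forall w, cabs w < 1 -> cabs (h w) <= M) ->
  0 <= r' < 1 -> 0 < del -> exists P : {poly C},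
  (forall z, cabs z < 1 -> cabs P.[z] <= M + 1) /\
  (forall z, cabs z <= r' -> cabs (P.[z] - h z) <= del).
Proof.
move=> hh hM /andP[r'0 r'1] del0.
have M0 : 0 <= M by apply: le_trans (cabs_ge0 (h 0)) (hM _ _); rewrite cabs0.
(* [K] bounds |h'| on |z| <= r'. Dilating by 1 - t moves such a point radially by at most t, so h
   changes by at most tK <= del/2; the other del/2 is left for the polynomial. *)
pose K := (M + 1) / (1 - r').
have K0 : 0 < K by rewrite divr_gt0 ?subr_gt0// ltr_wpDl.
pose t := Num.min (1 / 2) (del / 2 / K).
have t0 : 0 < t.
  by rewrite /t lt_min; apply/andP; split; [lra|rewrite divr_gt0// divr_gt0].
have t2 : t <= 1 / 2 by rewrite /t ge_min lexx.
have tK : t * K <= del / 2 by rewrite -ler_pdivlMr// /t ge_min lexx orbT.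
pose rho := 1 - t.
have rhoI : 0 <= rho < 1 by rewrite /rho; apply/andP; split; lra.
have /andP[rho0 rho1] := rhoI.
have e0 : 0 < Num.min 1 (del / 2) by rewrite lt_min ltr01 divr_gt0.
have [Q HQ] := poly_approx hh rhoI e0.
pose P := Q \Po ((rho%:C : C) *: 'X).
have PE z : P.[z] = Q.[(rho%:C : C) * z] by rewrite /P horner_comp hornerZ hornerX.
have rz z : cabs ((rho%:C : C) * z) = rho * cabs z by rewrite cabsM cabs_real ger0_norm.
have B z : cabs z <= 1 -> cabs (P.[z] - h ((rho%:C : C) * z)) <= Num.min 1 (del / 2).
  by move=> z1; rewrite PE cabs_distC HQ// rz ler_piMr.
exists P; split=> z hz.
  rewrite -(subrK (h ((rho%:C : C) * z)) P.[z]) (le_trans (cabsD _ _))// addrC lerD//.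
    by rewrite hM// rz (le_lt_trans _ rho1)// ler_piMr// ltW.
  by rewrite (le_trans (B z (ltW hz)))// ge_min lexx.
have z1 : cabs z <= 1 by rewrite (le_trans hz)// ltW.
rewrite -(subrK (h ((rho%:C : C) * z)) P.[z]) -addrA (le_trans (cabsD _ _))// [del]splitr lerD//.
  by rewrite (le_trans (B z z1))// ge_min lexx orbT.
have [s Us zE] := polar_form z; set x := cabs z in zE hz z1 *.
have x0 : 0 <= x by exact: cabs_ge0.
have x1 : x < 1 by exact: le_lt_trans r'1.
have -> : h ((rho%:C : C) * z) - h z = - (h ((x%:C : C) * circ s) - h (((rho * x)%:C : C) * circ s)).
  by rewrite {1 2}zE mulrA -rmorphM opprB.
rewrite cabsN.
have rx : rho * x <= x by rewrite ler_piMl// ltW.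
have rx0 : 0 <= rho * x by rewrite mulr_ge0.
have I1 : 0 <= rho * x <= x by rewrite rx0.
apply: (le_trans (radial_increment s hh I1 x1)).
apply: le_trans tK.
have fin := lam_itv_fin (rho * x) x.
have hq : cbm (T := mR) `[rho * x, x] (fun y => 'D_1 h ((y%:C : C) * circ s)).
  apply: pcont_cbm => y /andP[h1 h2].
  apply: (@pcont_comp _ (fun z => 'D_1 h z) (fun y => (y%:C : C) * circ s)); last exact: pcont_scale.
  by apply: (ccont_deriv hh); rewrite cabs_scale_circ; [exact: le_lt_trans x1|exact: le_trans h1].
have iq := @cbm_cabs _ _ mR lam _ (measurable_itv _) fin _ hq.
have iK : lam.-integrable `[rho * x, x] (EFin \o (fun=> K : R)).
  by apply: (@bm_integrable _ _ mR lam _ (measurable_itv _) fin _ `|K|) => //; exact: measurable_cst.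
apply: (@le_trans _ _ (Rintegral lam `[rho * x, x] (fun=> K))).
  apply: le_Rintegral => // y; rewrite /= in_itv /= => /andP[y1 y2].
  have y0 : 0 <= y by exact: le_trans y1.
  have yd : cabs ((y%:C : C) * circ s) < 1 by rewrite cabs_scale_circ// (le_lt_trans y2).
  apply: (le_trans (deriv_bound_bounded hh hM yd)); rewrite cabs_scale_circ//.
  have d1 : 0 < 1 - y by rewrite subr_gt0 (le_lt_trans y2).
  have d2 : 0 < 1 - r' by rewrite subr_gt0.
  apply: ler_pM => //; first by rewrite invr_ge0 ltW.
    by rewrite lerDl.
  by rewrite lef_pV2 ?posrE// lerD2l lerN2 (le_trans y2).
rewrite Rintegral_cst// lam_itv// mulrC ler_wpM2r ?(ltW K0)//.
have -> : x - rho * x = t * x by rewrite /rho; ring.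
by rewrite ler_piMr// ltW.
Qed.

Lemma pairing_near (f g : C -> C) M e r' : hol 1 f -> W1 g ->
  (forall w, cabs w < 1 -> cabs (f w) <= M) -> r' < 1 ->
  (forall r, r' <= r -> r < 1 -> cabs (npair f g r r - npair f g r' r') <= e) ->
  cabs (bpair f g - npair f g r' r') <= e.
Proof.
move=> hf Wg fM r'1 H; apply/ler_addgt0Pr => d d0.
have [rho rho1 Hr] := pairing_limit hf Wg fM d0.
pose r := Num.max rho r'.
have r1 : r < 1 by rewrite gt_max rho1.
have k1 : cabs (npair f g r r - npair f g r' r') <= e by apply: H => //; rewrite le_max lexx orbT.
have k2 : cabs (npair f g r r - bpair f g) <= d by apply: Hr; rewrite r1 le_max lexx.
have -> : bpair f g - npair f g r' r' =
  (npair f g r r - npair f g r' r') - (npair f g r r - bpair f g) by ring.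
by rewrite (le_trans (cabsB _ _))// lerD.
Qed.

Variable S : C -> C.
Hypotheses (hS : hol 1 S) (S1 : forall z, cabs z < 1 -> cabs (S z) <= 1).

Lemma multiple_in_closure (u h : C -> C) : Hinf h -> (forall z, disc z -> u z = S z * h z) ->
  wstar_closure_polmul S u /\ Hinf u.
Proof.
move=> [/analytic_hol hh [M hM]] uE.
have M0 : 0 <= M by apply: le_trans (cabs_ge0 (h 0)) (hM _ _); rewrite /disc /= cabs0.
have hu : hol 1 u.
  by apply: (@hol_eq _ (fun z => S z * h z)); [move=> z hz; rewrite uE|exact: holM].
have uM z : cabs z < 1 -> cabs (u z) <= M.
  move=> hz; rewrite uE// cabsM -[M]mul1r ler_pM ?cabs_ge0//; [exact: S1|exact: hM].
have Hu : Hinf u by split; [exact/analytic_hol|exists M].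
split => //; split.
  split; first exact/analytic_hol.
  exists M => z hz; rewrite mulrC -ler_pdivlMr ?subr_gt0//.
  exact: deriv_bound_bounded.
move=> gs eps Wgs eps0.
(* A bound for P S - u that holds whichever P [bounded_approx] will supply. *)
pose B := M + 1 + M; have B0 : 0 < B by rewrite /B; lra.
have eB : 0 < eps / (2 * B) by rewrite divr_gt0// mulr_gt0.
(* A neighbourhood involves finitely many [g], so one radius serves them all, for every [f] bounded
   by [B]; [P] is chosen afterwards. *)
have [rho rhoI Hrho] : exists2 rho, 2^-1 < rho < 1 & forall g, g \in gs ->
    forall f r r', hol 1 f -> (forall w, cabs w < 1 -> cabs (f w) <= B) -> rho <= r' <= r -> r < 1 ->
    cabs (npair f g r r - npair f g r' r') <= B * (eps / (2 * B)).
  elim: gs Wgs => [|g gs ih] Wgs; first by exists (3 / 4) => //; apply/andP; split; lra.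
  have [|rho1 /andP[a1 b1] H1] := ih; first by move=> k kg; apply: Wgs; rewrite inE kg orbT.
  have [/analytic_hol hg Wg] : W1 g by apply: Wgs; rewrite inE eqxx.
  have [rho2 /andP[a2 b2] H2] := diagonal_cauchy hg Wg eB.
  exists (Num.max rho1 rho2); first by rewrite lt_max a1 gt_max b1.
  move=> k; rewrite inE => /predU1P[->|kg] f r r' hf fB /andP[]; rewrite ge_max => /andP[h1 h2] h3 h4.
    by apply: H2 => //; rewrite h2.
  by apply: (H1 _ kg) => //; rewrite h1.
have /andP[rho2 rho1] := rhoI.
have rI : 0 <= rho < 1 by apply/andP; split; lra.
have [N HN] : exists N, forall g, g \in gs -> forall t, U t -> cabs (g ((rho%:C : C) * circ t)) <= N.
  elim: gs Wgs {Hrho} => [|g gs ih] Wgs; first by exists 0.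
  have [|N1 H1] := ih; first by move=> k kg; apply: Wgs; rewrite inE kg orbT.
  have [/analytic_hol hg Wg] : W1 g by apply: Wgs; rewrite inE eqxx.
  have [_ _ [N2 H2]] := hol_circle hg rI.
  exists (Num.max N1 N2) => k; rewrite inE => /predU1P[->|kg] t Ut; rewrite le_max.
    by rewrite H2 ?orbT.
  by rewrite (H1 _ kg).
(* On the circle of radius rho, |P - h| <= eps/(4(|N| + 1)) and |g| <= N leave at most eps/4,
   besides eps/2 for passing to the limit. *)
have dl : 0 < eps / (4 * (`|N| + 1)) by rewrite divr_gt0// mulr_gt0// ltr_wpDl.
have [P [P1 P2]] := bounded_approx hh hM rI dl.
exists P => g gg; pose f z := P.[z] * S z - u z.
have Wg := Wgs _ gg; have [/analytic_hol hg _] := Wg.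
have hP : hol 1 (fun z : C => P.[z]) by move=> w _; exact: hd_poly.
have hf : hol 1 f by apply: holB => //; exact: holM.
have fB w : cabs w < 1 -> cabs (f w) <= B.
  move=> hw; rewrite (le_trans (cabsB _ _))// lerD ?uM// cabsM -[M + 1]mulr1.
  by rewrite ler_pM ?cabs_ge0 ?P1 ?S1.
have K := pairing_near (e := B * (eps / (2 * B))) hf Wg fB rho1.
have {}K : cabs (bpair f g - npair f g rho rho) <= B * (eps / (2 * B)).
  by apply: K => r r1 r2; apply: (Hrho _ gg) => //; rewrite lexx.
have c := cbm_npair hf hg rI rI.
have L : cabs (npair f g rho rho) <= eps / 4.
  have l1 : fine (lam U) = 1 by rewrite lamU.
  rewrite -[leRHS]mulr1 -[X in _ <= _ * X]l1; apply: cint_bound; [exact: measurable_unit|exact: lamU_fin|exact: c|].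
  move=> t Ut; rewrite cabsM cabs_conj.
  have -> : eps / 4 = eps / (4 * (`|N| + 1)) * (`|N| + 1) by field; rewrite gt_eqF// ltr_wpDl.
  apply: ler_pM; rewrite ?cabs_ge0//; last first.
    by rewrite (le_trans (HN _ gg _ Ut))// (le_trans (ler_norm _))// lerDl.
  have zr : cabs ((rho%:C : C) * circ t) <= rho by rewrite cabs_scale_circ//; lra.
  have z1 : cabs ((rho%:C : C) * circ t) < 1 by exact: le_lt_trans rho1.
  rewrite /f uE// mulrC -mulrBr cabsM -[leRHS]mul1r.
  by rewrite ler_pM ?cabs_ge0 ?S1 ?P2.
rewrite -(subrK (npair f g rho rho) (bpair f g)) (le_lt_trans (cabsD _ _))//.
have BE : B * (eps / (2 * B)) = eps / 2 by field; rewrite gt_eqF.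
by rewrite BE in K; lra.
Qed.

End InnerMultiples.

(** * Poisson integrals, difference quotients and domination in W^1 *)

Section Quotient.
Variable R : realType.
Local Notation C := (CC R).
Local Notation mR := (measurableTypeR R).
Local Notation lam := (@lebesgue_measure R).
Local Notation lam2 := (lam \x lam)%E.
Local Notation U := (@unit_interval R).

Let mU : measurable (U : set mR). Proof. exact: measurable_unit. Qed.
Let fU : (lam U < +oo)%E. Proof. exact: lamU_fin. Qed.
Let l1 : fine (lam U) = 1. Proof. by rewrite lamU. Qed.

Lemma Re_div (z w : C) : w != 0 -> complex.Re (z / w) = complex.Re (z * cconj w) / cabs w ^+ 2.
Proof.
move=> w0; have c0 : ((cabs w ^+ 2)%:C : C) != 0 by rewrite -cabs_eq0 cabs_real normr_eq0 expf_neq0// cabs_eq0.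
have -> : z / w = ((cabs w ^+ 2)^-1%:C : C) * (z * cconj w).
  by rewrite fmorphV /= -mul_cconj; field; rewrite -[cconj w == 0]cabs_eq0 cabs_conj cabs_eq0 w0.
by rewrite Re_real_mul mulrC.
Qed.

(** The function 2w/(w - a) - 1 = (w + a)/(w - a) has mean 1 over |w| = r and real part (r^2 -
    |a|^2)/|w - a|^2. *)
Lemma poisson_integral (a : C) (r : R) : cabs a < r ->
  lam.-integrable U (EFin \o (fun t => (cabs ((r%:C : C) * circ t - a) ^+ 2)^-1)) /\
  Rintegral lam U (fun t => (cabs ((r%:C : C) * circ t - a) ^+ 2)^-1) = (r ^+ 2 - cabs a ^+ 2)^-1.
Proof.
move=> ar; have r0 : 0 < r by exact: le_lt_trans (cabs_ge0 a) ar.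
have n0 t : (r%:C : C) * circ t - a != 0 by exact: circ_sub_neq0.
have d0 : 0 < r ^+ 2 - cabs a ^+ 2 by rewrite subr_gt0 ltrXn2r ?nnegrE ?cabs_ge0 ?(ltW r0).
pose k t : C := 2 * (((r%:C : C) * circ t) / ((r%:C : C) * circ t - a)) - 1.
have hk0 : cbm (T := mR) U (fun t => ((r%:C : C) * circ t) / ((r%:C : C) * circ t - a)).
  by apply: cbmM; [apply: pcont_cbm1 => t; exact: pcont_scale_circ|exact: cbm_circ_subV].
have hk : cbm (T := mR) U k by apply: cbmB; [exact: cbmZ|exact: cbm_cst].
have K : cint lam U k = 1.
  rewrite /k cintB//; [|exact: cbmZ|exact: cbm_cst].
  by rewrite cintZ// cint_cauchy_kernel// cint_cst// l1 mulr1 mul1r; ring.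
have Rek t : complex.Re (k t) = (r ^+ 2 - cabs a ^+ 2) * (cabs ((r%:C : C) * circ t - a) ^+ 2)^-1.
  have -> : k t = ((r%:C : C) * circ t + a) / ((r%:C : C) * circ t - a) by rewrite /k; field.
  rewrite Re_div//; congr (_ / _).
  have zz : cabs ((r%:C : C) * circ t) ^+ 2 = r ^+ 2 by rewrite cabs_scale_circ// ltW.
  rewrite -zz; move: (_ * circ t) => x.
  by rewrite !cabs_sqr ReM !(ReD, ImD, ReN, ImN) /= !(ReD, ImD, ReN, ImN); ring.
have iRe := @cbm_Re _ _ mR lam U mU fU _ hk.
have E : (fun t => (cabs ((r%:C : C) * circ t - a) ^+ 2)^-1) =
         (fun t => (r ^+ 2 - cabs a ^+ 2)^-1 * complex.Re (k t)).
  by apply/funext => t; rewrite Rek mulKf// gt_eqF.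
rewrite E; split.
  by apply: eq_integrable (integrableZl mU (r ^+ 2 - cabs a ^+ 2)^-1 iRe) => // t _.
rewrite RintegralZl//.
have -> : Rintegral lam U (fun t => complex.Re (k t)) = complex.Re (cint lam U k) by [].
by rewrite K mulr1.
Qed.

(** Removable singularity: by Cauchy's formula and partial fractions the quotient is, for |z| < r, a
    Cauchy-type integral, which is differentiable at z0 too. Elsewhere the quotient itself is
    used. *)
Lemma diff_quotient (f : C -> C) z0 : hol 1 f -> cabs z0 < 1 ->
  exists2 q, hol 1 q & forall z, cabs z < 1 -> z != z0 -> q z = (f z - f z0) / (z - z0).
Proof.
move=> hf z01; pose r := (1 + cabs z0) / 2.
have z0r : cabs z0 < r by rewrite /r; lra.
have r1 : r < 1 by rewrite /r; lra.
have rI : 0 <= r < 1 by rewrite r1 andbT (le_trans (cabs_ge0 z0))// ltW.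
pose p t : C := f ((r%:C : C) * circ t) * ((r%:C : C) * circ t).
have hp : cbm (T := mR) U p := cbm_cauchy_density hf rI.
pose P t : C := p t * ((r%:C : C) * circ t - z0)^-1.
have hP : cbm (T := mR) U P by apply: cbmM => //; exact: cbm_circ_subV.
have E z : cabs z < r -> z != z0 -> cauchy_lam P r 1 z = (f z - f z0) / (z - z0).
  move=> zr zz0; have zz : z - z0 != 0 by rewrite subr_eq0.
  rewrite (cauchy_formula hf r1 zr) (cauchy_formula hf r1 z0r).
  have hc w : cabs w < r -> cbm (T := mR) U (fun t => p t * ((r%:C : C) * circ t - w)^-1 ^+ 1).
    by move=> wr; under eq_fun do rewrite expr1; apply: cbmM => //; exact: cbm_circ_subV.
  have hPz : cbm (T := mR) U (fun t => P t * ((r%:C : C) * circ t - z)^-1 ^+ 1).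
    by under eq_fun do rewrite expr1; apply: cbmM => //; exact: cbm_circ_subV.
  apply: (mulfI zz); rewrite mulrCA divff// mulr1 /cauchy_lam /cauchy_type -/p.
  rewrite -cintB; [|exact: mU|exact: fU|exact: hc|exact: hc].
  rewrite -cintZ//.
  by apply: eq_cint => t _; rewrite /P /p !expr1; field; rewrite !circ_sub_neq0.
pose q z := if cabs z < r then cauchy_lam P r 1 z else (f z - f z0) / (z - z0).
have qE z : z != z0 -> q z = (f z - f z0) / (z - z0).
  by move=> zz0; rewrite /q; case: ifPn => // zr; exact: E.
exists q; last by move=> z _; exact: qE.
move=> w w1; have [wr|wr] := ltP (cabs w) r.
  exists (cauchy_lam P r 2 w); have d0 : 0 < r - cabs w by rewrite subr_gt0.
  apply: (hd_eq d0 _ (hd_cauchy_lam hP wr)) => h hh; rewrite /q ifT//.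
  by rewrite (le_lt_trans (cabsD _ _))// addrC -ltrBrDr.
have wz : w - z0 != 0 by rewrite subr_eq0; apply: contraTneq wr => ->; rewrite -ltNge.
have [d Hd] := hf w w1.
have H := @hd_div R (fun x => f x - f z0) (fun x => x - z0) w _ _ wz
    (hdB Hd (hd_cst (f z0) w)) (hdB (hd_id w) (hd_cst z0 w)).
have d0 : 0 < cabs w - cabs z0 by rewrite subr_gt0 (lt_le_trans z0r).
eexists; apply: (hd_eq d0 _ H) => h hh; rewrite qE//.
apply/eqP => E'; have := cabs_triB w (- h).
by rewrite cabsN opprK E'; lra.
Qed.

Lemma measurable_cabs_disc (G : C -> C) : (forall z, cabs z < 1 -> ccont G z) ->
  measurable_fun (@unit_disc R) (fun p => (cabs (G (cplane p)))%:E).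
Proof.
move=> Gc; apply/measurable_EFinP.
apply: (eq_measurable_fun (fun p => psi G (cplane p))).
  by move=> p; rewrite inE => /unit_discE pD; rewrite /psi pD.
by apply: measurable_funTS; exact: measurable_psi.
Qed.

Lemma area_disc_fin : (lam2 (@unit_disc R) < +oo)%E.
Proof.
have mI : measurable (`[-1, 1]%classic : set mR) by exact: measurable_itv.
apply: (@le_lt_trans _ _ (lam2 (`[-1, 1]%classic `*` `[-1, 1]%classic))).
  apply: le_measure; rewrite ?inE; [exact: measurable_unit_disc|exact: measurableX|].
  move=> [x y]; rewrite /unit_disc /= !in_itv /= => h.
  have := sqr_ge0 x; have := sqr_ge0 y; move: h; rewrite !expr2 => *.
  by split; apply/andP; split; nra.
rewrite product_measure1E// lte_mul_pinfty//; last exact: lam_itv_fin.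
by rewrite ge0_fin_numE//; exact: lam_itv_fin.
Qed.

Lemma integral_affine_fin (F : mR * mR -> \bar R) (D : set (mR * mR)) (a b : R) : measurable D ->
  (lam2 D < +oo)%E -> measurable_fun D F -> (forall p, D p -> (0 <= F p)%E) ->
  (\int[lam2]_(p in D) F p < +oo)%E -> 0 <= a -> 0 <= b ->
  (\int[lam2]_(p in D) (a%:E * F p + b%:E) < +oo)%E.
Proof.
move=> mD fD mF F0 fF a0 b0.
have maF : measurable_fun D (fun p => a%:E * F p)%E by exact: measurable_funeM.
have aF0 p : D p -> (0 <= a%:E * F p)%E by move=> /F0; apply: mule_ge0; rewrite lee_fin.
have bE p : D p -> (0 <= b%:E)%E by rewrite lee_fin.
have mb : measurable_fun D (fun=> b%:E : \bar R) by exact: measurable_cst.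
have -> : (\int[lam2]_(p in D) (a%:E * F p + b%:E) =
    \int[lam2]_(p in D) (a%:E * F p) + \int[lam2]_(p in D) b%:E)%E by exact: ge0_integralD.
have aE0 : (0 <= a%:E)%E by rewrite lee_fin.
have bE0 : (0 <= b%:E)%E by rewrite lee_fin.
have -> : (\int[lam2]_(p in D) (a%:E * F p) = a%:E * \int[lam2]_(p in D) F p)%E by exact: ge0_integralZl.
have -> : (\int[lam2]_(p in D) b%:E = b%:E * lam2 D)%E by exact: integral_cst.
have I0 : (0 <= \int[lam2]_(p in D) F p)%E by exact: integral_ge0.
apply: lte_add_pinfty; apply: lte_mul_pinfty => //; rewrite ?fin_numE//.
Qed.

Lemma W1_dominated (f g : C -> C) a b : W1 f -> hol 1 g -> 0 <= a -> 0 <= b ->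
  (forall z, cabs z < 1 -> cabs ('D_1 g z) <= a * cabs ('D_1 f z) + b) -> W1 g.
Proof.
move=> [/analytic_hol hf Wf] hg a0 b0 H; split; first exact/analytic_hol.
have mf : measurable_fun (@unit_disc R) (fun p => (cabs ('D_1 f (cplane p)))%:E).
  exact: (@measurable_cabs_disc (fun z => 'D_1 f z) (fun z h => ccont_deriv hf h)).
have mg : measurable_fun (@unit_disc R) (fun p => (cabs ('D_1 g (cplane p)))%:E).
  exact: (@measurable_cabs_disc (fun z => 'D_1 g z) (fun z h => ccont_deriv hg h)).
have mD := @measurable_unit_disc R.
have mb : measurable_fun (@unit_disc R) (fun=> b%:E : \bar R) by exact: measurable_cst.
have maf : measurable_fun (@unit_disc R) (fun p => (a%:E * (cabs ('D_1 f (cplane p)))%:E)%E).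
  exact: (measurable_funeM a%:E mf).
apply: (@le_lt_trans _ _ (\int[lam2]_(p in @unit_disc R) (a%:E * (cabs ('D_1 f (cplane p)))%:E + b%:E))%E).
  apply: ge0_le_integral => //.
  - by move=> p _; rewrite lee_fin cabs_ge0.
  - exact: emeasurable_funD.
  - by move=> p /unit_discE pD; rewrite -EFinM -EFinD lee_fin; exact: H.
have F0 p : (@unit_disc R) p -> (0 <= (cabs ('D_1 f (cplane p)))%:E)%E by rewrite lee_fin cabs_ge0.
exact: (@integral_affine_fin (fun p => (cabs ('D_1 f (cplane p)))%:E) (@unit_disc R) a b mD area_disc_fin mf F0 Wf a0 b0).
Qed.

Lemma poly_bounded (P : {poly C}) : exists M, forall z : C, cabs z < 1 -> cabs P.[z] <= M.
Proof.
elim/poly_ind: P => [|P c [M HM]]; first by exists 0 => z _; rewrite horner0 cabs0.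
exists (M + cabs c) => z z1; rewrite hornerD hornerM hornerX hornerC (le_trans (cabsD _ _))// lerD//.
by rewrite cabsM -[M]mulr1 ler_pM ?cabs_ge0 ?HM// ltW.
Qed.

End Quotient.

(** * Bounded elements of the closure are multiples of S *)

Section Permanence.
Variable R : realType.
Local Notation C := (CC R).
Local Notation mR := (measurableTypeR R).
Local Notation lam := (@lebesgue_measure R).
Local Notation U := (@unit_interval R).

Let mU : measurable (U : set mR). Proof. exact: measurable_unit. Qed.
Let fU : (lam U < +oo)%E. Proof. exact: lamU_fin. Qed.
Let l1 : fine (lam U) = 1. Proof. by rewrite lamU. Qed.

Variable S : C -> C.
Hypotheses (hS : hol 1 S) (S1 : forall z, cabs z < 1 -> cabs (S z) <= 1).
Hypothesis S0 : forall z, cabs z < 1 -> S z != 0.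
Hypothesis WS : W1 S.
(** The form in which |S| = 1 on the boundary is used: the circle means of 1 - |S|^2 tend to 0. *)
Hypothesis Sinner : forall e, 0 < e -> exists2 rho, rho < 1 & forall r, rho <= r < 1 -> 0 <= r ->
  Rintegral lam U (fun t => 1 - cabs (S ((r%:C : C) * circ t)) ^+ 2) <= e.

Section OnePoint.
Variable z0 : C.
Hypothesis z01 : cabs z0 < 1.

Let k (z : C) : C := (1 - cconj z0 * z)^-1.

Let k_neq0 z : cabs z < 1 -> 1 - cconj z0 * z != 0.
Proof.
move=> z1; rewrite subr_eq0; apply/eqP => /(congr1 (@cabs R)); rewrite cabs1 cabsM cabs_conj => E.
have h1 := cabs_ge0 z; have h2 := cabs_ge0 z0.
by have := ler_wpM2r h1 (ltW z01); rewrite -E mul1r leNgt z1.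
Qed.

Let hd_k z : cabs z < 1 -> hd k z (cconj z0 * k z ^+ 2).
Proof.
move=> z1; have kn := k_neq0 z1.
have H := hd_comp (hdB (hd_cst 1 z) (hdM (hd_cst (cconj z0) z) (hd_id z))) (hdV kn).
by move: H; congr (hd _ _ _); rewrite /k; field.
Qed.

(** The functional [f |-> int f (conj S) P_z0 dm - f(z0)/S(z0)], with [P_z0] the Poisson kernel, kills every [p S]; its representative in W^1 is [S k + z0 (S - S(z0))/(z - z0) - k / conj(S(z0))], [k] the Szego kernel at [z0]. *)
Let test_function : exists g, [/\ W1 g &
  forall z, cabs z < 1 -> z != z0 ->
    g z = S z * k z + z0 * ((S z - S z0) / (z - z0)) - (cconj (S z0))^-1 * k z].
Proof.
have [q hq qE] := diff_quotient hS z01; set c := (cconj (S z0))^-1.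
pose g z := S z * k z + z0 * q z - c * k z.
have hk : hol 1 k by move=> w w1; eexists; exact: hd_k.
have hcst (d : C) : hol 1 (fun=> d) by move=> w _; exists 0; exact: hd_cst.
have hg : hol 1 g by apply: holB; [apply: holD|]; apply: holM.
exists g; split; last by move=> z z1 zz0; rewrite /g qE.
pose r := (1 + cabs z0) / 2; have s0 := cabs_ge0 z0.
have r1 : r < 1 by have h := z01; rewrite /r; lra.
have [M HM] := deriv_bounded_sub hg r1.
have r0 : 0 <= r by rewrite /r; lra.
have M0 : 0 <= M by apply: le_trans (cabs_ge0 _) (HM 0 _); rewrite cabs0.
(* [D] bounds |k| on the disc and 1/|z - z0| for |z| > r. There S k' costs D^2 and z0 q' costs D|S'|
   + 2 D^2; for |z| <= r the derivative is bounded by M. *)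
pose D := 2 / (1 - cabs z0).
have D0 : 0 < D by rewrite divr_gt0// subr_gt0.
apply: (W1_dominated (f := S) (a := 2 * D) (b := 3 * D ^+ 2 + cabs c * D ^+ 2 + M)) => //.
- by rewrite mulr_ge0// ltW.
- by rewrite !addr_ge0// mulr_ge0 ?cabs_ge0// sqr_ge0.
move=> z z1; have [zr|zr] := leP (cabs z) r.
  rewrite (le_trans (HM z zr))// addrA lerDr.
  have D2 := sqr_ge0 D; have D1 := ltW D0.
  apply: addr_ge0; first by apply: mulr_ge0; [apply: mulr_ge0|exact: cabs_ge0].
  by apply: addr_ge0; apply: mulr_ge0 => //; exact: cabs_ge0.
have zz0 : z - z0 != 0.
  by have h := z01; rewrite subr_eq0; apply: contraTneq zr => ->; rewrite -leNgt /r; lra.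
have [d Hd] := hS z1.
have HQ : hd q z ((d * (z - z0) - (S z - S z0)) / (z - z0) ^+ 2).
  have H := @hd_div R (fun x => S x - S z0) (fun x => x - z0) z _ _ zz0
    (hdB Hd (hd_cst (S z0) z)) (hdB (hd_id z) (hd_cst z0 z)).
  have d0 : 0 < Num.min (1 - cabs z) (cabs (z - z0)) by rewrite lt_min subr_gt0 z1 cabs_gt0.
  have {}H : hd q z (((d - 0) / (z - z0)) - (S z - S z0) * (1 - 0) / (z - z0) ^+ 2).
    apply: (hd_eq d0 _ H) => h; rewrite lt_min => /andP[h1 h2]; rewrite qE//.
      by rewrite (le_lt_trans (cabsD _ _))// addrC -ltrBrDr.
    apply/eqP => E; move: h2; have -> : z - z0 = - h by rewrite -E; ring.
    by rewrite cabsN ltxx.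
  by move: H; congr (hd _ _ _); field.
have Hk := hd_k z1.
have HG := hdB (hdD (hdM Hd Hk) (hdM (hd_cst z0 z) HQ)) (hdM (hd_cst c z) Hk).
have /hdP[_ E1] := Hd; have /hdP[_ E2] := HG.
have -> : 'D_1 g z = (d * k z + S z * (cconj z0 * k z ^+ 2) + (0 * q z + z0 * ((d * (z - z0) - (S z - S z0)) / (z - z0) ^+ 2)) -
  (0 * k z + c * (cconj z0 * k z ^+ 2))) by exact: E2.
rewrite E1.
have kD : cabs (k z) <= D.
  rewrite /k cabsV /D -[2 / _]invf_div lef_pV2 ?posrE ?cabs_gt0 ?k_neq0 ?divr_gt0 ?subr_gt0//.
  have := cabs_triB 1 (cconj z0 * z); rewrite cabs1 cabsM cabs_conj.
  by have h1 := cabs_ge0 z; have h2 := cabs_ge0 z0; have h3 := z01; move: z1; nra.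
have qD : cabs (z - z0)^-1 <= D.
  rewrite cabsV /D -[2 / _]invf_div lef_pV2 ?posrE ?cabs_gt0 ?divr_gt0 ?subr_gt0//.
  by have h := cabs_triB z z0; have h3 := z01; move: zr; rewrite /r; lra.
have k2 : cabs (k z ^+ 2) <= D ^+ 2 by rewrite cabsX lerXn2r ?nnegrE ?cabs_ge0 ?(ltW D0).
have q2 : cabs ((z - z0)^-1 ^+ 2) <= D ^+ 2 by rewrite cabsX lerXn2r ?nnegrE ?cabs_ge0 ?(ltW D0).
have D2 : 0 <= D ^+ 2 by rewrite sqr_ge0.
have zl : cabs (cconj z0) <= 1 by rewrite cabs_conj ltW.
have dS : cabs (S z - S z0) <= 2 by rewrite (le_trans (cabsB _ _))// -[2]/(1 + 1) lerD// S1.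
have b1 : cabs (d * k z) <= D * cabs d by rewrite cabsM mulrC ler_wpM2r ?cabs_ge0.
have b2 : cabs (S z * (cconj z0 * k z ^+ 2)) <= D ^+ 2.
  rewrite cabsM -[leRHS]mul1r ler_pM ?cabs_ge0 ?S1// cabsM -[leRHS]mul1r.
  by rewrite ler_pM ?cabs_ge0.
have b3 : cabs (z0 * ((d * (z - z0) - (S z - S z0)) / (z - z0) ^+ 2)) <= D * cabs d + 2 * D ^+ 2.
  have -> : z0 * ((d * (z - z0) - (S z - S z0)) / (z - z0) ^+ 2) =
     z0 * (d * (z - z0)^-1) - z0 * ((S z - S z0) * (z - z0)^-1 ^+ 2) by field.
  rewrite (le_trans (cabsB _ _))// lerD//.
    rewrite cabsM -[leRHS]mul1r ler_pM ?cabs_ge0 ?(ltW z01)// cabsM.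
    by rewrite mulrC ler_wpM2r ?cabs_ge0.
  rewrite cabsM -[leRHS]mul1r ler_pM ?cabs_ge0 ?(ltW z01)// cabsM.
  by rewrite ler_pM ?cabs_ge0.
have b4 : cabs (c * (cconj z0 * k z ^+ 2)) <= cabs c * D ^+ 2.
  rewrite cabsM ler_wpM2l ?cabs_ge0// cabsM -[leRHS]mul1r.
  by rewrite ler_pM ?cabs_ge0.
rewrite !mul0r !add0r (le_trans (cabsB _ _))//.
apply: (le_trans (lerD (le_trans (cabsD _ _) (lerD (le_trans (cabsD _ _) (lerD b1 b2)) b3)) b4)).
lra.
Qed.

(** For r = 1 this is the Poisson kernel of z0. For r < 1 it is the factor of F conj(S) that comes
    out when F is paired with the test function on the circle of radius r. *)
Let B r t : C := circ t / (circ t - (r%:C : C) * z0) + cconj z0 / cconj ((r%:C : C) * circ t - z0).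

Let cabs_rz0 r : 0 <= r <= 1 -> cabs ((r%:C : C) * z0) < 1.
Proof. by move=> /andP[r0 r1]; rewrite cabsM cabs_real ger0_norm// (le_lt_trans _ z01)// ler_piMl ?cabs_ge0. Qed.

Let n1 r t : 0 <= r <= 1 -> circ t - (r%:C : C) * z0 != 0.
Proof. by move=> rI; have := circ_sub_neq0 t (cabs_rz0 rI); rewrite mul1r. Qed.

Let n2 r t : cabs z0 < r -> cconj ((r%:C : C) * circ t - z0) != 0.
Proof. by move=> zr; rewrite -cabs_eq0 cabs_conj cabs_eq0 circ_sub_neq0. Qed.

Let cb1 r : 0 <= r <= 1 -> cbm (T := mR) U (fun t => circ t / (circ t - (r%:C : C) * z0)).
Proof.
move=> rI; apply: pcont_cbm1 => t; apply: (@pcontM _ (@circ R) (fun t => (circ t - (r%:C : C) * z0)^-1)).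
  exact: pcont_circ.
apply: (@pcontV _ (fun t => circ t - (r%:C : C) * z0)); first exact: n1.
by apply: (@pcontB _ (@circ R) (fun=> (r%:C : C) * z0)); [exact: pcont_circ|exact: pcont_cst].
Qed.

Let cb2 r : cabs z0 < r -> cbm (T := mR) U (fun t => cconj z0 / cconj ((r%:C : C) * circ t - z0)).
Proof.
move=> zr; have := cbm_conj (cbmZ z0 (cbm_circ_subV zr)); apply: eq_cbm => t.
by rewrite cconjM cconjV.
Qed.

Let cbB r : cabs z0 < r <= 1 -> cbm (T := mR) U (B r).
Proof.
move=> /andP[zr r1]; apply: cbmD; [apply: cb1|exact: cb2].
by rewrite r1 (le_trans (cabs_ge0 z0))// ltW.
Qed.

(** The kernel is re/(re - r^2 z0) with e = circ t, so this is Cauchy's formula at the point r^2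
    z0. *)
Let mean1 (F : C -> C) r : hol 1 F -> cabs z0 < r < 1 ->
  cint lam U (fun t => F ((r%:C : C) * circ t) * (circ t / (circ t - (r%:C : C) * z0))) =
  F (((r ^+ 2)%:C : C) * z0).
Proof.
move=> hF /andP[zr r1]; have r0 : 0 < r by exact: le_lt_trans (cabs_ge0 z0) zr.
have rC : (r%:C : C) != 0 by rewrite -cabs_eq0 cabs_real normr_eq0 gt_eqF.
have rI : 0 <= r <= 1 by rewrite !ltW.
have az : cabs (((r ^+ 2)%:C : C) * z0) < r.
  rewrite cabsM cabs_real ger0_norm ?sqr_ge0// expr2 -mulrA -[X in _ < X]mulr1 ltr_pM2l//.
  by have := cabs_ge0 z0; nra.
rewrite (cauchy_formula hF r1 az); apply: eq_cint => t _; rewrite expr1 -mulrA; congr (_ * _).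
have -> : ((r ^+ 2)%:C : C) = (r%:C : C) * r%:C by rewrite -rmorphM expr2.
have N : (r%:C : C) * circ t - (r%:C : C) * r%:C * z0 = (r%:C : C) * (circ t - (r%:C : C) * z0) by ring.
by rewrite N; field; rewrite rC n1.
Qed.

(** On |w| = r the conjugated factor equals conj(z0) w/(r^2 - conj(z0) w), which is holomorphic past
    the circle and vanishes at 0. *)
Let mean2 (F : C -> C) r : hol 1 F -> cabs z0 < r < 1 ->
  cint lam U (fun t => F ((r%:C : C) * circ t) * (cconj z0 / cconj ((r%:C : C) * circ t - z0))) = 0.
Proof.
move=> hF /andP[zr r1]; have r0 : 0 < r by exact: le_lt_trans (cabs_ge0 z0) zr.
have rC : (r%:C : C) != 0 by rewrite -cabs_eq0 cabs_real normr_eq0 gt_eqF.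
pose G (w : C) : C := F w * (cconj z0 * w / ((r%:C : C) * r%:C - cconj z0 * w)).
pose R1 := Num.min 1 (2 * r ^+ 2 / (r + cabs z0)).
have ra : 0 < r + cabs z0 by rewrite ltr_wpDr ?cabs_ge0.
have rR1 : r < R1 by rewrite lt_min r1 ltr_pdivlMr// expr2; nra.
have Gd (w : C) : cabs w < R1 -> (r%:C : C) * r%:C - cconj z0 * w != 0.
  rewrite lt_min => /andP[_ wR]; rewrite subr_eq0; apply/eqP => /(congr1 (@cabs R)).
  rewrite !cabsM cabs_conj cabs_real gtr0_norm// => E.
  have := cabs_ge0 z0; have := cabs_ge0 w; move: wR; rewrite ltr_pdivlMr// expr2; nra.
have hG : hol R1 G.
  apply: holM; first by apply: hol_sub hF; rewrite ge_min lexx.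
  move=> w wR; pose rr : C := (r%:C : C) * r%:C.
  have HN := hdM (hd_cst (cconj z0) w) (hd_id w).
  have H := @hd_div R _ (fun x => rr - cconj z0 * x) w _ _ (Gd _ wR) HN (hdB (hd_cst rr w) HN).
  by eexists; exact: H.
have rI : 0 <= r < R1 by rewrite ltW.
have := hol_cmean hG rI; rewrite {2}/G mulr0 mul0r mulr0 => <-.
apply: eq_cint => t _; rewrite /G; congr (_ * _).
have E : (r%:C : C) * r%:C - cconj z0 * ((r%:C : C) * circ t) =
   ((r%:C : C) * circ t) * cconj ((r%:C : C) * circ t - z0).
  rewrite cconjB cconjM cconj_real mulrBr.
  have -> : (r%:C : C) * circ t * ((r%:C : C) * cconj (circ t)) = (r%:C : C) * r%:C * (circ t * cconj (circ t)) by ring.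
  by rewrite circ_mul_conj mulr1; ring.
by rewrite E; field; rewrite rC circ_neq0 n2.
Qed.

Let BE r t : cabs z0 < r <= 1 ->
  B r t = ((r * (1 - cabs z0 ^+ 2))%:C : C) / ((circ t - (r%:C : C) * z0) * cconj ((r%:C : C) * circ t - z0)).
Proof.
move=> /andP[zr r1]; have rI : 0 <= r <= 1 by rewrite r1 (le_trans (cabs_ge0 z0))// ltW.
have a0 := n1 t rI; have b0 := n2 t zr.
have -> : ((r * (1 - cabs z0 ^+ 2))%:C : C) = (r%:C : C) * (circ t * cconj (circ t)) - (r%:C : C) * (z0 * cconj z0).
  by rewrite circ_mul_conj mul_cconj -mulrBr rmorphM rmorphB.
move: b0; rewrite /B cconjB cconjM cconj_real => b0.
by field; rewrite a0 b0.
Qed.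

(** By [BE], |B| is r(1 - s^2) times a product of two inverse distances. Bound the product by half
    the sum of squares and evaluate each by [poisson_integral]: the two quotients are at most 1 and,
    by the condition on r^2, at most 2. Hence 3/2. *)
Let Bint r : cabs z0 < r <= 1 -> (1 + cabs z0 ^+ 2) / 2 <= r ^+ 2 ->
  Rintegral lam U (fun t => cabs (B r t)) <= 3 / 2.
Proof.
move=> rI r2; have /andP[zr r1] := rI; set s := cabs z0 in zr r2 *.
have s0 : 0 <= s by exact: cabs_ge0.
have r0 : 0 < r by exact: le_lt_trans zr.
have rI' : 0 <= r <= 1 by rewrite (ltW r0).
have [i1] := poisson_integral (cabs_rz0 rI'); have [i2] := poisson_integral zr.
rewrite cabsM cabs_real (ger0_norm (ltW r0)) -/s expr1n exprMn.
set h1 := fun t => _; set h2 := fun t => _ => E1 E2.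
pose c := r * (1 - s ^+ 2) / 2.
have s1 : s ^+ 2 < 1 by rewrite expr_lt1.
have c0 : 0 <= c by rewrite /c divr_ge0// mulr_ge0 ?(ltW r0)// subr_ge0 ltW.
have i12 : lam.-integrable U (EFin \o (fun t => h2 t + h1 t)).
  by apply: eq_integrable (integrableD mU i1 i2) => // t _.
have ic : lam.-integrable U (EFin \o (fun t => c * (h2 t + h1 t))).
  by apply: eq_integrable (integrableZl mU c i12) => // t _.
have iB := @cbm_cabs _ _ mR lam U mU fU _ (cbB rI).
apply: (@le_trans _ _ (Rintegral lam U (fun t => c * (h2 t + h1 t)))).
  apply: le_Rintegral => // t _; rewrite (BE t rI) cabsf cabsM cabs_conj cabs_real ger0_norm; last first.
    by rewrite mulr_ge0 ?(ltW r0)// subr_ge0 ltW.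
  rewrite /c /h1 /h2 mul1r invfM.
  set x := (cabs (circ t - _))^-1; set y := (cabs (_ - z0))^-1.
  rewrite -!exprVn -/x -/y -/s.
  have : 0 <= (x - y) ^+ 2 by exact: sqr_ge0.
  have k0 : 0 <= r * (1 - s ^+ 2) by rewrite mulr_ge0 ?(ltW r0)// subr_ge0 ltW.
  rewrite !expr2 in k0 *; nra.
rewrite RintegralZl// RintegralD// E1 E2 /c.
have q1 : (1 - s ^+ 2) / (1 - r ^+ 2 * s ^+ 2) <= 1.
  have rs : r ^+ 2 * s ^+ 2 <= s ^+ 2 by rewrite ler_piMl ?sqr_ge0// expr_le1 // ltW.
  by rewrite ler_pdivrMr ?mul1r; lra.
have q2 : (1 - s ^+ 2) / (r ^+ 2 - s ^+ 2) <= 2 by rewrite ler_pdivrMr; lra.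
have -> : r * (1 - s ^+ 2) / 2 * ((1 - r ^+ 2 * s ^+ 2)^-1 + (r ^+ 2 - s ^+ 2)^-1) =
  r * (((1 - s ^+ 2) / (1 - r ^+ 2 * s ^+ 2) + (1 - s ^+ 2) / (r ^+ 2 - s ^+ 2)) / 2) by ring.
set X := _ / (1 - _) in q1 *; set Y := _ / (r ^+ 2 - _) in q2 *.
have X0 : 0 <= X.
  have rs : r ^+ 2 * s ^+ 2 <= s ^+ 2 by rewrite ler_piMl ?sqr_ge0// expr_le1 // ltW.
  by rewrite divr_ge0; lra.
have Y0 : 0 <= Y by rewrite divr_ge0; lra.
apply: (@le_trans _ _ (1 * ((X + Y) / 2))); last by lra.
by apply: ler_wpM2r => //; lra.
Qed.

Let Bsup r t : (1 + cabs z0) / 2 <= r <= 1 -> cabs (B r t) <= 3 / (1 - cabs z0).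
Proof.
move=> /andP[rz r1]; have s0 := cabs_ge0 z0; have s1 := z01.
have zr : cabs z0 < r by lra.
have d0 : 0 < 1 - cabs z0 by rewrite subr_gt0.
rewrite (le_trans (cabsD _ _))// !cabsf cabs_circ !cabs_conj mul1r.
have a1 : 1 - cabs z0 <= cabs (circ t - (r%:C : C) * z0).
  have := circ_sub_ge t ((r%:C : C) * z0) (ler01 : (0 : R) <= 1); rewrite mul1r => /(le_trans _); apply.
  by rewrite cabsM cabs_real ger0_norm; nra.
have a2 : (1 - cabs z0) / 2 <= cabs ((r%:C : C) * circ t - z0).
  by apply: (le_trans _ (circ_sub_ge t z0 _)); lra.
have b1 : (cabs (circ t - (r%:C : C) * z0))^-1 <= (1 - cabs z0)^-1.
  by rewrite lef_pV2 ?posrE// (lt_le_trans d0).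
have b2 : (cabs ((r%:C : C) * circ t - z0))^-1 <= 2 * (1 - cabs z0)^-1.
  have -> : 2 * (1 - cabs z0)^-1 = ((1 - cabs z0) / 2)^-1 by rewrite invf_div.
  by rewrite lef_pV2 ?posrE ?divr_gt0// (lt_le_trans _ a2)// divr_gt0.
have b3 : cabs z0 / cabs ((r%:C : C) * circ t - z0) <= 2 * (1 - cabs z0)^-1.
  by rewrite -[leRHS]mul1r ler_pM ?invr_ge0 ?cabs_ge0// ltW.
lra.
Qed.

(** On the circle of radius r the pairing with the test function is the intended functional, except
    that F is evaluated at r^2 z0 in place of z0. *)
Let npair_test g (F : C -> C) r : hol 1 F -> hol 1 g ->
  (forall z, cabs z < 1 -> z != z0 ->
    g z = S z * k z + z0 * ((S z - S z0) / (z - z0)) - (cconj (S z0))^-1 * k z) ->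
  cabs z0 < r < 1 ->
  npair F g r r = cint lam U (fun t => F ((r%:C : C) * circ t) * cconj (S ((r%:C : C) * circ t)) * B r t)
    - F (((r ^+ 2)%:C : C) * z0) / S z0.
Proof.
move=> hF hg gE rI; have /andP[zr r1] := rI.
have r0 : 0 < r by exact: le_lt_trans (cabs_ge0 z0) zr.
have rI' : 0 <= r <= 1 by rewrite !ltW.
have rI2 : 0 <= r < 1 by rewrite ltW.
have rI3 : cabs z0 < r <= 1 by rewrite zr ltW.
have cF := hol_circle hF rI2; have cS := hol_circle hS rI2.
pose A1 t := F ((r%:C : C) * circ t) * cconj (S ((r%:C : C) * circ t)) * B r t.
pose A2 t := F ((r%:C : C) * circ t) * (cconj z0 / cconj ((r%:C : C) * circ t - z0)).
pose A3 t := F ((r%:C : C) * circ t) * (circ t / (circ t - (r%:C : C) * z0)).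
have h1 : cbm (T := mR) U A1 by apply: cbmM; [apply: cbmM; [exact: cF|exact: cbm_conj cS]|exact: cbB].
have h2 : cbm (T := mR) U A2 by apply: cbmM; [exact: cF|exact: cb2].
have h3 : cbm (T := mR) U A3 by apply: cbmM; [exact: cF|exact: cb1].
have E : npair F g r r = cint lam U (fun t => (A1 t - cconj (S z0) * A2 t) - (S z0)^-1 * A3 t).
  apply: eq_cint => t _.
  have w1 : cabs ((r%:C : C) * circ t) < 1 by rewrite cabs_scale_circ// ltW.
  have wz : (r%:C : C) * circ t != z0 by have := circ_sub_neq0 t zr; rewrite subr_eq0.
  rewrite (gE _ w1 wz) /A1 /A2 /A3 /B.
  have ck : cconj (k ((r%:C : C) * circ t)) = circ t / (circ t - (r%:C : C) * z0).
    rewrite /k cconjV cconjB !cconjM cconjK !cconj_real cconj_circ.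
    have a0 := n1 t rI'; have c0 := circ_neq0 t.
    have -> : ((1 : R)%:C : C) - z0 * ((r%:C : C) * (circ t)^-1) = (circ t - (r%:C : C) * z0) / circ t by field.
    by rewrite invf_div.
  rewrite cconjB cconjD !cconjM cconjV cconjB ck cconjV cconjK.
  have b0 := n2 t zr; have a0 := n1 t rI'; have s0 := S0 z01.
  set X := cconj (S (_ * _)); set V := cconj (_ - z0) in b0 *; set W := circ t - _ in a0 *.
  by field; rewrite a0 b0 s0.
rewrite E cintB//; [|by apply: cbmB => //; apply: cbmZ|exact: cbmZ].
rewrite cintB//; last exact: cbmZ.
rewrite !cintZ// /A2 /A3 mean1// mean2// mulr0 subr0.
by rewrite [_^-1 * _]mulrC.
Qed.

Let cont_at (F : C -> C) e : hol 1 F -> 0 < e -> exists2 rho, rho < 1 & forall r, rho <= r < 1 -> 0 <= r ->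
  cabs (F (((r ^+ 2)%:C : C) * z0) - F z0) <= e.
Proof.
move=> hF e0; have [d /hd_ccont/(_ _ e0)[del d0 H]] := hF _ z01.
exists (1 - del / 4); first by rewrite ltrBlDr ltrDl divr_gt0.
move=> r /andP[r1 r2] r0.
have -> : ((r ^+ 2)%:C : C) * z0 = z0 + (((r ^+ 2 - 1)%:C : C) * z0) by rewrite rmorphB /=; ring.
apply: H; rewrite cabsM cabs_real.
have r21 : r ^+ 2 <= 1 by rewrite expr_le1// ltW.
rewrite ler0_norm ?subr_le0// opprB.
have q : 1 - r ^+ 2 <= del / 2 by rewrite expr2; nra.
have z00 := cabs_ge0 z0; have z1 := z01; have u0 : 0 <= 1 - r ^+ 2 by rewrite subr_ge0.
apply: (@le_lt_trans _ _ (del / 2)); last by lra.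
by apply: le_trans q; rewrite ler_piMr// ltW.
Qed.

(** The count: the neighbourhood and the limit of the pairing cost 1 each, pairing p S costs 1 + 1,
    so |npair u| <= 4. The Poisson-type integral of u conj(S) adds 3M/2, and moving from r^2 z0 back
    to z0 adds 1. *)
Lemma quotient_bound (u : C -> C) M : wstar_closure_polmul S u -> hol 1 u ->
  (forall w, cabs w < 1 -> cabs (u w) <= M) -> cabs (u z0 / S z0) <= 2 * M + 5.
Proof.
move=> [_ Hcl] hu uM; have [g [Wg gE]] := test_function.
have [/analytic_hol hg _] := Wg.
have M0 : 0 <= M by apply: le_trans (cabs_ge0 (u 0)) (uM _ _); rewrite cabs0.
(* One test function and eps = 1 are enough, since only a bound independent of z0 is wanted. *)
have [|p Hp] := Hcl [:: g] 1 _ ltr01; first by move=> h; rewrite inE => /eqP ->.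
have {}Hp := Hp g (mem_head _ _).
set f := (fun z : C => p.[z] * S z - u z) in Hp.
have hp : hol 1 (fun z : C => p.[z]) by move=> w _; exact: hd_poly.
have hpS : hol 1 (fun z => p.[z] * S z) by exact: holM.
have hf : hol 1 f by exact: holB.
have [N HN] := poly_bounded p.
have N0 : 0 <= N by apply: le_trans (cabs_ge0 _) (HN 0 _); rewrite cabs0.
have N1 : 0 < N + 1 by rewrite ltr_wpDl.
have fB w : cabs w < 1 -> cabs (f w) <= N + M.
  move=> hw; rewrite (le_trans (cabsB _ _))// lerD ?uM// cabsM -[N]mulr1.
  by rewrite ler_pM ?cabs_ge0 ?HN ?S1.
have sz := S0 z01; have sz0 : 0 < cabs (S z0) by rewrite cabs_gt0.
have [r1 r11 Hr1] := pairing_limit hf Wg fB ltr01.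
have d0 : 0 < 1 - cabs z0 by rewrite subr_gt0.
(* Sized against the bounds of |p| and |B|, so that replacing |S|^2 by 1 under the integral costs at
   most 1. The radius is therefore chosen after [p]. *)
have [|r2 r21 Hr2] := Sinner (e := (N + 1)^-1 * (3 / (1 - cabs z0))^-1).
  by rewrite mulr_gt0 ?invr_gt0// divr_gt0.
have [|r3 r31 Hr3] := cont_at hS (e := cabs (S z0) / (N + 1)); first by rewrite divr_gt0.
have [|r4 r41 Hr4] := cont_at hu (e := cabs (S z0)) => //.
pose s := cabs z0; have s0 : 0 <= s by exact: cabs_ge0.
(* Here r5^2 - (1 + s^2)/2 = (1 - s^2)^2/16 >= 0, as [Bint] requires; [r6] keeps r away from |z0| as
   [Bsup] requires. *)
pose r5 := (3 + s ^+ 2) / 4.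
pose r6 := (1 + s) / 2.
pose r := Num.max r1 (Num.max r2 (Num.max r3 (Num.max r4 (Num.max r5 r6)))).
have ss : s ^+ 2 < 1 by rewrite expr_lt1.
have rlt : r < 1 by rewrite /r !gt_max r11 r21 r31 r41 /r5 /r6; apply/andP; split; rewrite /s in ss *; lra.
have [k1 k2 k3 [k4 [k5 k6]]] : [/\ r1 <= r, r2 <= r, r3 <= r & r4 <= r /\ r5 <= r /\ r6 <= r].
  by rewrite /r; split; rewrite ?le_max ?lexx ?orbT//; split; rewrite ?le_max ?lexx ?orbT//; split; rewrite ?le_max ?lexx ?orbT.
have rge : 0 <= r by apply: le_trans k6; rewrite /r6; lra.
have zr : cabs z0 < r by apply: lt_le_trans k6; rewrite /r6 /s; lra.
have rI : cabs z0 < r < 1 by rewrite zr.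
have rI' : cabs z0 < r <= 1 by rewrite zr ltW.
have rI2 : 0 <= r < 1 by rewrite rge.
have r2s : (1 + cabs z0 ^+ 2) / 2 <= r ^+ 2.
  have r5r : r5 ^+ 2 <= r ^+ 2 by rewrite lerXn2r ?nnegrE// /r5 divr_ge0// addr_ge0// sqr_ge0.
  apply: le_trans r5r; rewrite /r5 -/s [X in _ <= X]expr2; have := sqr_ge0 (s ^+ 2 - 1); rewrite [(_ - 1) ^+ 2]expr2; lra.
have Bi := Bint rI' r2s.
have iB := @cbm_cabs _ _ mR lam U mU fU _ (cbB rI').
have cS := hol_circle hS rI2; have cp := hol_circle hp rI2; have cu := hol_circle hu rI2.
have w1 t : cabs ((r%:C : C) * circ t) < 1 by rewrite cabs_scale_circ.
have rz1 : cabs (((r ^+ 2)%:C : C) * z0) < 1.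
  rewrite cabsM cabs_real ger0_norm ?sqr_ge0// (le_lt_trans _ z01)// ler_piMl ?cabs_ge0//.
  by rewrite expr_le1// ltW.
have n_f : cabs (npair f g r r) <= 2.
  have := Hr1 r; rewrite k1 rlt => /(_ isT) K.
  rewrite -(subrK (bpair f g) (npair f g r r)) (le_trans (cabsD _ _))//.
  by rewrite -[2]/(1 + 1) lerD// ltW.
have EpS := npair_test hpS hg gE rI.
have Eu := npair_test hu hg gE rI.
have Efg : npair f g r r = npair (fun z => p.[z] * S z) g r r - npair u g r r.
  rewrite /npair -cintB//; [|exact: (cbm_npair hpS hg rI2 rI2)|exact: (cbm_npair hu hg rI2 rI2)].
  by apply: eq_cint => t _; rewrite mulrBl.
pose X t := p.[(r%:C : C) * circ t] * ((1 - cabs (S ((r%:C : C) * circ t)) ^+ 2)%:C : C) * B r t.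
have mean_p : cint lam U (fun t => p.[(r%:C : C) * circ t] * B r t) = p.[((r ^+ 2)%:C : C) * z0].
  rewrite -[RHS]addr0 -(mean1 hp rI) -[X in _ + X](mean2 hp rI) -cintD//.
  - by apply: eq_cint => t _; rewrite /B mulrDr.
  - by apply: cbmM; [exact: cp|apply: cb1; rewrite rge ltW].
  - by apply: cbmM; [exact: cp|exact: cb2].
pose Y t := p.[(r%:C : C) * circ t] * S ((r%:C : C) * circ t) * cconj (S ((r%:C : C) * circ t)) * B r t.
have hY : cbm (T := mR) U Y.
  by apply: cbmM; [apply: cbmM; [apply: cbmM; [exact: cp|exact: cS]|exact: cbm_conj cS]|exact: cbB].
have hpB : cbm (T := mR) U (fun t => p.[(r%:C : C) * circ t] * B r t) by apply: cbmM; [exact: cp|exact: cbB].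
have XE t : X t = p.[(r%:C : C) * circ t] * B r t - Y t.
  by rewrite /X /Y rmorphB /= -mul_cconj; ring.
have hX : cbm (T := mR) U X by apply: (eq_cbm XE); exact: cbmB.
(* Up to the integral of the defect [X], the functional sends p S to p(r^2 z0)(S(z0) - S(r^2
   z0))/S(z0), which is small by continuity of S. *)
have n_pS : cabs (npair (fun z => p.[z] * S z) g r r) <= 2.
  have -> : npair (fun z => p.[z] * S z) g r r =
      p.[((r ^+ 2)%:C : C) * z0] * ((S z0 - S (((r ^+ 2)%:C : C) * z0)) / S z0) - cint lam U X.
    rewrite EpS -/Y; have -> : cint lam U X = p.[((r ^+ 2)%:C : C) * z0] - cint lam U Y.
      by rewrite -mean_p -cintB//; apply: eq_cint => t _; exact: XE.
    by field.
  rewrite (le_trans (cabsB _ _))// -[2]/(1 + 1) lerD//.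
    rewrite cabsM cabsf cabs_distC.
    have K := Hr3 r _ rge; rewrite k3 rlt in K; have {}K := K isT.
    apply: (@le_trans _ _ ((N + 1) * (N + 1)^-1)); last by rewrite divff// gt_eqF.
    apply: ler_pM; [exact: cabs_ge0|exact: (divr_ge0 (cabs_ge0 _) (cabs_ge0 _))| |].
      by rewrite (le_trans (HN _ rz1))// lerDl.
    by rewrite ler_pdivrMr// [leRHS]mulrC.
  have K := Hr2 r _ rge; rewrite k2 rlt in K; have {}K := K isT.
  pose v t := 1 - cabs (S ((r%:C : C) * circ t)) ^+ 2.
  have v0 t : 0 <= v t by rewrite /v subr_ge0 expr_le1 ?cabs_ge0// S1.
  have iv : lam.-integrable U (EFin \o v).
    have hv : cbm (T := mR) U (fun t => 1 - S ((r%:C : C) * circ t) * cconj (S ((r%:C : C) * circ t))).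
      by apply: cbmB; [exact: cbm_cst|apply: cbmM; [exact: cS|exact: cbm_conj cS]].
    apply: eq_integrable (@cbm_Re _ _ mR lam U mU fU _ hv) => // t _.
    by rewrite /= mul_cconj ReD ReN.
  pose c := N * (3 / (1 - cabs z0)).
  have c0 : 0 <= c by rewrite mulr_ge0// divr_ge0// ltW.
  apply: (@le_trans _ _ (Rintegral lam U (fun t => c * v t))).
    apply: le_cint => //.
      by apply: eq_integrable (integrableZl mU c iv) => // t _.
    move=> t _; rewrite /X /c !cabsM cabs_real (ger0_norm (v0 t)) mulrAC.
    rewrite ler_wpM2r// ler_pM ?cabs_ge0 ?HN//; apply: Bsup.
    by rewrite (ltW rlt) andbT; exact: k6.
  rewrite RintegralZl//; apply: (le_trans (ler_wpM2l c0 K)).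
  rewrite /c; have q : 0 < 3 / (1 - cabs z0) by rewrite divr_gt0.
  set Q := 3 / _ in q *.
  have -> : N * Q * ((N + 1)^-1 * Q^-1) = N / (N + 1) by field; rewrite !gt_eqF.
  by rewrite ler_pdivrMr// mul1r lerDl.
have n_u : cabs (npair u g r r) <= 4.
  have -> : npair u g r r = npair (fun z => p.[z] * S z) g r r - npair f g r r by rewrite Efg; ring.
  by rewrite (le_trans (cabsB _ _))// -[4]/(2 + 2)%:R natrD lerD.
have int_u : cabs (cint lam U (fun t => u ((r%:C : C) * circ t) * cconj (S ((r%:C : C) * circ t)) * B r t)) <= M * (3 / 2).
  apply: (@le_trans _ _ (Rintegral lam U (fun t => M * cabs (B r t)))).
    apply: le_cint => //.
    - by apply: cbmM; [apply: cbmM; [exact: cu|exact: cbm_conj cS]|exact: cbB].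
    - by apply: eq_integrable (integrableZl mU M iB) => // t _.
    move=> t _; rewrite cabsM ler_wpM2r ?cabs_ge0// cabsM cabs_conj -[M]mulr1.
    by rewrite ler_pM ?cabs_ge0 ?uM ?S1.
  by rewrite RintegralZl// ler_wpM2l.
have q1 : cabs (u (((r ^+ 2)%:C : C) * z0) / S z0) <= 4 + M * (3 / 2).
  have -> : u (((r ^+ 2)%:C : C) * z0) / S z0 =
    cint lam U (fun t => u ((r%:C : C) * circ t) * cconj (S ((r%:C : C) * circ t)) * B r t) - npair u g r r.
    by rewrite Eu; ring.
  by rewrite (le_trans (cabsB _ _))// addrC lerD.
have K4 := Hr4 r _ rge; rewrite k4 rlt in K4; have {}K4 := K4 isT.
have -> : u z0 / S z0 = u (((r ^+ 2)%:C : C) * z0) / S z0 - (u (((r ^+ 2)%:C : C) * z0) - u z0) / S z0 by field.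
rewrite (le_trans (cabsB _ _))//.
have q2 : cabs ((u (((r ^+ 2)%:C : C) * z0) - u z0) / S z0) <= 1 by rewrite cabsf ler_pdivrMr// mul1r.
lra.
Qed.

End OnePoint.

Lemma inner_permanence : permanence S.
Proof.
move=> u; split=> [[Hcl [/analytic_hol hu [M HM]]]|[h [Hh uE]]]; last first.
  exact: multiple_in_closure uE.
exists (fun z => u z / S z); split; last by move=> z z1; rewrite mulrC divfK// S0.
split; last first.
  by exists (2 * M + 5) => z z1; exact: quotient_bound Hcl hu HM.
apply/analytic_hol => w w1; have [a Ha] := hu w w1; have [b Hb] := hS w1.
by eexists; exact: (hd_div (S0 w1) Ha Hb).
Qed.

End Permanence.

(** * The measure on the gaps *)

Section Gaps.
Variable R : realType.
Local Notation C := (CC R).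
Local Notation U := (@unit_interval R).

Let p2 n : 0 < (2 : R) ^+ n. Proof. exact: exprn_gt0. Qed.

Lemma dyadic_uniq n i j (t : R) : dyadic n i t -> dyadic n j t -> i = j.
Proof.
move=> /andP[]; rewrite ler_pdivrMr// ltr_pdivlMr// => a b /andP[]; rewrite ler_pdivrMr// ltr_pdivlMr// => c d.
have h1 : (i < j.+1)%N by rewrite -(ltr_nat R) (le_lt_trans a).
have h2 : (j < i.+1)%N by rewrite -(ltr_nat R) (le_lt_trans c).
by apply/eqP; rewrite eqn_leq; apply/andP; split; rewrite -ltnS.
Qed.

Lemma dyadic_half n j : @dyadic R n.+1 j `<=` dyadic n j./2.
Proof.
move=> t /andP[]; rewrite (ler_pdivrMr _ _ (p2 n.+1)) (ltr_pdivlMr _ _ (p2 n.+1)) exprS mulrCA => a b.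
have lo : (j./2)%:R * 2 <= (j%:R : R).
  by rewrite -natrM ler_nat muln2 -geq_half_double.
have hi : j.+1%:R <= ((j./2).+1%:R * 2 : R).
  by rewrite -natrM ler_nat muln2 -ltn_half_double.
by apply/andP; rewrite (ler_pdivrMr _ _ (p2 n)) (ltr_pdivlMr _ _ (p2 n)); split; lra.
Qed.

Lemma dyadic_nested m d i j (t : R) : dyadic (m + d) i t -> dyadic m j t -> @dyadic R (m + d) i `<=` dyadic m j.
Proof.
move=> hi hj s; suff H : forall k, exists l, @dyadic R (m + d) i `<=` dyadic (m + d - k) l.
  have [l hl] := H d; rewrite addnK in hl.
  by rewrite (dyadic_uniq hj (hl _ hi)); exact: hl.
elim=> [|k [l hl]]; first by exists i; rewrite subn0.
have [dk|dk] := leqP (m + d) k.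
  exists l; have -> : (m + d - k.+1 = m + d - k)%N by apply/eqP; rewrite (eqP dk) subn_eq0 ltnW.
  exact: hl.
exists l./2 => u /hl; have -> : (m + d - k = (m + d - k.+1).+1)%N by rewrite -subSn// subSS.
exact: dyadic_half.
Qed.

Lemma dyadic_sub m n i j (t : R) : (m <= n)%N -> dyadic n i t -> dyadic m j t -> @dyadic R n i `<=` dyadic m j.
Proof. by move=> /subnKC <-; exact: dyadic_nested. Qed.

Lemma dyadic_mem n (t : R) : U t -> exists2 j, (j < 2 ^ n)%N & dyadic n j t.
Proof.
move=> /andP[t0 t1]; have x0 : 0 <= t * 2 ^+ n by rewrite mulr_ge0// ltW.
have /andP[a b] := Num.Theory.truncn_itv x0.
exists (Num.truncn (t * 2 ^+ n)); last by rewrite /dyadic /= ler_pdivrMr// ltr_pdivlMr// a.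
by rewrite -(ltr_nat R) natrX (le_lt_trans a)// gtr_pMl.
Qed.

Lemma dyadic_diam n j (s t : R) : dyadic n j s -> j%:R / 2 ^+ n <= t <= j.+1%:R / 2 ^+ n -> `|s - t| <= (2 ^+ n)^-1.
Proof.
move=> /andP[a b] /andP[c d]; move: b d; rewrite -natr1 mulrDl mul1r => b d.
by rewrite ler_norml; apply/andP; split; lra.
Qed.

Lemma dyadic_sub_unit n j : (j < 2 ^ n)%N -> @dyadic R n j `<=` U.
Proof.
move=> jn t /andP[a b]; rewrite /unit_interval /= (le_trans _ a) ?divr_ge0 ?(ltW (p2 n))//=.
by rewrite (lt_le_trans b)// ler_pdivrMr// mul1r -natrX ler_nat.
Qed.

Variable E : set C.
Hypotheses (Ecl : closed E) (Esub : E `<=` @circle R) (E0 : E !=set0).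

Let meets n j := exists2 t, dyadic n j t & E (circ t).
Let gap n j := [/\ (0 < n)%N, (j < 2 ^ n)%N, ~ meets n j & meets n.-1 j./2].

Lemma closed_circ_avoid t : ~ E (circ t) -> exists2 d : R, 0 < d & forall z, cabs (z - circ t) < d -> ~ E z.
Proof.
move=> Et; have := closed_openC Ecl; rewrite openE => /(_ _ Et) /nbhsC[d d0 H].
exists d => // z hz Ez; apply: (H (z - circ t) hz).
by have -> : circ t + (z - circ t) = z by ring.
Qed.

Lemma closed_circ_avoid_curve t : ~ E (circ t) -> exists2 d : R, 0 < d & forall s, `|s - t| < d -> ~ E (circ s).
Proof.
move=> /closed_circ_avoid[d d0 H]; have d2 : 0 < d / 2 by rewrite divr_gt0.
have [e e0 He] := pcont_circ t d2; exists e => // s st; apply: H.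
have := He (s - t) st; have -> : t + (s - t) = s by ring.
by move/le_lt_trans; apply; rewrite ltr_pdivrMr// ltr_pMr// ltr1n.
Qed.

Lemma exists_param : exists2 t, U t & E (circ t).
Proof.
have [z Ez] := E0; have [t Ut zE] := polar_form z; exists t => //.
by move: zE; have -> : cabs z = 1 := Esub Ez; rewrite mul1r => <-.
Qed.

(** As E is closed, small dyadic intervals around t avoid it. The first level at which this happens
    gives a gap; it is positive, because the interval of level 0 contains a parameter of a point of
    E. *)
Lemma gap_cover t : U t -> ~ E (circ t) -> exists n j, gap n j /\ dyadic n j t.
Proof.
move=> Ut Et; have ex : exists n, `[< exists2 j, dyadic n j t & ~ meets n j >].
  have [d d0 H] := closed_circ_avoid_curve Et.
  have [n nd] : exists n, (2 ^+ n)^-1 < d.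
    exists (Num.truncn d^-1); rewrite invf_plt ?posrE//; apply: (lt_le_trans (Num.Theory.truncnS_gt _)).
    by rewrite -natrX ler_nat ltn_expl.
  have [j jn jt] := dyadic_mem n Ut; exists n; apply/asboolP; exists j => // -[s js].
  apply: H; apply: le_lt_trans nd; apply: dyadic_diam js _.
  by case/andP: jt => -> /ltW ->.
case: (ex_minnP ex) => n /asboolP[j jt jm] nmin.
have n0 : (0 < n)%N.
  case: n jt jm {nmin} => // jt; case; have [s Us Es] := exists_param; exists s => //.
  have [i i1 it] := dyadic_mem 0 Ut; rewrite (dyadic_uniq jt it).
  by move: i1; rewrite expn0 ltnS leqn0 => /eqP ->; rewrite /dyadic /= expr0 mul0r divr1.
have jn : (j < 2 ^ n)%N by have [i i1 it] := dyadic_mem n Ut; rewrite (dyadic_uniq jt it).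
exists n, j; split; last exact: jt.
split; [exact: n0|exact: jn|exact: jm|].
apply: contrapT => h; suff : (n <= n.-1)%N by rewrite leqNgt ltn_predL n0.
by apply: nmin; apply/asboolP; exists j./2 => //; apply: dyadic_half; rewrite prednK.
Qed.

(** Were the level m at least n, the interval would lie inside the gap and could not meet E; so m <
    n and nesting applies to the parent. *)
Lemma gap_maximal n j m i (t : R) : gap n j -> dyadic n j t -> dyadic m i t -> meets m i -> dyadic n.-1 j./2 `<=` @dyadic R m i.
Proof.
move=> [n0 jn jm mm] jt it mi.
have mn : (m < n)%N.
  rewrite ltnNge; apply/negP => nm; apply: jm; have [s si Es] := mi; exists s => //.
  by apply: (dyadic_sub nm it jt).
apply: (@dyadic_sub m n.-1 _ _ t) => //; first by rewrite -ltnS prednK.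
by apply: dyadic_half; rewrite prednK.
Qed.

(** If two gaps of different levels share a point, the parent of the finer one lies inside the
    coarser one, yet meets E. *)
Lemma gap_uniq n j m i (t : R) : gap n j -> gap m i -> dyadic n j t -> dyadic m i t -> n = m /\ j = i.
Proof.
wlog nm : n j m i / (n <= m)%N.
  move=> H gn gm hn hm; have [nm|mn] := leqP n m; first exact: H.
  by have [-> ->] := H _ _ _ _ (ltnW mn) gm gn hm hn.
move=> gn gm hn hm.
move: nm; rewrite leq_eqVlt => /predU1P[nm|nm].
  by split => //; move: hm; rewrite -nm => hm; exact: dyadic_uniq hn hm.
have [n0 jn jm mm] := gn; have [m0 im im' [s ss Es]] := gm; case: jm.
exists s => //; apply: (@dyadic_sub n m.-1 _ _ t _ _ _ _ ss) => //; first by rewrite -ltnS prednK.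
by apply: dyadic_half; rewrite prednK.
Qed.

(** Besides the dyadic gaps of [E], the enumeration contains empty intervals ([k N = 0]). *)
Lemma gap_decomposition : exists a k x : nat -> R,
  [/\ (forall N, 0 <= k N) /\ (forall N, U (x N) /\ E (circ (x N))),
   forall N t, a N <= t <= a N + k N -> `|x N - t| <= 2 * k N,
   trivIset setT (fun N => `[a N, a N + k N[%classic) /\ forall N, `[a N, a N + k N[ `<=` U,
   forall t, U t -> ~ E (circ t) -> exists N, a N <= t < a N + k N &
   forall n j, (exists t, dyadic n j t /\ E (circ t)) ->
     forall N t, a N <= t < a N + k N -> dyadic n j t -> dyadic n j (x N)].
Proof.
have [t0 Ut0 Et0] := exists_param.
pose x0 n j := xget t0 [set t | dyadic n.-1 j./2 t /\ E (circ t)].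
(* An index that codes no gap gets the empty interval at [t0]. As [t0] is a parameter of a point of
   E, the conditions on [x] hold for it too. *)
pose F N (P : (nat * nat) -> R) := match pickle_inv N with
  | Some p => if `[< gap p.1 p.2 >] then P p else t0 | None => t0 end.
pose F0 N (P : (nat * nat) -> R) := match pickle_inv N with
  | Some p => if `[< gap p.1 p.2 >] then P p else 0 | None => 0 end.
pose a N := F N (fun p => p.2%:R / 2 ^+ p.1).
pose k N := F0 N (fun p => (2 ^+ p.1)^-1).
pose x N := F N (fun p => x0 p.1 p.2).
have cases N : (exists n j, [/\ pickle_inv N = Some (n, j), gap n j & [/\ a N = j%:R / 2 ^+ n, k N = (2 ^+ n)^-1 & x N = x0 n j]]) \/
   [/\ a N = t0, k N = 0 & x N = t0].
  rewrite /a /k /x /F /F0; case: (pickle_inv N) => [[n j]|]; last by right.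
  by case: asboolP => g; [left; exists n, j|right].
have x0P n j : gap n j -> dyadic n.-1 j./2 (x0 n j) /\ E (circ (x0 n j)).
  by move=> [_ _ _ [s s1 s2]]; rewrite /x0; exact: (@xgetPex _ t0 [set t | dyadic n.-1 j./2 t /\ E (circ t)] (ex_intro _ s (conj s1 s2))).
have mem N t : a N <= t < a N + k N -> exists n j, [/\ pickle_inv N = Some (n, j), gap n j, dyadic n j t & x N = x0 n j].
  case: (cases N) => [[n [j [e g [-> -> ->]]]]|[-> -> _]]; last by rewrite addr0 => /andP[h1 h2]; have := le_lt_trans h1 h2; rewrite ltxx.
  by move=> h; exists n, j; split => //; rewrite /dyadic /= -[j.+1%:R]natr1 mulrDl mul1r.
have gU n j : gap n j -> @dyadic R n.-1 j./2 `<=` U.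
  move=> [n0 jn _ _]; apply: dyadic_sub_unit; move: jn; case: n n0 => // n _ /=.
  by rewrite expnS mul2n -ltn_half_double.
exists a, k, x; split.
- split=> N; first by case: (cases N) => [[n [j [e g [_ -> _]]]]|[_ -> _]]//; rewrite invr_ge0 ltW.
  case: (cases N) => [[n [j [e g [_ _ ->]]]]|[_ _ ->]]//.
  by have [h1 h2] := x0P _ _ g; split => //; exact: gU h1.
- move=> N t; case: (cases N) => [[n [j [e g [-> -> ->]]]]|[-> -> ->]]; last first.
    by rewrite addr0 -eq_le => /eqP <-; rewrite subrr normr0 mulr0.
  have [h1 _] := x0P _ _ g; have [n0 _ _ _] := g; move=> /andP[t1 t2].
  (* The chosen point lies in the parent, whose length is twice that of the gap; this is the factor
     2. *)
  have -> : 2 * (2 ^+ n)^-1 = (2 ^+ n.-1)^-1 :> R by case: n n0 {e g h1 t1 t2} => // n _; rewrite exprS invfM mulrA divff// mul1r.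
  apply: dyadic_diam h1 _.
  have n1 : dyadic n j (j%:R / 2 ^+ n : R) by rewrite /dyadic /= lexx ltr_pdivrMr// divfK ?gt_eqF// ltr_nat ltnSn.
  move: n1; rewrite -{1}(prednK n0) => /dyadic_half /andP[c1 c2].
  rewrite (le_trans c1 t1)/= (le_trans t2)//.
  move: c2; case: n n0 {e g t1 t2 c1} => // n _ /=; rewrite exprS invfM mulrA => c2.
  have -> : j%:R / 2 / 2 ^+ n + 2^-1 / 2 ^+ n = (j.+1)%:R / 2 / 2 ^+ n :> R by rewrite -[j.+1%:R]natr1; ring.
  rewrite ler_pM2r ?invr_gt0// ler_pdivrMr// -natrM ler_nat.
  by rewrite muln2 -ltn_half_double.
- split; last by move=> N t; rewrite /= in_itv /= => /mem[n [j [_ [_ jn _ _] h _]]]; exact: dyadic_sub_unit jn _ h.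
  apply/trivIsetP => N M _ _ NM; apply/seteqP; split => // t [] /=; rewrite !in_itv /=.
  move=> /mem[n [j [e1 g1 h1 _]]] /mem[m [i [e2 g2 h2 _]]].
  have [E1 E2] := gap_uniq g1 g2 h1 h2; move: NM.
  have := @pickle_invK (nat * nat)%type N; have := @pickle_invK (nat * nat)%type M.
  by rewrite e1 e2 /= E1 E2 => <- <-; rewrite eqxx.
- move=> t Ut Et; have [n [j [g h]]] := gap_cover Ut Et; exists (pickle (n, j)).
  rewrite /a /k /F /F0 pickleK_inv /= asboolT//.
  by move: h; rewrite /dyadic /= -[j.+1%:R]natr1 mulrDl mul1r.
- move=> n j [s [s1 s2]] N t /mem[m [i [_ g h ->]]] jt.
  have [h1 _] := x0P _ _ g.
  by apply: (gap_maximal g h jt) h1; exists s.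
Qed.

End Gaps.

(** * Transport of Lebesgue measure to E *)

Section PushedMeasure.
Variable R : realType.
Local Notation mR := (measurableTypeR R).
Local Notation lam := (@lebesgue_measure R).
Local Notation U := (@unit_interval R).

Let mU : measurable (U : set mR). Proof. exact: measurable_unit. Qed.
Let fU : (lam U < +oo)%E. Proof. exact: lamU_fin. Qed.

(** The identity outside [U] serves to make the preimage of [U] equal to [U], which [pushed_measure]
    asks for; the value [t0] covers the points of [U] in no gap. *)
Lemma piecewise_constant_map (a k x : nat -> R) (t0 : R) :
  trivIset setT (fun N => `[a N, a N + k N[%classic) ->
  exists2 T : mR -> mR, measurable_fun setT T &
    [/\ forall N t, a N <= t < a N + k N -> T t = x N,
     forall t, U t -> (forall N, ~ (a N <= t < a N + k N)) -> T t = t0 &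
     forall t, ~ U t -> (forall N, ~ (a N <= t < a N + k N)) -> T t = t].
Proof.
move=> tK; pose K N : set mR := `[a N, a N + k N[%classic.
pose T (t : mR) : mR := match pselect (exists N, a N <= t < a N + k N) with
  | left h => x (projT1 (cid h)) | right _ => if `[< U t >] then t0 else t end.
have T1 N t : a N <= t < a N + k N -> T t = x N.
  move=> h; rewrite /T; case: pselect => [e|]; last by case; exists N.
  case: (cid e) => M /= hM; congr x; apply: contrapT => /eqP MN.
  have /trivIsetP /(_ M N I I MN) KK := tK.
  have : (K M `&` K N) t by split; rewrite /K /= in_itv.
  by rewrite KK.
have T2 t : U t -> (forall N, ~ (a N <= t < a N + k N)) -> T t = t0.
  by move=> Ut h; rewrite /T; case: pselect => [[N hN]|_]; [have := h N|rewrite asboolT].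
have T3 t : ~ U t -> (forall N, ~ (a N <= t < a N + k N)) -> T t = t.
  by move=> Ut h; rewrite /T; case: pselect => [[N hN]|_]; [have := h N|rewrite asboolF].
exists T => // _ B mB; rewrite setTI.
have mK : measurable (\bigcup_N K N) by apply: bigcup_measurable => N _; exact: measurable_itv.
have cst (P : Prop) : measurable ([set _ | P] : set mR).
  by have [p|p] := pselect P; [rewrite (_ : [set _ | P] = setT)|rewrite (_ : [set _ | P] = set0)] => //; apply/seteqP; split.
have -> : T @^-1` B = (\bigcup_N (K N `&` [set _ | B (x N)])) `|`
   ((~` \bigcup_N K N) `&` ((U `&` [set _ | B t0]) `|` (~` U `&` B))).
  apply/seteqP; split => t /=.
    have [[N hN]|h] := pselect (exists N, a N <= t < a N + k N).
      by rewrite (T1 N)// => Bx; left; exists N => //; split => //; rewrite /K /= in_itv.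
    have h' N : ~ (a N <= t < a N + k N) by move=> hN; apply: h; exists N.
    have nK : ~ (\bigcup_N K N) t by move=> [N _]; rewrite /K /= in_itv; exact: h'.
    by have [Ut|Ut] := pselect (U t); [rewrite T2// => Bt; right; split => //; left|rewrite T3// => Bt; right; split => //; right].
  move=> [[N _ [hN Bx]]|[nK]]; first by rewrite (T1 N)//; move: hN; rewrite /K /= in_itv.
  have h' N : ~ (a N <= t < a N + k N) by move=> hN; apply: nK; exists N => //; rewrite /K /= in_itv.
  by move=> [[Ut Bt]|[Ut Bt]]; [rewrite (T2 _ Ut h')|rewrite (T3 _ Ut h')].
apply: measurableU.
  by apply: bigcup_measurable => N _; apply: measurableI; [exact: measurable_itv|exact: cst].
apply: measurableI; first exact: measurableC.
by apply: measurableU; apply: measurableI => //; exact: measurableC.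
Qed.

Lemma pushed_measure (T : mR -> mR) : measurable_fun setT T -> T @^-1` U = U ->
  exists mu : {measure set R -> \bar R},
    (forall A, mu A = lam (T @^-1` A `&` U)) /\
    forall (f : mR -> R) M, measurable_fun setT f -> (forall t, `|f t| <= M) ->
      Rintegral mu U f = Rintegral lam U (f \o T).
Proof.
move=> mT TU; have mT' : measurable_fun setT (T : mR -> R) := mT.
pose nu := mrestr lam mU.
pose mu : {measure set R -> \bar R} := pushforward nu (T : mR -> R).
exists (mu mT'); split => // f M mf fM; rewrite /Rintegral; congr fine.
have fnu : (nu setT < +oo)%E by rewrite /nu /mrestr setTI.
have ib : nu.-integrable (T @^-1` U) (EFin \o (f \o T)).
  rewrite TU; apply: (@bm_integrable R _ mR nu U mU _ (f \o T) M) => //.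
    by apply: le_lt_trans fnu; apply: le_measure; rewrite ?inE.
    by apply: measurable_funTS; exact: measurableT_comp.
  by move=> t _; exact: fM.
have mEf : measurable_fun setT (EFin \o f) by apply/measurable_EFinP.
transitivity (\int[nu]_(t in U) (f (T t))%:E)%E.
  by have := @integral_pushforward _ _ mR R R T mT' nu U (EFin \o f) mEf ib mU; rewrite TU.
apply: eq_measure_integral => A mA AU.
transitivity (lam (A `&` U)) => //; by rewrite (setIidl AU).
Qed.
End PushedMeasure.

Section GapMeasure.
Variable R : realType.
Local Notation C := (CC R).
Local Notation mR := (measurableTypeR R).
Local Notation lam := (@lebesgue_measure R).
Local Notation U := (@unit_interval R).

Let mU : measurable (U : set mR). Proof. exact: measurable_unit. Qed.

Lemma measurable_circ_preimage (E : set C) : closed E -> measurable (@circ R @^-1` E : set mR).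
Proof.
move=> Ecl; have op : open (@circ R @^-1` (~` E)).
  rewrite openE => t /= Et; have [d d0 H] := closed_circ_avoid_curve Ecl Et.
  by apply/nbhs_ballP; exists d => //= s; rewrite /ball /= distrC => /H.
rewrite -[X in measurable X]setCK; apply: measurableC.
exact: open_measurable op.
Qed.

Lemma lebesgue_dyadic n j : lam (@dyadic R n j) = (2 ^+ n)^-1%:E.
Proof.
have -> : @dyadic R n j = `[(j%:R / 2 ^+ n : R), j.+1%:R / 2 ^+ n[%classic.
  by apply/seteqP; split => t /=; rewrite in_itv.
rewrite lebesgue_measure_itv /= lte_fin ltr_pM2r ?invr_gt0 ?exprn_gt0// ltr_nat ltnSn.
by rewrite -EFinB -[j.+1%:R]natr1 mulrDl addrAC subrr add0r mul1r.
Qed.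

Lemma measurable_dyadic n j : measurable (@dyadic R n j : set mR).
Proof.
have -> : @dyadic R n j = `[(j%:R / 2 ^+ n : R), j.+1%:R / 2 ^+ n[%classic.
  by apply/seteqP; split => t /=; rewrite in_itv.
exact: measurable_itv.
Qed.

Variable E : set C.
Hypotheses (Ecl : closed E) (Esub : E `<=` @circle R) (E0 : E !=set0).
Hypothesis Enull : lam (U `&` @circ R @^-1` E) = 0%E.

Let A : set mR := U `&` @circ R @^-1` E.

(** The gaps and the map [T] are exported with the measure, since membership in W^1 is estimated gap
    by gap. *)
Lemma gap_measure : exists (mu : {measure set R -> \bar R}) (a k x : nat -> R) (T : mR -> mR),
  [/\ [/\ mu U = 1%E, mu (~` U) = 0%E, mu (~` A) = 0%E &
       forall n j : nat, (j < 2 ^ n)%N -> (exists t, @dyadic R n j t /\ E (@circ R t)) ->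
       ((2 ^+ n)^-1%:E <= mu (@dyadic R n j))%E],
   [/\ forall N, 0 <= k N,
       forall N t, a N <= t <= a N + k N -> `|x N - t| <= 2 * k N,
       trivIset setT (fun N => `[a N, a N + k N[%classic),
       forall N, `[a N, a N + k N[ `<=` U &
       forall t, U t -> ~ E (circ t) -> exists N, a N <= t < a N + k N],
   measurable_fun setT T,
   (forall N t, a N <= t < a N + k N -> T t = x N) /\ (forall t, U t -> E (circ (T t))) &
   forall (f : mR -> R) M, measurable_fun setT f -> (forall t, `|f t| <= M) ->
      Rintegral mu U f = Rintegral lam U (f \o T)].
Proof.
have [t0 Ut0 Et0] := exists_param Esub E0.
have [a [k [x [[k0 xE] xk [tK KU] cov dx]]]] := gap_decomposition Ecl Esub E0.
have [T mT [T1 T2 T3]] := piecewise_constant_map x t0 tK.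
have TA t : U t -> A (T t).
  move=> Ut; have [[N h]|h] := pselect (exists N, a N <= t < a N + k N).
    by rewrite (T1 N)//; have [h1 h2] := xE N.
  by rewrite T2// => N hN; apply: h; exists N.
have TU : T @^-1` U = U.
  apply/seteqP; split => t /=; last by move=> /TA[].
  apply: contraPP => Ut; rewrite T3// => N hN.
  by apply: Ut; apply: (KU N); rewrite /= in_itv.
have [mu [muE muI]] := pushed_measure mT TU.
exists mu, a, k, x, T; split => //; last first.
  by split => // t /TA[].
split.
- by rewrite muE TU setIid lamU.
- rewrite muE (_ : _ `&` _ = set0) ?measure0//; apply/seteqP; split => // t [] /= h Ut.
  by apply: h; have [] := TA t Ut.
- rewrite muE (_ : _ `&` _ = set0) ?measure0//; apply/seteqP; split => // t [] /= h Ut.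
  by apply: h; exact: TA.
- move=> n j jn H; rewrite -(lebesgue_dyadic n j).
  have mD := measurable_dyadic n j.
  have mA : measurable A by apply: measurableI => //; exact: measurable_circ_preimage.
  have mTD : measurable (T @^-1` @dyadic R n j `&` U).
    by apply: measurableI => //; rewrite -[X in measurable X]setTI; exact: mT.
  rewrite muE; apply: (@le_trans _ _ (lam ((T @^-1` @dyadic R n j `&` U) `|` A))); last first.
    apply: le_trans (measureU2 _ mTD mA) _.
    by rewrite [X in (_ + X)%E](_ : _ = 0%E) ?adde0.
  apply: le_measure; rewrite ?inE//; first exact: measurableU.
  move=> t nt; have Ut := dyadic_sub_unit jn nt.
  have [Et|Et] := pselect (E (circ t)); first by right.
  have [N hN] := cov _ Ut Et; left; split => //=.
  by rewrite (T1 N)//; exact: (dx n j H N t).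
Qed.

End GapMeasure.

(** * The singular inner function *)

Section PushedHerglotz.
Variable R : realType.
Local Notation C := (CC R).
Local Notation mR := (measurableTypeR R).
Local Notation lam := (@lebesgue_measure R).
Local Notation U := (@unit_interval R).

Let mU : measurable (U : set mR). Proof. exact: measurable_unit. Qed.
Let fU : (lam U < +oo)%E. Proof. exact: lamU_fin. Qed.
Let l1 : fine (lam U) = 1. Proof. by rewrite lamU. Qed.

Lemma Re_herglotz_kernel (e z : C) : cabs e = 1 -> e - z != 0 ->
  complex.Re ((e + z) / (e - z)) = (1 - cabs z ^+ 2) / cabs (e - z) ^+ 2.
Proof.
move=> e1 ez; rewrite Re_div//; congr (_ / _).
have <- : cabs e ^+ 2 = 1 by rewrite e1 expr1n.
by rewrite !cabs_sqr ReM !(ReD, ImD, ReN, ImN) /= !(ReD, ImD, ReN, ImN); ring.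
Qed.

Variables (mu : {measure set R -> \bar R}) (T : mR -> mR).
Hypothesis mT : measurable_fun setT T.
Hypothesis muI : forall (f : mR -> R) M, measurable_fun setT f -> (forall t, `|f t| <= M) ->
      Rintegral mu U f = Rintegral lam U (f \o T).

Let ep (t : mR) : C := circ (T t).

Lemma cbm_pushed (p : R -> C) M : (forall t, pcont p t) -> (forall t, cabs (p t) <= M) ->
  cbm (T := mR) U (fun t => p (T t)).
Proof.
move=> pc pM; have mRe : measurable_fun setT (@complex.Re R \o p : mR -> R).
  by apply: continuous_measurable_fun => t; have /pcontP[] := pc t.
have mIm : measurable_fun setT (@complex.Im R \o p : mR -> R).
  by apply: continuous_measurable_fun => t; have /pcontP[] := pc t.
split; [| |by exists M].
  by apply: measurable_funTS; exact: (measurableT_comp mRe mT).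
by apply: measurable_funTS; exact: (measurableT_comp mIm mT).
Qed.

Let pcont_sub r z t : cabs z < r -> pcont (fun t => ((r%:C : C) * circ t - z)^-1) t.
Proof.
move=> zr; apply: (@pcontV _ (fun t => (r%:C : C) * circ t - z)); first exact: circ_sub_neq0.
by apply: (@pcontB _ (fun t => (r%:C : C) * circ t) (fun=> z)); [exact: pcont_scale_circ|exact: pcont_cst].
Qed.

Lemma cabs_circ_subV (r t : R) (z : C) : cabs z < r -> cabs ((r%:C : C) * circ t - z)^-1 <= (r - cabs z)^-1.
Proof.
move=> zr; have r0 : 0 <= r by rewrite (le_trans (cabs_ge0 z))// ltW.
have d0 : 0 < r - cabs z by rewrite subr_gt0.
by rewrite cabsV lef_pV2 ?posrE ?(lt_le_trans d0)// circ_sub_ge.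
Qed.

Let cbe (r : R) (z : C) : cabs z < r -> cbm (T := mR) U (fun t => ((r%:C : C) * ep t - z)^-1).
Proof.
move=> zr; apply: (@cbm_pushed (fun t => ((r%:C : C) * circ t - z)^-1) (r - cabs z)^-1).
  by move=> t; exact: pcont_sub.
by move=> t; exact: cabs_circ_subV.
Qed.

Let cep : cbm (T := mR) U ep.
Proof. by apply: (@cbm_pushed (@circ R) 1) => t; [exact: pcont_circ|rewrite cabs_circ]. Qed.

(** The Herglotz integral over Lebesgue measure; the estimates work with [T], and the measure enters
    only through [muI]. *)
Definition pushed_herglotz (z : C) : C := cint lam U (fun t => (ep t + z) / (ep t - z)).
Local Notation H := pushed_herglotz.

Let cbH z : cabs z < 1 -> cbm (T := mR) U (fun t => (ep t + z) / (ep t - z)).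
Proof.
move=> z1; apply: cbmM; first by apply: cbmD => //; exact: cbm_cst.
by apply: (eq_cbm _ (cbe z1)) => t; rewrite mul1r.
Qed.

Lemma herglotz_pushed z : cabs z < 1 -> herglotz mu z = H z.
Proof.
move=> z1; pose f (t : R) : C := (circ t + z) / (circ t - z).
have fc t : pcont f t.
  apply: (@pcontM _ (fun t => circ t + z) (fun t => (circ t - z)^-1)).
    by apply: (@pcontD _ (@circ R) (fun=> z)); [exact: pcont_circ|exact: pcont_cst].
  apply: (@pcontV _ (fun t => circ t - z)); first by have := circ_sub_neq0 t z1; rewrite mul1r.
  by apply: (@pcontB _ (@circ R) (fun=> z)); [exact: pcont_circ|exact: pcont_cst].
have fM t : cabs (f t) <= 2 * (1 - cabs z)^-1.
  rewrite /f cabsM; apply: ler_pM; rewrite ?cabs_ge0//.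
    by rewrite (le_trans (cabsD _ _))// cabs_circ -[2]/(1 + 1) lerD2l ltW.
  by have := cabs_circ_subV t z1; rewrite mul1r.
rewrite /herglotz /H /cint.
rewrite (@muI (fun t => complex.Re (f t)) (2 * (1 - cabs z)^-1)); first last.
- by move=> t; apply: le_trans (cabs_ge_Re _) (fM t).
- by apply: continuous_measurable_fun => t; have /pcontP[] := fc t.
rewrite (@muI (fun t => complex.Im (f t)) (2 * (1 - cabs z)^-1))//.
- by apply: continuous_measurable_fun => t; have /pcontP[] := fc t.
- by move=> t; apply: le_trans (cabs_ge_Im _) (fM t).
Qed.

Let Q (z : C) : C := cauchy_type lam U ep ep 1 2 z.

(** Since (e + z)/(e - z) = 2e/(e - z) - 1, the integral is a Cauchy-type integral up to
    constants. *)
Lemma hd_pushed_herglotz z : cabs z < 1 -> hd H z (2 * Q z).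
Proof.
move=> z1; have HK := @hd_cauchy_type R _ _ lam U ep mU fU (fun t => cabs_circ (T t)) cbe ep 1 z cep z1.
have HH := hdB (hdM (hd_cst (2 : C) z) HK) (hd_cst (1 : C) z).
have d0 : 0 < 1 - cabs z by rewrite subr_gt0.
have {}HH : hd H z (0 * cauchy_type lam U ep ep 1 1 z + 2 * Q z - 0).
  apply: (hd_eq d0 _ HH) => h hh.
  have zh : cabs (z + h) < 1 by rewrite (le_lt_trans (cabsD _ _))// addrC -ltrBrDr.
  rewrite /cauchy_type; have hk : cbm (T := mR) U (fun t => ep t * ((1%:C : C) * ep t - (z + h))^-1 ^+ 1).
    by apply: cbmM => //; apply: (eq_cbm _ (cbe zh)) => t; rewrite expr1.
  rewrite /H -cintZ// -[X in _ - X](_ : cint lam U (fun=> 1) = 1); last by rewrite cint_cst// l1 mul1r.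
  rewrite -cintB//; [|exact: cbmZ|exact: cbm_cst].
  apply: eq_cint => t _; rewrite expr1 mul1r.
  have n0 : ep t - (z + h) != 0 by have := circ_sub_neq0 (T t) zh; rewrite mul1r.
  by field.
by move: HH; congr (hd _ _ _); ring.
Qed.

Let pk t z := (1 - cabs z ^+ 2) / cabs (ep t - z) ^+ 2.

Let epn t z : cabs z < 1 -> ep t - z != 0.
Proof. by move=> z1; have := circ_sub_neq0 (T t) z1; rewrite mul1r. Qed.

Lemma integrable_poisson z : cabs z < 1 -> lam.-integrable U (EFin \o (pk^~ z)).
Proof.
move=> z1; apply: eq_integrable (@cbm_Re _ _ mR lam U mU fU _ (cbH z1)) => // t _.
by rewrite /= Re_herglotz_kernel ?cabs_circ ?epn.
Qed.

Lemma Re_pushed_herglotz z : cabs z < 1 -> complex.Re (H z) = Rintegral lam U (pk^~ z).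
Proof.
move=> z1; apply: eq_Rintegral => t _.
by rewrite Re_herglotz_kernel ?cabs_circ ?epn.
Qed.

Lemma poisson_ge0 t z : cabs z < 1 -> 0 <= pk t z.
Proof. by move=> z1; rewrite divr_ge0 ?sqr_ge0// subr_ge0 expr_le1 ?cabs_ge0 ?ltW. Qed.

Local Notation S := (S_mu mu).

Lemma S_muE z : cabs z < 1 -> S z = cexp (- H z).
Proof. by move=> z1; rewrite /S_mu herglotz_pushed. Qed.

Lemma hd_S_mu z : cabs z < 1 -> hd S z (- (2 * Q z) * S z).
Proof.
move=> z1; have d0 : 0 < 1 - cabs z by rewrite subr_gt0.
have HS := hd_comp (hdN (hd_pushed_herglotz z1)) (hd_cexp _).
rewrite S_muE//; have {}HS : hd S z (cexp (- H z) * - (2 * Q z)).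
  apply: (hd_eq d0 _ HS) => h hh; rewrite S_muE// (le_lt_trans (cabsD _ _))// addrC -ltrBrDr//.
by move: HS; congr (hd _ _ _); rewrite mulrC.
Qed.

Lemma cabs_S_mu z : cabs z < 1 -> cabs (S z) = expR (- Rintegral lam U (pk^~ z)).
Proof. by move=> z1; rewrite S_muE// cabs_cexp ReN Re_pushed_herglotz. Qed.

Lemma cabs_S_mu_le1 z : cabs z < 1 -> cabs (S z) <= 1.
Proof.
move=> z1; rewrite cabs_S_mu// expR_le1 oppr_le0; apply: Rintegral_ge0 => t _; exact: poisson_ge0.
Qed.

Lemma S_mu_neq0 z : cabs z < 1 -> S z != 0.
Proof. by move=> z1; rewrite S_muE// cexp_neq0. Qed.

(** The logarithm of |S| is minus the Poisson integral, whose integrand is nonnegative; only the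
    part over [a, b[, all of whose mass goes to y, is kept. *)
Lemma cabs_S_mu_atom (a b y : R) z : cabs z < 1 -> `[a, b[ `<=` U -> a <= b -> (forall t, a <= t < b -> T t = y) ->
  cabs (S z) <= expR (- ((b - a) * ((1 - cabs z ^+ 2) / cabs (circ y - z) ^+ 2))).
Proof.
move=> z1 sU ab Ty; rewrite cabs_S_mu// ler_expR lerN2.
have mI : measurable (`[a, b[%classic : set mR) by exact: measurable_itv.
have iU := integrable_poisson z1.
have iI : lam.-integrable (`[a, b[%classic : set mR) (EFin \o (pk^~ z)) by apply: integrableS iU.
apply: (@le_trans _ _ (Rintegral lam `[a, b[ (pk^~ z))); last first.
  rewrite /Rintegral fine_le ?integrable_fin_num//.
  have /integrableP[miU _] := iU; apply: ge0_subset_integral => //.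
  by move=> t _; rewrite lee_fin poisson_ge0.
rewrite (@eq_Rintegral _ _ _ lam _ (fun=> (1 - cabs z ^+ 2) / cabs (circ y - z) ^+ 2)); last first.
  by move=> t; rewrite inE /= in_itv /= => h; rewrite /pk /ep Ty.
have lE : lam `[a, b[%classic = (b - a)%:E.
  rewrite lebesgue_measure_itv /= lte_fin; case: ltP => h; first by rewrite -EFinB.
  by congr (_%:E); apply/eqP; rewrite eq_sym subr_eq0 eq_le h ab.
by rewrite Rintegral_cst// (_ : fine _ = b - a) 1?mulrC//; exact: (congr1 fine lE).
Qed.

Variable E : set C.
Hypothesis Ecl : closed E.
Hypothesis TE : forall t, U t -> E (circ (T t)).
Hypothesis Enull : lam (U `&` @circ R @^-1` E) = 0%E.

(** Let d be the radius of a ball about circ t that avoids E. If 1 - r >= d/2 the bound 1 suffices.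
    Otherwise the point is at distance at least d/2 from E, so the Poisson integral I is at most 8(1
    - r)/d^2, and 1 - exp(-2I) <= 2I. *)
Lemma one_sub_S_mu t : U t -> ~ E (circ t) -> exists2 c : R, 0 < c & forall r, 0 <= r -> r < 1 ->
  1 - cabs (S ((r%:C : C) * circ t)) ^+ 2 <= c * (1 - r).
Proof.
move=> Ut Et; have [d d0 Hd] := closed_circ_avoid Ecl Et.
exists (Num.max (2 / d) (16 / d ^+ 2)); first by rewrite lt_max divr_gt0.
move=> r r0 r1; have r10 : 0 <= 1 - r by rewrite subr_ge0 ltW.
have z1 : cabs ((r%:C : C) * circ t) < 1 by rewrite cabs_scale_circ.
have [rd|rd] := leP (d / 2) (1 - r).
  apply: (@le_trans _ _ 1); first by rewrite lerBlDr lerDl sqr_ge0.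
  apply: (@le_trans _ _ (2 / d * (1 - r))); last by rewrite ler_wpM2r// le_max lexx.
  by rewrite -ler_pdivrMl ?divr_gt0// mulr1 invf_div.
apply: (@le_trans _ _ (16 / d ^+ 2 * (1 - r))); last by rewrite ler_wpM2r// le_max lexx orbT.
rewrite cabs_S_mu// -expRM_natr; set I := Rintegral _ _ _.
have I1 : 1 - expR (- I * 2) <= 2 * I by have := expR_ge1Dx (- I * 2); lra.
apply: (le_trans I1).
have db s : U s -> d / 2 <= cabs (ep s - (r%:C : C) * circ t).
  move=> Us; have h1 : d <= cabs (ep s - circ t).
    by rewrite leNgt; apply/negP => /Hd; apply; exact: TE.
  have -> : ep s - (r%:C : C) * circ t = (ep s - circ t) - (- ((1 - r)%:C : C) * circ t).
    by rewrite rmorphB /= rmorph1; ring.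
  apply: le_trans (cabs_triB _ _); rewrite cabsM cabsN cabs_real cabs_circ mulr1 ger0_norm//.
  by move: h1 rd; lra.
have : I <= (1 - r ^+ 2) / (d / 2) ^+ 2.
  have K0 : 0 <= 1 - r ^+ 2 by rewrite subr_ge0 expr_le1 // ltW.
  apply: (@le_trans _ _ (Rintegral lam U (fun=> (1 - r ^+ 2) / (d / 2) ^+ 2))).
    apply: le_Rintegral => //; first exact: integrable_poisson.
      by apply: (@bm_integrable R _ mR lam U mU fU _ `|(1 - r ^+ 2) / (d / 2) ^+ 2|).
    move=> s Us; rewrite /pk cabs_scale_circ// ler_wpM2l// lef_pV2 ?posrE ?exprn_gt0 ?divr_gt0//.
      by rewrite lerXn2r ?nnegrE ?cabs_ge0 ?db// ltW// divr_gt0.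
    by rewrite (lt_le_trans _ (db _ Us))// divr_gt0.
  by rewrite Rintegral_cst// l1 mulr1.
have -> : (1 - r ^+ 2) / (d / 2) ^+ 2 = 4 / d ^+ 2 * (1 - r ^+ 2) by field; rewrite gt_eqF.
have r2 : 1 - r ^+ 2 <= 2 * (1 - r) by rewrite expr2; nra.
have d2 : 0 <= 4 / d ^+ 2 by rewrite divr_ge0// sqr_ge0.
have := ler_wpM2l d2 r2; have -> : 16 / d ^+ 2 = 4 * (4 / d ^+ 2) by field; rewrite gt_eqF.
by set D := 4 / _; lra.
Qed.

Lemma hol_S_mu : hol 1 S.
Proof. by move=> z z1; eexists; exact: hd_S_mu. Qed.

(** Dominated convergence works along sequences, so a failure is turned into radii r_n -> 1 whose
    means stay above e; by [one_sub_S_mu] the integrands tend to 0 off the null set E. *)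
Lemma S_mu_inner e : 0 < e -> exists2 rho : R, rho < 1 & forall r, rho <= r < 1 -> 0 <= r ->
  Rintegral lam U (fun t => 1 - cabs (S ((r%:C : C) * circ t)) ^+ 2) <= e.
Proof.
move=> e0; apply: contrapT => Hn.
pose v r t := 1 - cabs (S ((r%:C : C) * circ t)) ^+ 2.
have ex n : exists r, [/\ 0 <= r < 1, 1 - r <= n.+1%:R^-1 & e < Rintegral lam U (v r)].
  apply: contrapT => Hr; apply: Hn; exists (1 - n.+1%:R^-1); first by rewrite ltrBlDr ltrDl invr_gt0.
  move=> r /andP[r1 r2] r0; rewrite leNgt; apply/negP => er; apply: Hr; exists r; split => //.
    by rewrite r0.
  by rewrite lerBlDr addrC -lerBlDr.
have /choice[r rP] := ex.
have vU n : 0 <= r n < 1 by have [] := rP n.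
have v01 n t : 0 <= v (r n) t <= 1.
  have h : cabs (S (((r n)%:C : C) * circ t)) <= 1.
    by apply: cabs_S_mu_le1; have /andP[h1 h2] := vU n; rewrite cabs_scale_circ.
  by rewrite /v subr_ge0 expr_le1 ?cabs_ge0// h lerBlDr lerDl sqr_ge0.
have mv n : measurable_fun (U : set mR) (v (r n)).
  have hS := hol_circle hol_S_mu (vU n).
  have hv : cbm (T := mR) U (fun t => 1 - S (((r n)%:C : C) * circ t) * cconj (S (((r n)%:C : C) * circ t))).
    by apply: cbmB; [exact: cbm_cst|apply: cbmM; [exact: hS|exact: cbm_conj hS]].
  have [m1 _ _] := hv; apply: (eq_measurable_fun _ _ m1) => t _.
  set X := S (((r n)%:C : C) * circ t); transitivity (complex.Re (1 - X * cconj X)) => //.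
  by rewrite mul_cconj ReD ReN.
pose A : set mR := U `&` @circ R @^-1` E.
have mA : measurable A by apply: measurableI => //; exact: measurable_circ_preimage.
have [|||||_ _] := @dominated_convergence _ mR R lam U mU (fun n t => (v (r n) t)%:E) (cst 0%E) (cst 1%E).
- by move=> n; apply/measurable_EFinP; exact: mv.
- exact: measurable_cst.
- exists A; split => // t /= Ht; split; first by apply: contrapT => Ut; apply: Ht => /Ut.
  apply: contrapT => Et; apply: Ht => Ut; have [c c0 Hc] := one_sub_S_mu Ut Et.
  have cv : (fun n => v (r n) t) @ \oo --> (0 : R).
    apply/cvgrPdist_le => d d0; have dc : 0 < d / c by rewrite divr_gt0.
    near=> n; have /andP[h1 _] := v01 n t; rewrite sub0r normrN ger0_norm//.
    have /andP[r0 r1] := vU n; apply: le_trans (Hc _ r0 r1) _.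
    rewrite -ler_pdivlMl// mulrC; have [_ h _] := rP n; apply: (le_trans h); apply: ltW.
    by near: n; exact: (near_infty_natSinv_lt (PosNum dc)).
  by apply/fine_cvgP; split; [exact: nearW|exact: cv].
- by apply: (@bm_integrable R _ mR lam U mU fU (cst 1) 1) => // t _; rewrite normr1.
- apply: aeW => t n _ /=; have /andP[h1 h2] := v01 n t.
  by rewrite lee_fin ger0_norm.
rewrite (integral0 lam U) => /fine_cvgP[_ /cvgrPdist_lt /(_ _ e0)].
move=> [N _ /(_ N (leqnn N))] /=; rewrite sub0r normrN; have [_ _ h] := rP N.
by rewrite /comp; move=> /(le_lt_trans (ler_norm _)) /(lt_trans h); rewrite ltxx.
Unshelve. all: by end_near. Qed.

End PushedHerglotz.

(** * Integrability of the derivative *)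

Section PlanarEstimates.
Variable R : realType.
Local Notation mR := (measurableTypeR R).
Local Notation lam := (@lebesgue_measure R).
Local Notation lam2 := (lam \x lam)%E.

Lemma integral_even_FTC (M : R) (f F : R -> R) : 0 < M ->
  (forall s, 0 <= s <= M -> is_derive s 1 F (f s)) ->
  (forall s, 0 <= s <= M -> {for s, continuous f}) -> (forall s, 0 <= s <= M -> 0 <= f s) ->
  (\int[lam]_(s in `[(- M)%R, M]) (f `|s|)%:E = (2 * (F M - F 0))%:E)%E.
Proof.
move=> M0 dF cf f0.
have mI (a b : R) : measurable (`[a, b]%classic : set mR) by exact: measurable_itv.
have cE (b c : R) : (forall s, b <= s <= c -> `|s| <= M) -> {within `[b, c], continuous (fun s => f `|s|)}.
  move=> H; apply: continuous_in_subspaceT => s; rewrite inE /= in_itv => /H sM.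
  apply: (@continuous_comp _ _ _ (fun s : R => `|s|) f); first exact: norm_continuous.
  by apply: cf; rewrite normr_ge0.
have c1 : {within `[- M, 0], continuous (fun s => f `|s|)}.
  by apply: cE => s /andP[h1 h2]; rewrite ler0_norm// lerNl.
have c2 : {within `[0, M], continuous (fun s => f `|s|)}.
  by apply: cE => s /andP[h1 h2]; rewrite ger0_norm.
have pos : (\int[lam]_(s in `[(0%R:R), M]) (f `|s|)%:E = (F M - F 0)%:E)%E.
  rewrite (eq_integral (fun s : mR => (f s)%:E)); last first.
    by move=> s; rewrite inE /= in_itv /= => /andP[s0 _]; rewrite ger0_norm.
  have := FTC_real M0 dF cf; rewrite /Rintegral => <-; rewrite fineK//.
  apply: integrable_fin_num => //; apply: continuous_compact_integrable; first exact: segment_compact.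
  by apply: continuous_in_subspaceT => s; rewrite inE /= in_itv => /cf.
have neg : (\int[lam]_(s in `[(- M)%R, (0%R:R)]) (f `|s|)%:E = (F M - F 0)%:E)%E.
  have := @integration_by_substitution_oppr R (fun s => f `|s|) 0 M (ltW M0).
  rewrite oppr0 => /(_ c1) ->; rewrite -pos; apply: eq_integral => s _.
  by rewrite /= normrN.
have -> : `[- M, M]%classic = `[- M, 0]%classic `|` `]0, M]%classic :> set mR.
  apply/seteqP; split => s /=; rewrite !in_itv /=.
    by move=> /andP[h1 h2]; have [h|h] := leP s 0; [left|right]; rewrite ?h1 ?h2.
  by move=> [/andP[h1 h2]|/andP[h1 h2]]; apply/andP; split; lra.
have mf (b c : R) : {within `[b, c], continuous (fun s => f `|s|)} -> measurable_fun (`[b, c]%classic : set mR) (fun s => (f `|s|)%:E).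
  by move=> h; apply/measurable_EFinP; exact: subspace_continuous_measurable_fun.
have mo : measurable_fun (`]0, M]%classic : set mR) (fun s => (f `|s|)%:E).
  by apply: measurable_funS (mf _ _ c2) => //; exact: subset_itv_oc_cc.
rewrite ge0_integral_setU//=.
- rewrite neg (integral_itv_obnd_cbnd mo) pos -EFinD; congr (_%:E); ring.
- by rewrite measurable_funU//; split; [exact: mf|exact: mo].
- by move=> s h; rewrite lee_fin f0// normr_ge0/=; case: h; rewrite /= in_itv /= => /andP[h1 h2]; rewrite ler_norml; apply/andP; split; lra.
- apply/disj_set2P; apply/seteqP; split => // s [] /=; rewrite !in_itv /= => /andP[_ h1] /andP[h2 _].
  by have := lt_le_trans h2 h1; rewrite ltxx.
Qed.

(** A one-variable singularity of order a at 0, cut off at M and regularised by e to stay continuous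
    on its support; planar singularities are bounded by products of two of these. *)
Definition cusp (e a M : R) (s : R) : R := if `|s| <= M then (e + `|s|) `^ (- a) else 0.

Lemma cusp_ge0 e a M s : 0 <= cusp e a M s.
Proof. by rewrite /cusp; case: ifP => // _; exact: powR_ge0. Qed.

Let cusp_restrict e a M : (fun s => (cusp e a M s)%:E) = ((fun s => ((e + `|s|) `^ (- a))%:E) \_ `[(- M)%R, M])%E.
Proof.
by apply/funext => s; rewrite /cusp patchE mem_setE in_itv /= -ler_norml; case: ifP.
Qed.

Let is_derive_shift (e s : R) : is_derive s 1 (fun x : R => e + x) 1.
Proof.
apply: eps_is_derive => d d0; exists 1 => // h _.
have -> : e + (s + h) - (e + s) - 1 * h = 0 by ring.
by rewrite normr0 mulr_ge0// ltW.
Qed.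

Let cusp_cont (e a s : R) : 0 < e -> 0 <= s -> {for s, continuous (fun s : R => (e + s) `^ (- a))}.
Proof.
move=> e0 s0; have es : 0 < e + s by rewrite ltr_wpDr.
have H : is_derive s 1 (fun s => (e + s) `^ (- a)) (- a * (e + s) `^ (- a - 1)).
  have h1 := is_derive_shift e s.
  have h2 := is_derive1_powR (- a) es.
  by have := is_derive1_comp h2 h1; rewrite mulr1.
exact: is_derive_cts H.
Qed.

Lemma measurable_cusp e a M : 0 < e -> measurable_fun setT (cusp e a M : mR -> R).
Proof.
move=> e0; apply/measurable_EFinP; rewrite -[EFin \o _]/(fun s => (cusp e a M s)%:E) cusp_restrict.
apply/(measurable_restrictT _ _).1 => //.
apply/measurable_EFinP; apply: subspace_continuous_measurable_fun => //.
apply: continuous_in_subspaceT => s _.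
apply: (@continuous_comp _ _ _ (fun s : R => `|s|) (fun s => (e + s) `^ (- a))); first exact: norm_continuous.
exact: cusp_cont.
Qed.

Lemma integral_cusp e a M : 0 < e -> 0 < M -> a != 1 ->
  (\int[lam]_s (cusp e a M s)%:E = (2 * (((e + M) `^ (1 - a) - e `^ (1 - a)) / (1 - a)))%:E)%E.
Proof.
move=> e0 M0 a1; rewrite cusp_restrict -integral_mkcond.
have a10 : 1 - a != 0 by rewrite subr_eq0 eq_sym.
pose F (s : R) := (e + s) `^ (1 - a) / (1 - a).
have dF (s : R) : 0 <= s <= M -> is_derive s 1 F ((e + s) `^ (- a)).
  move=> /andP[s0 _]; have es : 0 < e + s by rewrite ltr_wpDr.
  have h3 := is_derive1_comp (is_derive1_powR (1 - a) es) (is_derive_shift e s).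
  have : is_derive s 1 (fun s => (1 - a)^-1 *: (e + s) `^ (1 - a)) ((1 - a)^-1 *: ((1 - a) * (e + s) `^ (1 - a - 1) * 1)) by exact: is_deriveZ.
  have -> : (1 - a)^-1 *: ((1 - a) * (e + s) `^ (1 - a - 1) * 1) = (e + s) `^ (- a).
    by rewrite mulr1 -[_ *: _]/(_ * _) mulrA mulVf// mul1r; congr (_ `^ _); ring.
  by move=> h; have -> : F = (fun s => (1 - a)^-1 *: (e + s) `^ (1 - a)) by apply/funext => y; rewrite /F mulrC.
have cF (s : R) : 0 <= s <= M -> {for s, continuous (fun s : R => (e + s) `^ (- a))}.
  by move=> /andP[s0 _]; exact: cusp_cont.
have F0 (s : R) : 0 <= s <= M -> 0 <= (e + s) `^ (- a) by move=> _; exact: powR_ge0.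
by rewrite (integral_even_FTC M0 dF cF F0) /F addr0 mulrBl.
Qed.

(** The bound does not involve [e], so it survives as the regularisation is removed. *)
Lemma integral_cusp_lt1 e a M : 0 < e -> e <= M -> a < 1 ->
  (\int[lam]_s (cusp e a M s)%:E <= (2 * ((2 * M) `^ (1 - a) / (1 - a)))%:E)%E.
Proof.
move=> e0 eM a1; have M0 : 0 < M by exact: lt_le_trans eM.
have d0 : 0 < 1 - a by rewrite subr_gt0.
rewrite integral_cusp ?lt_eqF// lee_fin ler_pM2l// ler_pM2r ?invr_gt0//.
apply: (@le_trans _ _ ((e + M) `^ (1 - a))); first by rewrite lerBlDr lerDl powR_ge0.
by rewrite ge0_ler_powR ?nnegrE ?(ltW d0)//; lra.
Qed.

Lemma integral_cusp_gt1 e a M : 0 < e -> 0 < M -> 1 < a ->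
  (\int[lam]_s (cusp e a M s)%:E <= (2 * (e `^ (1 - a) / (a - 1)))%:E)%E.
Proof.
move=> e0 M0 a1; have d0 : 0 < a - 1 by rewrite subr_gt0.
rewrite integral_cusp ?gt_eqF// lee_fin ler_pM2l//.
have -> : ((e + M) `^ (1 - a) - e `^ (1 - a)) / (1 - a) = (e `^ (1 - a) - (e + M) `^ (1 - a)) / (a - 1).
  by rewrite -[1 - a in X in _ / X]opprB invrN mulrN -mulNr opprB.
by rewrite ler_pM2r ?invr_gt0// lerBlDr lerDl powR_ge0.
Qed.

(** For fixed second variable the inner integral is translation invariant. The shift [g] will be
    constant, to recentre, or - sqrt(1 - y^2), to measure the horizontal distance to the circle. *)
Lemma integral_sheared_product (h1 h2 g : mR -> R) : measurable_fun setT h1 -> measurable_fun setT h2 ->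
  measurable_fun setT g -> (forall s, 0 <= h1 s) -> (forall s, 0 <= h2 s) ->
  measurable_fun setT (fun p : mR * mR => (h1 p.2 * h2 (p.1 + g p.2))%:E) /\
  (\int[lam2]_p (h1 p.2 * h2 (p.1 + g p.2)%R)%:E = (\int[lam]_s (h1 s)%:E) * (\int[lam]_s (h2 s)%:E))%E.
Proof.
move=> m1 m2 mg p1 p2.
have mF : measurable_fun setT (fun p : mR * mR => (h1 p.2 * h2 (p.1 + g p.2))%:E).
  apply/measurable_EFinP; apply: measurable_funM; first exact: measurableT_comp.
  apply: measurableT_comp => //; apply: measurable_funD; first exact: measurable_fst.
  by apply: measurableT_comp.
split=> //.
have F0 (p : mR * mR) : (0 <= (h1 p.2 * h2 (p.1 + g p.2)%R)%:E)%E by rewrite lee_fin mulr_ge0.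
have H1 : (0 <= \int[lam]_s (h2 s)%:E)%E by apply: integral_ge0 => s _; rewrite lee_fin.
rewrite fubini_tonelli2// -ge0_integralZr//; last first.
- by move=> s _; rewrite lee_fin.
- exact/measurable_EFinP.
apply: eq_integral => y _; rewrite /fubini_G /=.
have mh : measurable_fun setT (fun x : mR => (h2 x)%:E) by exact/measurable_EFinP.
have h20 x : (0 <= (h2 x)%:E)%E by rewrite lee_fin.
have <- := @ge0_integral_shift R (g y) (fun x => (h2 x)%:E) mh h20.
rewrite -ge0_integralZl//.
- by apply: (measurableT_comp mh); apply: measurable_funD => //; exact: measurable_cst.
- by rewrite lee_fin.
Qed.

End PlanarEstimates.

(** * Kernel estimates near a gap *)

Section GapKernel.
Variable R : realType.
Local Notation C := (CC R).
Local Notation lam := (@lebesgue_measure R).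

Lemma pder_circ t : pder (@circ R) t (@twopii R * circ t).
Proof.
have E : @circ R = @cexp R \o (fun s : R => (s%:C : C) * @twopii R).
  apply/funext => s; have := cexp_polar 0 s; rewrite expR0 mul1r => <- /=; congr cexp.
  by rewrite add0r mulrC.
have H := pder_comp (hd_cexp ((t%:C : C) * @twopii R)) (pder_scale (@twopii R) t).
by rewrite E; move: H; congr (pder _ _ _); rewrite mulrC.
Qed.

Lemma cabs_twopii : cabs (@twopii R) = 2 * pi.
Proof. by rewrite /twopii /cabs /= expr0n /= add0r sqrtr_sqr ger0_norm// mulr_ge0// pi_ge0. Qed.

Lemma circ_lip (s t : R) : cabs (circ s - circ t) <= 2 * pi * `|s - t|.
Proof.
wlog st : s t / t <= s.
  by move=> H; have [st|/ltW st] := leP t s; [exact: H|rewrite cabs_distC distrC; exact: H].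
have pq u : pcont (fun u => @twopii R * circ u) u.
  by apply: (@pcontM _ (fun=> @twopii R) (@circ R)); [exact: pcont_cst|exact: pcont_circ].
rewrite -(FTC_curve st (fun u _ => pder_circ u) (fun u _ => pq u)) ger0_norm ?subr_ge0// -(lam_itv st).
apply: cint_bound.
- exact: measurable_itv.
- exact: lam_itv_fin.
- by apply: pcont_cbm => u _; exact: pq.
- by move=> u _; rewrite cabsM cabs_twopii cabs_circ mulr1.
Qed.

(** The integrand has the primitive -(circ t - z)^{-1}/(2 pi i), so only the endpoints count; the
    factor 1/(2 pi) is dropped. *)
Lemma arc_kernel_integral (a b : R) (z : C) : a <= b -> cabs z < 1 ->
  cabs (cint lam `[a, b] (fun t => circ t / (circ t - z) ^+ 2)) <=
    (cabs (circ a - z))^-1 + (cabs (circ b - z))^-1.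
Proof.
move=> ab z1; have n0 t : circ t - z != 0 by have := circ_sub_neq0 t z1; rewrite mul1r.
have i0 := @twopii_neq0 R.
pose p t := - (@twopii R)^-1 * (circ t - z)^-1.
have cp t : pcont (fun t => circ t / (circ t - z) ^+ 2) t.
  have h1 : pcont (fun t => circ t - z) t.
    by apply: (@pcontB _ (@circ R) (fun=> z)); [exact: pcont_circ|exact: pcont_cst].
  apply: (@pcontM _ (@circ R) (fun t => ((circ t - z) ^+ 2)^-1)); first exact: pcont_circ.
  by apply: (@pcontV _ (fun t => (circ t - z) ^+ 2)); [rewrite expf_neq0|exact: (@pcontM _ (fun t => circ t - z) (fun t => circ t - z) t h1 h1)].
have dp t : pder p t (circ t / (circ t - z) ^+ 2).
  have H1 := hdB (hd_id (circ t)) (hd_cst z (circ t)).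
  have H2 := hd_comp H1 (hdV (n0 t)).
  have H3 := hdM (hd_cst (- (@twopii R)^-1) (circ t)) H2.
  have := pder_comp H3 (pder_circ t); congr (pder _ _ _).
  by field; rewrite i0 n0.
rewrite (FTC_curve ab (fun u _ => dp u) (fun u _ => cp u)) (le_trans (cabsB _ _))//.
have pb t : cabs (p t) <= (cabs (circ t - z))^-1.
  rewrite /p cabsM cabsN !cabsV ler_piMl ?invr_ge0 ?cabs_ge0// cabs_twopii invf_le1 ?mulr_gt0 ?pi_gt0//.
  by have := pi_ge2 R; lra.
by rewrite addrC lerD.
Qed.

(** The numerator of the difference factors as (e - p)(p(e - z) + z(p - z)). With P = |p - z|, E =
    |e - z| and P <= 2E, the constant 6 comes from 6E^2 - EP - P^2 = (2E - P)(3E + P) >= 0. *)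
Lemma kernel_diff_bound (e p z : C) (d : R) : cabs e = 1 -> cabs p = 1 -> cabs z <= 1 -> 0 < cabs (p - z) ->
  cabs (e - p) <= d -> 2 * d <= cabs (p - z) ->
  cabs (p / (p - z) ^+ 2 - e / (e - z) ^+ 2) <= 6 * d / cabs (p - z) ^+ 3.
Proof.
move=> e1 p1 z1 P0 ed dP; have d0 : 0 <= d by exact: le_trans (cabs_ge0 _) ed.
set P := cabs (p - z) in P0 dP *; pose E := cabs (e - z).
have PE : P / 2 <= E.
  have : P <= E + cabs (e - p).
    have T := cabs_triB (p - z) (p - e); have E1 : p - z - (p - e) = e - z by ring.
    by rewrite E1 [cabs (p - e)]cabs_distC lerBlDr in T.
  by lra.
have E0 : 0 < E by rewrite (lt_le_trans _ PE)// divr_gt0.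
have n1 : p - z != 0 by rewrite -cabs_gt0.
have n2 : e - z != 0 by rewrite -cabs_gt0.
have -> : p / (p - z) ^+ 2 - e / (e - z) ^+ 2 = (e - p) * (p * (e - z) + z * (p - z)) / ((p - z) ^+ 2 * (e - z) ^+ 2).
  by field; rewrite n1 n2.
rewrite cabsf (cabsM (e - p)) (cabsM ((p - z) ^+ 2)) !cabsX -/P -/E.
have h : cabs (p * (e - z) + z * (p - z)) <= E + P.
  by rewrite (le_trans (cabsD _ _))// !cabsM p1 mul1r lerD// ler_piMl ?cabs_ge0.
apply: (@le_trans _ _ (d * (E + P) / (P ^+ 2 * E ^+ 2))).
  by rewrite ler_pM2r ?invr_gt0 ?mulr_gt0 ?exprn_gt0// ler_pM ?cabs_ge0.
rewrite ler_pdivrMr ?mulr_gt0 ?exprn_gt0//.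
have -> : 6 * d / P ^+ 3 * (P ^+ 2 * E ^+ 2) = d * (6 * E ^+ 2 / P) by field; rewrite gt_eqF.
rewrite ler_wpM2l// ler_pdivlMr//.
have : 0 <= (2 * E - P) * (3 * E + P) by rewrite mulr_ge0//; lra.
by rewrite expr2; lra.
Qed.

(** Bounds a radial singularity by a product of two one-dimensional cusps, using [e + |w_i| <= 2 |w|]. *)
Lemma inv_powR_le_cusp (e a M : R) (w : C) : 0 < e -> 0 < a -> e <= cabs w -> cabs w <= M ->
  cabs w `^ (- (2 * a)) <= 2 `^ (2 * a) * (cusp e a M (complex.Re w) * cusp e a M (complex.Im w)).
Proof.
move=> e0 a0 ew wM; have hr := cabs_ge_Re w; have hi := cabs_ge_Im w.
have w0 : 0 < cabs w by exact: lt_le_trans ew.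
rewrite /cusp !ifT ?(le_trans hr)// ?(le_trans hi)//.
have bd (x : R) : `|x| <= cabs w -> (2 * cabs w) `^ (- a) <= (e + `|x|) `^ (- a).
  move=> xw; have p0 : 0 < e + `|x| by rewrite ltr_pwDl.
  rewrite !powRN lef_pV2 ?posrE ?powR_gt0 ?mulr_gt0//.
  by rewrite ge0_ler_powR ?nnegrE ?(ltW a0) ?(ltW p0) ?mulr_ge0 ?cabs_ge0//; lra.
apply: (@le_trans _ _ (2 `^ (2 * a) * ((2 * cabs w) `^ (- a) * (2 * cabs w) `^ (- a)))).
  have n0 : 2 * cabs w != 0 by rewrite gt_eqF// mulr_gt0.
  rewrite -powRD; last by rewrite n0 implybT.
  rewrite powRM ?cabs_ge0// mulrA -powRD; last by rewrite pnatr_eq0 implybT.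
  by have -> : 2 * a + (- a - a) = 0; [ring|rewrite powRr0 mul1r; have -> : - a - a = - (2 * a) by ring].
by rewrite ler_wpM2l ?powR_ge0// ler_pM ?powR_ge0 ?bd.
Qed.

(** With [y] the exponent, [exp(-y) <= y^(-1/2)]; the cusp exponent 3/4 comes from [|1 - z| >= |Im z|^(3/4) u^(1/4)] and [1 - |z|^2 >= u], where [u] is the horizontal distance to the circle. *)
Lemma atom_le_cusp (e M k : R) (z : C) : 0 < e -> 0 < k -> cabs z <= 1 - e -> cabs (1 - z) < 2^-1 -> cabs (1 - z) <= M ->
  expR (- (k * ((1 - cabs z ^+ 2) / cabs (1 - z) ^+ 2))) * (k / cabs (1 - z) ^+ 2) <=
  4 * Num.sqrt k * (cusp e (3 / 4) M (complex.Im z) *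
    cusp e (3 / 4) M (complex.Re z - Num.sqrt (1 - complex.Im z ^+ 2))).
Proof.
move=> e0 k0 ze z2 zM; set v := cabs (1 - z) in z2 zM *; set W := 1 - cabs z ^+ 2.
set x := complex.Re z; set y := complex.Im z; set g := Num.sqrt (1 - _).
have z0 := cabs_ge0 z.
have ev : e <= v.
  have := cabs_triB 1 z; rewrite cabs1 -/v; lra.
have v0 : 0 < v by exact: lt_le_trans ev.
have eW : e <= W by rewrite /W expr2; nra.
have W0 : 0 < W by exact: lt_le_trans eW.
have vx : `|1 - x| <= v by have := cabs_ge_Re (1 - z); rewrite ReD ReN.
have vy : `|y| <= v by have := cabs_ge_Im (1 - z); rewrite ImD ImN /= sub0r normrN.
have zz : cabs z ^+ 2 = x ^+ 2 + y ^+ 2 by exact: cabs_sqr.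
have z11 : cabs z ^+ 2 <= 1 by rewrite expr_le1//; lra.
have y1 : 0 <= 1 - y ^+ 2 by have := sqr_ge0 x; move: zz z11; lra.
have g2 : g ^+ 2 = 1 - y ^+ 2 by exact: sqr_sqrtr.
have g0 : 0 <= g by exact: sqrtr_ge0.
have x2 : 2^-1 <= x by move: vx; rewrite ler_norml => /andP[h1 h2]; lra.
have gx : x <= g by rewrite -(@ler_pXn2r _ 2)// ?nnegrE// ?g2; lra.
have g1 : g <= 1 by rewrite -(@ler_pXn2r _ 2)// ?nnegrE// ?g2 expr1n gerBl sqr_ge0.
(* 1 - |z|^2 = (g - x)(g + x), and g + x >= 1 because |1 - z| < 1/2 forces x >= 1/2. *)
have uW : g - x <= W.
  have -> : W = (g - x) * (g + x).
    have -> : (g - x) * (g + x) = g ^+ 2 - x ^+ 2 by ring.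
    by rewrite g2 /W zz; ring.
  by rewrite ler_peMr ?subr_ge0//; lra.
have u0 : 0 <= g - x by rewrite subr_ge0.
have uv : g - x <= v by move: vx; rewrite ler_norml => /andP[h1 h2]; lra.
have ux : `|x - g| = g - x by rewrite distrC ger0_norm.
rewrite /cusp ux !ifT ?(le_trans uv)// ?(le_trans vy)//.
set A := e + `|y|; set B := e + (g - x).
have A0 : 0 < A by rewrite /A ltr_pwDl.
have B0 : 0 < B by rewrite /B ltr_pwDl.
have AB : A `^ (3 / 4) * B `^ (3 / 4) <= 4 * (v * Num.sqrt W).
  (* Both A and B are at most 2v, and B is at most 2W: the fourth root of B completes A^(3/4) to 2v,
     the square root of B goes into sqrt W. *)
  have -> : B `^ (3 / 4) = B `^ 4^-1 * Num.sqrt B.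
    rewrite -powR12_sqrt ?(ltW B0)// -powRD ?gt_eqF// ?implybT//.
    by congr (_ `^ _); field.
  have hA : A `^ (3 / 4) <= (2 * v) `^ (3 / 4).
    by rewrite ge0_ler_powR ?nnegrE ?(ltW A0) ?mulr_ge0 ?(ltW v0)// /A; lra.
  have hB : B `^ 4^-1 <= (2 * v) `^ 4^-1.
    by rewrite ge0_ler_powR ?nnegrE ?(ltW B0) ?mulr_ge0 ?(ltW v0)// /B; lra.
  have hs : Num.sqrt B <= 2 * Num.sqrt W.
    have -> : 2 * Num.sqrt W = Num.sqrt (4 * W).
      by rewrite sqrtrM// (_ : 4 = 2 ^+ 2) ?sqrtr_sqr ?ger0_norm// -natrX.
    by rewrite ler_sqrt ?mulr_ge0 ?(ltW W0)// /B; lra.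
  have E : (2 * v) `^ (3 / 4) * (2 * v) `^ 4^-1 = 2 * v.
    rewrite -powRD; last by rewrite gt_eqF ?implybT// mulr_gt0.
    by have -> : 3 / 4 + 4^-1 = 1 :> R; [field|rewrite powRr1// mulr_ge0// ltW].
  rewrite mulrA; apply: (@le_trans _ _ ((2 * v) * (2 * Num.sqrt W))).
    by rewrite -E ler_pM ?mulr_ge0 ?powR_ge0 ?sqrtr_ge0// ler_pM ?powR_ge0.
  by have -> : 2 * v * (2 * Num.sqrt W) = 4 * (v * Num.sqrt W) by ring.
have sW : 0 < Num.sqrt W by rewrite sqrtr_gt0.
have sk : 0 < Num.sqrt k by rewrite sqrtr_gt0.
set E1 := expR _.
have exp1 : E1 * (k / v ^+ 2) <= Num.sqrt k / (v * Num.sqrt W).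
  pose s := Num.sqrt k * Num.sqrt W / v; have s0 : 0 <= s by rewrite divr_ge0 ?mulr_ge0 ?ltW.
  have s2 : k * (W / v ^+ 2) = s ^+ 2.
    by rewrite /s expr_div_n exprMn (sqr_sqrtr (ltW k0)) (sqr_sqrtr (ltW W0)) mulrA.
  have es : E1 * s <= 1.
    rewrite /E1 s2 expRN mulrC ler_pdivrMr ?expR_gt0// mul1r.
    by have := expR_ge1Dx (s ^+ 2); have := sqr_ge0 (s - 2^-1); rewrite !expr2; lra.
  have -> : k / v ^+ 2 = s * (Num.sqrt k / (v * Num.sqrt W)).
    rewrite /s -[k in LHS](sqr_sqrtr (ltW k0)); field.
    by rewrite !gt_eqF.
  rewrite (mulrA E1 s); set X := Num.sqrt k / _; have X0 : 0 <= X by rewrite divr_ge0 ?mulr_ge0 ?ltW.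
  by rewrite -[leRHS]mul1r ler_wpM2r.
apply: (le_trans exp1); rewrite !powRN -invfM.
rewrite ler_pdivrMr ?mulr_gt0//.
rewrite [4 * _]mulrC -!mulrA ler_peMr ?(ltW sk)//.
rewrite mulrCA mulrC ler_pdivlMr ?mul1r ?mulr_gt0 ?powR_gt0//.
Qed.

End GapKernel.

(** * The integrable majorant of one gap *)

Section GapMajorant.
Variable R : realType.
Local Notation C := (CC R).
Local Notation mR := (measurableTypeR R).
Local Notation lam := (@lebesgue_measure R).
Local Notation lam2 := (lam \x lam)%E.

Let sq_le (I : \bar R) (B : R) : (0 <= I)%E -> (I <= B%:E)%E -> (I * I <= (B * B)%:E)%E.
Proof. by move=> I0 IB; rewrite EFinM; exact: lee_pmul. Qed.

Let cusp_int_ge0 e a M : (0 <= \int[lam]_s (cusp e a M s)%:E)%E.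
Proof. by apply: integral_ge0 => s _; rewrite lee_fin cusp_ge0. Qed.

Definition cusp_at e a M (c : C) (q : mR * mR) : R :=
  cusp e a M (complex.Re (cplane q - c)) * cusp e a M (complex.Im (cplane q - c)).

Let cusp_at_spec e a M (c : C) : 0 < e -> measurable_fun setT (cusp_at e a M c) /\
  (\int[lam2]_q (cusp_at e a M c q)%:E = (\int[lam]_s (cusp e a M s)%:E) * (\int[lam]_s (cusp e a M s)%:E))%E.
Proof.
move=> e0; have mc := @measurable_cusp R e a M e0.
pose h1 (s : mR) : R := cusp e a M (s + - complex.Im c).
have ms : measurable_fun setT (fun s : mR => (s + - complex.Im c : mR)).
  by apply: measurable_funD => //; exact: measurable_cst.
have m1 : measurable_fun setT h1 by exact: (measurableT_comp mc ms).
have mg : measurable_fun setT (fun _ : mR => - complex.Re c : mR) by exact: measurable_cst.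
have h10 s : 0 <= h1 s by exact: cusp_ge0.
have [mF IF] := integral_sheared_product m1 mc mg h10 (cusp_ge0 e a M).
have E q : cusp_at e a M c q = h1 q.2 * cusp e a M (q.1 + - complex.Re c).
  by rewrite /cusp_at /h1 mulrC !(ReD, ImD, ReN, ImN).
split.
  by apply/measurable_EFinP; rewrite [EFin \o _](_ : _ = (fun p : mR * mR => (h1 p.2 * cusp e a M (p.1 + - complex.Re c))%:E))//; apply/funext => q; rewrite /= E.
rewrite (eq_integral (fun p : mR * mR => (h1 p.2 * cusp e a M (p.1 + - complex.Re c))%:E)); last first.
  by move=> q _; rewrite E.
rewrite -[X in (X * _)%E](@ge0_integral_shift R (- complex.Im c) (fun s => (cusp e a M s)%:E)); first exact: IF.
  exact/measurable_EFinP.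
by move=> s; rewrite lee_fin cusp_ge0.
Qed.

Lemma measurable_cusp_at e a M (c : C) : 0 < e -> measurable_fun setT (cusp_at e a M c).
Proof. by move=> /(cusp_at_spec a M c)[]. Qed.

Lemma cusp_at_integral e a M (c : C) B : 0 < e -> (\int[lam]_s (cusp e a M s)%:E <= B%:E)%E ->
  (\int[lam2]_q (cusp_at e a M c q)%:E <= (B * B)%:E)%E.
Proof. by move=> /(cusp_at_spec a M c)[_ ->]; exact: sq_le. Qed.

(** Adapted to the circle at the point 1: one factor in the ordinate, the other in the horizontal
    distance to the right half of the circle. Rotations carry it to the other points. *)
Definition cusp_tangent e a M (q : mR * mR) : R :=
  cusp e a M q.2 * cusp e a M (q.1 + - Num.sqrt (1 - q.2 ^+ 2)).

Let cusp_tangent_spec e a M : 0 < e -> measurable_fun setT (cusp_tangent e a M) /\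
  (\int[lam2]_q (cusp_tangent e a M q)%:E = (\int[lam]_s (cusp e a M s)%:E) * (\int[lam]_s (cusp e a M s)%:E))%E.
Proof.
move=> e0; have mc := @measurable_cusp R e a M e0.
have mg : measurable_fun setT (fun y : mR => - Num.sqrt (1 - y ^+ 2) : mR).
  apply: continuous_measurable_fun => y; apply: (@cvgN R R^o).
  apply: (@continuous_comp _ _ _ (fun y : R => 1 - y ^+ 2) (@Num.sqrt R)); last exact: sqrt_continuous.
  by apply: (@cvgB R R^o); [exact: cvg_cst|exact: exprn_continuous].
have [mF IF] := integral_sheared_product mc mc mg (cusp_ge0 e a M) (cusp_ge0 e a M).
by split; [exact/measurable_EFinP|exact: IF].
Qed.

Lemma measurable_cusp_tangent e a M u v : 0 < e -> measurable_fun setT (fun q => cusp_tangent e a M (rot u v q)).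
Proof. by move=> /(cusp_tangent_spec a M)[m _]; exact: (measurableT_comp m (measurable_rot u v)). Qed.

Lemma cusp_tangent_integral e a M u v B : 0 < e -> u ^+ 2 + v ^+ 2 = 1 ->
  (\int[lam]_s (cusp e a M s)%:E <= B%:E)%E ->
  (\int[lam2]_q (cusp_tangent e a M (rot u v q))%:E <= (B * B)%:E)%E.
Proof.
move=> e0 uv IB; have [m I] := cusp_tangent_spec a M e0.
have -> : (\int[lam2]_q (cusp_tangent e a M (rot u v q))%:E = \int[lam2]_q (cusp_tangent e a M q)%:E)%E.
  apply: (@ge0_integral_rot R _ _ (fun q => (cusp_tangent e a M q)%:E)) => //; first exact/measurable_EFinP.
  by move=> q; rewrite lee_fin mulr_ge0 ?cusp_ge0.
by rewrite [X in (X <= _)%E]I; exact: sq_le.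
Qed.

Variables (a x k e0 : R).
Hypotheses (k0 : 0 < k) (e00 : 0 < e0).
Hypothesis xk : forall t, a <= t <= a + k -> `|x - t| <= 2 * k.

Definition gap_kernel (z : C) : C := cint lam `[a, a + k]
  (fun t => circ x / (circ x - z) ^+ 2 - circ t / (circ t - z) ^+ 2).

(** By [circ_lip] and |x - t| <= 2k, the arc of the gap lies within [d] of circ x; distance 2d
    separates the far from the near estimate. *)
Let d := 4 * pi * k.
Let d0 : 0 < d. Proof. by rewrite !mulr_gt0// pi_gt0. Qed.
Let dn n : 0 <= n%:R * d. Proof. by rewrite mulr_ge0// ltW. Qed.
(** At most e0, so that |z| <= 1 - e0 keeps z at distance e from the circle; at most d, so that e
    does not exceed the cut-offs 2d and 3d. *)
Let e := Num.min e0 d.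
Let ep0 : 0 < e. Proof. by rewrite lt_min e00 d0. Qed.

Let pi_le4 : (pi : R) <= 4. Proof. by have [/andP[_ h] _] := pihalf_02_cos_pihalf R; lra. Qed.

(** The three planar integrals scale like 1/d, sqrt d and d. With the prefactors k d, sqrt k and 1
    they are all O(k), as d is a multiple of k. *)
Let I1 : (\int[lam2]_q (cusp_at (2 * d) (3 / 2) 2 (circ x) q)%:E <= (8 / d)%:E)%E.
Proof.
have h : (\int[lam]_s (cusp (2 * d) (3 / 2) 2 s)%:E <= (4 / Num.sqrt (2 * d))%:E)%E.
  apply: le_trans (integral_cusp_gt1 _ _ _) _ => //; [by rewrite mulr_gt0|lra|].
  rewrite lee_fin; have -> : 1 - 3 / 2 = - 2^-1 :> R by field.
  rewrite powRN powR12_sqrt ?(dn 2)//; have -> : 3 / 2 - 1 = 2^-1 :> R by field.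
  by rewrite invrK; lra.
have d20 : 0 < 2 * d by rewrite mulr_gt0.
have H := cusp_at_integral (circ x) d20 h.
apply: (le_trans H); rewrite lee_fin mulf_div -expr2 -expr2 sqr_sqrtr ?(dn 2) ?(dn 6)//.
by rewrite le_eqVlt; apply/orP; left; apply/eqP; field; rewrite gt_eqF.
Qed.

Let I2 : (\int[lam2]_q (cusp_tangent e (3 / 4) (2 * d) (rot (cos (2 * pi * - x)) (sin (2 * pi * - x)) q))%:E
  <= (128 * Num.sqrt d)%:E)%E.
Proof.
have h : (\int[lam]_s (cusp e (3 / 4) (2 * d) s)%:E <= (8 * (4 * d) `^ 4^-1)%:E)%E.
  apply: le_trans (integral_cusp_lt1 _ _ _) _ => //; [|lra|].
    by rewrite /e ge_min; apply/orP; right; move: d0; lra.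
  rewrite lee_fin; have -> : 1 - 3 / 4 = 4^-1 :> R by field.
  by rewrite invrK (_ : 2 * (2 * d) = 4 * d); [lra|ring].
have H := cusp_tangent_integral ep0 (cos2Dsin2 (2 * pi * - x)) h.
apply: (le_trans H); rewrite lee_fin mulrACA -powRD; last by rewrite implybE gt_eqF ?orbT// mulr_gt0.
have -> : 4^-1 + 4^-1 = 2^-1 :> R by field.
have s4 : Num.sqrt (4 * d) = 2 * Num.sqrt d.
  by rewrite sqrtrM// (_ : 4 = 2 ^+ 2) ?sqrtr_sqr ?ger0_norm// -natrX.
by rewrite powR12_sqrt ?(dn 4)// s4; lra.
Qed.

Let I3 c : (\int[lam2]_q (cusp_at e 2^-1 (3 * d) c q)%:E <= (96 * d)%:E)%E.
Proof.
have h : (\int[lam]_s (cusp e 2^-1 (3 * d) s)%:E <= (4 * Num.sqrt (6 * d))%:E)%E.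
  apply: le_trans (integral_cusp_lt1 _ _ _) _ => //; [|lra|].
    by rewrite /e ge_min; apply/orP; right; move: d0; lra.
  rewrite lee_fin; have -> : 1 - 2^-1 = 2^-1 :> R by field.
  have -> : 2 * (3 * d) = 6 * d by ring.
  by rewrite invrK powR12_sqrt ?(dn 6)//; lra.
have H := cusp_at_integral c ep0 h; apply: (le_trans H); rewrite lee_fin mulrACA -expr2 -expr2.
by rewrite sqr_sqrtr ?(dn 2) ?(dn 6)//; lra.
Qed.

Let int_scale (c B : R) (F : mR * mR -> R) : 0 <= c -> measurable_fun setT F -> (forall q, 0 <= F q) ->
  (\int[lam2]_q (F q)%:E <= B%:E)%E -> (\int[lam2]_q (c * F q)%:E <= (c * B)%:E)%E.
Proof.
move=> c0 mF F0 FB; have mE : measurable_fun setT (fun q => (F q)%:E) by exact/measurable_EFinP.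
have FE0 (q : mR * mR) : setT q -> (0 <= (F q)%:E)%E by rewrite lee_fin.
have cE : (0 <= c%:E)%E by rewrite lee_fin.
have := @ge0_integralZl _ _ _ lam2 setT measurableT (fun q => (F q)%:E) mE c%:E FE0 cE.
by move=> E; rewrite [X in (X <= _)%E]E EFinM; exact: lee_wpmul2l.
Qed.

Let int_add (B1 B2 : R) (F1 F2 : mR * mR -> R) : measurable_fun setT F1 -> measurable_fun setT F2 ->
  (forall q, 0 <= F1 q) -> (forall q, 0 <= F2 q) ->
  (\int[lam2]_q (F1 q)%:E <= B1%:E)%E -> (\int[lam2]_q (F2 q)%:E <= B2%:E)%E ->
  (\int[lam2]_q (F1 q + F2 q)%:E <= (B1 + B2)%:E)%E.
Proof.
move=> m1 m2 p1 p2 b1 b2.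
have e1 : measurable_fun setT (fun q => (F1 q)%:E) by exact/measurable_EFinP.
have e2 : measurable_fun setT (fun q => (F2 q)%:E) by exact/measurable_EFinP.
have q1 (q : mR * mR) : setT q -> (0 <= (F1 q)%:E)%E by rewrite lee_fin.
have q2 (q : mR * mR) : setT q -> (0 <= (F2 q)%:E)%E by rewrite lee_fin.
have := @ge0_integralD _ _ _ lam2 setT measurableT (fun q => (F1 q)%:E) (fun q => (F2 q)%:E) q1 e1 q2 e2.
by move=> E; rewrite [X in (X <= _)%E]E EFinD; exact: leeD.
Qed.

(** The far term, the damped atom and one endpoint of the arc. In [F1], 48 is the 6 of
    [kernel_diff_bound] times 2^3 from [inv_powR_le_cusp]; the 2 in [F3] has the latter origin. *)
Let F1 q := 48 * k * d * cusp_at (2 * d) (3 / 2) 2 (circ x) q.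
Let F2 q := 4 * Num.sqrt k * cusp_tangent e (3 / 4) (2 * d) (rot (cos (2 * pi * - x)) (sin (2 * pi * - x)) q).
Let F3 c q := 2 * cusp_at e 2^-1 (3 * d) c q.

Let c1 : 0 <= 48 * k * d. Proof. by rewrite mulr_ge0 ?(ltW d0)// mulr_ge0 ?(ltW k0). Qed.
Let c2 : 0 <= 4 * Num.sqrt k. Proof. by rewrite mulr_ge0 ?sqrtr_ge0. Qed.
Let d20 : 0 < 2 * d. Proof. by rewrite mulr_gt0. Qed.

Let mF1 : measurable_fun setT F1.
Proof. by apply: measurable_funM; [exact: measurable_cst|exact: measurable_cusp_at]. Qed.
Let mF2 : measurable_fun setT F2.
Proof. by apply: measurable_funM; [exact: measurable_cst|exact: measurable_cusp_tangent]. Qed.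
Let mF3 c : measurable_fun setT (F3 c).
Proof. by apply: measurable_funM; [exact: measurable_cst|exact: measurable_cusp_at]. Qed.
Let F10 q : 0 <= F1 q. Proof. by rewrite /F1 mulr_ge0// mulr_ge0 ?cusp_ge0. Qed.
Let F20 q : 0 <= F2 q. Proof. by rewrite /F2 mulr_ge0// mulr_ge0 ?cusp_ge0. Qed.
Let F30 c q : 0 <= F3 c q. Proof. by rewrite /F3 mulr_ge0// mulr_ge0 ?cusp_ge0. Qed.

Let d16 : d <= 16 * k.
Proof. by have h := pi_le4; rewrite /d ler_pM2r//; lra. Qed.

Let n0 t (z : C) : cabs z < 1 -> circ t - z != 0.
Proof. by move=> z1; have := circ_sub_neq0 t z1; rewrite mul1r. Qed.

Let bound_total : 48 * k * d * (8 / d) + 4 * Num.sqrt k * (128 * Num.sqrt d) + 2 * (96 * d) + 2 * (96 * d) <= 10000 * k.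
Proof.
have h1 : 48 * k * d * (8 / d) = 384 * k by field; rewrite gt_eqF.
have h2 : Num.sqrt k * Num.sqrt d <= 4 * k.
  have E : 4 * k = Num.sqrt (16 * k ^+ 2).
    rewrite sqrtrM// sqrtr_sqr (ger0_norm (ltW k0)) (_ : 16 = 4 ^+ 2) ?sqrtr_sqr ?ger0_norm//.
    by rewrite -natrX.
  have le : k * d <= 16 * k ^+ 2.
    have -> : 16 * k ^+ 2 = k * (16 * k) by ring.
    by rewrite ler_pM2l// d16.
  by rewrite E -sqrtrM ?(ltW k0)//; exact: ler_wsqrtr.
have -> : 4 * Num.sqrt k * (128 * Num.sqrt d) = 512 * (Num.sqrt k * Num.sqrt d) by ring.
rewrite h1; move: h2 d16 (ltW k0); set X := _ * Num.sqrt d => g1 g2 g3; lra.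
Qed.

Let cp t (z : C) : cabs z < 1 -> pcont (fun t => circ t / (circ t - z) ^+ 2) t.
Proof.
move=> z1; have h1 : pcont (fun t => circ t - z) t.
  by apply: (@pcontB _ (@circ R) (fun=> z)); [exact: pcont_circ|exact: pcont_cst].
apply: (@pcontM _ (@circ R) (fun t => ((circ t - z) ^+ 2)^-1)); first exact: pcont_circ.
apply: (@pcontV _ (fun t => (circ t - z) ^+ 2)); first by rewrite expf_neq0// n0.
exact: (@pcontM _ (fun t => circ t - z) (fun t => circ t - z) t h1 h1).
Qed.

Let mI : measurable (`[a, a + k]%classic : set mR). Proof. exact: measurable_itv. Qed.
Let fI : (lam `[a, (a + k)%R] < +oo)%E. Proof. exact: lam_itv_fin. Qed.
Let lI : fine (lam `[a, a + k]) = k.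
Proof. by rewrite lam_itv ?lerDl ?(ltW k0)//; ring. Qed.

Let cbk z : cabs z < 1 -> cbm (T := mR) `[a, a + k] (fun t => circ t / (circ t - z) ^+ 2).
Proof. by move=> z1; apply: pcont_cbm => t _; exact: cp. Qed.

Let near_x t : a <= t <= a + k -> cabs (circ t - circ x) <= d.
Proof.
move=> /xk h; rewrite (le_trans (circ_lip t x))// /d distrC.
have p0 := pi_ge0 R; have -> : 4 * pi * k = 2 * pi * (2 * k) by ring.
by rewrite ler_wpM2l// mulr_ge0.
Qed.

Let far z : cabs z < 1 -> 2 * d <= cabs (circ x - z) -> cabs (gap_kernel z) <= 6 * d / cabs (circ x - z) ^+ 3 * k.
Proof.
move=> z1 far; rewrite -lI; apply: cint_bound => //.
  by apply: cbmB; [exact: cbm_cst|exact: cbk].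
move=> t /=; rewrite in_itv /= => ht; apply: kernel_diff_bound; rewrite ?cabs_circ ?(ltW z1)//.
  by rewrite (lt_le_trans _ far).
exact: near_x.
Qed.

Let near z : cabs z < 1 -> cabs (gap_kernel z) <=
  k / cabs (circ x - z) ^+ 2 + ((cabs (circ a - z))^-1 + (cabs (circ (a + k) - z))^-1).
Proof.
move=> z1; rewrite /gap_kernel cintB//; [|exact: cbm_cst|exact: cbk].
rewrite (le_trans (cabsB _ _))// lerD//.
  by rewrite cint_cst// lI cabsM cabs_real (ger0_norm (ltW k0)) cabsf cabs_circ cabsX mul1r.
by apply: arc_kernel_integral => //; rewrite lerDl ltW.
Qed.

(** Here [s] stands for |S(z)|, of which only the damping by this one atom is used. The term 4k
    absorbs the undamped atom at distance at least 1/2, and the bound on the integral does not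
    depend on [e0]. *)
Lemma gap_majorant : exists G : mR * mR -> R, [/\ measurable_fun setT G, forall q, 0 <= G q,
  (\int[lam2]_q (G q)%:E <= (10000 * k)%:E)%E &
  forall q s, cabs (cplane q) <= 1 - e0 -> 0 <= s <= 1 ->
    s <= expR (- (k * ((1 - cabs (cplane q) ^+ 2) / cabs (circ x - cplane q) ^+ 2))) ->
    s * cabs (gap_kernel (cplane q)) <= 4 * k + G q].
Proof.
have mF12 : measurable_fun setT (fun q => F1 q + F2 q) by exact: measurable_funD.
have mF123 : measurable_fun setT (fun q => F1 q + F2 q + F3 (circ a) q) by exact: measurable_funD.
exists (fun q => F1 q + F2 q + F3 (circ a) q + F3 (circ (a + k)) q); split.
- exact: measurable_funD.
- by move=> q; rewrite !addr_ge0.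
- apply: (@le_trans _ _ (48 * k * d * (8 / d) + 4 * Num.sqrt k * (128 * Num.sqrt d) + 2 * (96 * d) + 2 * (96 * d))%:E); last first.
    by rewrite lee_fin; exact: bound_total.
  apply: int_add => //; [by move=> q; rewrite !addr_ge0| |]; last first.
    by apply: int_scale => //; [exact: measurable_cusp_at|move=> q; rewrite mulr_ge0 ?cusp_ge0].
  apply: int_add => //; [by move=> q; rewrite !addr_ge0| |]; last first.
    by apply: int_scale => //; [exact: measurable_cusp_at|move=> q; rewrite mulr_ge0 ?cusp_ge0].
  apply: int_add => //.
    by apply: int_scale => //; [exact: measurable_cusp_at|move=> q; rewrite mulr_ge0 ?cusp_ge0].
  by apply: int_scale => //; [exact: measurable_cusp_tangent|move=> q; rewrite mulr_ge0 ?cusp_ge0].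
move=> q s; set z := cplane q => ze /andP[s0 s1] sE.
have z1 : cabs z < 1 by move: e00; lra.
set v := cabs (circ x - z) in sE *.
have v0 : 0 < v by rewrite cabs_gt0 n0.
have v2 : v <= 2 by rewrite /v (le_trans (cabsB _ _))// cabs_circ -[2]/(1 + 1) lerD2l ltW.
have p1 := F10 q; have p2 := F20 q; have p3 := F30 (circ a) q; have p4 := F30 (circ (a + k)) q.
have K0 := cabs_ge0 (gap_kernel z).
have [vd|vd] := leP (2 * d) v.
  apply: (@le_trans _ _ (F1 q)); last by move: k0; lra.
  apply: (@le_trans _ _ (6 * d / v ^+ 3 * k)).
    by rewrite (le_trans _ (far z1 vd))// ler_piMl.
  have a32 : (0 : R) < 3 / 2 by [].
  have := @inv_powR_le_cusp R (2 * d) (3 / 2) 2 (z - circ x) d20 a32.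
  rewrite cabs_distC -/v => /(_ vd v2); have -> : 2 * (3 / 2) = 3 :> R by field.
  rewrite powRN powR_mulrn ?(ltW v0)// powR_mulrn// => H.
  have -> : 6 * d / v ^+ 3 * k = 6 * k * d * (v ^+ 3)^-1 by ring.
  have kd : 0 <= 6 * k * d by rewrite mulr_ge0 ?(ltW d0)// mulr_ge0 ?(ltW k0).
  rewrite (le_trans (ler_wpM2l kd H))// /F1 /cusp_at -/z le_eqVlt; apply/orP; left; apply/eqP.
  by rewrite (_ : 2 ^+ 3 = 8) -?natrX//; ring.
have arc c : cabs (circ c - circ x) <= d -> (cabs (circ c - z))^-1 <= F3 (circ c) q.
  move=> hc; have a12 : (0 : R) < 2^-1 by [].
  have := @inv_powR_le_cusp R e 2^-1 (3 * d) (z - circ c) ep0 a12.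
  have w1 : e <= cabs (z - circ c).
    have := circ_sub_ge c z (ler01 : (0 : R) <= 1); rewrite mul1r cabs_distC => h.
    by apply: le_trans h; rewrite /e ge_min; apply/orP; left; lra.
  have w2 : cabs (z - circ c) <= 3 * d.
    have -> : z - circ c = - (circ x - z) - (circ c - circ x) by ring.
    by rewrite (le_trans (cabsB _ _))// cabsN -/v; lra.
  move=> /(_ w1 w2); rewrite divff// powR_inv1 ?cabs_ge0// powRr1// => H.
  by rewrite cabs_distC.
have e1 : a <= a <= a + k by rewrite lexx lerDl ltW.
have e2 : a <= a + k <= a + k by rewrite lexx lerDl ltW.
have h1 := arc _ (near_x e1); have h2 := arc _ (near_x e2).
have atom : s * (k / v ^+ 2) <= 4 * k + F2 q.
  have [v12|v12] := leP 2^-1 v.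
    have h : k / v ^+ 2 <= 4 * k.
      rewrite ler_pdivrMr ?exprn_gt0//; have : 2^-1 * 2^-1 <= v * v by rewrite ler_pM.
      by rewrite expr2; move: k0; nra.
    apply: (@le_trans _ _ (4 * k)); last by rewrite lerDl.
    by rewrite (le_trans _ h)// ler_piMl// divr_ge0 ?(ltW k0)// sqr_ge0.
  apply: (@le_trans _ _ (F2 q)); last by rewrite lerDr mulr_ge0// ltW.
  (* The rotation that moves the atom to 1, where [atom_le_cusp] applies. *)
  pose z' := cplane (rot (cos (2 * pi * - x)) (sin (2 * pi * - x)) q).
  have zE : z' = circ (- x) * z by rewrite /z' cplane_rot.
  have cz' : cabs z' = cabs z by rewrite zE cabsM cabs_circ mul1r.
  have vz' : cabs (1 - z') = v.
    have cx : circ (- x) * circ x = 1 :> C by rewrite circN mulrC circ_mul_conj.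
    have -> : 1 - z' = circ (- x) * (circ x - z) by rewrite zE mulrBr cx.
    by rewrite cabsM cabs_circ mul1r.
  have := @atom_le_cusp R e (2 * d) k z' ep0 k0.
  rewrite cz' vz' => /(_ _ v12 (ltW vd)) H.
  have ze' : cabs z <= 1 - e.
    by have h : e <= e0 by [rewrite /e ge_min lexx]; move: ze; lra.
  have {}H := H ze'.
  apply: (@le_trans _ _ (expR (- (k * ((1 - cabs z ^+ 2) / v ^+ 2))) * (k / v ^+ 2))).
    by rewrite ler_wpM2r// divr_ge0 ?(ltW k0)// sqr_ge0.
  exact: (le_trans H).
rewrite (le_trans (ler_wpM2l s0 (near z1)))// mulrDr -/v.
have arcs : s * ((cabs (circ a - z))^-1 + (cabs (circ (a + k) - z))^-1) <= F3 (circ a) q + F3 (circ (a + k)) q.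
  apply: (@le_trans _ _ (1 * (F3 (circ a) q + F3 (circ (a + k)) q))); last by rewrite mul1r.
  by rewrite ler_pM ?addr_ge0 ?invr_ge0 ?cabs_ge0 ?lerD.
by apply: (le_trans (lerD atom arcs)); move: p1; lra.
Qed.

End GapMajorant.

(** * Summation over the gaps *)

Section GapSeries.
Variable R : realType.
Local Notation C := (CC R).
Local Notation mR := (measurableTypeR R).
Local Notation lam := (@lebesgue_measure R).
Local Notation U := (@unit_interval R).

Let mU : measurable (U : set mR). Proof. exact: measurable_unit. Qed.
Let fU : (lam U < +oo)%E. Proof. exact: lamU_fin. Qed.
Let l1 : fine (lam U) = 1. Proof. by rewrite lamU. Qed.

Lemma cint_setU (A B : set mR) (p : mR -> C) : measurable A -> measurable B -> (lam (A `|` B) < +oo)%E ->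
  [disjoint A & B] -> cbm (T := mR) (A `|` B) p -> cint lam (A `|` B) p = cint lam A p + cint lam B p.
Proof.
move=> mA mB fAB dAB hp; have mAB : measurable (A `|` B) by exact: measurableU.
have i1 := @cbm_Re _ _ mR lam _ mAB fAB _ hp; have i2 := @cbm_Im _ _ mR lam _ mAB fAB _ hp.
by apply: Ceq; rewrite /cint ?ReD ?ImD /=; apply: Rintegral_setU.
Qed.

Lemma cint_half_open (a b : R) (p : mR -> C) : cbm (T := mR) `[a, b] p ->
  cint lam `[a, b[ p = cint lam `[a, b] p.
Proof.
move=> hp; have f1 := lam_itv_fin a b.
have s : `[a, b[ `<=` `[a, b] by apply: subset_itvl; rewrite bnd_simp.
have i1 : lam.-integrable `[a, b[ (EFin \o (fun t => complex.Re (p t))).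
  by apply: integrableS (cbm_Re _ f1 hp).
have i2 : lam.-integrable `[a, b[ (EFin \o (fun t => complex.Im (p t))).
  by apply: integrableS (cbm_Im _ f1 hp).
by rewrite /cint (Rintegral_itv_bndo_bndc i1) (Rintegral_itv_bndo_bndc i2).
Qed.

Variables (a k x : nat -> R) (T : mR -> mR).
Hypothesis k0 : forall N, 0 <= k N.
Let K N : set mR := `[a N, a N + k N[%classic.
Hypothesis tK : trivIset setT K.
Hypothesis KU : forall N, K N `<=` U.
Hypothesis mT : measurable_fun setT T.
Hypothesis T1 : forall N t, a N <= t < a N + k N -> T t = x N.

Let phi (z : C) (t : mR) : C := circ (T t) / (circ (T t) - z) ^+ 2 - circ t / (circ t - z) ^+ 2.

(** A finite sum with a remainder takes the place of a series over gaps: for |z| <= r < 1 the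
    integrand is bounded, and the measure of the remainder tends to 0. *)
Definition remainder n : set mR := [set t | U t /\ forall i, (i < n)%N -> ~ K i t].

Let mK N : measurable (K N). Proof. exact: measurable_itv. Qed.

Lemma remainder0 : remainder 0 = U.
Proof. by apply/seteqP; split => t; [case|split]. Qed.

Lemma remainderS n : remainder n = K n `|` remainder n.+1.
Proof.
apply/seteqP; split => t.
  move=> [Ut H]; have [Kt|Kt] := pselect (K n t); first by left.
  by right; split => // i; rewrite ltnS leq_eqVlt => /predU1P[->//|]; exact: H.
move=> [Kt|[Ut H]]; last by split => // i hi; apply: H; exact: ltnW.
split; first exact: KU Kt.
move=> i hi Kit; have /trivIsetP /(_ i n I I) := tK; rewrite neq_ltn hi => /(_ isT) E.
by have : (K i `&` K n) t by []; rewrite E.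
Qed.

Lemma measurable_remainder n : measurable (remainder n).
Proof.
elim: n => [|n ih]; first by rewrite remainder0.
have -> : remainder n.+1 = remainder n `\` K n.
  rewrite [in RHS]remainderS; apply/seteqP; split => t; last by move=> [[|]].
  by move=> H; split; [right|move: H => [_]; apply].
exact: measurableD.
Qed.

Lemma remainder_sub n : remainder n `<=` U. Proof. by move=> t []. Qed.

Let cbphi z : cabs z < 1 -> cbm (T := mR) U (phi z).
Proof.
move=> z1.
have main (T' : mR -> mR) : measurable_fun setT T' -> cbm (T := mR) U (fun t => circ (T' t) / (circ (T' t) - z) ^+ 2).
  move=> mT'; have c1 : cbm (T := mR) U (fun t => circ (T' t)).
    by apply: (@cbm_pushed R _ mT' (@circ R) 1) => t; [exact: pcont_circ|rewrite cabs_circ].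
  have c2 : cbm (T := mR) U (fun t => (circ (T' t) - z)^-1).
    apply: (@cbm_pushed R _ mT' (fun t => (circ t - z)^-1) (1 - cabs z)^-1) => t.
      apply: (@pcontV _ (fun t => circ t - z)); first by have := circ_sub_neq0 t z1; rewrite mul1r.
      by apply: (@pcontB _ (@circ R) (fun=> z)); [exact: pcont_circ|exact: pcont_cst].
    by have := cabs_circ_subV t z1; rewrite mul1r.
  apply: cbmM => //; apply: (eq_cbm _ (cbmM c2 c2)) => t.
  by rewrite -exprVn expr2.
by apply: cbmB; apply: main.
Qed.

Lemma cint_gaps n z : cabs z < 1 ->
  cint lam U (phi z) = \sum_(i < n) cint lam (K i) (phi z) + cint lam (remainder n) (phi z).
Proof.
move=> z1; elim: n => [|n ->]; first by rewrite big_ord0 add0r remainder0.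
rewrite big_ord_recr /= -addrA; congr (_ + _).
have mr := measurable_remainder n.+1; have E := remainderS n.
have sub : K n `|` remainder n.+1 `<=` U by rewrite -E; exact: remainder_sub.
rewrite {1}E cint_setU//.
- by apply: le_lt_trans fU; apply: le_measure; rewrite ?inE//; exact: measurableU.
- by apply/disj_set2P; apply/seteqP; split => // t [Kt [_ /(_ n (ltnSn n))]].
- exact: (cbm_sub mU sub (cbphi z1)).
Qed.

(** This integral is the derivative in z of the Cauchy integral of the constant 1, which is constant
    in the disc. *)
Lemma kernel_mean z : cabs z < 1 -> cint lam U (fun t => circ t / (circ t - z) ^+ 2) = 0.
Proof.
move=> z1; have ce : cbm (T := mR) U (@circ R) by apply: pcont_cbm1 => t; exact: pcont_circ.
have H := hd_cauchy_lam ce z1.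
have d0 : 0 < 1 - cabs z by rewrite subr_gt0.
have {}H : hd (fun=> 1) z (cauchy_lam (@circ R) 1 2 z).
  apply: (hd_eq d0 _ H) => h hh.
  have zh : cabs (z + h) < 1 by rewrite (le_lt_trans (cabsD _ _))// addrC -ltrBrDr.
  rewrite -(cint_cauchy_kernel zh); apply: eq_cint => t _.
  by rewrite expr1 mul1r.
have /hdP[_ e1] := H; have /hdP[_ e2] := hd_cst (1 : C) z.
transitivity (cauchy_lam (@circ R) 1 2 z); last by rewrite -e1 -e2.
by apply: eq_cint => t _; rewrite mul1r exprVn.
Qed.

Let Q z := cauchy_type lam U (fun t => circ (T t)) (fun t => circ (T t)) 1 2 z.

Lemma pushed_kernel_split n z : cabs z < 1 ->
  Q z = \sum_(i < n) cint lam (K i) (phi z) + cint lam (remainder n) (phi z).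
Proof.
move=> z1; rewrite -cint_gaps// /Q /cauchy_type.
have hc : cbm (T := mR) U (fun t => circ t / (circ t - z) ^+ 2).
  have c2 := cbm_circ_subV z1; have ce : cbm (T := mR) U (@circ R) by apply: pcont_cbm1 => t; exact: pcont_circ.
  by apply: (eq_cbm _ (cbmM ce (cbmM c2 c2))) => t; rewrite mul1r -exprVn expr2.
have hT : cbm (T := mR) U (fun t => circ (T t) / (circ (T t) - z) ^+ 2).
  by apply: (eq_cbm _ (cbmD (cbphi z1) hc)) => t; rewrite /phi subrK.
rewrite /phi cintB// kernel_mean// subr0.
by apply: eq_cint => t _; rewrite mul1r exprVn.
Qed.

Lemma cint_gap_kernel i z : cabs z < 1 -> cint lam (K i) (phi z) = gap_kernel (a i) (x i) (k i) z.
Proof.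
move=> z1; rewrite /gap_kernel -cint_half_open.
  by apply: eq_cint => t; rewrite /K /= in_itv /= => h; rewrite /phi (T1 h).
apply: pcont_cbm => t _; apply: (@pcontB _ (fun=> _) (fun t => circ t / (circ t - z) ^+ 2)); first exact: pcont_cst.
have h1 : pcont (fun t => circ t - z) t.
  by apply: (@pcontB _ (@circ R) (fun=> z)); [exact: pcont_circ|exact: pcont_cst].
apply: (@pcontM _ (@circ R) (fun t => ((circ t - z) ^+ 2)^-1)); first exact: pcont_circ.
apply: (@pcontV _ (fun t => (circ t - z) ^+ 2)).
  by rewrite expf_neq0//; have := circ_sub_neq0 t z1; rewrite mul1r.
exact: (@pcontM _ (fun t => circ t - z) (fun t => circ t - z) t h1 h1).
Qed.

Lemma remainder_bound n z r : cabs z <= r -> r < 1 ->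
  cabs (cint lam (remainder n) (phi z)) <= 2 / (1 - r) ^+ 2 * fine (lam (remainder n)).
Proof.
move=> zr r1; have z1 : cabs z < 1 by exact: le_lt_trans r1.
have mr := measurable_remainder n.
have d0 : 0 < 1 - r by rewrite subr_gt0.
apply: (@cint_bound R _ mR lam _ mr).
- by apply: le_lt_trans fU; apply: le_measure; rewrite ?inE//; exact: remainder_sub.
- exact: (cbm_sub mU (@remainder_sub n) (cbphi z1)).
have main s : cabs (circ s / (circ s - z) ^+ 2) <= 1 / (1 - r) ^+ 2.
  rewrite cabsf cabs_circ cabsX ler_pM2l// lef_pV2 ?posrE ?exprn_gt0//.
    rewrite lerXn2r ?nnegrE ?(ltW d0) ?cabs_ge0//.
    have := circ_sub_ge s z (ler01 : (0 : R) <= 1); rewrite mul1r; apply: le_trans; lra.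
  by rewrite cabs_gt0; have := circ_sub_neq0 s z1; rewrite mul1r.
by move=> t _; rewrite /phi (le_trans (cabsB _ _))// -[2]/(1 + 1) mulrDl lerD.
Qed.

Lemma sum_gaps_le1 n : \sum_(i < n) k i <= 1.
Proof.
have lr : fine (lam (remainder n)) = 1 - \sum_(i < n) k i.
  elim: n => [|n ih]; first by rewrite remainder0 big_ord0 subr0 l1.
  rewrite big_ord_recr /= opprD addrA -ih.
  have mr := measurable_remainder n.+1; have E := remainderS n.
  have sub : K n `|` remainder n.+1 `<=` U by rewrite -E; exact: remainder_sub.
  have f1 : (lam (remainder n.+1) < +oo)%E.
    by apply: le_lt_trans fU; apply: le_measure; rewrite ?inE//; exact: remainder_sub.
  have lK : lam (K n) = (k n)%:E.
    rewrite /K lebesgue_measure_itv /= lte_fin; case: ltP => h; first by rewrite -EFinB; congr (_%:E); ring.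
    by congr (_%:E); apply/eqP; rewrite eq_le k0 /=; move: h; rewrite gerDl.
  have -> : lam (remainder n) = (lam (K n) + lam (remainder n.+1))%E.
    rewrite {1}E measureU//; apply/seteqP; split => // t [Kt [_ /(_ n (ltnSn n))]]; exact.
  rewrite lK fineD//; last by rewrite ge0_fin_numE.
  by rewrite /=; ring.
have : 0 <= fine (lam (remainder n)) by rewrite fine_ge0.
by rewrite lr subr_ge0.
Qed.

Variable A : set mR.
Hypotheses (A0 : lam A = 0%E) (mA : measurable A).
Hypothesis cov : forall t, U t -> ~ A t -> exists N, a N <= t < a N + k N.

(** The remainders decrease to points of [U] in no gap, which lie in the null set [A]; conclude by
    continuity of the measure from above. *)
Lemma remainder_small e : 0 < e -> exists n, fine (lam (remainder n)) <= e.
Proof.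
move=> e0; have mr := measurable_remainder.
have mcap : measurable (\bigcap_n remainder n) by exact: bigcap_measurable.
have f0 : (lam (remainder 0) < +oo)%E by rewrite remainder0.
have ho : {homo remainder : n m / (n <= m)%N >-> (m <= n)%O}.
  move=> n m nm; apply/subsetPset => t [Ut H]; split => // i hi; apply: H.
  exact: leq_trans nm.
have cv := nonincreasing_cvg_mu f0 mr mcap ho.
have E0 : lam (\bigcap_n remainder n) = 0%E.
  apply/eqP; rewrite eq_le measure_ge0 andbT -A0; apply: le_measure; rewrite ?inE// => t Ht.
  apply: contrapT => At; have [Ut _] := Ht 0%N I.
  have [N hN] := cov Ut At; have [_ /(_ N (ltnSn N))] := Ht N.+1 I.
  by apply; rewrite /K /= in_itv.
have {cv}: (fun n => lam (remainder n)) @ \oo --> 0%E by rewrite -E0; exact: cv.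
move=> /fine_cvgP[_ /cvgrPdist_le /(_ _ e0)] [n _ /(_ n (leqnn n))] /=.
by rewrite sub0r normrN => h; exists n; apply: le_trans h; exact: ler_norm.
Qed.

End GapSeries.

(** * Membership of the inner function in W^1 *)

Section SingularInnerW1.
Variable R : realType.
Local Notation C := (CC R).
Local Notation mR := (measurableTypeR R).
Local Notation lam := (@lebesgue_measure R).
Local Notation lam2 := (lam \x lam)%E.
Local Notation U := (@unit_interval R).

Variables (mu : {measure set R -> \bar R}) (a k x : nat -> R) (T : mR -> mR) (A : set mR).
Hypothesis k0 : forall N, 0 <= k N.
Hypothesis xk : forall N t, a N <= t <= a N + k N -> `|x N - t| <= 2 * k N.
Hypothesis tK : trivIset setT (fun N => `[a N, a N + k N[%classic).
Hypothesis KU : forall N, `[a N, a N + k N[ `<=` U.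
Hypothesis mT : measurable_fun setT T.
Hypothesis T1 : forall N t, a N <= t < a N + k N -> T t = x N.
Hypothesis muI : forall (f : mR -> R) M, measurable_fun setT f -> (forall t, `|f t| <= M) ->
      Rintegral mu U f = Rintegral lam U (f \o T).
Hypotheses (A0 : lam A = 0%E) (mA : measurable A).
Hypothesis cov : forall t, U t -> ~ A t -> exists N, a N <= t < a N + k N.

Local Notation S := (S_mu mu).

Let hS : hol 1 S. Proof. exact: (hol_S_mu mT muI). Qed.

Let area_disc := fine (lam2 (@unit_disc R)).

Definition disc_le (r : R) : set (mR * mR) := [set q | q.1 ^+ 2 + q.2 ^+ 2 <= r ^+ 2].

Lemma disc_leE r q : 0 <= r -> disc_le r q -> cabs (cplane q) <= r.
Proof.
move=> r0 h; rewrite -(@ler_pXn2r _ 2)// ?nnegrE ?cabs_ge0// cabs_sqr; exact: h.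
Qed.

Lemma measurable_disc_le r : measurable (disc_le r).
Proof.
have m : measurable_fun setT ((fun p => p.1 ^+ 2 + p.2 ^+ 2)%R : mR * mR -> R).
  by apply: measurable_funD; apply: measurable_funX.
have -> : disc_le r = (fun p : mR * mR => p.1 ^+ 2 + p.2 ^+ 2)%R @^-1` `]-oo, r ^+ 2].
  by apply/seteqP; split => t; rewrite /disc_le /= in_itv.
by rewrite -[X in measurable X]setTI; exact: m.
Qed.

Let disc_le_sub r : 0 <= r -> r < 1 -> disc_le r `<=` @unit_disc R.
Proof. by move=> r0 r1 q /(disc_leE r0) h; apply/unit_discE; exact: le_lt_trans r1. Qed.

Let deriv_bound n r z : cabs z <= r -> r < 1 ->
  cabs ('D_1 S z) <= \sum_(i < n) 2 * (cabs (S z) * cabs (gap_kernel (a i) (x i) (k i) z))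
    + 2 * (2 / (1 - r) ^+ 2 * fine (lam (remainder a k n))).
Proof.
move=> zr r1; have z1 : cabs z < 1 by exact: le_lt_trans r1.
have /hdP[_ ->] := hd_S_mu mT muI z1.
rewrite (pushed_kernel_split tK KU mT n z1) cabsM cabsN cabsM.
have c2 : (2 : C) = ((2 : R)%:C : C) by rewrite rmorph_nat.
have -> : cabs (2 : C) = 2 by rewrite c2 cabs_real ger0_norm.
have S0 := cabs_ge0 (S z); have S1 := cabs_S_mu_le1 muI z1.
have rb := remainder_bound tK KU mT n zr r1.
set X := cabs (cint _ _ _) in rb; set Y := cabs (\sum_(i < n) _ + _).
have Yle : Y <= \sum_(i < n) cabs (gap_kernel (a i) (x i) (k i) z) + X.
  rewrite /Y (le_trans (cabsD _ _))// lerD2r.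
  elim/big_ind2: _ => [|u1 v1 u2 v2 h1 h2|i _]; first by rewrite cabs0.
    by rewrite (le_trans (cabsD _ _))// lerD.
  by rewrite (cint_gap_kernel T1).
rewrite -mulr_sumr -mulrA [Y * _]mulrC -mulrDr ler_pM2l//.
apply: (le_trans (ler_wpM2l S0 Yle)); rewrite mulrDr mulr_sumr lerD2l.
by apply: (le_trans _ rb); rewrite ler_piMl ?cabs_ge0.
Qed.

Let majorant r i : 0 <= r -> r < 1 -> exists G : mR * mR -> R, [/\ measurable_fun setT G, forall q, 0 <= G q,
  (\int[lam2]_q (G q)%:E <= (10000 * k i)%:E)%E &
  forall q, cabs (cplane q) <= r -> cabs (S (cplane q)) * cabs (gap_kernel (a i) (x i) (k i) (cplane q)) <= 4 * k i + G q].
Proof.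
(* An index with k = 0 codes no gap: its kernel is an integral over one point and vanishes. *)
move=> r0 r1; have := k0 i; rewrite le_eqVlt => /predU1P[ki|ki].
  exists (fun=> 0); rewrite -ki; split => //.
    by rewrite integral0 mulr0.
  move=> q _; rewrite mulr0 addr0 /gap_kernel addr0 set_itv1 /cint /Rintegral !integral_set1 /=.
  by rewrite -[_ +i* _]/(0 : C) cabs0 mulr0.
have e0 : 0 < 1 - r by rewrite subr_gt0.
have [G [mG G0 IG bG]] := gap_majorant ki e0 (@xk i).
exists G; split => // q qr; have z1 : cabs (cplane q) < 1 by exact: le_lt_trans r1.
apply: bG; first by rewrite opprB addrC subrK.
  by rewrite cabs_ge0 (cabs_S_mu_le1 muI z1).
have ab : a i <= a i + k i by rewrite lerDl.
have := cabs_S_mu_atom mT muI z1 (@KU i) ab (@T1 i).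
by have -> : a i + k i - a i = k i by ring.
Qed.

(** The bound is independent of r, while the number n of gaps used depends on r. The derivative
    carries a factor 2 and the k_i sum to at most 1: the majorants give 2 * 10000, the constant
    terms 2 * 4, and the remainder the last 1 of the 9. *)
Let int_disc_le r : 0 <= r -> r < 1 ->
  (\int[lam2]_(q in disc_le r) (cabs ('D_1 S (cplane q)))%:E <= (20000 + 9 * area_disc)%:E)%E.
Proof.
move=> r0 r1; have mD := measurable_disc_le r.
have /choice[G GP] : forall i, exists G, _ := fun i => majorant i r0 r1.
have d0 : 0 < 1 - r by rewrite subr_gt0.
(* Chosen so that 2 * (2/(1 - r)^2) times the measure of the remainder is at most 1. *)
have [|n Hn] := remainder_small tK KU A0 mA cov (e := (1 - r) ^+ 2 / 4).
  by rewrite divr_gt0// exprn_gt0.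
pose F q := \sum_(i < n) 2 * G i q.
have F0 q : 0 <= F q by apply: sumr_ge0 => i _; rewrite mulr_ge0//; have [] := GP i.
have mF : measurable_fun setT F.
  by apply: measurable_sum => i; apply: measurable_funM; [exact: measurable_cst|have [] := GP i].
have IF : (\int[lam2]_q (F q)%:E <= 20000%:E)%E.
  have mi (i : 'I_n) : measurable_fun setT (fun q => (2 * G i q)%:E).
    by apply/measurable_EFinP; apply: measurable_funM; [exact: measurable_cst|have [] := GP i].
  have pi (i : 'I_n) (q : mR * mR) : setT q -> (0 <= (2 * G i q)%:E)%E.
    by move=> _; rewrite lee_fin mulr_ge0//; have [] := GP i.
  have E : (\int[lam2]_q (F q)%:E = \sum_(i < n) \int[lam2]_q (2 * G i q)%:E)%E.
    rewrite -(@ge0_integral_sum _ _ R lam2 setT measurableT 'I_n (fun i q => (2 * G i q)%:E) mi pi (index_enum 'I_n)).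
    by apply: eq_integral => q _; rewrite /F sumEFin.
  rewrite E; apply: (@le_trans _ _ (\sum_(i < n) (20000 * k i)%:E)%E).
    apply: lee_sum => i _; have [mG G0 IG _] := GP i.
    have mE : measurable_fun setT (fun q => (G i q)%:E) by exact/measurable_EFinP.
    have GE0 (q : mR * mR) : setT q -> (0 <= (G i q)%:E)%E by rewrite lee_fin.
    have c0 : (0 <= 2%:E :> \bar R)%E by rewrite lee_fin.
    have E2 : (\int[lam2]_q (2%:E * (G i q)%:E) = 2%:E * \int[lam2]_q (G i q)%:E)%E.
      exact: ge0_integralZl.
    rewrite [X in (X <= _)%E]E2; apply: (le_trans (lee_wpmul2l c0 IG)).
    by rewrite -EFinM lee_fin mulrA -natrM.
  rewrite sumEFin lee_fin -mulr_sumr -[leRHS]mulr1; apply: ler_wpM2l; first exact: ler0n.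
  exact: (sum_gaps_le1 k0 tK KU).
have mF' : measurable_fun (disc_le r) (fun q => (F q)%:E).
  by apply: measurable_funTS; exact/measurable_EFinP.
have m9 : measurable_fun (disc_le r) (fun=> 9%:E : \bar R) by exact: measurable_cst.
have mS : measurable_fun (disc_le r) (fun q => (cabs ('D_1 S (cplane q)))%:E).
  apply: (measurable_funS (@measurable_unit_disc R)); first exact: disc_le_sub.
  exact: (@measurable_cabs_disc R (fun z => 'D_1 S z) (fun z h => ccont_deriv hS h)).
have f0 (q : mR * mR) : disc_le r q -> (0 <= (F q)%:E)%E by rewrite lee_fin.
have g0 (q : mR * mR) : disc_le r q -> (0 <= 9%:E :> \bar R)%E by rewrite lee_fin.
apply: (@le_trans _ _ (\int[lam2]_(q in disc_le r) ((F q)%:E + 9%:E))%E).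
  apply: ge0_le_integral => //.
  - by move=> q _; rewrite lee_fin cabs_ge0.
  - exact: emeasurable_funD.
  move=> q qr; have zr := disc_leE r0 qr; rewrite -EFinD lee_fin (le_trans (deriv_bound n zr r1))//.
  have h1 : 2 * (2 / (1 - r) ^+ 2 * fine (lam (remainder a k n))) <= 1.
    rewrite mulrA mulrA -natrM mulrC -ler_pdivlMr ?divr_gt0 ?exprn_gt0//.
    by rewrite div1r invf_div.
  have h2 : \sum_(i < n) 2 * (cabs (S (cplane q)) * cabs (gap_kernel (a i) (x i) (k i) (cplane q))) <= F q + 8.
    apply: (@le_trans _ _ (\sum_(i < n) (2 * G i q + 8 * k i))).
      apply: ler_sum => i _; have [_ _ _ H] := GP i; have := H q zr.
      have -> : 2 * G i q + 8 * k i = 2 * (4 * k i + G i q) by ring.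
      by rewrite ler_pM2l.
    rewrite big_split /= lerD2l -mulr_sumr -[leRHS]mulr1 ler_pM2l//.
    exact: (sum_gaps_le1 k0 tK KU).
  by apply: (le_trans (lerD h2 h1)); rewrite -addrA lerD2l natr1.
have -> : (\int[lam2]_(q in disc_le r) ((F q)%:E + 9%:E) =
    \int[lam2]_(q in disc_le r) (F q)%:E + \int[lam2]_(q in disc_le r) 9%:E)%E by exact: ge0_integralD.
rewrite [X in (_ <= X)%E]EFinD; apply: leeD.
  apply: (le_trans _ IF); apply: ge0_subset_integral => //; first exact/measurable_EFinP.
  by move=> q _; rewrite lee_fin.
have -> : (\int[lam2]_(q in disc_le r) 9%:E = 9%:E * lam2 (disc_le r))%E by exact: integral_cst.
have fin : lam2 (@unit_disc R) \is a fin_num by rewrite ge0_fin_numE ?measure_ge0//; exact: area_disc_fin.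
rewrite EFinM /area_disc fineK//; apply: lee_wpmul2l; first by rewrite lee_fin.
by apply: le_measure; rewrite ?inE//; [exact: measurable_unit_disc|exact: disc_le_sub].
Qed.

(** The uniform bounds on the discs of radius 1 - 1/(n+1) pass to the whole disc by monotone
    convergence. *)
Lemma W1_S_mu : W1 S.
Proof.
split; first exact/analytic_hol.
pose rr n : R := 1 - n.+1%:R^-1.
have rr0 n : 0 <= rr n by rewrite subr_ge0 invf_le1// ler1n.
have rr1 n : rr n < 1 by rewrite ltrBlDr ltrDl invr_gt0.
pose D n := disc_le (rr n).
have mono n m : (n <= m)%N -> rr n <= rr m.
  by move=> nm; rewrite lerD2l lerN2 lef_pV2 ?posrE// ler_nat.
have DE : \bigcup_n D n = @unit_disc R.
  apply/seteqP; split => [q [n _]|q]; first exact: disc_le_sub.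
  move=> /unit_discE q1; have d0 : 0 < 1 - cabs (cplane q) by rewrite subr_gt0.
  have [n Hn] : exists n, n.+1%:R^-1 < 1 - cabs (cplane q).
    by have [n _ /(_ n (leqnn n))] := near_infty_natSinv_lt (PosNum d0); exists n.
  exists n => //; rewrite /D /disc_le /=.
  have -> : q.1 ^+ 2 + q.2 ^+ 2 = cabs (cplane q) ^+ 2 by rewrite cabs_sqr.
  have qr : cabs (cplane q) <= rr n by rewrite /rr lerBrDr addrC -lerBrDr ltW.
  by rewrite lerXn2r ?nnegrE ?cabs_ge0 ?rr0.
have mD n : measurable (D n) by exact: measurable_disc_le.
have mS : measurable_fun (@unit_disc R) (fun q => (cabs ('D_1 S (cplane q)))%:E).
  exact: (@measurable_cabs_disc R (fun z => 'D_1 S z) (fun z h => ccont_deriv hS h)).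
have ho : {homo D : n m / (n <= m)%N >-> (n <= m)%O}.
  move=> n m nm; apply/subsetPset => q; rewrite /D /disc_le /= => h; apply: (le_trans h).
  by rewrite lerXn2r ?nnegrE ?mono.
have mSn n : measurable_fun (D n) (fun q => (cabs ('D_1 S (cplane q)))%:E).
  by apply: (measurable_funS (@measurable_unit_disc R) _ mS); exact: disc_le_sub.
have S0 n (q : mR * mR) : D n q -> (0 <= (cabs ('D_1 S (cplane q)))%:E)%E by rewrite lee_fin cabs_ge0.
have cv := @ge0_nondecreasing_set_cvg_integral _ _ R D (fun q => (cabs ('D_1 S (cplane q)))%:E) lam2 ho mD mSn S0.
apply: (@le_lt_trans _ _ (20000 + 9 * area_disc)%:E); last exact: ltry.
have : (\int[lam2]_(q in \bigcup_n D n) (cabs ('D_1 S (cplane q)))%:E <= (20000 + 9 * area_disc)%:E)%E.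
  rewrite -(cvg_lim _ cv)//; apply: lime_le; first by apply/cvg_ex; eexists; exact: cv.
  by apply: nearW => n; exact: int_disc_le.
by rewrite DE.
Qed.

End SingularInnerW1.

Theorem theorem1p6 (R : realType) (E : set (CC R)) :
  E `<=` @circle R -> closed E -> E !=set0 ->
  lebesgue_measure (@unit_interval R `&` @circ R @^-1` E) = 0%E ->
  exists mu : {measure set R -> \bar R},
    (* mu is a probability measure on the circle (carried by [0,1) via circ) *)
    mu (@unit_interval R) = 1%E /\ mu (~` @unit_interval R) = 0%E /\
    (* mu is singular with respect to normalized Lebesgue measure *)
    (exists A : set R, measurable A /\ lebesgue_measure A = 0%E /\ mu (~` A) = 0%E) /\
    (* mu is supported on E *)
    mu (@unit_interval R `&` ~` (@circ R @^-1` E)) = 0%E /\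
    (* (i) mu(I) >= |I| for every dyadic arc I meeting E *)
    (forall n j : nat, (j < 2 ^ n)%N ->
       (exists t, @dyadic R n j t /\ E (@circ R t)) ->
       ((2 ^+ n)^-1%:E <= mu (@dyadic R n j))%E) /\
    (* (ii) S_mu in W^1, and the permanence property *)
    W1 (S_mu mu) /\ permanence (S_mu mu).
Proof.
move=> Esub Ecl E0 Enull.
have mU : measurable (@unit_interval R : set (measurableTypeR R)) by exact: measurable_unit.
have mE := measurable_circ_preimage Ecl.
have [mu [a [k [x [T [[mu1 mu2 mu3 mu4] [k0 xk tK KU cov] mT [T1 TE] muI]]]]]] := gap_measure Ecl Esub E0 Enull.
set A := @unit_interval R `&` @circ R @^-1` E in mu3 *.
have mA : measurable (A : set (measurableTypeR R)) by exact: measurableI.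
have covA t : unit_interval t -> ~ A t -> exists N, a N <= t < a N + k N.
  by move=> Ut At; apply: cov => // Et; apply: At.
have WS : W1 (S_mu mu) := W1_S_mu k0 xk tK KU mT T1 muI Enull mA covA.
exists mu; do 2!split => //; split; first by exists A.
split.
  apply/eqP; rewrite eq_le measure_ge0 andbT -mu3; apply: le_measure; rewrite ?inE.
  - by apply: measurableI => //; exact: measurableC.
  - exact: measurableC.
  - by move=> t [Ut Et] [_ At]; exact: Et.
split; first exact: mu4.
split; first exact: WS.
apply: inner_permanence.
- exact: (hol_S_mu mT muI).
- exact: (cabs_S_mu_le1 muI).
- exact: (S_mu_neq0 muI).
- exact: WS.
- exact: (S_mu_inner mT muI Ecl TE Enull).
Qed.
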